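(* Let $f:\mathbb{C}\to\mathbb{C}$ be a polynomial of degree $d\ge3$ such that exactly one of its $d-1$ critical points (counted with multiplicity) has bounded orbit; denote this critical point by $c_0$ and its orbit by $c_0\mapsto c_1\mapsto c_2\mapsto\cdots$. Suppose that the critical tableau is not periodic, or equivalently that the post-critical points $c_1,c_2,\ldots$ are all disjoint from the critical component $\bigcap_k P_k(c_0)$. Then for every point $z_0$ of the filled Julia set $K$ the sum $\sum_k \operatorname{mod} A_k(z_0)$ is infinite, hence $\bigcap_k P_k(z_0)=\{z_0\}$. It follows that the Julia set satisfies $J=K$ and that $J$ is a totally disconnected set of area (two-dimensional Lebesgue measure) zero.
   Context: $K$ is the filled Julia set of $f$, $J=\partial K$ the Julia set, and $G:\mathbb{C}\to[0,\infty)$ is the canonical potential (Green's) function of $f$, which satisfies $G(f(z))=d\,G(z)$ and vanishes precisely on $K$. Since the critical point $c_0$ of bounded orbit is counted with multiplicity, it is a simple critical point; the other $d-2$ critical points (with multiplicity) have orbits escaping to infinity. Branner–Hubbard puzzle: fix a number $G_0>0$ which is not a critical value of $G$ and such that the region $G^{-1}(0,G_0]$ contains no critical value of $f$. The puzzle pieces of depth $k\ge 0$ are the connected components of $\{z: G(z)\le G_0/d^k\}$; they are closed topological disks. For $z\in K$, $P_k(z)$ is the puzzle piece of depth $k$ containing $z$, and $A_k(z)=\mathrm{Interior}(P_k(z))\smallsetminus P_{k+1}(z)$, which is an annulus of positive modulus. The modulus of an annulus conformally isomorphic to a cylinder of height $\Delta y$ and circumference $\Delta x$ is $\Delta y/\Delta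 x$. The critical tableau is periodic if there is some $p\ge1$ with $P_k(c_p)=P_k(c_0)$ for all depths $k$. *)

(* Defs.v *)
(* MathComp-Analysis. The complex numbers are R[i] for an arbitrary R : realType. *)
From HB Require Import structures.
From mathcomp Require Import all_boot all_order all_algebra.
From mathcomp Require Import complex.
From mathcomp Require Import all_classical all_reals all_analysis.
Set Implicit Arguments.
Unset Strict Implicit.
Unset Printing Implicit Defensive.
Import Order.TTheory GRing.Theory Num.Theory numFieldNormedType.Exports.
Local Open Scope classical_set_scope.
Local Open Scope complex_scope.
Local Open Scope ring_scope.

(* The library provides the norm topology of a numFieldType K only on K^o and
   on abstract K; these copies make it available on R[i] itself, as a normed
   module over itself. Hence derivability on R[i] is complex derivability. *)
HB.instance Definition _ (R : realType) := GRing.ComAlgebra.copy R[i] R[i]^o.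
HB.instance Definition _ (R : realType) := Vector.copy R[i] R[i]^o.
HB.instance Definition _ (R : realType) := NormedModule.copy R[i] R[i]^o.

Section Dynamics.
Context {R : realType}.
Implicit Types (f : {poly R[i]}) (z c : R[i]) (k n p : nat).

Definition degree f : nat := (size f).-1.

Definition fwd_orbit f z n : R[i] := iter n (horner f) z.

Definition cmod z : R := Normc.normc z.

Definition filled_julia f : set R[i] :=
  [set z | exists M : R, forall n, cmod (fwd_orbit f z n) <= M].

Definition julia f : set R[i] :=
  closure (filled_julia f) `\` interior (filled_julia f).

(* G(z) = lim_n d^-n log^+ |f^n(z)| *)
Definition green f z : R :=
  limn (fun n => ln (Num.max 1 (cmod (fwd_orbit f z n))) / (degree f)%:R ^+ n).

(* The list s enumerates the critical points of f with multiplicity. *)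
Definition sole_bounded_critical_point f c0 : Prop :=
  exists2 s : seq R[i],
    f^`() = lead_coef f^`() *: \prod_(c <- s) ('X - c%:P) &
    [seq c <- s | `[< filled_julia f c >]] = [:: c0].

(* G is regarded as a function of two real variables. *)
Definition green_critical_value f (t : R) : Prop :=
  exists2 z, green f z = t &
    is_diff ((complex.Re z, complex.Im z) : R * R)
            (fun q : R * R => green f (q.1 +i* q.2)) (cst 0).

Definition admissible_level f (G0 : R) : Prop :=
  [/\ 0 < G0,
      ~ green_critical_value f G0 &
      forall c, root f^`() c -> ~ (0 < green f f.[c] <= G0)].

End Dynamics.

Section Modulus.
Context {R : realType}.

Definition strip (h : R) : set R[i] := [set w | 0 < complex.Im w < h].

(* The cylinder of circumference dx and height dy is strip dy modulo w ~ w + dx.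
   A conformal isomorphism from it onto A is given by its lift phi to the strip:
   phi is holomorphic, has image A, and identifies exactly the points that
   differ by a multiple of dx. The inverse is then automatically holomorphic. *)
Definition cylinder_isomorphic (A : set R[i]) (dx dy : R) : Prop :=
  exists phi : R[i] -> R[i],
    [/\ forall w, strip dy w -> derivable phi w 1,
        phi @` strip dy = A &
        forall w w', strip dy w -> strip dy w' ->
          (phi w = phi w' <-> exists n : int, w' = w + (n%:~R * dx)%:C)].

Definition is_modulus (A : set R[i]) (m : R) : Prop :=
  exists dx dy : R, [/\ 0 < dx, 0 < dy, cylinder_isomorphic A dx dy & m = dy / dx].

(* By convention 0 when A is not isomorphic to a cylinder of finite height. *)
Definition modulus (A : set R[i]) : R := xget 0 [set m | is_modulus A m].

Definition area (A : set R[i]) : \bar R :=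
  (lebesgue_measure \x lebesgue_measure)%E
    [set q : measurableTypeR R * measurableTypeR R | A (q.1 +i* q.2)].

End Modulus.

Section Puzzle.
Context {R : realType}.
Implicit Types (f : {poly R[i]}) (z c : R[i]) (k n p : nat).

Definition puzzle_piece f (G0 : R) k z : set R[i] :=
  connected_component [set w | green f w <= G0 / (degree f)%:R ^+ k] z.

Definition puzzle_annulus f (G0 : R) k z : set R[i] :=
  interior (puzzle_piece f G0 k z) `\` puzzle_piece f G0 k.+1 z.

Definition nest_intersection f (G0 : R) z : set R[i] :=
  \bigcap_k puzzle_piece f G0 k z.

Definition critical_tableau_periodic f (G0 : R) c0 : Prop :=
  exists2 p, (1 <= p)%N &
    forall k, puzzle_piece f G0 k (fwd_orbit f c0 p) = puzzle_piece f G0 k c0.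

End Puzzle.

(* Main.v *)
(** The Branner-Hubbard argument. Inside the puzzle [f] maps a piece two-to-one if it contains [c0] and
    conformally otherwise, so the modulus of an annulus is at least a fixed multiple of [2^-hits], where
    [hits] counts the critical annuli met along its orbit. A tableau count shows that the sum of these
    weights diverges unless the critical tableau is periodic. By the length-area inequality an annulus of
    modulus [m] around two points at distance [r] has area at least [c m r^2]; as the annuli of a nest are
    disjoint, the nest shrinks to a point, and the same estimate on all pieces meeting [K] gives area zero.
    Uniformization is avoided by pulling cylinders back along inverse branches and square roots. *)
Require Import Defs.
From HB Require Import structures.
From mathcomp Require Import all_boot all_order all_algebra.
From mathcomp Require Import complex ring lra zify.
From mathcomp Require Import all_classical all_reals all_analysis.
Set Implicit Arguments.
Unset Strict Implicit.
Unset Printing Implicit Defensive.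
Import Order.TTheory GRing.Theory Num.Theory numFieldNormedType.Exports.
Local Open Scope classical_set_scope.
Local Open Scope complex_scope.
Local Open Scope ring_scope.
Arguments cmod : simpl never.
Local Notation Re := complex.Re.
Local Notation Im := complex.Im.

(** [modulus] picks by choice one cylinder isomorphic to the annulus, with default 0. A lower bound
    must therefore hold for every such cylinder, and a cylinder of finite height must be exhibited.
    The first is a Schwarz-Pick comparison with a strip map that winds once about a point omitted by
    the annulus ([modulus_ge]). The second uniformizes the logarithmic cover of a disc minus a
    compact set and excludes the parabolic case ([cyl_exists]). The object carried by induction on
    depth is [collar], an embedded cylinder in a piece winding about everything of the next level
    there. It pulls back unchanged along an inverse branch and with half the height along a square
    root; it serves both the modulus bound and the area bound. Contour integrals yield only the
    estimate [cmod (k a) <= 4 * M] on a square. Taking powers removes the 4, and afterwards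
    derivatives are controlled through divided differences. Simple connectivity is encoded by chains
    of complement points running to infinity, which give square roots by a count of signs on a
    grid. *)

Ltac split_lra := apply/andP; split; lra.

(** * Moduli of complex numbers, compactness, complex derivatives *)

Section Basics.
Context {R : realType}.
Local Notation C := R[i].
Implicit Types (z w a b c l : C) (r e d M s t : R) (u v : C -> C).

Lemma cmodE (x y : R) : cmod (x +i* y) = Num.sqrt (x ^+ 2 + y ^+ 2).
Proof. by []. Qed.

Lemma cmod_ge0 z : 0 <= cmod z.
Proof. by case: z => x y; rewrite -[complex.Complex x y]/(x +i* y) cmodE sqrtr_ge0. Qed.

Lemma cmodM z w : cmod (z * w) = cmod z * cmod w.
Proof. exact: (@Normc.normcM R z w). Qed.

Lemma cmod0 : cmod (0 : C) = 0.
Proof. exact: (@Normc.normc0 R). Qed.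

Lemma cmod1 : cmod (1 : C) = 1.
Proof. exact: (@Normc.normc1 R). Qed.

Lemma cmod_eq0 z : cmod z = 0 -> z = 0.
Proof. exact: (@Normc.eq0_normc R z). Qed.

Lemma cmodN z : cmod (- z) = cmod z.
Proof. exact: (@normcN R z). Qed.

Lemma cmodBC z w : cmod (z - w) = cmod (w - z).
Proof. by rewrite -cmodN opprB. Qed.

Lemma cmodD z w : cmod (z + w) <= cmod z + cmod w.
Proof. exact: (@le_normcD R z w). Qed.

Lemma cmodB z w : cmod (z - w) <= cmod z + cmod w.
Proof. by rewrite -[cmod w]cmodN; exact: cmodD. Qed.

Lemma cmod_sub z w : cmod z - cmod w <= cmod (z - w).
Proof. by have := cmodD (z - w) w; rewrite subrK; lra. Qed.

Lemma cmod_tri a z w : cmod (z - w) <= cmod (z - a) + cmod (a - w).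
Proof. by have := cmodD (z - a) (a - w); rewrite addrA subrK. Qed.

Lemma cmodV z : cmod z^-1 = (cmod z)^-1.
Proof. exact: (@Normc.normcV R z). Qed.

Lemma cmod_div z w : cmod (z / w) = cmod z / cmod w.
Proof. by rewrite cmodM cmodV. Qed.

Lemma cmodX z n : cmod (z ^+ n) = cmod z ^+ n.
Proof. by elim: n => [|n IH]; rewrite ?expr0 ?cmod1// !exprS cmodM IH. Qed.

Lemma cmod_gt0 z : (0 < cmod z) = (z != 0).
Proof.
rewrite lt_def cmod_ge0 andbT; congr (~~ _).
by apply/eqP/eqP => [/cmod_eq0|->]; rewrite ?cmod0.
Qed.

Lemma cmod_neq0 z : z != 0 -> 0 < cmod z.
Proof. by rewrite cmod_gt0. Qed.

Lemma cmod_gt0P z : 0 < cmod z -> z != 0.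
Proof. by rewrite cmod_gt0. Qed.

Lemma cmod_real (x : R) : cmod x%:C = `|x|.
Proof. by rewrite -[x%:C]/(x +i* 0) cmodE expr0n addr0 sqrtr_sqr. Qed.

Lemma cmod_sqr z : cmod z ^+ 2 = Re z ^+ 2 + Im z ^+ 2.
Proof. by case: z => x y; rewrite cmodE sqr_sqrtr ?addr_ge0 ?sqr_ge0. Qed.

Lemma normRe z : `|Re z| <= cmod z.
Proof.
case: z => x y; rewrite cmodE -sqrtr_sqr ler_wsqrtr //=.
by rewrite lerDl sqr_ge0.
Qed.

Lemma normIm z : `|Im z| <= cmod z.
Proof.
case: z => x y; rewrite cmodE -sqrtr_sqr ler_wsqrtr //=.
by rewrite lerDr sqr_ge0.
Qed.

Lemma cReD z w : Re (z + w) = Re z + Re w.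
Proof. by case: z w => [a b] [c d]. Qed.
Lemma cImD z w : Im (z + w) = Im z + Im w.
Proof. by case: z w => [a b] [c d]. Qed.
Lemma cReN z : Re (- z) = - Re z.
Proof. by case: z. Qed.
Lemma cImN z : Im (- z) = - Im z.
Proof. by case: z. Qed.
Lemma cReB z w : Re (z - w) = Re z - Re w.
Proof. by case: z w => [a b] [c d]. Qed.
Lemma cImB z w : Im (z - w) = Im z - Im w.
Proof. by case: z w => [a b] [c d]. Qed.
Lemma cReM z w : Re (z * w) =
  Re z * Re w - Im z * Im w.
Proof. by case: z w => [a b] [c d]. Qed.
Lemma cImM z w : Im (z * w) =
  Re z * Im w + Im z * Re w.
Proof. by case: z w => [a b] [c d]. Qed.

Lemma cplxE z : z = Re z +i* Im z.
Proof. by case: z. Qed.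

Lemma cplx_eq z w : Re z = Re w -> Im z = Im w -> z = w.
Proof. by case: z w => [a b] [c d] /= -> ->. Qed.

Lemma cmod_ReIm z : cmod z <= `|Re z| + `|Im z|.
Proof.
case: z => x y; rewrite -[complex.Complex x y]/(x +i* y) cmodE /=.
have h : 0 <= `|x| + `|y| by rewrite addr_ge0.
rewrite -[leRHS](ger0_norm h) -sqrtr_sqr ler_wsqrtr //.
have := normr_ge0 x; have := normr_ge0 y.
by rewrite -(real_normK (num_real x)) -(real_normK (num_real y)); nra.
Qed.

Lemma cmod_small z : (forall e, 0 < e -> cmod z <= e) -> z = 0.
Proof.
move=> h; apply: cmod_eq0; apply/eqP; rewrite eq_le cmod_ge0 andbT.
by apply/ler_addgt0Pr => e e0; rewrite add0r; exact: h.
Qed.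

Lemma le_small (x y : R) : (forall e, 0 < e -> x <= y + e) -> x <= y.
Proof. by move=> h; apply/ler_addgt0Pr => e; exact: h. Qed.

(* An ultrafilter limit replaces every extraction of subsequences below. *)
Definition ufilter : set_system nat :=
  projT1 (cid (@ultraFilterLemma nat \oo _)).

#[local] Instance ufilter_ultra : UltraFilter ufilter.
Proof. by rewrite /ufilter; case: cid => /= G []. Qed.

Lemma ufilter_tail N : ufilter [set n | (N <= n)%N].
Proof.
rewrite /ufilter; case: cid => /= G [_ sG]; apply: sG.
by exists N.
Qed.

Lemma ufilterI P Q : ufilter P -> ufilter Q -> ufilter (P `&` Q).
Proof. exact: filterI. Qed.

Lemma ufilterS P Q : (forall n, P n -> Q n) -> ufilter P -> ufilter Q.
Proof. exact: filterS. Qed.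

Lemma ufilterT P : (forall n, P n) -> ufilter P.
Proof. by move=> h; apply: filterS filterT => n _. Qed.

Lemma ufilter_ex P : ufilter P -> exists n, P n.
Proof. by move=> /filter_ex [n]; exists n. Qed.

Lemma ufilterVC P : ufilter P \/ ufilter (~` P).
Proof. exact: in_ultra_setVsetC. Qed.

Lemma ulimR (x : nat -> R) (M : R) : (forall n, `|x n| <= M) ->
  exists l : R, forall e, 0 < e -> ufilter [set n | `|x n - l| < e].
Proof.
move=> xM; have := @segment_compact R (- M) M; rewrite compact_ultra.
have UF : UltraFilter (x @ ufilter).
  split; first exact: fmap_proper_filter.
  move=> G GF sG; rewrite predeqE => A; split; last exact: sG.
  move=> GA; have [//|UnA] := ufilterVC (x @^-1` A).
  have /sG GnA : (x @ ufilter) (~` A) by [].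
  have G0 : G set0 by rewrite -(setICr A); exact: filterI.
  by case: (@filter_not_empty _ G GF).
move=> /(_ _ UF) [].
  by apply: ufilterT => n /=; rewrite in_itv /= -ler_norml.
move=> l [_ xl]; exists l => e e0.
have /= : nbhs l (ball l e) by exact: nbhsx_ballx.
by move=> /xl; apply: ufilterS => n; rewrite /ball /= distrC.
Qed.

Lemma ulim_ex (x : nat -> C) M : (forall n, cmod (x n) <= M) ->
  exists l, forall e, 0 < e -> ufilter [set n | cmod (x n - l) < e].
Proof.
move=> xM.
have [n|p hp] := @ulimR (fun n => Re (x n)) M.
  exact: le_trans (normRe _) (xM n).
have [n|q hq] := @ulimR (fun n => Im (x n)) M.
  exact: le_trans (normIm _) (xM n).
exists (p +i* q) => e e0.
have e2 : 0 < e / 2 by lra.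
apply: ufilterS (ufilterI (hp _ e2) (hq _ e2)) => n [] /= h1 h2.
apply: le_lt_trans (cmod_ReIm _) _.
by rewrite cReB cImB /=; lra.
Qed.

Lemma BW (x : nat -> C) M : (forall n, cmod (x n) <= M) ->
  exists l, forall e n, 0 < e -> exists2 m, (n <= m)%N & cmod (x m - l) < e.
Proof.
move=> /ulim_ex [l hl]; exists l => e n e0.
have [m [h1 h2]] := ufilter_ex (ufilterI (hl _ e0) (ufilter_tail n)).
by exists m.
Qed.

Lemma min_pos2 s t : 0 < s -> 0 < t -> exists e, [/\ 0 < e, e <= s & e <= t].
Proof. by move=> s0 t0; exists (Num.min s t); rewrite lt_min s0 t0 !ge_min !lexx orbT. Qed.

Definition copen (O : set C) := forall z, O z ->
  exists2 r : R, 0 < r & forall w, cmod (w - z) < r -> O w.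

Definition cclosed (X : set C) :=
  forall z, (forall e, 0 < e -> exists2 w, X w & cmod (w - z) < e) -> X z.

Definition cbounded (X : set C) := exists M, forall z, X z -> cmod z <= M.

Lemma inv_lt_eps e : 0 < e -> exists N : nat, forall n, (N <= n)%N -> n.+1%:R^-1 < e.
Proof.
move=> e0; exists (Num.bound e^-1) => n hn.
rewrite invf_plt ?posrE//.
apply: lt_le_trans (archi_boundP _) _; first by rewrite invr_ge0 ltW.
by rewrite ler_nat; apply: leq_trans hn _.
Qed.

(** Compactness as a uniform radius. If it failed, points [x n] violating [Q] at radius [n.+1%:R^-1]
    would cluster at some [l] of [X], against the local radius at [l], since [Q] passes to smaller
    radii. *)
Lemma compact_uniform (X : set C) (Q : C -> R -> Prop) :
  cclosed X -> cbounded X ->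
  (forall (y : C) r r', Q y r -> r' <= r -> Q y r') ->
  (forall x : C, X x -> exists r, [/\ 0 < r & forall y : C, X y -> cmod (y - x) < r -> Q y r]) ->
  exists2 r : R, 0 < r & forall y : C, X y -> Q y r.
Proof.
move=> Xcl [M XM] Qmono Qloc; apply: contrapT => /forall2NP hn.
have /choice [x hx] : forall n : nat, exists y : C, X y /\ ~ Q y n.+1%:R^-1.
  move=> n; have [h|h] := hn n.+1%:R^-1; first by exfalso; apply: h.
  by move: h => /existsNP [y /not_implyP [Xy nQ]]; exists y.
have [|l hl] := @BW x M; first by move=> n; apply: XM; case: (hx n).
have Xl : X l.
  apply: Xcl => e e0; have [m _ hm] := hl e 0%N e0.
  by exists (x m) => //; case: (hx m).
have [r [r0 hr]] := Qloc l Xl.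
have [N hN] := inv_lt_eps r0.
have [m Nm hm] := hl r N r0.
have [Xm nQ] := hx m; apply: nQ; apply: Qmono (hr _ Xm hm) _.
exact/ltW/hN.
Qed.

Lemma EVT (X : set C) (g : C -> R) : cclosed X -> cbounded X -> X !=set0 ->
  (forall x : C, X x -> forall e, 0 < e -> exists2 d : R, 0 < d &
     forall y : C, X y -> cmod (y - x) < d -> `|g y - g x| < e) ->
  exists2 x, X x & forall y : C, X y -> g y <= g x.
Proof.
move=> Xcl Xb [x0 Xx0] gc.
have [r r0 hr] : exists2 r : R, 0 < r & forall y : C, X y -> g y <= r^-1.
  (* The disjunct [r <= 0] makes the property inherited by all smaller radii, where [r^-1] is not an
     upper bound. *)
  have := @compact_uniform X (fun y r => g y <= r^-1 \/ r <= 0) Xcl Xb.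
  case=> [z r r' [h|h] rr|z Xz|r r0 hr].
  - have [r'0|r'0] := ltP 0 r'; [left|by right].
    apply: le_trans h _; rewrite lef_pV2 ?posrE //.
    exact: lt_le_trans r'0 rr.
  - by right; apply: le_trans rr h.
  - have [d d0 hd] := gc z Xz 1 ltr01.
    exists (Num.min d (`|g z| + 1)^-1); split.
      by rewrite lt_min d0 invr_gt0; have := normr_ge0 (g z); lra.
    move=> y Xy; rewrite lt_min => /andP[/(hd _ Xy) h _].
    left; apply: (@le_trans _ _ (`|g z| + 1)).
      have := ler_norm (g y - g z); have := ler_norm (g z); lra.
    have p : 0 < `|g z| + 1 by have := normr_ge0 (g z); lra.
    rewrite -[leLHS]invrK lef_pV2 ?posrE ?lt_min ?d0 ?invr_gt0//.
    by rewrite ge_min lexx orbT.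
  - by exists r => // y Xy; case: (hr y Xy) => // h; move: r0; rewrite ltNge h.
pose A := [set g z | z in X].
have Asup : has_sup A.
  by split; [exists (g x0), x0 | exists r^-1 => _ [z Xz <-]; exact: hr].
apply: contrapT => hn.
have lt_sup (x : C) : X x -> g x < sup A.
  move=> Xx; rewrite lt_neqAle; apply/andP; split; last first.
    by apply: ub_le_sup; [case: Asup|exists x].
  apply/eqP => gxs; apply: hn; exists x => // y Xy.
  by rewrite gxs; apply: ub_le_sup; [case: Asup|exists y].
(* Were the supremum not attained, the gap below it would be locally, hence uniformly, bounded away
   from 0. *)
have [s s0 hs] : exists2 s : R, 0 < s & forall y : C, X y -> g y <= sup A - s.
  apply: (@compact_uniform X (fun y s => g y <= sup A - s) Xcl Xb) => [y s s' h ss|x Xx].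
    by lra.
  have gx := lt_sup x Xx.
  have [|d d0 hd] := gc x Xx ((sup A - g x) / 2); first by lra.
  exists (Num.min d ((sup A - g x) / 2)); split; first by rewrite lt_min d0; lra.
  move=> y Xy; rewrite lt_min => /andP[/(hd _ Xy) h _].
  have := ler_norm (g y - g x).
  have : Num.min d ((sup A - g x) / 2) <= (sup A - g x) / 2 by rewrite ge_min lexx orbT.
  lra.
have : sup A <= sup A - s.
  by apply: ge_sup; [exists (g x0), x0 | move=> _ [x Xx <-]; exact: hs].
by lra.
Qed.

Definition ccont (u : C -> C) z := forall e, 0 < e -> exists2 d : R, 0 < d &
  forall w, cmod (w - z) < d -> cmod (u w - u z) < e.

Definition hasd (u : C -> C) z l := forall e, 0 < e -> exists2 d : R, 0 < d &
  forall w, cmod (w - z) < d -> cmod (u w - u z - l * (w - z)) <= e * cmod (w - z).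

Definition hol (O : set C) (u : C -> C) := forall z, O z -> exists l, hasd u z l.

Lemma hasd_loc u v z l r : 0 < r -> (forall w, cmod (w - z) < r -> u w = v w) ->
  hasd u z l -> hasd v z l.
Proof.
move=> r0 uv hu e e0; have [d d0 hd] := hu e e0.
exists (Num.min d r); first by rewrite lt_min d0.
move=> w; rewrite lt_min => /andP[wd wr].
by rewrite -!uv ?subrr ?cmod0//; exact: hd.
Qed.

Lemma hasd_lip u z l : hasd u z l -> exists2 d : R, 0 < d &
  forall w, cmod (w - z) < d -> cmod (u w - u z) <= (cmod l + 1) * cmod (w - z).
Proof.
move=> /(_ 1 ltr01) [d d0 hd]; exists d => // w /hd h.
have := cmodD (u w - u z - l * (w - z)) (l * (w - z)).
by rewrite subrK cmodM; lra.
Qed.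

Lemma hasd_cont u z l : hasd u z l -> ccont u z.
Proof.
move=> /hasd_lip [d d0 hd] e e0.
have l0 := cmod_ge0 l.
have p : 0 < e / (cmod l + 1) by apply: divr_gt0 => //; lra.
exists (Num.min d (e / (cmod l + 1))); first by rewrite lt_min d0.
move=> w; rewrite lt_min => /andP[/hd h1 h2].
apply: le_lt_trans h1 _; rewrite mulrC -ltr_pdivlMr //; lra.
Qed.

Lemma hasd_cst (c z : C) : hasd (fun=> c) z 0.
Proof.
move=> e e0; exists 1 => // w _.
by rewrite subrr mul0r subr0 cmod0 mulr_ge0 ?cmod_ge0 // ltW.
Qed.

Lemma hasd_id z : hasd id z 1.
Proof.
move=> e e0; exists 1 => // w _.
by rewrite mul1r subrr cmod0 mulr_ge0 ?cmod_ge0 // ltW.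
Qed.

Lemma ccontM u v z : ccont u z -> ccont v z -> ccont (fun w => u w * v w) z.
Proof.
move=> hu hv e e0; have x0 := cmod_ge0 (u z); have y0 := cmod_ge0 (v z).
have p : 0 < e / (cmod (u z) + cmod (v z) + 1) by apply: divr_gt0; lra.
have [t [t0 t1 te]] := min_pos2 ltr01 p; rewrite ler_pdivlMr in te; last lra.
have [d1 d10 h1] := hu _ t0; have [d2 d20 h2] := hv _ t0.
exists (Num.min d1 d2); first by rewrite lt_min d10.
move=> w; rewrite lt_min => /andP[/h1 k1 /h2 k2].
rewrite (_ : _ - _ = (u w - u z) * (v w - v z) + u z * (v w - v z) + (u w - u z) * v z); last by ring.
apply: le_lt_trans (cmodD _ _) _; have := cmodD ((u w - u z) * (v w - v z)) (u z * (v w - v z)).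
rewrite !cmodM; have := cmod_ge0 (u w - u z); have := cmod_ge0 (v w - v z).
move: (cmod (u w - u z)) (cmod (v w - v z)) (cmod (u z)) (cmod (v z)) x0 y0 te k1 k2 t0 t1.
move=> a b x y x0 y0 te ka kb t0 t1 b0 a0 h; apply: le_lt_trans (lerD h (lexx _)) _.
have : a * b <= t * b by apply: ler_wpM2r => //; exact: ltW.
have : t * b < t by rewrite gtr_pMr //; lra.
have : x * b <= x * t by apply: ler_wpM2l => //; exact: ltW.
have : a * y <= t * y by apply: ler_wpM2r => //; exact: ltW.
lra.
Qed.

Lemma ccontD u v z : ccont u z -> ccont v z -> ccont (fun w => u w + v w) z.
Proof.
move=> hu hv e e0; have e2 : 0 < e / 2 by lra.
have [d1 d10 h1] := hu _ e2; have [d2 d20 h2] := hv _ e2.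
exists (Num.min d1 d2); first by rewrite lt_min d10.
move=> w; rewrite lt_min => /andP[/h1 k1 /h2 k2].
rewrite (_ : _ - _ = (u w - u z) + (v w - v z)); last by ring.
apply: le_lt_trans (cmodD _ _) _; lra.
Qed.

Lemma ccont_cst c z : ccont (fun=> c) z.
Proof. exact: hasd_cont (hasd_cst c z). Qed.

Lemma ccont_id z : ccont id z.
Proof. exact: hasd_cont (hasd_id z). Qed.

Lemma ccont_ext u v z : u =1 v -> ccont u z -> ccont v z.
Proof. by move=> /funext ->. Qed.

Lemma ccont_loc u v z r : 0 < r -> (forall w, cmod (w - z) < r -> u w = v w) ->
  ccont u z -> ccont v z.
Proof.
move=> r0 uv h e e0; have [d d0 hd] := h e e0; exists (Num.min d r); first by rewrite lt_min d0.
by move=> w; rewrite lt_min => /andP[h1 h2]; rewrite -!uv ?subrr ?cmod0 //; exact: hd.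
Qed.

Lemma ccontB u v z : ccont u z -> ccont v z -> ccont (fun w => u w - v w) z.
Proof.
move=> hu hv; have := ccontD hu (ccontM (ccont_cst (-1) z) hv).
by apply: ccont_ext => w; rewrite mulN1r.
Qed.

Lemma ccontX u n z : ccont u z -> ccont (fun w => u w ^+ n) z.
Proof.
move=> hu; elim: n => [|n IH]; first by apply: ccont_ext (ccont_cst 1 z).
by apply: ccont_ext (ccontM hu IH) => w; rewrite exprS.
Qed.

Lemma ccont_comp u v z : ccont u z -> ccont v (u z) -> ccont (fun w => v (u w)) z.
Proof. by move=> hu hv e /hv [d /hu [d' d'0 h'] h]; exists d' => // w /h' /h. Qed.

(** Divided difference at [b], completed by the derivative. Bounds on it and its holomorphy replace
    Cauchy's formulas for derivatives throughout. *)
Definition slope u b l w : C := if w == b then l else (u w - u b) / (w - b).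

Lemma slopeE u b l w : w != b -> slope u b l w = (u w - u b) / (w - b).
Proof. by rewrite /slope => /negPf ->. Qed.

Lemma slope_bb u b l : slope u b l b = l.
Proof. by rewrite /slope eqxx. Qed.

Lemma slopeM u b l w : slope u b l w * (w - b) = u w - u b.
Proof.
have [->|wb] := eqVneq w b; first by rewrite !subrr mulr0.
by rewrite slopeE // divfK // subr_eq0.
Qed.

Lemma slope_ccont_at u b l : hasd u b l -> ccont (slope u b l) b.
Proof.
move=> hl e e0; have e2 : 0 < e / 2 by lra.
have [d d0 hd] := hl _ e2; exists d => // w hw.
rewrite slope_bb; have [->|wb] := eqVneq w b; first by rewrite slope_bb subrr cmod0.
have np : 0 < cmod (w - b) by rewrite cmod_gt0 subr_eq0.
rewrite -(ltr_pM2r np) -cmodM mulrBl slopeM.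
apply: le_lt_trans (hd _ hw) _; rewrite ltr_pM2r //; lra.
Qed.

(** Caratheodory's criterion; with it the sum, product and chain rules become statements about
    continuity of slopes. *)
Lemma slope_hasd u q z : ccont q z -> (forall w, q w * (w - z) = u w - u z) -> hasd u z (q z).
Proof.
move=> hq E e /hq [d d0 hd]; exists d => // w /hd h.
by rewrite -E -mulrBl cmodM; apply: ler_wpM2r; [exact: cmod_ge0|exact: ltW].
Qed.

Lemma hasdD u v z l m : hasd u z l -> hasd v z m -> hasd (fun w => u w + v w) z (l + m).
Proof.
move=> hu hv; rewrite -(slope_bb u z l) -(slope_bb v z m).
apply: (slope_hasd (ccontD (slope_ccont_at hu) (slope_ccont_at hv))) => w.
by rewrite mulrDl !slopeM; ring.
Qed.

Lemma hasdM u v z l m : hasd u z l -> hasd v z m ->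
  hasd (fun w => u w * v w) z (l * v z + u z * m).
Proof.
move=> hu hv; rewrite -[in l * _](slope_bb u z l) -[in _ * m](slope_bb v z m).
have h1 := ccontM (slope_ccont_at hu) (hasd_cont hv); have h2 := ccontM (ccont_cst (u z) z) (slope_ccont_at hv).
by apply: (slope_hasd (ccontD h1 h2)) => w; rewrite mulrDl mulrAC slopeM -mulrA slopeM; ring.
Qed.

Lemma hasd_comp u v z l m : hasd u z l -> hasd v (u z) m ->
  hasd (fun w => v (u w)) z (m * l).
Proof.
move=> hu hv; rewrite -[in m * _](slope_bb v (u z) m) -[in _ * l](slope_bb u z l).
have h := ccont_comp (hasd_cont hu) (slope_ccont_at hv).
by apply: (slope_hasd (ccontM h (slope_ccont_at hu))) => w; rewrite -mulrA !slopeM.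
Qed.

Lemma hasd_inv z : z != 0 -> hasd (fun w => w^-1) z (- z^-1 ^+ 2).
Proof.
move=> z0 e e0; have zp := cmod_neq0 z0.
pose d := Num.min (cmod z / 2) (e * cmod z ^+ 3 / 2).
have z3 : 0 < cmod z ^+ 3 by rewrite exprn_gt0.
exists d; first by rewrite lt_min; apply/andP; split; [|apply: divr_gt0; rewrite ?mulr_gt0]; lra.
move=> w; rewrite lt_min => /andP[h1 h2].
have wp : cmod z / 2 < cmod w.
  by have := cmod_sub z w; rewrite cmodBC; lra.
have w0 : w != 0 by apply: cmod_gt0P; lra.
rewrite (_ : _ - _ - _ = (w - z) * ((w - z) / (w * z ^+ 2))); last by field; rewrite w0 z0.
rewrite cmodM mulrC; apply: ler_wpM2r; rewrite ?cmod_ge0//.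
rewrite cmod_div cmodM cmodX ler_pdivrMr ?mulr_gt0 ?exprn_gt0//; last lra.
apply: le_trans (ltW h2) _.
have t0 : 0 <= e * cmod z ^+ 2 by rewrite mulr_ge0 ?sqr_ge0 // ltW.
have -> : cmod z ^+ 3 = cmod z * cmod z ^+ 2 by rewrite exprS.
nra.
Qed.

Lemma hasd_uniq u z l m : hasd u z l -> hasd u z m -> l = m.
Proof.
move=> hu hv; apply/eqP; rewrite -subr_eq0; apply/eqP; apply: cmod_small => e e0.
have e2 : 0 < e / 2 by lra.
have [d d0 hd] := hu _ e2; have [d' d'0 hd'] := hv _ e2.
pose s := Num.min d d' / 2.
have s0 : 0 < s by rewrite divr_gt0 // lt_min d0.
have [sd sd'] : s < d /\ s < d'.
  have : Num.min d d' <= d /\ Num.min d d' <= d' by rewrite !ge_min !lexx orbT.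
  by rewrite /s; move=> [] *; move: s0; rewrite /s; lra.
have E : z + s%:C - z = s%:C by rewrite addrC addKr.
have ns : cmod s%:C = s by rewrite cmod_real gtr0_norm.
have := hd (z + s%:C); have := hd' (z + s%:C); rewrite E ns => /(_ sd') k1 /(_ sd) k2.
have := cmodB (u (z + s%:C) - u z - m * s%:C) (u (z + s%:C) - u z - l * s%:C).
rewrite (_ : _ - _ = (l - m) * s%:C); last by ring.
by rewrite cmodM ns => k3; rewrite -(ler_pM2r s0); lra.
Qed.

Lemma slope_hasd_off u b l z m : z != b -> hasd u z m -> exists n : C, hasd (slope u b l) z n.
Proof.
move=> zb hm; have zb0 : z - b != 0 by rewrite subr_eq0.
have h1 := hasdD hm (hasd_cst (- u b) z).
have h2 := hasd_comp (hasdD (hasd_id z) (hasd_cst (- b) z)) (hasd_inv zb0).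
have zp := cmod_neq0 zb0.
eexists; apply: (hasd_loc zp _ (hasdM h1 h2)) => w hw.
rewrite slopeE //; apply: contraTneq hw => ->; rewrite -leNgt (cmodBC b) lexx //.
Qed.

Lemma slope_ccont_off u b l z : z != b -> ccont u z -> ccont (slope u b l) z.
Proof.
move=> zb hu; have zb0 : z - b != 0 by rewrite subr_eq0.
have h1 := ccontB hu (ccont_cst (u b) z).
have h2 := hasd_comp (hasdD (hasd_id z) (hasd_cst (- b) z)) (hasd_inv zb0).
have zp := cmod_neq0 zb0.
apply: (ccont_loc zp _ (ccontM h1 (hasd_cont h2))) => w hw.
rewrite slopeE //; apply: contraTneq hw => ->; rewrite -leNgt (cmodBC b) lexx //.
Qed.

Lemma slope_ccont u b l z : hasd u b l -> ccont u z -> ccont (slope u b l) z.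
Proof.
move=> hl hz; have [->|zb] := eqVneq z b; first exact: slope_ccont_at.
exact: slope_ccont_off.
Qed.

Lemma hol_sub (O O' : set C) u : (forall z, O' z -> O z) -> hol O u -> hol O' u.
Proof. by move=> s h z /s /h. Qed.

Lemma hol_cst (O : set C) c : hol O (fun=> c).
Proof. by move=> z _; exists 0; exact: hasd_cst. Qed.

Lemma hol_id (O : set C) : hol O id.
Proof. by move=> z _; exists 1; exact: hasd_id. Qed.

Lemma holD (O : set C) u v : hol O u -> hol O v -> hol O (fun w => u w + v w).
Proof. by move=> hu hv z Oz; have [l] := hu z Oz; have [m] := hv z Oz; exists (l + m); exact: hasdD. Qed.

Lemma holM (O : set C) u v : hol O u -> hol O v -> hol O (fun w => u w * v w).
Proof.
move=> hu hv z Oz; have [l hl] := hu z Oz; have [m hm] := hv z Oz.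
by exists (l * v z + u z * m); exact: hasdM.
Qed.

Lemma holN (O : set C) u : hol O u -> hol O (fun w => - u w).
Proof.
move=> hu z Oz; have [l hl] := holM (@hol_cst O (-1)) hu Oz; exists l.
by apply: hasd_loc hl => [|w _]; [exact: ltr01|rewrite mulN1r].
Qed.

Lemma holB (O : set C) u v : hol O u -> hol O v -> hol O (fun w => u w - v w).
Proof. by move=> hu hv; apply: holD => //; exact: holN. Qed.

Lemma hol_comp (O O' : set C) u v : (forall z, O z -> O' (u z)) -> hol O u -> hol O' v ->
  hol O (fun w => v (u w)).
Proof.
move=> s hu hv z Oz; have [l hl] := hu z Oz; have [m hm] := hv _ (s z Oz).
by exists (m * l); exact: hasd_comp.
Qed.

Lemma holV (O : set C) u : hol O u -> (forall z, O z -> u z != 0) -> hol O (fun w => (u w)^-1).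
Proof.
move=> hu u0; apply: (hol_comp (O' := [set w | w != 0])) => // z z0.
by eexists; exact: hasd_inv.
Qed.

Lemma hol_div (O : set C) u v : hol O u -> hol O v -> (forall z, O z -> v z != 0) ->
  hol O (fun w => u w / v w).
Proof. by move=> hu hv v0; apply: holM => //; exact: holV. Qed.

Lemma holX (O : set C) u n : hol O u -> hol O (fun w => u w ^+ n).
Proof.
move=> hu; elim: n => [|n IH z Oz].
  by move=> z _; exists 0; apply: hasd_loc (@hasd_cst 1 z) => [|w _]; [exact: ltr01|].
have [l hl] := holM hu IH Oz; exists l.
by apply: hasd_loc hl => [|w _]; [exact: ltr01|rewrite exprS].
Qed.

Lemma hol_eq (O : set C) u v : copen O -> (forall z, O z -> u z = v z) -> hol O u -> hol O v.
Proof.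
move=> oO uv hu z Oz; have [l hl] := hu z Oz; exists l.
have [r r0 hr] := oO z Oz.
by apply: hasd_loc hl => [|w /hr /uv]; [exact: r0|].
Qed.

Lemma hasd_poly (p : {poly C}) z : hasd (fun w => p.[w]) z p^`().[z].
Proof.
elim/poly_ind: p => [|p c IH].
  rewrite deriv0 horner0; apply: hasd_loc (hasd_cst 0 z) => [|w _]; [exact: ltr01|by rewrite horner0].
have := hasdD (hasdM IH (hasd_id z)) (hasd_cst c z).
rewrite derivD derivC derivM derivX addr0 mulr1 !hornerE.
by apply: hasd_loc => [|w _]; [exact: ltr01|rewrite /= !hornerE].
Qed.

Lemma hol_cont (O : set C) u z : hol O u -> O z -> ccont u z.
Proof. by move=> h /h [l /hasd_cont]. Qed.

End Basics.

(** * Integration along the sides of rectangles *)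

Section Goursat.
Context {R : realType}.
Local Notation C := R[i].
Implicit Types (g h : R -> R) (u v k : C -> C) (a b x y m M s e d : R).

(** The composite with [Re] turns a curve into a function on [C], so the lemmas on [ccont] serve for
    curves as well. *)
Definition curve_cont (c : R -> C) := forall z : C, ccont (fun w => c (Re w)) z.

Definition rcont g := curve_cont (fun x => (g x)%:C).

Lemma cmod_realB x y : cmod (x%:C - y%:C : C) = `|x - y|.
Proof. by rewrite -cmod_real rmorphB. Qed.

Lemma rcont_cvg g x : rcont g -> {for x, continuous g}.
Proof.
move=> gc; apply/cvgrPdist_lt => e e0; have [d d0 hd] := gc x%:C e e0.
apply/nbhs_ballP; exists d => //= y; rewrite /ball /= => xy; have := hd y%:C.
by rewrite !cmod_realB /= distrC (distrC (g y)); apply.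
Qed.

(** The primitive is an integral from -3 within [[-3, 3]], so that the window [-2 < x < 2] is
    interior; all contours below stay in that window. *)
Lemma primitive_ex g : rcont g ->
  exists G : R -> R, forall x : R, -2 < x < 2 -> is_derive x 1 G (g x).
Proof.
move=> gc.
pose G x : R := (\int[@lebesgue_measure R]_(t in [set` `[(-3 : R), x]]) (g t))%R.
exists G => x /andP[x1 x2].
have ig : (@lebesgue_measure R).-integrable `[(-3 : R), 3] (EFin \o g).
  apply: continuous_compact_integrable; first exact: segment_compact.
  by apply: continuous_subspaceT => y; exact: rcont_cvg.
have x3 : x < 3 by lra.
have x3' : -3 < x by lra.
have [d1 d2] := continuous_FTC1_closed x3 ig x3' (rcont_cvg gc).
apply: DeriveDef; first exact: d1.
by rewrite -derive1E; exact: d2.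
Qed.

(** Integration by primitives: two primitives on the window differ by a constant, and the endpoints
    may come in either order. *)
Definition int1 g (a b : R) : R := xget 0 [set v | exists G : R -> R,
  (forall x : R, -2 < x < 2 -> is_derive x 1 G (g x)) /\ v = G b - G a].

Lemma deriv_bound (G g : R -> R) m M a b :
  (forall x : R, -2 < x < 2 -> is_derive x 1 G (g x)) ->
  -2 < a -> a <= b -> b < 2 -> (forall x, a <= x <= b -> m <= g x <= M) ->
  m * (b - a) <= G b - G a <= M * (b - a).
Proof.
move=> dG a2; rewrite le_eqVlt => /orP[/eqP ->|ab] b2 hg.
  by rewrite !subrr !mulr0 lexx.
have d x : x \in `]a, b[ -> is_derive x 1 G (g x).
  by rewrite in_itv /= => /andP[h1 h2]; apply: dG; split_lra.
have cG : {within `[a, b], continuous G}.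
  apply: derivable_within_continuous => x; rewrite in_itv /= => /andP[h1 h2].
  by have [] : is_derive x 1 G (g x) by apply: dG; split_lra.
have [c] := MVT ab d cG; rewrite in_itv /= => /andP[h1 h2] ->.
have /andP[h3 h4] : m <= g c <= M by apply: hg; rewrite !ltW.
by apply/andP; split; rewrite ler_pM2r // subr_gt0.
Qed.

Lemma int1E g (G : R -> R) a b : (forall x : R, -2 < x < 2 -> is_derive x 1 G (g x)) ->
  -2 < a < 2 -> -2 < b < 2 -> int1 g a b = G b - G a.
Proof.
move=> dG a2 b2; rewrite /int1; case: xgetP => [v _ [H [dH ->]]|/(_ (G b - G a))]; last first.
  by case; exists G.
have dz : forall x : R, -2 < x < 2 -> is_derive x (1 : R) (G - H) ((fun=> 0 : R) x).
  move=> x hx; have h1 := dG x hx; have h2 := dH x hx.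
  by have := is_deriveB h1 h2; rewrite subrr.
have key (p q : R) : -2 < p -> p <= q -> q < 2 -> (G - H) p = (G - H) q.
  move=> h1 h2 h3; have := @deriv_bound _ _ 0 0 _ _ dz h1 h2 h3.
  rewrite !mul0r lexx => /(_ (fun _ _ => isT)) /andP[k1 k2].
  by apply/eqP; rewrite eq_le; split_lra.
have : (G - H) a = (G - H) b.
  have [ab|ba] := leP a b; first by apply: key => //; lra.
  by rewrite (key b a) //; lra.
move=> E; have {}E : G a - H a = G b - H b by exact: E.
lra.
Qed.

Lemma int1_ex g : rcont g -> exists2 G : R -> R,
  (forall x : R, -2 < x < 2 -> is_derive x 1 G (g x)) &
  (forall a b, -2 < a < 2 -> -2 < b < 2 -> int1 g a b = G b - G a).
Proof.
by move=> /primitive_ex [G dG]; exists G => // a b ha hb; exact: int1E.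
Qed.

Lemma int1_cat g a b c : rcont g -> -2 < a < 2 -> -2 < b < 2 -> -2 < c < 2 ->
  int1 g a c = int1 g a b + int1 g b c.
Proof. by move=> /int1_ex [G _ hG] ha hb hc; rewrite !hG //; lra. Qed.

Lemma int1_bound g m M a b : rcont g -> -2 < a -> a <= b -> b < 2 ->
  (forall x, a <= x <= b -> m <= g x <= M) -> m * (b - a) <= int1 g a b <= M * (b - a).
Proof.
move=> /int1_ex [G dG hG] ha ab hb; rewrite hG; [exact: deriv_bound|lra|lra].
Qed.

Lemma int1_lin g h p q a b : rcont g -> rcont h -> -2 < a < 2 -> -2 < b < 2 ->
  int1 (fun x => p * g x + q * h x) a b = p * int1 g a b + q * int1 h a b.
Proof.
move=> /int1_ex [G dG hG] /int1_ex [H dH hH] ha hb; rewrite hG // hH //.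
have d : forall x : R, -2 < x < 2 -> is_derive x (1 : R) (fun x => p * G x + q * H x) (p * g x + q * h x).
  move=> x hx; have h1 := is_deriveZ p (dG x hx); have h2 := is_deriveZ q (dH x hx).
  exact: is_deriveD h1 h2.
by rewrite (int1E d) //; ring.
Qed.

Lemma int1_aff p q a b : -2 < a < 2 -> -2 < b < 2 ->
  int1 (fun x => p + q * x) a b = p * (b - a) + q * ((b ^+ 2 - a ^+ 2) / 2).
Proof.
move=> ha hb.
have d : forall x : R, -2 < x < 2 -> is_derive x (1 : R) (fun x => p * x + (q / 2) * x ^+ 2) (p + q * x).
  move=> x _; have h1 := is_deriveZ p (is_derive_id x 1).
  have h3 := is_deriveZ (q / 2) (is_deriveX 2 (is_derive_id x (1 : R))).
  have := is_deriveD h1 h3.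
  set D1 := (X in is_derive _ _ _ X); set D2 := (X in _ -> is_derive _ _ _ X).
  suff -> : D1 = D2 by [].
  by rewrite /D1 /D2 /GRing.scale /= !mulr1 expr1 mulr2n; field.
by rewrite (int1E d) //; field.
Qed.

Arguments int1 : simpl never.
Lemma curve_contRe c : curve_cont c -> rcont (fun x => Re (c x)).
Proof.
by move=> h z e e0; have [d d0 hd] := h z e e0; exists d => // w /hd; apply: le_lt_trans; rewrite cmod_realB -cReB normRe.
Qed.

Lemma curve_contIm c : curve_cont c -> rcont (fun x => Im (c x)).
Proof.
by move=> h z e e0; have [d d0 hd] := h z e e0; exists d => // w /hd; apply: le_lt_trans; rewrite cmod_realB -cImB normIm.
Qed.

Definition cint (c : R -> C) a b : C :=
  int1 (fun x => Re (c x)) a b +i* int1 (fun x => Im (c x)) a b.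

Arguments cint : simpl never.
Lemma cint_cat c x y z : curve_cont c -> -2 < x < 2 -> -2 < y < 2 -> -2 < z < 2 ->
  cint c x z = cint c x y + cint c y z.
Proof.
move=> h hx hy hz; rewrite /cint (@int1_cat _ x y z) //; last exact: curve_contRe.
by rewrite (@int1_cat (fun x => Im (c x)) x y z) //; exact: curve_contIm.
Qed.

Lemma int1_ext g h a b : g =1 h -> int1 g a b = int1 h a b.
Proof. by move=> /funext ->. Qed.

Lemma cint_lin c1 c2 p q a b : curve_cont c1 -> curve_cont c2 ->
  -2 < a < 2 -> -2 < b < 2 ->
  cint (fun x => p * c1 x + q * c2 x) a b = p * cint c1 a b + q * cint c2 a b.
Proof.
move=> h1 h2 ha hb; have r1 := curve_contRe h1; have r2 := curve_contRe h2.
have i1 := curve_contIm h1; have i2 := curve_contIm h2.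
have aux s t g h : rcont g -> rcont h -> rcont (fun x => s * g x + t * h x).
  move=> gc hc z; have := ccontD (ccontM (ccont_cst s%:C z) (gc z)) (ccontM (ccont_cst t%:C z) (hc z)).
  by apply: ccont_ext => w; rewrite !rmorphD !rmorphM.
apply: cplx_eq; rewrite /cint ?cReD ?cImD ?cReM ?cImM /=.
  rewrite (int1_ext _ _ (h := fun x => 1 * (Re p * Re (c1 x) + (- Im p) * Im (c1 x)) + 1 * (Re q * Re (c2 x) + (- Im q) * Im (c2 x)))); last by move=> x; rewrite cReD !cReM; ring.
  rewrite int1_lin ?int1_lin //; try exact: aux; ring.
rewrite (int1_ext _ _ (h := fun x => 1 * (Re p * Im (c1 x) + Im p * Re (c1 x)) + 1 * (Re q * Im (c2 x) + Im q * Re (c2 x)))); last by move=> x; rewrite cImD !cImM; ring.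
rewrite int1_lin ?int1_lin //; try exact: aux; ring.
Qed.

(** The factor 2 comes from bounding real and imaginary parts separately. It does no harm, as
    constants are later removed by taking powers. *)
Lemma cint_bound c M a b : curve_cont c -> -2 < a -> a <= b -> b < 2 ->
  (forall x, a <= x <= b -> cmod (c x) <= M) -> cmod (cint c a b) <= 2 * M * (b - a).
Proof.
move=> h ha ab hb hM; apply: le_trans (cmod_ReIm _) _; rewrite /cint /=.
have h1 : - M * (b - a) <= int1 (fun x => Re (c x)) a b <= M * (b - a).
  apply: int1_bound => //; first exact: curve_contRe.
  by move=> x /hM hx; rewrite -ler_norml; apply: le_trans (normRe _) hx.
have h2 : - M * (b - a) <= int1 (fun x => Im (c x)) a b <= M * (b - a).
  apply: int1_bound => //; first exact: curve_contIm.
  by move=> x /hM hx; rewrite -ler_norml; apply: le_trans (normIm _) hx.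
move: h1 h2; rewrite mulNr -!ler_norml; lra.
Qed.

Lemma cint_aff p q a b : -2 < a < 2 -> -2 < b < 2 ->
  cint (fun x => p + q * x%:C) a b = p * (b - a)%:C + q * ((b ^+ 2 - a ^+ 2) / 2)%:C.
Proof.
move=> ha hb; apply: cplx_eq; rewrite /cint ?cReD ?cImD ?cReM ?cImM /= ?mulr0 ?subr0.
  rewrite (int1_ext _ _ (h := fun x => Re p + Re q * x)).
    by rewrite int1_aff // cReD !cReM /= !mulr0 !subr0.
  by move=> x; rewrite cReD cReM /= mulr0 subr0.
rewrite (int1_ext _ _ (h := fun x => Im p + Im q * x)).
  by rewrite int1_aff //=; ring.
by move=> x; rewrite cImD cImM /=; ring.
Qed.

Definition contour u x0 x1 y0 y1 : C :=
  cint (fun x => u (x +i* y0)) x0 x1 + 'i * cint (fun y => u (x1 +i* y)) y0 y1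
  - cint (fun x => u (x +i* y1)) x0 x1 - 'i * cint (fun y => u (x0 +i* y)) y0 y1.

Lemma slice_h u (y : R) : (forall x : R, ccont u (x +i* y)) -> curve_cont (fun x => u (x +i* y)).
Proof.
move=> uc z; apply: (ccont_comp (u := fun w => Re w +i* y)) (uc _) => e e0; exists e => // w.
by apply: le_lt_trans; rewrite (_ : _ - _ = (Re (w - z))%:C) ?cmod_real ?normRe //; apply: cplx_eq; rewrite ?cReB ?cImB /= ?subrr.
Qed.

Lemma cmodI : cmod ('i : C) = 1.
Proof. by rewrite cmodE expr0n expr1n add0r sqrtr1. Qed.

Lemma slice_v u (x : R) : (forall y : R, ccont u (x +i* y)) -> curve_cont (fun y => u (x +i* y)).
Proof.
move=> uc z; apply: (ccont_comp (u := fun w => x +i* Re w)) (uc _) => e e0; exists e => // w.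
apply: le_lt_trans; rewrite (_ : _ - _ = 'i * (Re (w - z))%:C) ?cmodM ?cmodI ?mul1r ?cmod_real ?normRe //.
by apply: cplx_eq; rewrite ?cReB ?cImB ?cReM ?cImM ?cReB /=; ring.
Qed.

Lemma contour_hsplit u x0 x1 x2 y0 y1 : (forall z, ccont u z) ->
  -2 < x0 < 2 -> -2 < x1 < 2 -> -2 < x2 < 2 ->
  contour u x0 x2 y0 y1 = contour u x0 x1 y0 y1 + contour u x1 x2 y0 y1.
Proof.
move=> uc h0 h1 h2; rewrite /contour.
rewrite (@cint_cat (fun x => u (x +i* y0)) x0 x1 x2) //; last exact: slice_h.
rewrite (@cint_cat (fun x => u (x +i* y1)) x0 x1 x2) //; last exact: slice_h.
by ring.
Qed.

Lemma contour_vsplit u x0 x1 y0 y1 y2 : (forall z, ccont u z) ->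
  -2 < y0 < 2 -> -2 < y1 < 2 -> -2 < y2 < 2 ->
  contour u x0 x1 y0 y2 = contour u x0 x1 y0 y1 + contour u x0 x1 y1 y2.
Proof.
move=> uc h0 h1 h2; rewrite /contour.
rewrite (@cint_cat (fun y => u (x0 +i* y)) y0 y1 y2) //; last exact: slice_v.
rewrite (@cint_cat (fun y => u (x1 +i* y)) y0 y1 y2) //; last exact: slice_v.
by ring.
Qed.

Definition rect x0 x1 y0 y1 : set C :=
  [set z | x0 <= Re z <= x1 /\ y0 <= Im z <= y1].

(** The four full lines rather than the sides: the lemmas on [cint] ask for curves that are
    continuous on the whole line. *)
Definition edge x0 x1 y0 y1 : set C := [set z | (Re z = x0 \/ Re z = x1) \/ (Im z = y0 \/ Im z = y1)].

(** 8 is four sides times the factor 2 of [cint_bound]. *)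
Lemma contour_bound u M s x0 x1 y0 y1 : (forall z, edge x0 x1 y0 y1 z -> ccont u z) ->
  -2 < x0 -> x0 <= x1 -> x1 < 2 -> -2 < y0 -> y0 <= y1 -> y1 < 2 ->
  x1 - x0 <= s -> y1 - y0 <= s -> 0 <= M ->
  (forall z, rect x0 x1 y0 y1 z -> edge x0 x1 y0 y1 z -> cmod (u z) <= M) ->
  cmod (contour u x0 x1 y0 y1) <= 8 * M * s.
Proof.
move=> uc h1 h2 h3 h4 h5 h6 h7 h8 M0 hM.
have b1 y : y = y0 \/ y = y1 -> cmod (cint (fun x => u (x +i* y)) x0 x1) <= 2 * M * s.
  move=> hy; apply: (@le_trans _ _ (2 * M * (x1 - x0))); last by nra.
  apply: cint_bound => // [|x hx]; first by apply: slice_h => x; apply: uc; right.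
  by apply: hM; [split=> //=; case: hy => ->; rewrite lexx ?andbT|right].
have b2 x : x = x0 \/ x = x1 -> cmod (cint (fun y => u (x +i* y)) y0 y1) <= 2 * M * s.
  move=> hx; apply: (@le_trans _ _ (2 * M * (y1 - y0))); last by nra.
  apply: cint_bound => // [|y hy]; first by apply: slice_v => y; apply: uc; left.
  by apply: hM; [split=> //=; case: hx => ->; rewrite lexx ?andbT|left].
have k1 := b1 y0 (or_introl erefl); have k2 := b1 y1 (or_intror erefl).
have k3 := b2 x0 (or_introl erefl); have k4 := b2 x1 (or_intror erefl).
rewrite /contour; apply: le_trans (cmodB _ _) _; rewrite cmodM cmodI mul1r.
set A := cint _ _ _ in k1 *; set B := cint _ _ _ in k4 *; set D := cint _ _ _ in k2 *.
have := cmodB (A + 'i * B) D; have := cmodD A ('i * B); rewrite cmodM cmodI mul1r; lra.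
Qed.

Lemma contour_aff p q x0 x1 y0 y1 :
  -2 < x0 < 2 -> -2 < x1 < 2 -> -2 < y0 < 2 -> -2 < y1 < 2 ->
  contour (fun z => p + q * z) x0 x1 y0 y1 = 0.
Proof.
move=> h1 h2 h3 h4; rewrite /contour.
have E1 y : (fun x => p + q * (x +i* y)) = (fun x => (p + q * ('i * y%:C)) + q * x%:C).
  by apply: funext => x; apply: cplx_eq; rewrite !(cReD, cImD, cReM, cImM) /=; ring.
have E2 x : (fun y => p + q * (x +i* y)) = (fun y => (p + q * x%:C) + (q * 'i) * y%:C).
  by apply: funext => y; apply: cplx_eq; rewrite !(cReD, cImD, cReM, cImM) /=; ring.
rewrite !E1 !E2 !cint_aff //.
have EB s t : (s - t)%:C = s%:C - t%:C :> C by apply: cplx_eq; rewrite ?cReB ?cImB /= ?subr0.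
by rewrite !(EB x1 x0) !(EB y1 y0); ring.
Qed.

Lemma contour_lin u v p q x0 x1 y0 y1 :
  (forall z, edge x0 x1 y0 y1 z -> ccont u z) -> (forall z, edge x0 x1 y0 y1 z -> ccont v z) ->
  -2 < x0 < 2 -> -2 < x1 < 2 -> -2 < y0 < 2 -> -2 < y1 < 2 ->
  contour (fun z => p * u z + q * v z) x0 x1 y0 y1 =
  p * contour u x0 x1 y0 y1 + q * contour v x0 x1 y0 y1.
Proof.
move=> uc vc h1 h2 h3 h4; rewrite /contour.
rewrite !cint_lin //; first by ring.
all: try (by apply: slice_h => x; (apply: uc || apply: vc); right; auto).
all: by apply: slice_v => y; (apply: uc || apply: vc); left; auto.
Qed.

End Goursat.

(** * Goursat's theorem and a Cauchy estimate at the centre of a square *)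

Section MaxMod.
Context {R : realType}.
Local Notation C := R[i].
Implicit Types (u v k : C -> C) (M m s e d r : R) (z w p q : C).
Arguments cint : simpl never.
Arguments int1 : simpl never.

Lemma pow_small (t e : R) : 0 <= t -> t < 1 -> 0 < e -> exists n, t ^+ n < e.
Proof.
move=> t0 t1 e0; have h := @cvg_expr R t; rewrite ger0_norm // in h.
have /cvgrPdist_lt /(_ e e0) [N _ hN] := h t1.
exists N; have := hN N (leqnn N) => /=.
by rewrite sub0r normrN ger0_norm // exprn_ge0.
Qed.

(** Bisection in general form: [(x', y')] is the lower left corner after [n] halvings, and the
    suprema of the corner coordinates give the common point. *)
Lemma nested_rects (P : R -> R -> nat -> Prop) (x y w h : R) :
  0 <= w -> 0 <= h -> P x y 0%N ->
  (forall x y n, P x y n -> exists x' y', [/\ P x' y' n.+1,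
     x' = x \/ x' = x + w / 2 ^+ n.+1 & y' = y \/ y' = y + h / 2 ^+ n.+1]) ->
  exists a b, forall n, exists x' y', [/\ P x' y' n,
     [/\ x <= x', x' <= a & a <= x' + w / 2 ^+ n], x' + w / 2 ^+ n <= x + w &
     [/\ y <= y', y' <= b, b <= y' + h / 2 ^+ n & y' + h / 2 ^+ n <= y + h]].
Proof.
move=> w0 h0 P0 Pn.
have /choice [f hf] : forall t : R * R * nat, exists s : R * R, P t.1.1 t.1.2 t.2 ->
    [/\ P s.1 s.2 t.2.+1, s.1 = t.1.1 \/ s.1 = t.1.1 + w / 2 ^+ t.2.+1 &
      s.2 = t.1.2 \/ s.2 = t.1.2 + h / 2 ^+ t.2.+1].
  move=> [[x' y'] n] /=; have [Pxy|nP] := pselect (P x' y' n); last by exists (0, 0).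
  by have [x1 [y1 [h1 h2 h3]]] := Pn _ _ _ Pxy; exists (x1, y1).
pose g := fix g n : R * R := if n is n'.+1 then f (g n', n') else (x, y).
have gP n : P (g n).1 (g n).2 n.
  by elim: n => [|n IH] //=; have [] := hf (g n, n) IH.
have gS n : ((g n.+1).1 = (g n).1 \/ (g n.+1).1 = (g n).1 + w / 2 ^+ n.+1) /\
    ((g n.+1).2 = (g n).2 \/ (g n.+1).2 = (g n).2 + h / 2 ^+ n.+1).
  by have [] := hf (g n, n) (gP n).
have half (v : R) n : v / 2 ^+ n = 2 * (v / 2 ^+ n.+1).
  by rewrite exprS; field; rewrite expf_neq0 // pnatr_eq0.
have pos (v : R) n : 0 <= v -> 0 <= v / 2 ^+ n.
  by move=> v0; rewrite divr_ge0 // exprn_ge0.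
have key (c : nat -> R) (v : R) : 0 <= v -> (forall n, c n.+1 = c n \/ c n.+1 = c n + v / 2 ^+ n.+1) ->
    exists a, forall n, [/\ c 0%N <= c n, c n <= a, a <= c n + v / 2 ^+ n & c n + v / 2 ^+ n <= c 0%N + v].
  move=> v0 cS.
  have mono n i : c n <= c (n + i)%N /\ c (n + i)%N + v / 2 ^+ (n + i) <= c n + v / 2 ^+ n.
    elim: i => [|i [IH1 IH2]]; first by rewrite addn0.
    rewrite addnS; have := pos v (n + i).+1 v0; have := half v (n + i)%N.
    by case: (cS (n + i)%N) => ->; split; lra.
  have ub (m n : nat) : c m <= c n + v / 2 ^+ n.
    have [/subnKC <-|/ltnW /subnKC <-] := leqP m n.
      by have [h1 h2] := mono m (n - m)%N; have := pos v (m + (n - m))%N v0; lra.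
    by have [h1 h2] := mono n (m - n)%N; have := pos v (n + (m - n))%N v0; lra.
  have hs : has_sup [set c n | n in setT].
    by split; [exists (c 0%N), 0%N | exists (c 0%N + v / 2 ^+ 0) => _ [n _ <-]; exact: ub].
  exists (sup [set c n | n in setT]) => n; split.
  - by have [] := mono 0%N n; rewrite add0n.
  - by apply: ub_le_sup; [case: hs|exists n].
  - by apply: ge_sup; [case: hs|move=> _ [m _ <-]].
  - by have [_] := mono 0%N n; rewrite add0n expr0 divr1.
have [a ha] := key (fun n => (g n).1) w w0 (fun n => (gS n).1).
have [b hb] := key (fun n => (g n).2) h h0 (fun n => (gS n).2).
exists a, b => n; exists (g n).1, (g n).2.
by have [] := ha n; have [] := hb n.
Qed.

(** Relative to [Q], because functions extended by clamping are merely continuous across the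
    boundary of the square. *)
Definition diff_within (Q : set C) u p := exists l, forall e, 0 < e ->
  exists2 d : R, 0 < d & forall w, Q w -> cmod (w - p) < d ->
    cmod (u w - u p - l * (w - p)) <= e * cmod (w - p).

Lemma goursat u (x y w h : R) : (forall z, ccont u z) ->
  0 < w -> 0 < h -> -2 < x -> x + w < 2 -> -2 < y -> y + h < 2 ->
  (forall p, rect x (x + w) y (y + h) p -> diff_within (rect x (x + w) y (y + h)) u p) ->
  contour u x (x + w) y (y + h) = 0.
Proof.
move=> uc w0 h0 x2 xw2 y2 yh2 ud; set Q := rect _ _ _ _ in ud *.
pose J x' y' n := contour u x' (x' + w / 2 ^+ n) y' (y' + h / 2 ^+ n).
suff : cmod (J x y 0%N) = 0 by rewrite /J !expr0 !divr1 => /cmod_eq0.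
apply/eqP; rewrite eq_le cmod_ge0 andbT leNgt; apply/negP => Jp.
set c := cmod _ in Jp.
pose P x' y' n := [/\ c / 4 ^+ n <= cmod (J x' y' n),
  x <= x', x' + w / 2 ^+ n <= x + w, y <= y' & y' + h / 2 ^+ n <= y + h].
have half (t : R) n : t / 2 ^+ n = 2 * (t / 2 ^+ n.+1).
  by rewrite exprS; field; rewrite expf_neq0 // pnatr_eq0.
have quart (t : R) n : t / 4 ^+ n = 4 * (t / 4 ^+ n.+1).
  by rewrite exprS; field; rewrite expf_neq0 // pnatr_eq0.
have pos (t : R) n : 0 < t -> 0 < t / 2 ^+ n by move=> t0; rewrite divr_gt0 // exprn_gt0.
have [||||a [b hab]] := @nested_rects P x y w h; [lra|lra| | |].
- by rewrite /P !expr0 !divr1 !lexx.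
- move=> x' y' n [h1 h2 h3 h4 h5].
  have w1 := half w n; have hh1 := half h n; have c1 := quart c n.
  have wp := pos w n.+1 w0; have hp := pos h n.+1 h0.
  set w' := w / 2 ^+ n.+1 in w1 wp *; set h' := h / 2 ^+ n.+1 in hh1 hp *.
  have E : J x' y' n = J x' y' n.+1 + J (x' + w') y' n.+1 + J x' (y' + h') n.+1 + J (x' + w') (y' + h') n.+1.
    have rx1 : -2 < x' < 2 by clear -h2 h3 w1 wp x2 xw2; split_lra.
    have rx2 : -2 < x' + w' < 2 by clear -h2 h3 w1 wp x2 xw2; split_lra.
    have rx3 : -2 < x' + w' + w' < 2 by clear -h2 h3 w1 wp x2 xw2; split_lra.
    have ry1 : -2 < y' < 2 by clear -h4 h5 hh1 hp y2 yh2; split_lra.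
    have ry2 : -2 < y' + h' < 2 by clear -h4 h5 hh1 hp y2 yh2; split_lra.
    have ry3 : -2 < y' + h' + h' < 2 by clear -h4 h5 hh1 hp y2 yh2; split_lra.
    rewrite /J w1 hh1 -/w' -/h' (_ : x' + 2 * w' = x' + w' + w'); last by ring.
    rewrite (_ : y' + 2 * h' = y' + h' + h'); last by ring.
    rewrite (@contour_hsplit _ u x' (x' + w')) //.
    rewrite (@contour_vsplit _ u x' (x' + w') y' (y' + h')) //.
    rewrite (@contour_vsplit _ u (x' + w') (x' + w' + w') y' (y' + h')) //.
    by ring.
  have [k1' k2' k3' k4'] : [/\ x + w' >= x, x' + w' + w' <= x + w, y' + h' + h' <= y + h & x' + w' <= x + w].
    by clear -h2 h3 h4 h5 w1 wp hh1 hp; split; lra.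
  have [l1 l2 l3] : [/\ x <= x' + w', y <= y' + h' & y' + h' <= y + h].
    by clear -h2 h3 h4 h5 w1 wp hh1 hp; split; lra.
  have [k|k1] := leP (c / 4 ^+ n.+1) (cmod (J x' y' n.+1)).
    by exists x', y'; split; [split => //; rewrite -/w' -/h'|left|left].
  have [k|k2] := leP (c / 4 ^+ n.+1) (cmod (J (x' + w') y' n.+1)).
    by exists (x' + w'), y'; split; [split => //; rewrite -/w' -/h'|right|left].
  have [k|k3] := leP (c / 4 ^+ n.+1) (cmod (J x' (y' + h') n.+1)).
    by exists x', (y' + h'); split; [split => //; rewrite -/w' -/h'|left|right].
  have [k|k4] := leP (c / 4 ^+ n.+1) (cmod (J (x' + w') (y' + h') n.+1)).
    by exists (x' + w'), (y' + h'); split; [split => //; rewrite -/w' -/h'|right|right].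
  clear -E h1 c1 k1 k2 k3 k4.
  have := cmodD (J x' y' n.+1 + J (x' + w') y' n.+1 + J x' (y' + h') n.+1) (J (x' + w') (y' + h') n.+1).
  have := cmodD (J x' y' n.+1 + J (x' + w') y' n.+1) (J x' (y' + h') n.+1).
  have := cmodD (J x' y' n.+1) (J (x' + w') y' n.+1).
  by rewrite -E; lra.
have Qp : Q (a +i* b).
  have [x' [y' [_ [h1 h2 h3] h4 [h5 h6 h7 h8]]]] := hab 0%N.
  by split => /=; split_lra.
have [l hl] := ud _ Qp.
pose s := w + h.
have s0 : 0 < s by rewrite /s; lra.
(* Chosen so that the final bound [8 * (e * t) * t], with [t = s / 2 ^+ n], is half of
   [c / 4 ^+ n]. *)
have e0 : 0 < c / (16 * s ^+ 2).
  by rewrite divr_gt0 // mulr_gt0 // exprn_gt0.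
have [d d0 hd] := hl _ e0.
have [n hn] : exists n, (2^-1 : R) ^+ n < d / s by apply: pow_small; rewrite ?divr_gt0 //; lra.
have [x' [y' [[hJ _ _ _ _] [h1 h2 h3] h4 [h5 h6 h7 h8]]]] := hab n.
have sn : s / 2 ^+ n < d by rewrite -exprVn mulrC -ltr_pdivlMr.
(* An affine function has contour 0, so subtracting the tangent map at the common point does not
   change [J]. *)
pose v := fun z => 1 * u z + (-1) * (u (a +i* b) - l * (a +i* b) + l * z).
have wn := pos w n w0; have hn' := pos h n h0.
have En : w / 2 ^+ n + h / 2 ^+ n = s / 2 ^+ n by rewrite -mulrDl.
have rx1 : -2 < x' < 2 by clear -h1 h4 wn x2 xw2; split_lra.
have rx2 : -2 < x' + w / 2 ^+ n < 2 by clear -h1 h4 wn x2 xw2; split_lra.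
have ry1 : -2 < y' < 2 by clear -h5 h8 hn' y2 yh2; split_lra.
have ry2 : -2 < y' + h / 2 ^+ n < 2 by clear -h5 h8 hn' y2 yh2; split_lra.
have ac : forall z : C, ccont (fun z => u (a +i* b) - l * (a +i* b) + l * z) z.
  move=> z; apply: hasd_cont.
  exact: hasdD (hasd_cst _ z) (hasdM (hasd_cst l z) (hasd_id z)).
have Ev : contour v x' (x' + w / 2 ^+ n) y' (y' + h / 2 ^+ n) = J x' y' n.
  by rewrite contour_lin // contour_aff // mulr0 addr0 mul1r.
have vc : forall z, ccont v z.
  by move=> z; apply: ccontD; apply: ccontM (ac z) || apply: ccontM (uc z); exact: ccont_cst.
have : cmod (J x' y' n) <= 8 * (c / (16 * s ^+ 2) * (s / 2 ^+ n)) * (s / 2 ^+ n).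
  have sp := pos s n s0.
  move/andP: rx1 => [r1 r2]; move/andP: rx2 => [r3 r4]; move/andP: ry1 => [r5 r6]; move/andP: ry2 => [r7 r8].
  rewrite -Ev; apply: contour_bound => //; try by clear -wn hn' En; lra.
    by rewrite mulr_ge0 // ltW.
  move=> z [/andP[z1 z2] /andP[z3 z4]] _.
  have zs : cmod (z - (a +i* b)) <= s / 2 ^+ n.
    apply: le_trans (cmod_ReIm _) _; rewrite cReB cImB /=.
    have : `|Re z - a| <= w / 2 ^+ n by clear -z1 z2 h2 h3; rewrite ler_norml; split_lra.
    have : `|Im z - b| <= h / 2 ^+ n by clear -z3 z4 h6 h7; rewrite ler_norml; split_lra.
    clear -En; lra.
  apply: (@le_trans _ _ (c / (16 * s ^+ 2) * cmod (z - (a +i* b)))); last by rewrite ler_pM2l.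
  rewrite /v (_ : 1 * u z + _ = u z - u (a +i* b) - l * (z - (a +i* b))); last by ring.
  by apply: hd; [clear -z1 z2 z3 z4 h1 h4 h5 h8; split; split_lra|apply: le_lt_trans zs sn].
rewrite (_ : 8 * _ * _ = c / 4 ^+ n / 2); last first.
  rewrite (_ : (4 : R) ^+ n = 2 ^+ n * 2 ^+ n); last by rewrite -exprMn; congr (_ ^+ n); ring.
  by field; rewrite expf_neq0 ?pnatr_eq0 //= gt_eqF.
have : 0 < c / 4 ^+ n by rewrite divr_gt0 // exprn_gt0.
lra.
Qed.

(** Differentiability may fail at 0, where continuity suffices: rectangles away from 0 contribute
    nothing, and a small square about 0 has a contour proportional to its side. This admits a
    divided difference based at 0. *)
Lemma goursat1 u : (forall z, ccont u z) ->
  (forall p, rect (-1) 1 (-1) 1 p -> p != 0 -> diff_within (rect (-1) 1 (-1) 1) u p) ->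
  contour u (-1) 1 (-1) 1 = 0.
Proof.
move=> uc ud; apply: cmod_small => e e0.
have [d d0 hd] := uc 0 1 ltr01.
pose M := cmod (u 0) + 1.
have M0 : 0 < M by have := cmod_ge0 (u 0); rewrite /M; lra.
(* [d / 3] keeps the square inside the disc where [u] is within 1 of [u 0]; [e / (16 * M)] makes
   [8 * M * (2 * s)] at most [e]. *)
pose s := Num.min (1 / 2) (Num.min (d / 3) (e / (16 * M))).
have s0 : 0 < s by rewrite !lt_min !divr_gt0 // ?mulr_gt0.
have s1 : s <= 1 / 2 by rewrite ge_min lexx.
have s2 : s <= d / 3 by rewrite /s !ge_min lexx orbT.
have s3 : s <= e / (16 * M) by rewrite /s !ge_min lexx !orbT.
have Z (x y w h : R) : 0 < w -> 0 < h -> -1 <= x -> x + w <= 1 -> -1 <= y -> y + h <= 1 ->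
    (x + w < 0 \/ 0 < x \/ y + h < 0 \/ 0 < y) -> contour u x (x + w) y (y + h) = 0.
  move=> w0 h0 x1 xw y1 yh out; apply: goursat => //; try by clear -w0 h0 x1 xw y1 yh; lra.
  move=> p [/andP[p1 p2] /andP[p3 p4]].
  have rp : rect (-1) 1 (-1) 1 p by clear -p1 p2 p3 p4 x1 xw y1 yh; split; split_lra.
  have p0 : p != 0.
    apply/eqP => E; move: p1 p2 p3 p4; rewrite E /=; clear -out => *.
    by case: out => [|[|[|]]]; lra.
  have [l hl] := ud p rp p0; exists l => e1 /hl [d1 d10 k1]; exists d1 => // w1 [/andP[q1 q2] /andP[q3 q4]].
  by apply: k1; clear -q1 q2 q3 q4 x1 xw y1 yh; split; split_lra.
have rm1 : -2 < (-1 : R) < 2 by clear; split_lra.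
have rp1 : -2 < (1 : R) < 2 by clear; split_lra.
have rs1 : -2 < s < 2 by clear -s0 s1; split_lra.
have rs2 : -2 < - s < 2 by clear -s0 s1; split_lra.
rewrite (@contour_hsplit _ u (-1) (- s) 1) //.
rewrite (@contour_hsplit _ u (- s) s 1) //.
rewrite (@contour_vsplit _ u (- s) s (-1) (- s) 1) //.
rewrite (@contour_vsplit _ u (- s) s (- s) s 1) //.
have := Z (-1) (-1) (1 - s) 2; rewrite (_ : -1 + (1 - s) = - s); last by ring.
rewrite (_ : -1 + 2 = 1); last by ring.
move=> ->; try by clear -s0 s1; lra.
have := Z s (-1) (1 - s) 2; rewrite (_ : s + (1 - s) = 1); last by ring.
rewrite (_ : -1 + 2 = 1); last by ring.
move=> ->; try by clear -s0 s1; lra.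
have := Z (- s) (-1) (2 * s) (1 - s); rewrite (_ : - s + 2 * s = s); last by ring.
rewrite (_ : -1 + (1 - s) = - s); last by ring.
move=> ->; try by clear -s0 s1; lra.
have := Z (- s) s (2 * s) (1 - s); rewrite (_ : - s + 2 * s = s); last by ring.
rewrite (_ : s + (1 - s) = 1); last by ring.
move=> ->; try by clear -s0 s1; lra.
rewrite !add0r !addr0.
apply: (@le_trans _ _ (8 * M * (2 * s))).
  apply: contour_bound => //; try by clear -s0 s1 M0; lra.
  move=> z [/andP[z1 z2] /andP[z3 z4]] _.
  have : cmod (u z - u 0) < 1.
    apply: hd; rewrite subr0; apply: le_lt_trans (cmod_ReIm _) _.
    have : `|Re z| <= s by rewrite ler_norml z1.
    have : `|Im z| <= s by rewrite ler_norml z3.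
    clear -s2 d0; lra.
  by have := cmod_sub (u z) (u 0); rewrite /M; lra.
rewrite ler_pdivlMr in s3; last lra.
lra.
Qed.

Lemma cV (x y : R) : (x +i* y)^-1 = (x / (x ^+ 2 + y ^+ 2)) +i* (- (y / (x ^+ 2 + y ^+ 2))) :> C.
Proof. by []. Qed.

Definition clamp (x : R) : R := Num.max (-1) (Num.min 1 x).

Lemma clamp_id (x : R) : -1 <= x <= 1 -> clamp x = x.
Proof. by move=> /andP[h1 h2]; rewrite /clamp min_r // max_r. Qed.

Lemma clamp_bnd (x : R) : -1 <= clamp x <= 1.
Proof. by rewrite /clamp le_max lexx ge_max ge_min lexx /= andbT; lra. Qed.

Lemma clamp_cases (x : R) : [\/ x <= -1 /\ clamp x = -1, -1 <= x <= 1 /\ clamp x = x | 1 <= x /\ clamp x = 1].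
Proof.
have [h|h] := leP x (-1).
  by constructor 1; rewrite /clamp min_r ?max_l //; lra.
have [h'|h'] := leP 1 x; last by constructor 2; rewrite clamp_id ?(ltW h) ?(ltW h').
by constructor 3; rewrite /clamp min_l // max_r //; lra.
Qed.

Lemma clamp_lip (x y : R) : `|clamp x - clamp y| <= `|x - y|.
Proof.
wlog xy : x y / x <= y.
  by move=> H; have [/H //|/ltW /H] := leP x y; rewrite distrC (distrC y).
rewrite (@ler0_norm _ (x - y)); last lra.
by rewrite ler_norml; case: (clamp_cases x) => -[? ->]; case: (clamp_cases y) => -[? ->]; split_lra.
Qed.

(** Retraction onto the square [[-1, 1]^2]. Composition with it extends a function on the square
    continuously to the plane, as the contour lemmas require. *)
Definition clampC z : C := clamp (Re z) +i* clamp (Im z).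

Lemma clampC_lip z w : cmod (clampC z - clampC w) <= 2 * cmod (z - w).
Proof.
apply: le_trans (cmod_ReIm _) _; rewrite cReB cImB /=.
have := clamp_lip (Re z) (Re w); have := clamp_lip (Im z) (Im w).
have := normRe (z - w); have := normIm (z - w); rewrite cReB cImB; lra.
Qed.

(** A bound standing in for the value [2 * pi * 'i]: each side adds to the imaginary part the
    integral of [1 / (x^2 + 1)] over [[-1, 1]], which is at least 1. *)
Lemma inv_contour : 4 <= cmod (contour (fun z => z^-1) (-1) 1 (-1) 1).
Proof.
apply: le_trans (normIm _); apply: le_trans (ler_norm _).
have Ei z : Im ('i * z) = Re z by rewrite cImM /=; ring.
rewrite /contour !(cImD, cImN) !Ei /cint /=; pose g (x : R) := (x ^+ 2 + 1)^-1.
have E1 : (fun x : R => Im (x +i* -1)^-1) = g.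
  by apply: funext => x; rewrite cV /= sqrrN expr1n mulN1r opprK.
have E2 : (fun y : R => Re (1 +i* y)^-1) = g.
  by apply: funext => y; rewrite cV /= expr1n div1r addrC.
have E3 : (fun x : R => Im (x +i* 1)^-1) = (fun x => -1 * g x + 0 * g x).
  by apply: funext => x; rewrite cV /= expr1n div1r mul0r addr0 mulN1r.
have E4 : (fun y : R => Re (-1 +i* y)^-1) = (fun y => -1 * g y + 0 * g y).
  by apply: funext => y; rewrite cV /= sqrrN expr1n mul0r addr0 mulN1r addrC mulN1r.
have gc : rcont g.
  rewrite -E1; apply/curve_contIm/slice_h => x; apply: hasd_cont; apply: hasd_inv.
  by apply/eqP => -[_ /eqP]; rewrite oppr_eq0 oner_eq0.
have [n1 r1 nr] : [/\ -2 < (-1 : R), (1 : R) < 2 & (-1 : R) <= 1] by split; lra.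
have [rn rp] : -2 < (-1 : R) < 2 /\ -2 < (1 : R) < 2 by split; split_lra.
have := int1_bound gc n1 nr r1 (m := 1 / 2) (M := 1); rewrite E1 E2 E3 E4 !int1_lin //.
case/(_ _)/andP => [x /andP[x1 x2]|]; last lra.
have [h1 h2] : 1 <= x ^+ 2 + 1 /\ x ^+ 2 + 1 <= 2 by split; nra.
by rewrite /g div1r lef_pV2 ?posrE ?invf_le1 //; [split_lra|lra|lra].
Qed.

(** The divided difference [(k z - k 0) / z] has contour 0, so [k 0] times the contour of [1 / z]
    equals the contour of [k z / z], of modulus at most [16 * M]. Division by the 4 of [inv_contour]
    gives the bound. *)
Lemma square_center_bound k M : (forall z, rect (-1) 1 (-1) 1 z -> exists l, hasd k z l) ->
  (forall z, rect (-1) 1 (-1) 1 z -> (`|Re z| = 1 \/ `|Im z| = 1) -> cmod (k z) <= M) ->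
  cmod (k 0) <= 4 * M.
Proof.
move=> kd kM; set Q := rect _ _ _ _ in kd kM.
have Q0 : Q 0 by split => /=; split_lra.
have [l hl] := kd 0 Q0.
(* Clamped to be continuous on the plane; relative to the square it is differentiable away from 0,
   as [goursat1] asks. *)
pose v w := slope k 0 l (clampC w).
have QcC w : Q (clampC w) by split; exact: clamp_bnd.
have vc z : ccont v z.
  have [m hm] := kd _ (QcC z).
  move=> e e0; have [d d0 hd] := slope_ccont hl (hasd_cont hm) e0.
  exists (d / 2); first by lra.
  move=> w hw; apply: hd; apply: le_lt_trans (clampC_lip _ _) _; lra.
have idQ w : Q w -> clampC w = w.
  by move=> [h1 h2]; rewrite /clampC !clamp_id //; exact/esym/cplxE.
have vd p : Q p -> p != 0 -> diff_within Q v p.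
  move=> Qp p0; have [m hm] := kd _ Qp; have [m' h] := slope_hasd_off l p0 hm.
  exists m' => e /h [d d0 hd]; exists d => // w Qw.
  by rewrite /v !idQ //; exact: hd.
have J0 := goursat1 vc vd.
have ne z : edge (-1) 1 (-1) 1 z -> 1 <= cmod z.
  have := normRe z; have := normIm z => h1 h2.
  by case=> -[] E; move: h1 h2; rewrite E ?normrN normr1.
have nz z : edge (-1) 1 (-1) 1 z -> z != 0 by move=> /ne h; rewrite -cmod_gt0; lra.
have ic z : edge (-1) 1 (-1) 1 z -> ccont (fun w => w^-1) z by move=> /nz h; exact: hasd_cont (hasd_inv h).
have [rn rp] : -2 < (-1 : R) < 2 /\ -2 < (1 : R) < 2 by split; split_lra.
have := @contour_lin R v (fun z => z^-1) 1 (k 0) (-1) 1 (-1) 1 (fun z _ => vc z) ic rn rp rn rp.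
rewrite J0 mulr0 add0r => J; have : cmod (k 0 * contour (fun z => z^-1) (-1) 1 (-1) 1) <= 8 * M * 2.
  have M0 : 0 <= M.
    have Q1 : Q 1 by split => /=; split_lra.
    by apply: le_trans (cmod_ge0 (k 1)) (kM _ Q1 _); left; rewrite /= normr1.
  have [n1 r1 nr] : [/\ -2 < (-1 : R), (1 : R) < 2 & (-1 : R) <= 1] by split; lra.
  have e2 : 1 - -1 <= (2 : R) by lra.
  rewrite -J; apply: (contour_bound _ n1 nr r1 n1 nr r1 e2 e2 M0).
    by move=> z ez; apply: ccontD; apply: ccontM (ic z ez) || apply: ccontM (vc z); exact: ccont_cst.
  move=> z Qz ez; rewrite mul1r /v idQ // slopeE ?nz // subr0 -mulrDl subrK cmod_div.
  rewrite ler_pdivrMr ?cmod_gt0 ?nz //; apply: le_trans (kM z Qz _) _.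
    by case: ez => -[] ->; rewrite ?normrN normr1; [left|left|right|right].
  by rewrite ler_peMr // ne.
by rewrite cmodM; have := inv_contour; have := cmod_ge0 (k 0); nra.
Qed.

Lemma cauchy_square k (a : C) r M : 0 < r ->
  (forall z, `|Re (z - a)| <= r -> `|Im (z - a)| <= r -> exists l, hasd k z l) ->
  (forall z, `|Re (z - a)| <= r -> `|Im (z - a)| <= r ->
     (`|Re (z - a)| = r \/ `|Im (z - a)| = r) -> cmod (k z) <= M) ->
  cmod (k a) <= 4 * M.
Proof.
move=> r0 kd kM.
have sc z : Re (a + r%:C * z - a) = r * Re z /\ Im (a + r%:C * z - a) = r * Im z.
  by rewrite addrAC subrr add0r cReM cImM /=; split; ring.
have nr : `|r| = r by rewrite gtr0_norm.
have := @square_center_bound (fun w => k (a + r%:C * w)) M.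
rewrite mulr0 addr0; apply.
  move=> z [h1 h2]; have [E1 E2] := sc z.
  have [||m hm] := kd (a + r%:C * z).
  - by rewrite E1 normrM nr -[leRHS]mulr1 ler_pM2l // ler_norml.
  - by rewrite E2 normrM nr -[leRHS]mulr1 ler_pM2l // ler_norml.
  - have := hasdD (hasd_cst a z) (hasdM (hasd_cst r%:C z) (hasd_id z)).
    by move=> /hasd_comp /(_ hm) h; eexists; exact: h.
move=> z [h1 h2] h3; have [E1 E2] := sc z; apply: kM.
- by rewrite E1 normrM nr -[leRHS]mulr1 ler_pM2l // ler_norml.
- by rewrite E2 normrM nr -[leRHS]mulr1 ler_pM2l // ler_norml.
- by rewrite E1 E2 !normrM nr; case: h3 => ->; rewrite mulr1; [left|right].
Qed.

End MaxMod.

(** * The maximum modulus principle *)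

Section Holomorphic.
Context {R : realType}.
Local Notation C := R[i].
Implicit Types (u v k h : C -> C) (B M s e d r t : R) (z w p a b c l : C) (O : set C).

Lemma ccont_mod u z e : ccont u z -> 0 < e -> exists2 d : R, 0 < d &
  forall w, cmod (w - z) < d -> `|cmod (u w) - cmod (u z)| < e.
Proof.
move=> hu /hu [d d0 hd]; exists d => // w /hd; apply: le_lt_trans.
have := cmod_sub (u w) (u z); have := cmod_sub (u z) (u w); rewrite (cmodBC (u z)) => h1 h2.
by rewrite ler_norml; split_lra.
Qed.

Lemma hasdX u n z l : hasd u z l -> exists m : C, hasd (fun w => u w ^+ n) z m.
Proof.
move=> h; have := @holX R [set z] u n; move=> /(_ _) H.
by apply: (H _ z erefl) => _ ->; exists l.
Qed.

Lemma copen_ball a r : copen [set z | cmod (z - a) < r].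
Proof.
move=> z /= h; exists (r - cmod (z - a)); first by rewrite subr_gt0.
by move=> w hw; have := cmod_tri z w a; lra.
Qed.

Lemma cclosed_ball a r : cclosed [set z | cmod (z - a) <= r].
Proof.
move=> z h /=; apply: le_small => e /h [w /= hw1 hw2].
by have := cmod_tri w z a; rewrite (cmodBC z w); lra.
Qed.

Lemma cbounded_ball a r : cbounded [set z | cmod (z - a) <= r].
Proof.
by exists (r + cmod a) => z /= h; have := cmodD (z - a) a; rewrite subrK; lra.
Qed.

Lemma cclosed_circle a r : cclosed [set z | cmod (z - a) = r].
Proof.
move=> z h /=; apply/eqP; rewrite eq_le; apply/andP; split; apply: le_small => e /h [w /= hw1 hw2].
  by have := cmod_tri w z a; rewrite (cmodBC z w); lra.
by have := cmod_tri z w a; lra.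
Qed.

Lemma cbounded_sub (X Y : set C) : (forall z, X z -> Y z) -> cbounded Y -> cbounded X.
Proof. by move=> s [M h]; exists M => z /s /h. Qed.

Lemma EVT_mod (X : set C) u : cclosed X -> cbounded X -> X !=set0 ->
  (forall z, X z -> ccont u z) ->
  exists2 z, X z & forall w, X w -> cmod (u w) <= cmod (u z).
Proof.
move=> h1 h2 h3 uc; apply: EVT => // z /uc uz e e0.
by have [d d0 hd] := ccont_mod uz e0; exists d => // w _ /hd.
Qed.

Lemma EVT_min (X : set C) u : cclosed X -> cbounded X -> X !=set0 ->
  (forall z, X z -> ccont u z) ->
  exists2 z, X z & forall w, X w -> cmod (u z) <= cmod (u w).
Proof.
move=> h1 h2 h3 uc.
have [|z Xz hz] := @EVT R X (fun z => - cmod (u z)) h1 h2 h3; last first.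
  by exists z => // w /hz; rewrite lerN2.
move=> z /uc uz e e0; have [d d0 hd] := ccont_mod uz e0; exists d => // w _ /hd.
by rewrite (_ : - _ - - _ = - (cmod (u w) - cmod (u z))) ?normrN //; ring.
Qed.

(** Power trick: a multiplicative constant independent of [n] disappears on taking [n]-th roots. *)
Lemma pow_le_of (x y : R) (c D : R) : 0 < c -> 0 < y -> 0 <= x ->
  (forall n, x ^+ n * c <= y ^+ n * D) -> x <= y.
Proof.
move=> c0 y0 x0 h; rewrite leNgt; apply/negP => yx.
have D0 : 0 < D by have := h 0%N; rewrite !expr0 !mul1r; lra.
have xp : 0 < x by lra.
have [n hn] : exists n, (y / x) ^+ n < c / D.
  by apply: pow_small; rewrite ?divr_ge0 ?divr_gt0 ?ltr_pdivrMr ?mul1r // ltW.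
have := h n; rewrite leNgt; move: hn; rewrite expr_div_n ltr_pdivrMr ?exprn_gt0 //.
by rewrite mulrAC ltr_pdivlMr // (mulrC c) => ->.
Qed.

(** [cauchy_square] applied to [u ^+ n] loses the same factor 4 for every [n], and the power trick
    removes it. *)
Lemma square_max u a r M : 0 < r ->
  (forall z, `|Re (z - a)| <= r -> `|Im (z - a)| <= r -> exists l, hasd u z l) ->
  (forall z, `|Re (z - a)| <= r -> `|Im (z - a)| <= r ->
     (`|Re (z - a)| = r \/ `|Im (z - a)| = r) -> cmod (u z) <= M) ->
  cmod (u a) <= M.
Proof.
move=> r0 ud um; have M0 : 0 <= M.
  have [E1 E2] : `|Re (a + r%:C - a)| = r /\ `|Im (a + r%:C - a)| = 0.
    by rewrite addrC addKr /= normr0 gtr0_norm.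
  by apply: le_trans (cmod_ge0 _) (um (a + r%:C) _ _ _); rewrite ?E1 ?E2 ?lexx ?ltW //; left.
apply: le_small => e e0; have Me : 0 < M + e by lra.
apply: (@pow_le_of _ _ 1 4) => //; [exact: cmod_ge0|] => n.
rewrite mulr1 -cmodX mulrC; apply: (@cauchy_square R (fun z => u z ^+ n) a r) => //.
  by move=> w h1 h2; have [l hl] := ud w h1 h2; exact: hasdX hl.
move=> w h1 h2 h3; rewrite !cmodX; apply: lerXn2r; rewrite ?nnegrE ?cmod_ge0 ?(ltW Me) //.
by have := um w h1 h2 h3; lra.
Qed.

Lemma cRe_conj z : Re (conjc z) = Re z.
Proof. by case: z. Qed.

Lemma cIm_conj z : Im (conjc z) = - Im z.
Proof. by case: z. Qed.

Lemma cmod_conj z : cmod (conjc z) = cmod z.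
Proof. by case: z => x y; rewrite -[conjc _]/(x +i* - y) !cmodE sqrrN. Qed.

Lemma ccont_conj z : ccont conjc z.
Proof. by move=> e e0; exists e => // w; rewrite -rmorphB cmod_conj. Qed.

(* If [s] maximises [cmod (u z) ^+ 2 * (1 + t * cmod z ^+ 2)], then by the strict Cauchy-Schwarz
   inequality [cmod (u z * (1 + t * conjc s * z))] is strictly smaller around [s] than at [s]. *)
Lemma maxmod O u B : copen O -> cbounded O -> hol O u -> 0 <= B ->
  (forall b, ~ O b -> forall e, 0 < e -> exists2 d : R, 0 < d &
     forall z, O z -> cmod (z - b) < d -> cmod (u z) <= B + e) ->
  forall z, O z -> cmod (u z) <= B.
Proof.
move=> oO [D OD] hu B0 bd z0 Oz0; rewrite leNgt; apply/negP => Bz.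
pose e := (cmod (u z0) - B) / 2.
have e0 : 0 < e by rewrite /e; lra.
(* The boundary hypothesis keeps this superlevel set away from the complement of [O], so it is
   closed in the plane. *)
pose K := [set z | O z /\ B + e <= cmod (u z)].
have Kcl : cclosed K.
  move=> z h; have Oz : O z.
    apply: contrapT => nO; have [|d d0 hd] := bd z nO (e / 2); first lra.
    by have [w [Ow k1] k2] := h d d0; have := hd w Ow k2; lra.
  split=> //; apply: le_small => e1 e10.
  have [d d0 hd] := ccont_mod (hol_cont hu Oz) e10.
  have [w [Ow k1] /hd] := h d d0.
  have := ler_norm (cmod (u w) - cmod (u z)); lra.
have Kb : cbounded K by exists D => z [/OD].
have c0 : 0 < (B + e) ^+ 2 * (D ^+ 2 + 1).
  by rewrite mulr_gt0 ?exprn_gt0 ?ltr_wpDl ?sqr_ge0 //; lra.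
(* So small that the weight [N], at most [1 + t * D ^+ 2], cannot lift the square of a value below
   [B + e] above [(B + 2 * e) ^+ 2]; a maximum over [K] is then one over [O]. *)
pose t := e ^+ 2 / ((B + e) ^+ 2 * (D ^+ 2 + 1)).
have t0 : 0 < t by rewrite divr_gt0 // exprn_gt0.
pose N z := 1 + t * cmod z ^+ 2; have N0 z : 0 < N z by rewrite ltr_wpDr // mulr_ge0 ?sqr_ge0 // ltW.
have ND z : O z -> N z <= 1 + t * D ^+ 2.
  by move=> /OD h; rewrite lerD2l ler_pM2l // lerXn2r ?nnegrE ?cmod_ge0 //; apply: le_trans h; exact: cmod_ge0.
pose v z := u z ^+ 2 * (1 + t%:C * (z * conjc z)).
have vE z : cmod (v z) = cmod (u z) ^+ 2 * N z.
  rewrite cmodM cmodX (_ : 1 + _ = (N z)%:C) ?cmod_real ?gtr0_norm //.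
  by apply: cplx_eq; rewrite /N cmod_sqr !(cReD, cImD, cReM, cImM) cRe_conj cIm_conj /=; ring.
have [||s Ks hs] := EVT_mod Kcl Kb (u := v).
- by exists z0; split=> //; rewrite /e; lra.
- move=> z [Oz _]; apply: ccontM; first exact/ccontX/(hol_cont hu).
  apply: ccontD; first exact: ccont_cst.
  by apply: ccontM; [exact: ccont_cst|apply: ccontM; [exact: ccont_id|exact: ccont_conj]].
have Os := Ks.1; have max z : O z -> cmod (u z) ^+ 2 * N z <= cmod (u s) ^+ 2 * N s.
  rewrite -!vE => Oz; have [h|h] := leP (B + e) (cmod (u z)); first exact: hs.
  apply: le_trans (hs z0 _); last by split=> //; rewrite /e; lra.
  have z0E : cmod (u z0) = B + 2 * e by rewrite /e; lra.
  rewrite !vE z0E; apply: (@le_trans _ _ ((B + 2 * e) ^+ 2)); last first.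
    by rewrite ler_peMr ?sqr_ge0 // lerDl mulr_ge0 ?sqr_ge0 // ltW.
  apply: (@le_trans _ _ ((B + e) ^+ 2 * (1 + t * D ^+ 2))).
    by apply: ler_pM; rewrite ?sqr_ge0 ?(ltW (N0 z)) ?ND // lerXn2r ?nnegrE ?cmod_ge0 ?ltW //; lra.
  have : (B + e) ^+ 2 * (t * (D ^+ 2 + 1)) = e ^+ 2 by rewrite mulrCA divfK // gt_eqF.
  have : 0 <= (B + e) ^+ 2 * t by rewrite mulr_ge0 ?sqr_ge0 // ltW.
  by move: (D ^+ 2) => y; rewrite !expr2; nra.
have Us : 0 < cmod (u s) ^+ 2 by rewrite exprn_gt0 //; have := Ks.2; lra.
pose h z := 1 + t%:C * conjc s * z.
have CS z : cmod (h z) ^+ 2 = N z * N s - t * cmod (z - s) ^+ 2.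
  by rewrite /N !cmod_sqr /h !(cReD, cImD, cReB, cImB, cReM, cImM) cRe_conj cIm_conj /=; ring.
have [r r0 hr] := oO s Os.
have sq_ball z : `|Re (z - s)| <= r / 3 -> `|Im (z - s)| <= r / 3 -> O z.
  by move=> h1 h2; apply: hr; apply: le_lt_trans (cmod_ReIm _) _; lra.
have Y0 : 0 < 1 + t * D ^+ 2 by apply: lt_le_trans (N0 s) (ND s Os).
(* The loss on the boundary of the square: there [t * cmod (z - s) ^+ 2] is at least [k * N z]. *)
pose k := t * (r / 3) ^+ 2 / (1 + t * D ^+ 2).
have k0 : 0 < k by rewrite divr_gt0 // mulr_gt0 // exprn_gt0 //; lra.
have r3 : 0 < r / 3 by lra.
have := @square_max (fun z => (u z * h z) ^+ 2) s (r / 3) (cmod (u s) ^+ 2 * N s * (N s - k)) r3.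
rewrite cmodX cmodM exprMn CS subrr cmod0 expr0n mulr0 subr0 mulrA ler_pM2l; last exact: mulr_gt0.
move=> H; suff : N s <= N s - k by lra.
apply: H => [z h1 h2|z h1 h2 h3].
  have [l hl] := hu z (sq_ball z h1 h2).
  have := hasdM hl (hasdD (hasd_cst 1 z) (hasdM (hasd_cst (t%:C * conjc s) z) (hasd_id z))).
  by move=> /(hasdX 2).
have Oz := sq_ball z h1 h2; have zr : r / 3 <= cmod (z - s).
  by case: h3 => <-; [exact: normRe|exact: normIm].
have kd : k * N z <= t * cmod (z - s) ^+ 2.
  apply: le_trans (_ : t * (r / 3) ^+ 2 <= _); last first.
    by rewrite ler_pM2l // lerXn2r ?nnegrE ?cmod_ge0 // ltW.
  by rewrite mulrAC ler_pdivrMr // ler_pM2l ?ND // mulr_gt0 // exprn_gt0.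
have := sqr_ge0 (cmod (h z)); rewrite cmodX cmodM exprMn CS => hz.
have kN : 0 <= N s - k by rewrite subr_ge0 -(ler_pM2r (N0 z)) (mulrC (N s)); lra.
apply: le_trans (_ : cmod (u z) ^+ 2 * N z * (N s - k) <= _); last by apply: ler_wpM2r => //; exact: max.
by rewrite -mulrA ler_wpM2l ?sqr_ge0 // mulrBr (mulrC (N z) k); lra.
Qed.

Lemma avoid_seq (F : seq C) z r : 0 < r -> exists2 w, cmod (w - z) < r & w \notin F.
Proof.
move=> r0; apply: contrapT => hn.
pose x n : C := z + (r / (n%:R + 2))%:C.
have xi : injective x.
  move=> n m /addrI /(congr1 (@complex.Re R)) /= E.
  have /eqP : (n%:R + 2 : R) = m%:R + 2.
    have p1 : (n%:R + 2 : R) != 0 by rewrite -natrD pnatr_eq0 addn2.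
    have p2 : (m%:R + 2 : R) != 0 by rewrite -natrD pnatr_eq0 addn2.
    by apply: invr_inj; apply: (mulfI (lt0r_neq0 r0)).
  by rewrite (inj_eq (addIr _)) eqr_nat => /eqP.
have xF n : x n \in F.
  apply: contrapT => nF; apply: hn; exists (x n); last by apply/negP.
  rewrite /x addrC addKr cmod_real ger0_norm; last by rewrite divr_ge0 ?addr_ge0 ?ler0n // ltW.
  by rewrite ltr_pdivrMr -?natrD ?ltr0n ?addn2 // ltr_pMr // ltr1n.
have := @uniq_leq_size _ (map x (iota 0 (size F).+1)) F.
rewrite map_inj_uniq // iota_uniq size_map size_iota ltnn => /(_ isT) h.
by suff : false by []; apply: h => w /mapP [n _ ->].
Qed.

(** Applies [maxmod] off [F] to [u ^+ n] times a polynomial vanishing on [F]; the product tends to 0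
    at [F], and the power trick removes the polynomial. Exceptional points occur because a divided
    difference is at first known only to be continuous at its base point. *)
Lemma maxmod_exc O u B (F : seq C) : copen O -> cbounded O ->
  (forall z, O z -> ccont u z) -> (forall z, O z -> z \notin F -> exists l, hasd u z l) -> 0 <= B ->
  (forall b, ~ O b -> forall e, 0 < e -> exists2 d : R, 0 < d &
     forall z, O z -> cmod (z - b) < d -> cmod (u z) <= B + e) ->
  forall z, O z -> cmod (u z) <= B.
Proof.
move=> oO [D OD] uc hu B0 bd.
suff main z : O z -> z \notin F -> cmod (u z) <= B.
  move=> z Oz; apply: le_small => e e0; have [r r0 hr] := oO z Oz.
  have [d d0 hd] := ccont_mod (uc z Oz) e0.
  have rd : 0 < Num.min r d by rewrite lt_min r0.
  have [w] := avoid_seq F z rd; rewrite lt_min => /andP[/hr Ow /hd k] wF.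
  have := main w Ow wF; have := ler_norm (- (cmod (u w) - cmod (u z))); rewrite normrN; lra.
move=> Oz zF; apply: le_small => e e0.
have D0 : 0 <= D by apply: le_trans (cmod_ge0 z) (OD _ Oz).
pose P (w : C) : C := \prod_(a <- F) (w - a).
have Pd w : exists l, hasd P w l.
  rewrite /P; elim: F {zF hu} @P => [|a F IH].
    exists 0; apply: hasd_loc (hasd_cst 1 w) => [|x _]; [exact: ltr01|by rewrite big_nil].
  have [l hl] := IH; have := hasdM (hasdD (hasd_id w) (hasd_cst (- a) w)) hl => h.
  by eexists; apply: hasd_loc h => [|x _]; [exact: ltr01|rewrite big_cons].
have [P1 P10 PP1] : exists2 P1 : R, 0 < P1 & forall w, O w -> cmod (P w) <= P1.
  rewrite /P; elim: F {zF hu P Pd} => [|a F [P1 P10 IH]].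
    by exists 1 => // w _; rewrite big_nil cmod1.
  exists ((D + cmod a + 1) * P1); first by apply: mulr_gt0 => //; have := cmod_ge0 a; lra.
  move=> w Ow; rewrite big_cons cmodM; apply: ler_pM; rewrite ?cmod_ge0 //; last exact: IH.
  by have := cmodB w a; have := OD w Ow; lra.
have Pz : P z != 0.
  rewrite /P prodf_seq_neq0; apply/allP => a aF /=; rewrite subr_eq0.
  by apply: contraNneq zF => ->.
have PF a : a \in F -> P a = 0.
  by move=> aF; apply/eqP; rewrite /P prodf_seq_eq0; apply/hasP; exists a; rewrite ?subrr /=.
apply: (@pow_le_of _ _ (cmod (P z)) P1); rewrite ?cmod_gt0 ?cmod_ge0 //; first lra.
move=> n; pose O' := [set w | O w /\ w \notin F].
rewrite -cmodX -cmodM.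
apply: (@maxmod O' (fun w => u w ^+ n * P w)) => //.
- move=> w [Ow wF]; have [r r0 hr] := oO w Ow.
  have [s s0 hs] : exists2 s : R, 0 < s & forall x, cmod (x - w) < s -> x \notin F.
    elim: F wF {hu zF P Pd PP1 Pz PF O'} => [|a F IH]; first by move=> _; exists 1.
    rewrite inE negb_or => /andP[wa /IH [s s0 hs]].
    exists (Num.min s (cmod (w - a))); first by rewrite lt_min s0 cmod_gt0 subr_eq0.
    move=> x; rewrite lt_min inE negb_or => /andP[/hs -> k]; rewrite andbT.
    by apply: contraTneq k => ->; rewrite cmodBC ltxx.
  exists (Num.min r s); first by rewrite lt_min r0.
  by move=> x; rewrite lt_min => /andP[/hr ? /hs].
- by exists D => w [/OD].
- move=> w [Ow wF]; have [l /(hasdX n) [l' hl']] := hu w Ow wF; have [m hm] := Pd w.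
  by eexists; exact: hasdM hl' hm.
- by rewrite mulr_ge0 ?exprn_ge0 //; [lra|exact: ltW].
- move=> b nO' e1 e10.
  have [Ob|nOb] := pselect (O b); last first.
    have [d d0 hd] := bd b nOb e e0; exists d => // w [Ow _] hw.
    rewrite cmodM cmodX; apply: le_trans (_ : (B + e) ^+ n * P1 <= _); last lra.
    apply: ler_pM; rewrite ?exprn_ge0 ?cmod_ge0 //; last exact: PP1.
    by apply: lerXn2r; rewrite ?nnegrE ?cmod_ge0 //; [lra|exact: hd].
  have bF : b \in F by apply: contrapT => /negP h; apply: nO'.
  have kc : ccont (fun w => u w ^+ n * P w) b.
    by apply: ccontM; [exact/ccontX/uc|have [l /hasd_cont] := Pd b].
  have [d d0 hd] := kc e1 e10; exists d => // w _ /hd.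
  rewrite (PF b bF) mulr0 subr0 => k.
  have : 0 <= (B + e) ^+ n * P1 by rewrite mulr_ge0 ?exprn_ge0 //; [lra|exact: ltW].
  lra.
Qed.

End Holomorphic.

(** * Derivative estimates, removable singularities, isolated zeros *)

Section Estimates.
Context {R : realType}.
Local Notation C := R[i].
Implicit Types (u v k h : C -> C) (B M K s e d r t : R) (z w p q a b c l y : C) (O : set C) (F : seq C).

Lemma cmod_tri3 z a w : cmod (z - w) <= cmod (z - a) + cmod (a - w).
Proof. exact: cmod_tri. Qed.

(** Near the circle [cmod (w - b)] is at least [r / 4], and the maximum principle carries the
    resulting bound inside. *)
Lemma div_bound D F a r b K : 0 < r -> cmod (b - a) <= r / 2 -> 0 <= K ->
  (forall z, cmod (z - a) < r -> ccont D z) ->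
  (forall z, cmod (z - a) < r -> z \notin F -> exists l, hasd D z l) ->
  (forall w, cmod (w - a) < r -> cmod (D w) * cmod (w - b) <= K) ->
  forall w, cmod (w - a) < r -> cmod (D w) <= 4 * K / r.
Proof.
move=> r0 br K0 Dc Dd DK; apply: (@maxmod_exc R [set z | cmod (z - a) < r] D _ F) => //.
- exact: copen_ball.
- by have [M h] := cbounded_ball a r; exists M => z /= /ltW /h.
- by rewrite divr_ge0 ?mulr_ge0 // ltW.
move=> c /= /negP; rewrite -leNgt => rc e e0; exists (r / 4); first by lra.
move=> z za zc; have zb : r / 4 <= cmod (z - b).
  by have := cmod_tri3 c z a; have := cmod_tri3 z b a; rewrite (cmodBC c z); lra.
apply: (@le_trans _ _ (4 * K / r)); last lra.
have := DK z za; rewrite ler_pdivlMr //; have := cmod_ge0 (D z); nra.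
Qed.

Lemma hasd_bound u b l K s : 0 < s -> hasd u b l ->
  (forall w, cmod (w - b) < s -> cmod (u w - u b) <= K * cmod (w - b)) -> cmod l <= K.
Proof.
move=> s0 hl hK; apply: le_small => e e0; have [d d0 hd] := hl e e0.
pose t := Num.min s d / 2.
have t0 : 0 < t by rewrite divr_gt0 // lt_min s0.
have [ts td] : t < s /\ t < d.
  have : Num.min s d <= s /\ Num.min s d <= d by rewrite !ge_min !lexx orbT.
  by rewrite /t; move=> [] *; move: t0; rewrite /t; lra.
have E : b + t%:C - b = t%:C by rewrite addrC addKr.
have nt : cmod t%:C = t by rewrite cmod_real gtr0_norm.
have := hd (b + t%:C); have := hK (b + t%:C); rewrite E nt => /(_ ts) k1 /(_ td) k2.
have := cmod_sub (l * t%:C) (u (b + t%:C) - u b); rewrite (cmodBC (l * _)) cmodM nt => k3.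
by rewrite -(ler_pM2r t0); lra.
Qed.

(** [div_bound] for the divided difference at [z], with [K = 2 * M]. For [z] in [F] the base point
    is moved slightly off [F], and continuity closes the gap. *)
Lemma lip_exc u F a r M : 0 < r -> 0 <= M ->
  (forall z, cmod (z - a) < r -> ccont u z) ->
  (forall z, cmod (z - a) < r -> z \notin F -> exists l, hasd u z l) ->
  (forall w, cmod (w - a) < r -> cmod (u w) <= M) ->
  forall z w, cmod (z - a) < r / 2 -> cmod (w - a) < r ->
    cmod (u w - u z) <= 8 * M / r * cmod (w - z).
Proof.
move=> r0 M0 uc ud uM.
have main z w : z \notin F -> cmod (z - a) < r / 2 -> cmod (w - a) < r ->
    cmod (u w - u z) <= 8 * M / r * cmod (w - z).
  move=> zF za wa; have zr : cmod (z - a) < r by lra.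
  have [l hl] := ud z zr zF.
  rewrite -(slopeM u z l) cmodM; apply: ler_wpM2r; first exact: cmod_ge0.
  rewrite (_ : 8 * M = 4 * (2 * M)); last by ring.
  apply: (@div_bound (slope u z l) (z :: F) a r z) => //; rewrite ?mulr_ge0 //; first exact: ltW.
  - by move=> p pa; apply: slope_ccont => //; exact: uc.
  - move=> p pa; rewrite inE negb_or => /andP[pz pF]; have [m hm] := ud p pa pF.
    exact: slope_hasd_off hm.
  - move=> p pa; rewrite -cmodM slopeM; apply: le_trans (cmodB _ _) _.
    by have := uM p pa; have := uM z zr; lra.
move=> z w za wa; apply: le_small => e e0.
pose L := 8 * M / r; have L0 : 0 <= L by rewrite divr_ge0 ?mulr_ge0 // ltW.
have zr : cmod (z - a) < r by lra.
have e2 : 0 < e / 2 by lra.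
have [d d0 hd] := uc z zr _ e2.
pose t := Num.min d (Num.min (r / 2 - cmod (z - a)) (e / (2 * (L + 1)))).
have t0 : 0 < t by rewrite !lt_min d0 subr_gt0 za divr_gt0 //; lra.
have [z' + z'F] := avoid_seq F z t0.
rewrite !lt_min => /andP[/hd k1 /andP[k2 k3]].
have z'a : cmod (z' - a) < r / 2 by have := cmod_tri3 z' z a; lra.
have := main z' w z'F z'a wa; have := cmod_tri3 w z z'; rewrite (cmodBC z z') -/L => k4 k5.
have := cmodD (u w - u z') (u z' - u z); rewrite addrA subrK => k6.
have k7 : L * cmod (z' - z) <= e / 2.
  rewrite ltr_pdivlMr in k3; last lra.
  by have := cmod_ge0 (z' - z); nra.
have : L * cmod (w - z') <= L * (cmod (w - z) + cmod (z' - z)) by apply: ler_wpM2l.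
lra.
Qed.

Lemma slope_bound u F a r M b l : 0 < r -> 0 <= M ->
  (forall z, cmod (z - a) < r -> ccont u z) ->
  (forall z, cmod (z - a) < r -> z \notin F -> exists l, hasd u z l) ->
  (forall w, cmod (w - a) < r -> cmod (u w) <= M) ->
  cmod (b - a) < r / 2 -> hasd u b l ->
  forall w, cmod (w - a) < r -> cmod (slope u b l w) <= 8 * M / r.
Proof.
move=> r0 M0 uc ud uM ba hl w wa; have L := lip_exc r0 M0 uc ud uM ba.
have [->|wb] := eqVneq w b; last first.
  have np : 0 < cmod (w - b) by rewrite cmod_gt0 subr_eq0.
  by rewrite -(ler_pM2r np) -cmodM slopeM; exact: L.
rewrite slope_bb; apply: (hasd_bound (s := r / 2) _ hl) => [|x xb]; first by lra.
by apply: L => //; have := cmod_tri3 x b a; lra.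
Qed.

Lemma slope_lip u F a r M b l : 0 < r -> 0 <= M ->
  (forall z, cmod (z - a) < r -> ccont u z) ->
  (forall z, cmod (z - a) < r -> z \notin F -> exists l, hasd u z l) ->
  (forall w, cmod (w - a) < r -> cmod (u w) <= M) ->
  cmod (b - a) < r / 2 -> hasd u b l ->
  forall z w, cmod (z - a) < r / 2 -> cmod (w - a) < r ->
    cmod (slope u b l w - slope u b l z) <= 64 * M / r ^+ 2 * cmod (w - z).
Proof.
move=> r0 M0 uc ud uM ba hl.
rewrite (_ : 64 * M / r ^+ 2 = 8 * (8 * M / r) / r); last by field; lra.
apply: (@lip_exc (slope u b l) (b :: F)) => //.
- by rewrite divr_ge0 ?mulr_ge0 // ltW.
- by move=> z za; apply: slope_ccont => //; exact: uc.
- move=> z za; rewrite inE negb_or => /andP[zb zF]; have [m hm] := ud z za zF.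
  exact: slope_hasd_off hm.
- exact: slope_bound r0 M0 uc ud uM ba hl.
Qed.

Lemma taylor_exc u F a r M z l : 0 < r -> 0 <= M ->
  (forall z, cmod (z - a) < r -> ccont u z) ->
  (forall z, cmod (z - a) < r -> z \notin F -> exists l, hasd u z l) ->
  (forall w, cmod (w - a) < r -> cmod (u w) <= M) ->
  cmod (z - a) < r / 2 -> hasd u z l ->
  cmod l <= 8 * M / r /\
  forall w, cmod (w - a) < r ->
    cmod (u w - u z - l * (w - z)) <= 64 * M / r ^+ 2 * cmod (w - z) ^+ 2.
Proof.
move=> r0 M0 uc ud uM za hl; split.
  by rewrite -(slope_bb u z l); apply: (slope_bound r0 M0 uc ud uM za hl); lra.
move=> w wa; have := slope_lip r0 M0 uc ud uM za hl za wa; rewrite slope_bb => h.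
rewrite -(slopeM u z l) -mulrBl cmodM expr2 mulrA.
by apply: ler_wpM2r => //; exact: cmod_ge0.
Qed.

Lemma taylor2 u a r M z l : 0 < r -> 0 <= M -> hol [set z | cmod (z - a) < r] u ->
  (forall w, cmod (w - a) < r -> cmod (u w) <= M) ->
  cmod (z - a) < r / 2 -> hasd u z l ->
  cmod l <= 8 * M / r /\
  forall w, cmod (w - a) < r ->
    cmod (u w - u z - l * (w - z)) <= 64 * M / r ^+ 2 * cmod (w - z) ^+ 2.
Proof.
move=> r0 M0 hu; apply: (@taylor_exc u [::]) => // w wa; first exact: hol_cont hu wa.
by move=> _; exact: hu.
Qed.

(** The Taylor estimate at points of differentiability [b n] tending to [a] has constants
    independent of [n]. It passes to the limit, with an ultrafilter limit of the derivatives as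
    derivative at [a]. *)
Lemma removable O u a : copen O -> O a -> ccont u a ->
  (forall z, O z -> z != a -> exists l, hasd u z l) -> exists l, hasd u a l.
Proof.
move=> oO Oa uca ud; have [r1 r10 hr1] := oO a Oa; have [r2 r20 hr2] := uca 1 ltr01.
have [r [r0 rr1 rr2]] := min_pos2 r10 r20.
pose M := cmod (u a) + 1; have M0 : 0 <= M by have := cmod_ge0 (u a); rewrite /M; lra.
have uM w : cmod (w - a) < r -> cmod (u w) <= M.
  move=> wa; have := hr2 w (lt_le_trans wa rr2); have := cmod_sub (u w) (u a); rewrite /M; lra.
have ud' z : cmod (z - a) < r -> z \notin [:: a] -> exists l, hasd u z l.
  by move=> za; rewrite inE => /ud; apply; apply: hr1; apply: lt_le_trans rr1.
have uc z : cmod (z - a) < r -> ccont u z.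
  move=> za; have [->//|zna] := eqVneq z a.
  by have [|l /hasd_cont] := ud' z za; rewrite ?inE.
pose L := 8 * M / r; have L0 : 0 <= L by rewrite divr_ge0 ?mulr_ge0 // ltW.
pose K := 64 * M / r ^+ 2; have K0 : 0 <= K by apply: divr_ge0; [exact: mulr_ge0|exact: sqr_ge0].
have /choice [b hb] : forall n : nat, exists bl : C * C, [/\ cmod (bl.1 - a) < n.+1%:R^-1, cmod bl.2 <= L &
    forall w, cmod (w - a) < r -> cmod (u w - u bl.1 - bl.2 * (w - bl.1)) <= K * cmod (w - bl.1) ^+ 2].
  move=> n; have rh : 0 < r / 2 by lra.
  have [t [t0 tr tn]] := min_pos2 rh (ltac:(by rewrite invr_gt0) : 0 < n.+1%:R^-1 :> R).
  have [b bt ba] := avoid_seq [:: a] a t0; have [|l hl] := ud' b _ ba; first lra.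
  have [|h1 h2] := taylor_exc r0 M0 uc ud' uM _ hl; first lra.
  by exists (b, l); split=> //; exact: lt_le_trans bt tn.
have [n|l hl] := @ulim_ex R (fun n => (b n).2) L; first by have [] := hb n.
have T w : cmod (w - a) < r -> cmod (u w - u a - l * (w - a)) <= K * cmod (w - a) ^+ 2.
  move=> wa; apply: le_small => e e0; have x0 := cmod_ge0 (w - a).
  pose S := K * (2 * cmod (w - a) + 1) + 1 + cmod (w - a) + L.
  have S0 : 0 < S by have : 0 <= K * (2 * cmod (w - a) + 1); [apply: mulr_ge0 => //; lra|rewrite /S; lra].
  have [t [t0 t1 te]] := min_pos2 ltr01 (divr_gt0 e0 S0); rewrite ler_pdivlMr // in te.
  have [d d0 hd] := uca t t0; have [s [s0 sd st]] := min_pos2 d0 t0; have [N hN] := inv_lt_eps s0.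
  have [n [/= h1 h2]] := ufilter_ex (ufilterI (hl t t0) (ufilter_tail N)).
  have [ba bl hw] := hb n; have := hw w wa; have := hN n h2 => h3 h4.
  have ba' := lt_trans ba h3.
  have := hd (b n).1 (lt_le_trans ba' sd) => h5.
  move: (b n) ba' bl h4 h5 h1 => [y m] /= ya ml h4 h5 h1.
  rewrite (_ : _ - _ = (u w - u y - m * (w - y)) + (u y - u a) + (m - l) * (w - a) - m * (y - a)); last by ring.
  apply: le_trans (cmodB _ _) _; have := cmodD (u w - u y - m * (w - y) + (u y - u a)) ((m - l) * (w - a)).
  have := cmodD (u w - u y - m * (w - y)) (u y - u a); have := cmod_tri3 w a y; rewrite (cmodBC a) !cmodM.
  have := cmod_ge0 m; have := cmod_ge0 (y - a); have := cmod_ge0 (w - y); have := cmod_ge0 (m - l).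
  move: (cmod (w - y)) (cmod (y - a)) (cmod m) (cmod (w - a)) @S S0 te h4 h5 h1 ya ml x0.
  move=> p q c x S S0 te h4 h5 h1 ya ml x0 ml0 p0 q0 c0 k1 k2 k3.
  have : c * q <= L * t by apply: ler_pM => //; lra.
  have : cmod (m - l) * x <= t * x by apply: ler_wpM2r => //; exact: ltW.
  have : K * p ^+ 2 <= K * (x ^+ 2 + t * (2 * x + 1)).
    by apply: ler_wpM2l => //; rewrite !expr2; nra.
  by move: te k2 k3 h4; rewrite /S !mulrDr; lra.
exists l => e e0; have K1 : 0 < K + 1 by lra.
have [d [d0 dr de]] := min_pos2 r0 (divr_gt0 e0 K1); exists d => // w wd.
apply: le_trans (T w (lt_le_trans wd dr)) _; rewrite expr2 mulrA; apply: ler_wpM2r; first exact: cmod_ge0.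
by rewrite ler_pdivlMr // in de; have := cmod_ge0 (w - a); nra.
Qed.

Lemma slope_sym u a b l m : hasd u a l -> hasd u b m -> slope u a l b = slope u b m a.
Proof.
move=> hl hm; have [E|ba] := eqVneq b a; first by rewrite E in hm *; rewrite !slope_bb (hasd_uniq hl hm).
by rewrite slopeE // slopeE; [field; rewrite !subr_eq0 (eq_sym a) ba|rewrite eq_sym].
Qed.

Lemma slope_hol O u b l : copen O -> O b -> hol O u -> hasd u b l -> hol O (slope u b l).
Proof.
move=> oO Ob hu hl.
have off z : O z -> z != b -> exists m, hasd (slope u b l) z m.
  by move=> Oz zb; have [m hm] := hu z Oz; exact: slope_hasd_off hm.
move=> z Oz; have [->|zb] := eqVneq z b; last exact: off.
by apply: (removable oO) => //; exact: slope_ccont_at.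
Qed.

Lemma hol_locbound O u a : copen O -> O a -> hol O u ->
  exists r M, [/\ 0 < r, 0 <= M, (forall w, cmod (w - a) < r -> O w) &
    forall w, cmod (w - a) < r -> cmod (u w) <= M].
Proof.
move=> oO Oa hu; have [r1 r10 hr1] := oO a Oa; have [r2 r20 hr2] := hol_cont hu Oa ltr01.
exists (Num.min r1 r2), (cmod (u a) + 1); split.
- by rewrite lt_min r10.
- by have := cmod_ge0 (u a); lra.
- by move=> w; rewrite lt_min => /andP[/hr1].
- move=> w; rewrite lt_min => /andP[_ /hr2 h].
  by have := cmod_sub (u w) (u a); lra.
Qed.

(** The divided difference at [a] is iterated. If all quotients vanish at [a], the maximum principle
    gives [cmod (us n w) <= M / (r / 2) ^+ n], so [u] vanishes on the disc of radius [r / 4].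
    Otherwise the first quotient not vanishing at [a] is nonzero near [a]. *)
Lemma isolated_zero O u a : copen O -> O a -> hol O u -> u a = 0 ->
  (forall r, 0 < r -> exists2 w, cmod (w - a) < r & u w != 0) ->
  exists2 r : R, 0 < r & forall w, cmod (w - a) < r -> w != a -> u w != 0.
Proof.
move=> oO Oa hu ua nz.
have [r [M [r0 M0 rO uM]]] := hol_locbound oO Oa hu.
pose D := [set z | cmod (z - a) < r].
have oD : copen D by exact: copen_ball.
have Da : D a by rewrite /D /= subrr cmod0.
pose lder v := xget 0 [set l | hasd v a l].
have lderP v : hol D v -> hasd v a (lder v).
  by move=> /(_ a Da) [l hl]; rewrite /lder; case: xgetP => [m _ //|/(_ l)].
pose us := fix us n := if n is n'.+1 then slope (us n') a (lder (us n')) else u.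
have ush n : hol D (us n).
  elim: n => [|n IH]; first by move=> z /rO; exact: hu.
  by apply: slope_hol => //; exact: lderP.
have uE n w : (forall k : nat, (k < n)%N -> us k a = 0) -> u w = (w - a) ^+ n * us n w.
  elim: n => [|n IH] h; first by rewrite expr0 mul1r.
  have := slopeM (us n) a (lder (us n)) w; rewrite (h n) // subr0 => E.
  by rewrite IH => [|k /ltnW/h//]; rewrite -E exprSr /= -!mulrA; congr (_ * _); rewrite mulrC.
have [[n hn]|h0] := pselect (exists n, us n a != 0); last first.
  exfalso; have {}uE n w : u w = (w - a) ^+ n * us n w.
    by apply: uE => k _; apply/eqP; apply: contrapT => /negP h; apply: h0; exists k.
  have usM n w : D w -> cmod (us n w) <= M / (r / 2) ^+ n.
    apply: (@maxmod R D) => //.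
    - by have [B h] := cbounded_ball a r; exists B => z /= /ltW /h.
    - by rewrite divr_ge0 ?exprn_ge0 // divr_ge0 // ltW.
    move=> b /= /negP; rewrite -leNgt => rb e e0; exists (r / 2); first by lra.
    move=> z Dz zb; apply: (@le_trans _ _ (M / (r / 2) ^+ n)); last lra.
    have za : r / 2 <= cmod (z - a) by have := cmod_tri3 b z a; rewrite (cmodBC b z); lra.
    have p : 0 < (r / 2) ^+ n by rewrite exprn_gt0 //; lra.
    rewrite ler_pdivlMr //; apply: le_trans (uM z Dz); rewrite (uE n z) cmodM cmodX mulrC.
    apply: ler_wpM2r; first exact: cmod_ge0.
    by apply: lerXn2r; rewrite ?nnegrE ?cmod_ge0 //; lra.
  have [|w wr uw] := nz (r / 4); first lra.
  have Dw : D w by rewrite /D /=; lra.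
  have wp : 0 < cmod (u w) by rewrite cmod_gt0.
  have [n hn] : exists n, (2^-1 : R) ^+ n < cmod (u w) / (M + 1) by apply: pow_small; rewrite ?divr_gt0 //; lra.
  rewrite ltr_pdivlMr in hn; last lra.
  have : cmod (u w) <= (2^-1) ^+ n * M.
    rewrite (uE n w) cmodM cmodX.
    apply: (@le_trans _ _ ((r / 4) ^+ n * (M / (r / 2) ^+ n))).
      apply: ler_pM; rewrite ?exprn_ge0 ?cmod_ge0 //; last exact: usM.
      by apply: lerXn2r; rewrite ?nnegrE ?cmod_ge0 //; lra.
    rewrite (_ : r / 4 = 2^-1 * (r / 2)); last by field.
    have p : (r / 2) ^+ n != 0 by rewrite expf_neq0 // gt_eqF //; lra.
    by rewrite exprMn mulrACA divff // mulr1.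
  have : 0 < (2^-1 : R) ^+ n by rewrite exprn_gt0.
  nra.
have [n0 hn0 mn] := ex_minnP (ex_intro (fun n => us n a != 0) n hn).
have {}uE w : u w = (w - a) ^+ n0 * us n0 w.
  by apply: uE => k; rewrite ltnNge => kn; apply/eqP; apply: contraNT kn; exact: mn.
have p : 0 < cmod (us n0 a) by rewrite cmod_gt0.
have [d d0 hd] := hol_cont (ush n0) Da p.
exists d => // w wd wa; rewrite uE mulf_neq0 //.
  by rewrite expf_neq0 // subr_eq0.
apply: contraTneq (hd w wd) => ->; rewrite sub0r cmodN ltxx //.
Qed.

(** With derivative 0 the Taylor estimate is quadratic in the distance, and halving a segment [n]
    times gains a factor [2^-1 ^+ n]. *)
Lemma hol_const0 u a r : 0 < r -> (forall z, cmod (z - a) < r -> hasd u z 0) ->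
  forall w, cmod (w - a) < r -> u w = u a.
Proof.
move=> r0 hu w wr; set rho := cmod (w - a) in wr.
have rho0 : 0 <= rho by exact: cmod_ge0.
pose s := (r - rho) / 2.
have s0 : 0 < s by rewrite /s; lra.
have hD : hol [set z | cmod (z - a) < r] u by move=> z /hu; exists 0.
have [||p /= pr hp] := @EVT_mod R [set z | cmod (z - a) <= rho + s] u (@cclosed_ball R a _) (@cbounded_ball R a _).
- by exists a; rewrite /= subrr cmod0; lra.
- by move=> z /= zr; apply: hol_cont hD _; rewrite /= ; move: zr; rewrite /s; lra.
set M := cmod (u p) in hp; have M0 : 0 <= M := cmod_ge0 _.
pose K := 64 * M / s ^+ 2.
have K0 : 0 <= K by apply: divr_ge0; [exact: mulr_ge0|exact: sqr_ge0].
have step z z' : cmod (z - a) <= rho -> cmod (z' - z) < s -> cmod (u z' - u z) <= K * cmod (z' - z) ^+ 2.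
  move=> za zz; have [||||_ H'] := @taylor2 u z s M z 0 s0 M0.
  - by move=> q /= qz; apply: hD => /=; have := cmod_tri3 q z a; move: za qz; rewrite /s; lra.
  - by move=> q qz; apply: hp; have := cmod_tri3 q z a; lra.
  - by rewrite subrr cmod0; lra.
  - by apply: hu; rewrite /s in s0; lra.
  - by have := H' z' zz; rewrite mul0r subr0.
have quad z z' : cmod (z - a) <= rho -> cmod (z' - a) <= rho -> cmod (u z' - u z) <= K * cmod (z' - z) ^+ 2.
  move=> za za'; have [h|h] := ltP (cmod (z' - z)) s; first exact: step.
  apply: (@le_trans _ _ (K * s ^+ 2)); last by apply: ler_wpM2l => //; apply: lerXn2r; rewrite ?nnegrE ?cmod_ge0 //; exact: ltW.
  rewrite /K divfK ?expf_neq0 ?gt_eqF //; apply: le_trans (cmodB _ _) _.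
  by have := hp z; have := hp z' => /(_ ltac:(lra)) h1 /(_ ltac:(lra)) h2; lra.
have half n : forall z z', cmod (z - a) <= rho -> cmod (z' - a) <= rho ->
    cmod (u z' - u z) <= K * cmod (z' - z) ^+ 2 * 2^-1 ^+ n.
  elim: n => [|n IH] z z' za za'; first by rewrite expr0 mulr1; exact: quad.
  have [t tE] : exists t : C, t = (2^-1)%:C * (z + z') by eexists.
  have t1 : t - z = (2^-1)%:C * (z' - z) by rewrite tE; apply: cplx_eq; rewrite !(cReM, cImM, cReB, cImB, cReD, cImD) /=; field.
  have t2 : z' - t = (2^-1)%:C * (z' - z) by rewrite tE; apply: cplx_eq; rewrite !(cReM, cImM, cReB, cImB, cReD, cImD) /=; field.
  have c2 : cmod ((2^-1)%:C : C) = 2^-1 by rewrite cmod_real ger0_norm.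
  have ta : cmod (t - a) <= rho.
    rewrite (_ : t - a = (2^-1)%:C * ((z - a) + (z' - a))); last by rewrite tE; apply: cplx_eq; rewrite !(cReM, cImM, cReB, cImB, cReD, cImD) /=; field.
    by rewrite cmodM c2; have := cmodD (z - a) (z' - a); lra.
  have := IH z t za ta; have := IH t z' ta za'; rewrite t1 t2 cmodM c2 !exprMn (exprS _ n).
  have := cmodD (u z' - u t) (u t - u z); rewrite addrA subrK.
  by move: (2^-1 ^+ n) (cmod (z' - z) ^+ 2) => x y; lra.
apply/eqP; rewrite -subr_eq0; apply/eqP; apply: cmod_small => e e0.
have c0 : 0 < K * cmod (w - a) ^+ 2 + 1 by apply: ltr_wpDl => //; apply: mulr_ge0 => //; exact: sqr_ge0.
have [n hn] : exists n, (2^-1 : R) ^+ n < e / (K * cmod (w - a) ^+ 2 + 1) by apply: pow_small; rewrite ?divr_gt0 //; lra.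
have := half n a w; rewrite subrr cmod0 => /(_ rho0 (lexx _)) h; apply: le_trans h _.
rewrite ltr_pdivlMr // in hn; have : 0 <= (2^-1 : R) ^+ n by rewrite exprn_ge0.
by move: (2^-1 ^+ n) hn => x; rewrite mulrDr mulr1 (mulrC x); lra.
Qed.

Lemma maxmod_ball O u a r B : copen O -> hol O u -> (forall w, cmod (w - a) <= r -> O w) -> 0 <= B ->
  (forall w, cmod (w - a) = r -> cmod (u w) <= B) -> forall w, cmod (w - a) < r -> cmod (u w) <= B.
Proof.
move=> oO hu rO B0 uB; apply: (@maxmod R [set w | cmod (w - a) < r] u B) => //.
- exact: copen_ball.
- by apply: cbounded_sub (@cbounded_ball R a r) => z /= /ltW.
- by apply: hol_sub hu => z /= /ltW /rO.
- move=> b /= /negP; rewrite -leNgt le_eqVlt => /orP[/eqP br|br] e e0; last first.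
    exists (cmod (b - a) - r); first by rewrite subr_gt0.
    by move=> w wr wb; have := cmod_tri3 b w a; rewrite (cmodBC b w); lra.
  have Ob : O b by apply: rO; rewrite br.
  have [d d0 hd] := ccont_mod (hol_cont hu Ob) e0; exists d => // w wr /hd.
  by rewrite ltr_norml => /andP[_]; have := uB b (esym br); lra.
Qed.

Lemma minmod_ball O u a r M : copen O -> hol O u -> (forall w, cmod (w - a) <= r -> O w) ->
  (forall w, O w -> u w != 0) -> 0 < r -> 0 < M -> (forall w, cmod (w - a) = r -> M <= cmod (u w)) -> M <= cmod (u a).
Proof.
move=> oO hu rO u0 r0 M0 h; have aa : cmod (a - a) < r by rewrite subrr cmod0.
have V w : O w -> (cmod (u w)^-1 <= M^-1) = (M <= cmod (u w)).
  by move=> Ow; rewrite cmodV lef_pV2 ?posrE ?cmod_gt0 ?u0.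
rewrite -V; last by apply: rO; exact: ltW.
apply: (maxmod_ball oO (holV hu u0) rO _ _ aa) => [|w wr]; first by rewrite invr_ge0 ltW.
by rewrite V; [exact: h|apply: rO; rewrite wr].
Qed.

Lemma ift (r M c : R) : 0 < r -> 0 <= M -> 0 < c -> exists rho : R, [/\ 0 < rho, rho <= r / 4 &
  forall (p : C -> C) (s l : C), hol [set z | cmod (z - s) < r] p -> (forall w, cmod (w - s) < r -> cmod (p w) <= M) ->
    hasd p s l -> c <= cmod l ->
    (forall w1 w2 : C, cmod (w1 - s) < rho -> cmod (w2 - s) < rho -> c / 2 * cmod (w1 - w2) <= cmod (p w1 - p w2)) /\
    (forall (t : R) y, 0 < t -> t <= rho -> cmod (y - p s) < c * t / 16 -> exists2 w, cmod (w - s) < t & p w = y)].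
Proof.
move=> r0 M0 c0; pose K := 64 * M / r ^+ 2.
have K0 : 0 <= K by apply: divr_ge0; [exact: mulr_ge0|exact: sqr_ge0].
pose rho := Num.min (r / 4) (c / (32 * (K + 1))).
have rho0 : 0 < rho by rewrite lt_min !divr_gt0 //; lra.
have rho1 : rho <= r / 4 by rewrite ge_min lexx.
have rho2 : 16 * K * rho <= c / 2.
  have : rho <= c / (32 * (K + 1)) by rewrite ge_min lexx orbT.
  rewrite ler_pdivlMr; last lra.
  nra.
exists rho; split=> // p s l hp pM hl cl.
have T := (taylor2 r0 M0 hp pM _ hl).
have {T} [|_ T] := T _; first by rewrite subrr cmod0; lra.
have L (w1 w2 : C) : cmod (w1 - s) < rho -> cmod (w2 - s) < rho -> c / 2 * cmod (w1 - w2) <= cmod (p w1 - p w2).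
  move=> h1 h2; pose v w := p w - p s - l * (w - s).
  have hv : hol [set z | cmod (z - s) < 2 * rho] v.
    apply: holB; first by apply: holB; [apply: hol_sub hp => z /=; lra|exact: hol_cst].
    by apply: holM; [exact: hol_cst|apply: holB; [exact: hol_id|exact: hol_cst]].
  have LL : cmod (v w1 - v w2) <= 8 * (K * (2 * rho) ^+ 2) / (2 * rho) * cmod (w1 - w2).
    apply: (@lip_exc v [::] s); try lra.
    - by apply: mulr_ge0 => //; exact: sqr_ge0.
    - by move=> z zs; exact: hol_cont hv zs.
    - by move=> z /hv.
    - move=> w ws; apply: le_trans (T w _) _; first lra.
      apply: ler_wpM2l => //; apply: lerXn2r; rewrite ?nnegrE ?cmod_ge0 //; lra.
  move: LL.
  rewrite (_ : 8 * _ / _ = 16 * K * rho); last by field; lra.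
  have -> : v w1 - v w2 = (p w1 - p w2) - l * (w1 - w2) by rewrite /v; ring.
  have := cmod_sub (l * (w1 - w2)) (p w1 - p w2); rewrite cmodM (cmodBC (l * _)) => k1 k2.
  have := cmod_ge0 (w1 - w2); nra.
split=> // t y t0 tr yps; apply: contrapT => hn.
have nz w : cmod (w - s) < t -> p w - y != 0.
  by move=> ws; rewrite subr_eq0; apply/eqP => E; apply: hn; exists w.
have ss : cmod (s - s) < rho by rewrite subrr cmod0.
have ct : 0 < c * t by rewrite mulr_gt0.
have : c * t / 8 <= cmod (p s - y).
  apply: (@minmod_ball [set z | cmod (z - s) < t] (fun w => p w - y) s (t / 2)) => //; try lra.
  - exact: copen_ball.
  - by apply: holB; [apply: hol_sub hp => z /=; lra|exact: hol_cst].
  - by move=> w /=; lra.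
  move=> z zs; have zr : cmod (z - s) < rho by lra.
  by have := L z s zr ss; have := cmod_tri3 (p z) y (p s); rewrite zs; lra.
by rewrite cmodBC; lra.
Qed.

End Estimates.

(** * Connectedness, limits of holomorphic functions, Hurwitz, biholomorphisms *)

Section Holomorphic2.
Context {R : realType}.
Local Notation C := R[i].
Implicit Types (u g h : C -> C) (M K s e d r t : R) (z w p q a b c l y : C) (O : set C).

Lemma inv_hasd (f g : C -> C) y0 l : hasd f (g y0) l -> l != 0 -> ccont g y0 ->
  (exists2 r, 0 < r & forall y, cmod (y - y0) < r -> f (g y) = y) -> hasd g y0 l^-1.
Proof.
move=> hf l0 gc [r r0 fg] e e0; have lp := cmod_neq0 l0.
pose e1 := Num.min (cmod l / 2) (e * cmod l ^+ 2 / 2).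
have l2 : 0 < cmod l ^+ 2 by rewrite exprn_gt0.
have e10 : 0 < e1 by rewrite lt_min !divr_gt0 // mulr_gt0.
have [e1a e1b] : e1 <= cmod l / 2 /\ e1 <= e * cmod l ^+ 2 / 2 by rewrite !ge_min !lexx orbT.
have [d d0 hd] := hf e1 e10; have [d' d'0 hd'] := gc d d0.
exists (Num.min r d'); first by rewrite lt_min r0.
move=> y; rewrite lt_min => /andP[yr /hd' /hd].
have y00 : cmod (y0 - y0) < r by rewrite subrr cmod0.
rewrite (fg y yr) (fg y0 y00); set D := g y - g y0 => k1.
have k2 : cmod l * cmod D <= 2 * cmod (y - y0).
  have := cmod_sub (l * D) (y - y0); rewrite cmodM (cmodBC (l * D)).
  by have := cmod_ge0 D; nra.
have -> : D - l^-1 * (y - y0) = - l^-1 * (y - y0 - l * D) by field.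
rewrite cmodM cmodN cmodV mulrC ler_pdivrMr //.
apply: le_trans k1 _.
have : e1 * cmod D <= e * cmod l ^+ 2 / 2 * cmod D by apply: ler_wpM2r => //; exact: cmod_ge0.
have := cmod_ge0 D; rewrite expr2; nra.
Qed.

Lemma local_homeo O f a l : copen O -> O a -> hol O f -> hasd f a l -> l != 0 ->
  exists rho : R, [/\ 0 < rho, (forall w, cmod (w - a) < rho -> O w),
   (forall w1 w2, cmod (w1 - a) < rho -> cmod (w2 - a) < rho -> f w1 = f w2 -> w1 = w2) &
   forall t, 0 < t -> exists2 d : R, 0 < d & forall y, cmod (y - f a) < d -> exists2 w, cmod (w - a) < t & f w = y].
Proof.
move=> oO Oa hf hl l0; have lp := cmod_neq0 l0.
have [r [M [r0 M0 rO fM]]] := hol_locbound oO Oa hf.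
have [rho [rho0 rhor H]] := ift r0 M0 lp.
have [||H1 H2] := H f a l _ fM hl; [by move=> z /rO; exact: hf|exact: lexx|].
exists rho; split=> //.
- by move=> w wr; apply: rO; lra.
- move=> w1 w2 h1 h2 E; apply/eqP; rewrite -subr_eq0; apply/eqP/cmod_eq0.
  have := H1 w1 w2 h1 h2; rewrite E subrr cmod0; have := cmod_ge0 (w1 - w2); nra.
- move=> t t0; pose t' := Num.min t rho.
  have t'0 : 0 < t' by rewrite lt_min t0.
  have [h1 h2] : t' <= t /\ t' <= rho by rewrite !ge_min !lexx orbT.
  exists (cmod l * t' / 16); first by rewrite divr_gt0 // mulr_gt0.
  by move=> y /(H2 t' y t'0 h2) [w hw E]; exists w => //; lra.
Qed.

(** Connectedness as an induction principle: a property that is relatively open together with its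
    negation spreads over [O]. *)
Definition cconn O := forall A : set C, (exists2 z, O z & A z) ->
  (forall z, O z -> A z -> exists2 r, 0 < r & forall w, O w -> cmod (w - z) < r -> A w) ->
  (forall z, O z -> ~ A z -> exists2 r, 0 < r & forall w, O w -> cmod (w - z) < r -> ~ A w) ->
  forall z, O z -> A z.

(** The points near which [u] equals [c] form a relatively clopen set, because a zero of [u - c] is
    isolated unless [u - c] vanishes around it. *)
Lemma identity_thm O u a c r : copen O -> cconn O -> hol O u -> O a -> 0 < r ->
  (forall w, cmod (w - a) < r -> u w = c) -> forall z, O z -> u z = c.
Proof.
move=> oO cO hu Oa r0 hc.
suff H z : O z -> exists2 r, 0 < r & forall w, cmod (w - z) < r -> u w = c.
  by move=> z /H [r1 r10]; apply; rewrite subrr cmod0.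
apply: (cO [set z | exists2 r : R, 0 < r & forall w, cmod (w - z) < r -> u w = c]).
- by exists a => //; exists r.
- move=> {}z Oz [r1 r10 h1]; exists (r1 / 2); first by lra.
  move=> w Ow wz; exists (r1 / 2); first by lra.
  by move=> x xw; apply: h1; have := cmod_tri3 x w z; lra.
- move=> {}z Oz nz; have [Ez|uz] := eqVneq (u z) c; last first.
    have p : 0 < cmod (u z - c) by rewrite cmod_gt0 subr_eq0.
    have [d d0 hd] := hol_cont hu Oz p; exists d => // w Ow wd [r1 r10 h1].
    have := hd w wd; rewrite h1 ?subrr ?cmod0 // => k.
    by move: (hd w wd); rewrite h1 ?subrr ?cmod0 // (cmodBC c) ltxx.
  have [|||d d0 hd] := @isolated_zero R O (fun w => u w - c) z oO Oz.
  - by apply: holB => //; exact: hol_cst.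
  - by rewrite Ez subrr.
  - move=> r1 r10; apply: contrapT => hn; apply: nz; exists r1 => // w wr.
    by apply/eqP; apply: contrapT => /negP h; apply: hn; exists w; rewrite ?subr_eq0.
  exists d => // w Ow wd [r1 r10 h1].
  have dd : 0 < Num.min r1 (d - cmod (w - z)) by rewrite lt_min r10 subr_gt0.
  have [x + xF] := avoid_seq [:: z] w dd; rewrite lt_min => /andP[xr xd].
  have xz : cmod (x - z) < d by have := cmod_tri3 x w z; lra.
  by have := hd x xz; rewrite h1 // subrr eqxx; move: xF; rewrite inE => xF /(_ xF).
Qed.

Section Limits.
Variables (O : set C) (g : nat -> C -> C) (g0 : C -> C) (M : R).
Hypotheses (oO : copen O) (hg : forall n, hol O (g n))
  (gM : forall n z, O z -> cmod (g n z) <= M)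
  (gl : forall z e, O z -> 0 < e -> ufilter [set n | cmod (g n z - g0 z) < e]).

(** The substance of Montel's theorem: a bounded family has pointwise ultrafilter limits for free,
    and the Taylor constants do not depend on [n]. *)
Lemma ulim_hol : hol O g0.
Proof.
move=> a Oa; have [r r0 rO] := oO Oa.
have M0 : 0 <= M by apply: le_trans (cmod_ge0 (g 0%N a)) (gM _ Oa).
have /choice [ln hln] : forall n, exists l, hasd (g n) a l by move=> n; exact: hg.
have aa : cmod (a - a) < r / 2 by rewrite subrr cmod0; lra.
have T n := taylor2 r0 M0 (hol_sub rO (@hg n)) (fun w wr => gM n (rO w wr)) aa (hln n).
have [l hl] := ulim_ex (fun n => (T n).1).
pose K := 64 * M / r ^+ 2.
have K0 : 0 <= K by apply: divr_ge0; [exact: mulr_ge0|exact: sqr_ge0].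
have H w : cmod (w - a) < r -> cmod (g0 w - g0 a - l * (w - a)) <= K * cmod (w - a) ^+ 2.
  move=> wr; apply: le_small => e e0.
  have e1 : 0 < e / (2 + r) by rewrite divr_gt0 //; lra.
  have [n [/= [h1 h2] h3]] := ufilter_ex (ufilterI (ufilterI (gl (rO w wr) e1) (gl Oa e1)) (hl _ e1)).
  have := (T n).2 w wr; rewrite -/K => h4.
  rewrite (_ : _ - _ - _ = (g n w - g n a - ln n * (w - a)) + (- (g n w - g0 w) + ((g n a - g0 a) + (ln n - l) * (w - a)))); last by ring.
  apply: le_trans (cmodD _ _) _.
  have := cmodD (- (g n w - g0 w)) ((g n a - g0 a) + (ln n - l) * (w - a)).
  have := cmodD (g n a - g0 a) ((ln n - l) * (w - a)); rewrite cmodN cmodM => h5 h6.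
  have : cmod (ln n - l) * cmod (w - a) <= e / (2 + r) * r.
    by apply: ler_pM; rewrite ?cmod_ge0 // ltW.
  have : e / (2 + r) * (2 + r) = e by rewrite divfK // gt_eqF //; lra.
  move: (e / (2 + r)) h1 h2 => x; lra.
exists l => e e0; exists (Num.min r (e / (K + 1))).
  by rewrite lt_min r0 divr_gt0 //; lra.
move=> w; rewrite lt_min => /andP[wr we]; apply: le_trans (H w wr) _.
rewrite expr2 mulrA; apply: ler_wpM2r; first exact: cmod_ge0.
rewrite ltr_pdivlMr in we; last lra.
by have := cmod_ge0 (w - a); nra.
Qed.

(** Otherwise bad points [x n] have a limit [zs], where the common Lipschitz bound and convergence
    at [zs] alone give a contradiction. *)
Lemma ulim_unif (X : set C) e : cclosed X -> cbounded X -> (forall z, X z -> O z) -> 0 < e ->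
  ufilter [set n | forall z, X z -> cmod (g n z - g0 z) < e].
Proof.
move=> Xc [D XD] XO e0.
have [//|nU] := ufilterVC [set n | forall z, X z -> cmod (g n z - g0 z) < e].
have /choice [x hx] : forall n, exists z, ~ (forall z, X z -> cmod (g n z - g0 z) < e) -> X z /\ e <= cmod (g n z - g0 z).
  move=> n; have [h|/existsNP [z /not_implyP [Xz /negP]]] := pselect (forall z, X z -> cmod (g n z - g0 z) < e).
    by exists 0.
  by rewrite -leNgt => h; exists z.
have /choice [x' hx'] : forall n, exists z, cmod z <= D + 1 /\ (X (x n) -> z = x n).
  move=> n; have [h|h] := pselect (X (x n)).
    by exists (x n); split => //; have := XD _ h; lra.
  exists 0; split => //; rewrite cmod0.
  have [D0|D0] := leP 0 D; first lra.
  have [m hm] := ufilter_ex nU; have [Xm _] := hx m hm.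
  by have := XD _ Xm; have := cmod_ge0 (x m); lra.
have [zs hzs] := ulim_ex (fun n => (hx' n).1).
have Xzs : X zs.
  apply: Xc => t t0; have [n [/= h1 h2]] := ufilter_ex (ufilterI nU (hzs _ t0)).
  by have [Xn _] := hx n h1; exists (x n) => //; rewrite -(hx' n).2.
have Ozs := XO _ Xzs; have [r r0 rO] := oO Ozs.
have M0 : 0 <= M by apply: le_trans (cmod_ge0 (g 0%N zs)) (gM _ Ozs).
have L n w : cmod (w - zs) < r -> cmod (g n w - g n zs) <= 8 * M / r * cmod (w - zs).
  move=> wr; apply: (@lip_exc R (g n) [::] zs r M) => //.
  - by move=> z zr; apply: hol_cont (@hg n) (rO z zr).
  - by move=> z zr _; exact: hg (rO z zr).
  - by move=> z zr; exact: gM (rO z zr).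
  - by rewrite subrr cmod0; lra.
pose K := 8 * M / r; have K0 : 0 <= K by rewrite divr_ge0 ?mulr_ge0 // ltW.
have e3 : 0 < e / 3 by lra.
have [d d0 hd] := hol_cont ulim_hol Ozs e3.
pose s := Num.min r (Num.min d (e / (3 * (K + 1)))).
have s0 : 0 < s by rewrite !lt_min r0 d0 divr_gt0 //; lra.
have [n [/= [h1 h2] h3]] := ufilter_ex (ufilterI (ufilterI nU (hzs _ s0)) (gl Ozs e3)).
have [Xn bad] := hx n h1; exfalso.
rewrite (hx' n).2 // !lt_min in h2; move/and3P: h2 => [k1 /hd k2 k3].
have := L n _ k1; rewrite -/K => k4.
rewrite ltr_pdivlMr in k3; last lra.
have k5 : K * cmod (x n - zs) <= e / 3 by have := cmod_ge0 (x n - zs); nra.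
have : cmod (g n (x n) - g0 (x n)) < e.
  rewrite (_ : _ - _ = (g n (x n) - g n zs) + ((g n zs - g0 zs) - (g0 (x n) - g0 zs))); last by ring.
  apply: le_lt_trans (cmodD _ _) _; have := cmodB (g n zs - g0 zs) (g0 (x n) - g0 zs); lra.
lra.
Qed.

(** On a small circle [cmod (g0 z)] stays above some [m]. By the minimum principle some [g n],
    having no zeros, is at least [m / 2] at the centre, while its distance there from [g0 a = 0] is
    below [m / 4]. *)
Lemma hurwitz_neq0 a : O a -> (forall n z, O z -> g n z != 0) ->
  (forall r, 0 < r -> exists2 w, cmod (w - a) < r & g0 w != 0) -> g0 a != 0.
Proof.
move=> Oa gz nz; apply/eqP => E; have [d d0 hd] := isolated_zero oO Oa ulim_hol E nz.
have [r1 r10 rO] := oO Oa; have [t [t0 td tr]] := min_pos2 d0 r10.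
pose r := t / 2; have r0 : 0 < r by rewrite divr_gt0.
have XO z : cmod (z - a) <= r -> O z by move=> h; apply: rO; rewrite /r in h; lra.
have [|||c /= cr hc] := @EVT_min R [set z | cmod (z - a) = r] g0 (@cclosed_circle R a r).
- by apply: cbounded_sub (@cbounded_ball R a r) => z /= ->.
- by exists (a + r%:C); rewrite /= addrC addKr cmod_real gtr0_norm.
- by move=> z /= zr; apply: hol_cont ulim_hol _; apply: XO; rewrite zr.
set m := cmod (g0 c) in hc.
have m0 : 0 < m by rewrite cmod_gt0; apply: hd; [rewrite cr /r; lra|apply/eqP => E1; move: cr; rewrite E1 subrr cmod0; lra].
have m4 : 0 < m / 4 by lra.
have [n U] := ufilter_ex (ulim_unif (@cclosed_ball R a r) (@cbounded_ball R a r) XO m4).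
have : m / 2 <= cmod (g n a).
  apply: (minmod_ball oO (hg n) XO (gz n) r0) => [|w wr]; first lra.
  have := hc w wr; have := U w; rewrite /= wr lexx => /(_ isT).
  by have := cmod_sub (g0 w) (g n w); rewrite (cmodBC (g0 w)); lra.
by have := U a; rewrite /= E subrr cmod0 subr0 => /(_ (ltW r0)); lra.
Qed.

End Limits.

(** Hurwitz for [g n - g n z2] on a disc about [z1] that excludes [z2]. *)
Lemma hurwitz_inj O (g : nat -> C -> C) (g0 : C -> C) M : copen O -> (forall n, hol O (g n)) ->
  (forall n z, O z -> cmod (g n z) <= M) ->
  (forall z e, O z -> 0 < e -> ufilter [set n | cmod (g n z - g0 z) < e]) ->
  cconn O -> (forall n z w, O z -> O w -> g n z = g n w -> z = w) ->
  (exists z w, [/\ O z, O w & g0 z != g0 w]) ->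
  forall z w, O z -> O w -> g0 z = g0 w -> z = w.
Proof.
move=> oO hg gM gl cO gi [p [q [Op Oq pq]]] z1 z2 O1 O2 E; apply/eqP; apply: contrapT => /negP z12.
have zp : 0 < cmod (z1 - z2) by rewrite cmod_gt0 subr_eq0.
have [r1 r10 rO] := oO z1 O1; have [r [r0 rr1 rz]] := min_pos2 r10 zp.
have DO w : cmod (w - z1) < r -> O w by move=> h; apply: rO; lra.
suff : g0 z1 - g0 z2 != 0 by rewrite E subrr eqxx.
apply: (@hurwitz_neq0 [set w | cmod (w - z1) < r] (fun n w => g n w - g n z2) (fun w => g0 w - g0 z2) (M + M)).
- exact: copen_ball.
- by move=> n; apply: holB; [exact: hol_sub DO (hg n)|exact: hol_cst].
- by move=> n w /DO Ow; apply: le_trans (cmodB _ _) _; apply: lerD; exact: gM.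
- move=> w e /DO Ow e0; have e2 : 0 < e / 2 by lra.
  apply: ufilterS (ufilterI (gl w _ Ow e2) (gl z2 _ O2 e2)) => n [/= h1 h2].
  rewrite (_ : _ - _ = (g n w - g0 w) - (g n z2 - g0 z2)); last by ring.
  by apply: le_lt_trans (cmodB _ _) _; lra.
- by rewrite /= subrr cmod0.
- by move=> n w Dw; rewrite subr_eq0; apply/eqP => /(gi n _ _ (DO w Dw) O2) Ew; move: Dw; rewrite Ew /= (cmodBC z2); lra.
- move=> s s0; apply: contrapT => hn.
  have cst z : O z -> g0 z = g0 z2.
    apply: (identity_thm oO cO (ulim_hol oO hg gM gl) O1 s0) => w ws.
    by apply/eqP; rewrite -subr_eq0; apply: contrapT => /negP k; apply: hn; exists w.
  by move: pq; rewrite (cst p) // (cst q) // eqxx.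
Qed.

(* Hurwitz, applied to the slopes of [f] at points tending to [a] where the derivative is not zero. *)
Lemma inj_hasd_neq0 O f a l : copen O -> O a -> hol O f ->
  (forall z w, O z -> O w -> f z = f w -> z = w) -> hasd f a l -> l != 0.
Proof.
move=> oO Oa hf fi hl; apply/eqP => l0; rewrite {}l0 in hl.
have [r [M [r0 M0 rO fM]]] := hol_locbound oO Oa hf.
have hD : hol [set z | cmod (z - a) < r] f by move=> z /rO; exact: hf.
have /choice [b hb] : forall n : nat, exists bl : C * C, [/\ cmod (bl.1 - a) < n.+1%:R^-1, cmod (bl.1 - a) < r / 2, bl.2 != 0 & hasd f bl.1 bl.2].
  move=> n; have rh : 0 < r / 2 by lra.
  have [s [s0 sn sr]] := min_pos2 (ltac:(by rewrite invr_gt0) : 0 < n.+1%:R^-1 :> R) rh.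
  apply: contrapT => hn; have d0 z : cmod (z - a) < s -> hasd f z 0.
    move=> zs; have [|m hm] := hD z; first by rewrite /=; lra.
    have [E|m0] := eqVneq m 0; first by rewrite -E.
    by exfalso; apply: hn; exists (z, m); split=> //=; exact: lt_le_trans zs _.
  have [w ws] := avoid_seq [:: a] a s0; rewrite inE => /eqP; apply.
  apply: fi => //; first by apply: rO; lra.
  exact: hol_const0 s0 d0 w ws.
suff : slope f a 0 a != 0 by rewrite slope_bb eqxx.
pose D := [set w : C | cmod (w - a) < r / 2].
have DO w : D w -> O w by rewrite /D /= => h; apply: rO; lra.
apply: (@hurwitz_neq0 D (fun n => slope f (b n).1 (b n).2) (slope f a 0) (8 * M / r)).
- exact: copen_ball.
- move=> n; have [_ br _ hlb] := hb n; apply: (hol_sub (O := [set z | cmod (z - a) < r])) => [z /=|]; first by rewrite /D /=; lra.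
  by apply: slope_hol hlb => //; [exact: copen_ball|rewrite /=; lra].
- move=> n z; have [_ br _ hlb] := hb n; rewrite /D /= => zr.
  apply: (@slope_bound _ _ [::] a r M) => //; last lra.
    by move=> w wr; exact: hol_cont hD wr.
  by move=> w wr _; exact: hD.
- move=> z e Dz e0; have [m hm] := hf z (DO z Dz).
  have [d d0 hd] := slope_ccont hm (hasd_cont hl) e0; have [N hN] := inv_lt_eps d0.
  apply: ufilterS (ufilter_tail N) => n /= /hN Nn; have [bn _ _ hlb] := hb n.
  by rewrite (slope_sym hlb hm) (slope_sym hl hm); apply: hd; exact: lt_trans bn Nn.
- by rewrite /D /= subrr cmod0; lra.
- move=> n z Dz; have [_ br lb0 hlb] := hb n; have [->|zb] := eqVneq z (b n).1; first by rewrite slope_bb.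
  by rewrite slopeE // mulf_neq0 ?invr_eq0 ?subr_eq0 //; apply: contra_neq zb; apply: fi; exact: DO.
- move=> s s0; have rh : 0 < r / 2 by lra.
  have [t [t0 ts tr]] := min_pos2 s0 rh; have [w wt] := avoid_seq [:: a] a t0; rewrite inE => wa.
  exists w; first exact: lt_le_trans ts.
  rewrite slopeE // mulf_neq0 ?invr_eq0 ?subr_eq0 //; apply: contra_neq wa; apply: fi => //.
  by apply: DO; exact: lt_le_trans tr.
Qed.

Definition image_of O f : set C := [set f z | z in O].

Definition biholo O (O' : set C) f g := [/\ hol O f, hol O' g,
  (forall z, O z -> O' (f z) /\ g (f z) = z) & (forall y, O' y -> O (g y) /\ f (g y) = y)].

Lemma inj_biholo O f : copen O -> hol O f -> (forall z w, O z -> O w -> f z = f w -> z = w) ->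
  copen (image_of O f) /\ exists g, biholo O (image_of O f) f g.
Proof.
move=> oO hf fi.
have loc z : O z -> forall t, 0 < t -> exists2 d : R, 0 < d & forall y, cmod (y - f z) < d -> exists w, [/\ cmod (w - z) < t, O w & f w = y].
  move=> Oz t t0; have [l hl] := hf z Oz; have l0 := inj_hasd_neq0 oO Oz hf fi hl.
  have [rho [rho0 rO _ H]] := local_homeo oO Oz hf hl l0.
  have [|d d0 hd] := H (Num.min t rho); first by rewrite lt_min t0.
  by exists d => // y /hd [w]; rewrite lt_min => /andP[h1 h2] E; exists w; split=> //; exact: rO.
split.
  move=> _ [z Oz <-]; have [d d0 hd] := loc z Oz 1 ltr01.
  by exists d => // y /hd [w [_ Ow <-]]; exists w.
have /choice [g hg] : forall y, exists z, image_of O f y -> O z /\ f z = y.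
  by move=> y; have [[z Oz E]|n] := pselect (image_of O f y); [exists z|exists 0].
have gf z : O z -> g (f z) = z.
  by move=> Oz; have [|O1 E] := hg (f z); [exists z|exact: fi].
exists g; split=> //.
- move=> _ [z Oz <-]; have [l hl] := hf z Oz; have l0 := inj_hasd_neq0 oO Oz hf fi hl.
  exists l^-1; have Egz := gf z Oz; apply: inv_hasd => //; first by rewrite Egz; exact: hl.
    move=> e e0; have [d d0 hd] := loc z Oz e e0; exists d => // y /hd [w [h1 Ow <-]].
    by rewrite Egz gf.
  have [d d0 hd] := loc z Oz 1 ltr01; exists d => // y /hd [w [_ Ow <-]].
  by rewrite gf.
- by move=> z Oz; split; [exists z|exact: gf].
Qed.

Lemma biholo_sym O (O' : set C) f g : biholo O O' f g -> biholo O' O g f.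
Proof. by case. Qed.

Lemma biholo_inj O (O' : set C) f g : biholo O O' f g -> forall z w, O z -> O w -> f z = f w -> z = w.
Proof. by move=> [_ _ h _] z w Oz Ow E; rewrite -(h z Oz).2 -(h w Ow).2 E. Qed.

Lemma biholo_neq0 O (O' : set C) f g z l : copen O -> biholo O O' f g -> O z -> hasd f z l -> l != 0.
Proof. by move=> oO h Oz; apply: (inj_hasd_neq0 oO Oz) (biholo_inj h); case: h. Qed.

End Holomorphic2.

(** * The exponential, the half-plane and the Schwarz-Pick inequality *)

Section ExpMobius.
Context {R : realType}.
Local Notation C := R[i].
Implicit Types (u h : C -> C) (s e d r t x y : R) (z w p q a b c l : C) (O T : set C).

(** The segment parameters form a compact set of complex numbers, so [compact_uniform] gives one
    step size over which membership in [A] propagates; finitely many steps reach [w]. *)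
Lemma cconn_convex T : (forall z w t, T z -> T w -> 0 <= t -> t <= 1 -> T (z + t%:C * (w - z))) -> cconn T.
Proof.
move=> Tc A [z Tz Az] Ao Anc w Tw.
pose X := [set c : C | Im c = 0 /\ 0 <= Re c <= 1].
pose f c := z + c * (w - z).
have fT c : X c -> T (f c).
  move=> [c2 /andP[c0 c1]]; rewrite /f (_ : c = (Re c)%:C); first exact: Tc.
  by apply: cplx_eq.
pose L := cmod (w - z) + 1; have L0 : 0 < L by have := cmod_ge0 (w - z); rewrite /L; lra.
have fl c c' : cmod (f c - f c') <= L * cmod (c - c').
  rewrite (_ : _ - _ = (c - c') * (w - z)) /f; last by ring.
  by rewrite cmodM mulrC; apply: ler_wpM2r; [exact: cmod_ge0|rewrite /L; lra].
have Xc : cclosed X.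
  move=> c hc; split.
    apply/eqP; rewrite -normr_le0; apply: le_small => e /hc [p [p2 _] pc].
    by have := normIm (p - c); rewrite cImB p2 sub0r normrN; lra.
  apply/andP; split; apply: le_small => e /hc [p [_ /andP[p0 p1]] pc];
    have := normRe (p - c); rewrite cReB ler_norml => /andP[]; lra.
have Xb : cbounded X.
  exists 1 => c [c2 /andP[c0 c1]]; have := cmod_ReIm c.
  by rewrite c2 normr0 addr0 ger0_norm //; lra.
have [||r r0 hr] := @compact_uniform R X (fun c s => A (f c) -> forall c', X c' -> cmod (c' - c) < s -> A (f c')) Xc Xb.
- by move=> c s s' H ss' Ac c' Xc' cc'; apply: (H Ac c' Xc'); lra.
- move=> c Xcc; have [Ac|nAc] := pselect (A (f c)).
    have [r r0 hr] := Ao _ (fT _ Xcc) Ac; exists (r / (2 * L)); split; first by rewrite divr_gt0 //; lra.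
    move=> c' Xc' cc' _ c'' Xc'' cc''; apply: hr; first exact: fT.
    apply: le_lt_trans (fl _ _) _.
    have := cmod_tri c' c'' c; rewrite ltr_pdivlMr in cc'; last lra.
    rewrite ltr_pdivlMr in cc''; last lra.
    by move: (cmod (c'' - c)) (cmod (c' - c)) (cmod (c'' - c')) cc' cc'' => *; nra.
  have [r r0 hr] := Anc _ (fT _ Xcc) nAc; exists (r / L); split; first by rewrite divr_gt0.
  move=> c' Xc' cc' Ac'; exfalso; apply: (hr (f c')) => //; first exact: fT.
  by apply: le_lt_trans (fl _ _) _; rewrite mulrC -ltr_pdivlMr.
have [N hN] := inv_lt_eps r0; have {}hN := hN N (leqnn N).
have XN (j : nat) : (j <= N.+1)%N -> X (j%:R / N.+1%:R)%:C.
  move=> jN; split=> //=; rewrite divr_ge0 //= ler_pdivrMr // mul1r ler_nat //.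
have H (j : nat) : (j <= N.+1)%N -> A (f (j%:R / N.+1%:R)%:C).
  elim: j => [_|j IH jN]; first by rewrite mul0r /f mul0r addr0.
  apply: (hr _ (XN j (ltnW jN)) (IH (ltnW jN)) _ (XN _ jN)).
  rewrite -rmorphB /= -mulrBl -natrB // subSnn mul1r cmod_real ger0_norm //.
have := H N.+1 (leqnn _); rewrite divff ?pnatr_eq0 // /f mul1r addrC subrK //.
Qed.

Lemma is_derive_eps (f : R -> R) (x l : R) : is_derive x 1 f l -> forall e, 0 < e ->
  exists2 d : R, 0 < d & forall h : R, `|h| < d -> `|f (x + h) - f x - l * h| <= e * `|h|.
Proof.
move=> [df dl] e e0.
have : (fun h : R => h^-1 *: ((f \o shift x) (h *: 1) - f x)) @ 0^' --> l by rewrite -dl; exact: df.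
move=> /cvgrPdist_lt /(_ e e0) [d /= d0 hd]; exists d => // h hr.
have [->|h0] := eqVneq h 0; first by rewrite addr0 subrr mulr0 subrr normr0 mulr0.
have := hd h; rewrite /= sub0r normrN => /(_ hr h0) /ltW.
rewrite /shift /= /GRing.scale /= mulr1 (addrC h) => k.
have -> : f (x + h) - f x - l * h = - (l - h^-1 * (f (x + h) - f x)) * h by field.
by rewrite normrM normrN; apply: ler_wpM2r.
Qed.

Fact cexp_key : unit. Proof. by []. Qed.
Definition cexp : C -> C := locked_with cexp_key
  (fun z => (expR (Re z))%:C * (cos (Im z) +i* sin (Im z))).

Lemma cexpE z : cexp z = (expR (Re z))%:C * (cos (Im z) +i* sin (Im z)).
Proof. by rewrite /cexp unlock. Qed.

Lemma cReMr (x : R) z : Re (x%:C * z) = x * Re z.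
Proof. by rewrite cReM /= mul0r subr0. Qed.
Lemma cImMr (x : R) z : Im (x%:C * z) = x * Im z.
Proof. by rewrite cImM /= mul0r addr0. Qed.

Lemma Re_cexp z : Re (cexp z) = expR (Re z) * cos (Im z).
Proof. by rewrite cexpE cReMr. Qed.
Lemma Im_cexp z : Im (cexp z) = expR (Re z) * sin (Im z).
Proof. by rewrite cexpE cImMr. Qed.

Lemma cmod_cexp z : cmod (cexp z) = expR (Re z).
Proof.
rewrite cexpE cmodM cmod_real ger0_norm ?expR_ge0 // cmodE cos2Dsin2 sqrtr1 mulr1 //.
Qed.

Lemma cexpD z w : cexp (z + w) = cexp z * cexp w.
Proof.
apply: cplx_eq.
  by rewrite cReM !Re_cexp !Im_cexp cReD cImD expRD cosD; ring.
by rewrite cImM !Re_cexp !Im_cexp cReD cImD expRD sinD; ring.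
Qed.

Lemma cexp0 : cexp 0 = 1.
Proof. by apply: cplx_eq; rewrite ?Re_cexp ?Im_cexp expR0 ?cos0 ?sin0 mul1r. Qed.

Lemma cexp_neq0 z : cexp z != 0.
Proof. by rewrite -cmod_gt0 cmod_cexp expR_gt0. Qed.

Lemma cexpN z : cexp (- z) = (cexp z)^-1.
Proof.
by apply: (mulfI (cexp_neq0 z)); rewrite -cexpD subrr cexp0 mulfV // cexp_neq0.
Qed.

Lemma cexpB z w : cexp (z - w) = cexp z / cexp w.
Proof. by rewrite cexpD cexpN. Qed.

Lemma cexp_mulrn z (n : nat) : cexp (n%:R * z) = cexp z ^+ n.
Proof.
elim: n => [|n IH]; first by rewrite mul0r cexp0 expr0.
by rewrite -addn1 natrD mulrDl mul1r cexpD IH addn1 exprSr.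
Qed.

Lemma hasd_cexp0 : hasd cexp 0 1.
Proof.
move=> e e0; have [s [s0 s1 s2]] : exists s, [/\ 0 < s, s <= e / 9 & s <= 1].
  by exists (Num.min (e / 9) 1); rewrite lt_min divr_gt0 //= ltr01 !ge_min !lexx orbT.
have [d1 d10 h1] := is_derive_eps (is_derive_expR (0 : R)) s0.
have [d2 d20 h2] := is_derive_eps (is_derive_cos (0 : R)) s0.
have [d3 d30 h3] := is_derive_eps (is_derive_sin (0 : R)) s0.
exists (Num.min s (Num.min d1 (Num.min d2 d3))); first by rewrite !lt_min s0 d10 d20.
move=> w; rewrite !lt_min subr0 => /and4P[w0 w1 w2 w3].
have RE := normRe w; have IM := normIm w.
have := h3 _ (le_lt_trans IM w3); have := h2 _ (le_lt_trans IM w2); have := h1 _ (le_lt_trans RE w1).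
rewrite !add0r expR0 cos0 sin0 oppr0 !mul0r !mul1r !subr0 cexp0.
move=> k1 k2 k3; apply: le_trans (cmod_ReIm _) _; rewrite !(cReB, cImB) Re_cexp Im_cexp /= subr0.
move: (Re w) (Im w) RE IM k1 k2 k3 => x y RE IM k1 k2 k3.
rewrite addr0 in k3; have x1 : `|x| <= 1 by lra.
have E3 : `|expR x| <= 3.
  have -> : expR x = (expR x - 1 - x) + (1 + x) by ring.
  apply: le_trans (ler_normD _ _) _; have := ler_normD 1 x; rewrite normr1.
  have : s * `|x| <= 1 by have := normr_ge0 x; nra.
  lra.
have E2 : `|expR x - 1| <= 2 * `|x|.
  have -> : expR x - 1 = (expR x - 1 - x) + x by ring.
  by apply: le_trans (ler_normD _ _) _; have := normr_ge0 x; nra.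
have -> : expR x * cos y - 1 - x = (expR x - 1 - x) + expR x * (cos y - 1) by ring.
have -> : expR x * sin y - y = expR x * (sin y - y) + (expR x - 1) * y by ring.
have n1 := ler_normD (expR x - 1 - x) (expR x * (cos y - 1)).
have n2 := ler_normD (expR x * (sin y - y)) ((expR x - 1) * y).
rewrite !normrM in n1 n2.
have b1 : `|expR x| * `|cos y - 1| <= 3 * (s * `|y|) by apply: ler_pM.
have b2 : `|expR x| * `|sin y - y| <= 3 * (s * `|y|) by apply: ler_pM.
have b3 : `|expR x - 1| * `|y| <= 2 * s * `|y|.
  by apply: ler_wpM2r => //; apply: le_trans E2 _; lra.
have b4 : s * `|x| <= s * cmod w by apply: ler_wpM2l => //; exact: ltW.
have b5 : s * `|y| <= s * cmod w by apply: ler_wpM2l => //; exact: ltW.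
have b6 : 9 * s * cmod w <= e * cmod w by apply: ler_wpM2r; [exact: cmod_ge0|lra].
move: n1 n2 b1 b2 b3 b4 b5 b6 k1; clear; lra.
Qed.

Lemma hasd_cexp z : hasd cexp z (cexp z).
Proof.
move=> e e0; have Ez := cexp_neq0 z; have pz := cmod_neq0 Ez.
have e1 : 0 < e / cmod (cexp z) by rewrite divr_gt0.
have [d d0 hd] := hasd_cexp0 e1; exists d => // w wz.
have := hd (w - z); rewrite subr0 cexp0 mul1r => /(_ wz) k.
rewrite (_ : _ - _ = cexp z * (cexp (w - z) - 1 - (w - z))); last first.
  by rewrite cexpB; field.
rewrite cmodM; apply: le_trans (ler_wpM2l (ltW pz) k) _.
by rewrite mulrA mulrCA divff ?gt_eqF // mulr1.
Qed.

Lemma hol_cexp O : hol O cexp.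
Proof. by move=> z _; exists (cexp z); exact: hasd_cexp. Qed.

(** The periods [2 * pi * n * 'i] of the exponential. *)
Definition per (n : int) : C := (n%:~R * (pi *+ 2))%:C * 'i.

Lemma cexp_per n : cexp (per n) = 1.
Proof.
have H (m : nat) : cexp (m%:R * ((pi *+ 2)%:C * 'i)) = 1.
  rewrite cexp_mulrn (_ : cexp _ = 1) ?expr1n //.
  by apply: cplx_eq; rewrite ?Re_cexp ?Im_cexp cReMr cImMr /= !mulr0 mulr1 expR0 ?cos2pi ?sin2pi mul1r.
have E (x : R) : (x * (pi *+ 2))%:C * 'i = x%:C * ((pi *+ 2)%:C * 'i) :> C.
  by rewrite rmorphM mulrA.
case: n => m; rewrite /per E.
  by rewrite -pmulrn rmorph_nat H.
by rewrite NegzE mulrNz rmorphN /= -pmulrn rmorph_nat mulNr cexpN H invr1.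
Qed.

(** After removal of full turns [t] lies in [[0, 2 * pi)], and [cos t = 1] forces [sin (t / 2) = 0],
    which fails for [0 < t / 2 < pi]. *)
Lemma cexp_eq1 w : cexp w = 1 -> exists n, w = per n.
Proof.
move=> E; have pp := pi_gt0 R.
have R0 : Re w = 0.
  by apply: (@expR_inj R); rewrite -cmod_cexp E cmod1 expR0.
have c1 : cos (Im w) = 1 by rewrite -[RHS]/(Re (1 : C)) -E Re_cexp R0 expR0 mul1r.
pose n := Num.floor (Im w / (pi *+ 2)).
pose t := Im w - n%:~R * (pi *+ 2).
have p2 : 0 < pi *+ 2 :> R by rewrite mulrn_wgt0.
have t0 : 0 <= t.
  by rewrite subr_ge0 -ler_pdivlMr //; exact: floor_le.
have t1 : t < pi *+ 2.
  rewrite ltrBlDl -[X in _ + X]mul1r -mulrDl -ltr_pdivrMr //.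
  by have := floorD1_gt (Im w / (pi *+ 2)); rewrite -/n intrD.
have ct : cos t = 1.
  have := cexp_per (- n); rewrite /per => k.
  have : Re (cexp (w + per (- n))) = 1 by rewrite cexpD cexp_per E mulr1.
  rewrite Re_cexp cReD cImD R0 /per cReMr cImMr /= !mulr0 !mulr1 addr0 expR0 mul1r.
  by rewrite rmorphN /= mulNr.
exists n; apply: cplx_eq; rewrite /per ?cReMr ?cImMr /= ?mulr0 ?mulr1 //.
apply/eqP; rewrite -subr_eq0 -/t; apply/negP => /negP tn.
have t2 : 0 < t by rewrite lt_neqAle eq_sym tn.
have := @sin_gt0_pi R (t / 2); have := cos_mulr2n (t / 2).
have -> : t / 2 *+ 2 = t by rewrite mulr2n; field.
rewrite ct cos2sin2 => k1 k2.
have : 0 < sin (t / 2) by apply: k2; rewrite divr_gt0 //= ltr_pdivrMr // mulr_natr.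
have : sin (t / 2) ^+ 2 = 0 by move: k1; rewrite mulr2n; lra.
by move/eqP; rewrite sqrf_eq0 => /eqP ->; rewrite ltxx.
Qed.

Lemma cexp_eq w1 w2 : cexp w1 = cexp w2 -> exists n, w2 = w1 + per n.
Proof.
move=> E; have [|n hn] := @cexp_eq1 (w2 - w1).
  by rewrite cexpB E divff // cexp_neq0.
by exists n; rewrite -hn addrC subrK.
Qed.

Lemma cexpDper w n : cexp (w + per n) = cexp w.
Proof. by rewrite cexpD cexp_per mulr1. Qed.

Lemma Im_per n : Im (per n) = n%:~R * (pi *+ 2).
Proof. by rewrite /per cImMr /= mulr1. Qed.

Lemma Re_per n : Re (per n) = 0.
Proof. by rewrite /per cReMr /= mulr0. Qed.

Lemma cexp_inj w1 w2 : `|Im w1 - Im w2| < pi *+ 2 -> cexp w1 = cexp w2 -> w1 = w2.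
Proof.
move=> h /cexp_eq [n E]; move: h; rewrite E cImD Im_per opprD addrA subrr sub0r normrN normrM.
have p2 : 0 < pi *+ 2 :> R by rewrite mulrn_wgt0 // pi_gt0.
rewrite (ger0_norm (ltW p2)).
rewrite -[X in _ < X]mul1r (ltr_pM2r p2) => h.
have : `|n| < 1 by rewrite -(ltr_int R) intr_norm.
move=> h'; have n0 : n = 0 by move: h'; clear; lia.
by rewrite n0 /per mul0r mul0r addr0.
Qed.

Lemma cexp_surj z : z != 0 -> exists w, [/\ cexp w = z, `|Im w| <= pi &
  (0 < Im z -> 0 < Im w < pi)].
Proof.
move=> z0; have zp := cmod_neq0 z0; pose c := Re z / cmod z.
have cs : c ^+ 2 + (Im z / cmod z) ^+ 2 = 1.
  by rewrite /c !expr_div_n -mulrDl -cmod_sqr divff // expf_neq0 ?gt_eqF.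
have cb : -1 <= c <= 1.
  by rewrite -ler_norml /c normrM normfV (ger0_norm (ltW zp)) ler_pdivrMr // mul1r normRe.
have ci : c \in `[(-1), 1] by rewrite in_itv.
have ca := acosK ci; have a0 := acos_ge0 cb; have a1 := acos_lepi cb.
have sa : sin (acos c) = `|Im z| / cmod z.
  rewrite sin_acos // (_ : 1 - c ^+ 2 = (Im z / cmod z) ^+ 2); last by rewrite -cs; ring.
  by rewrite sqrtr_sqr normrM normfV (ger0_norm (ltW zp)).
pose th := if 0 <= Im z then acos c else - acos c.
exists (ln (cmod z) +i* th); split.
- apply: cplx_eq; rewrite ?Re_cexp ?Im_cexp /= lnK ?posrE // /th.
    by case: ifP => _; rewrite ?cosN ca /c mulrC divfK // gt_eqF.
  case: ifP => h; rewrite ?sinN sa.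
    by rewrite ger0_norm // mulrC divfK // gt_eqF.
  by rewrite ler0_norm; [rewrite mulNr opprK mulrC divfK // gt_eqF|rewrite leNgt; apply/negP => /ltW; rewrite h].
- by rewrite /= /th; case: ifP => _; rewrite ?normrN ger0_norm.
- move=> h; rewrite /= /th (ltW h); have c1 : -1 < c < 1.
    have : 0 < (Im z / cmod z) ^+ 2 by rewrite exprn_gt0 // divr_gt0.
    by rewrite -ltr_norml => k; rewrite -(@ltr_pXn2r _ 2) ?nnegrE // expr1n real_normK ?num_real //; lra.
  by case/andP: c1 => c1 c2; rewrite acos_gt0 ?acos_ltpi ?c1 ?c2 ?andbT //= ltW.
Qed.

Definition hp : set C := [set z | 0 < Im z].
Definition disc : set C := [set z | cmod z < 1].

Lemma hp_cexp w : 0 < Im w < pi -> hp (cexp w).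
Proof. by move=> h; rewrite /hp /mkset Im_cexp mulr_gt0 ?expR_gt0 ?sin_gt0_pi. Qed.

Lemma copenI O T : copen O -> copen T -> copen (O `&` T).
Proof.
move=> oO oT z [/oO [r r0 h] /oT [s s0 k]]; exists (Num.min r s); first by rewrite lt_min r0.
by move=> w; rewrite lt_min => /andP[/h ? /k ?].
Qed.

Lemma copen_strip (m : R) : copen (strip m).
Proof.
move=> z /= /andP[h1 h2]; exists (Num.min (Im z) (m - Im z)).
  by rewrite lt_min h1 subr_gt0.
move=> w; rewrite lt_min => /andP[]; have := normIm (z - w); rewrite cImB ler_norml (cmodBC z).
by move=> /andP[] *; apply/andP; lra.
Qed.

Lemma log_hp : exists lg : C -> C, biholo (strip pi) hp cexp lg.
Proof.
have [|||op [lg h]] := @inj_biholo R (strip pi) cexp.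
- exact: copen_strip.
- exact: hol_cexp.
- move=> z w /= /andP[z0 z1] /andP[w0 w1]; apply: cexp_inj.
  by rewrite ltr_norml mulr2n; apply/andP; lra.
exists lg; suff -> : hp = image_of (strip pi) cexp by [].
apply/seteqP; split=> z /=.
  move=> z0; have [|w [Ew _ /(_ z0) hw]] := @cexp_surj z; last by exists w.
  by apply/eqP => E; move: z0; rewrite E /hp /= ltxx.
by move=> [w hw <-]; exact: hp_cexp.
Qed.

Lemma cmod_lt_sqr z w : (cmod z < cmod w) = (cmod z ^+ 2 < cmod w ^+ 2).
Proof. by rewrite ltr_pXn2r ?nnegrE ?cmod_ge0. Qed.

Lemma hp_dist z w : cmod (z - conjc w) ^+ 2 - cmod (z - w) ^+ 2 = 4 * Im z * Im w.
Proof. by rewrite !cmod_sqr !(cReB, cImB) cRe_conj cIm_conj; ring. Qed.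

Lemma hp_lt z w : hp w -> (cmod (z - w) < cmod (z - conjc w)) = (0 < Im z).
Proof.
move=> hw; rewrite cmod_lt_sqr -subr_gt0 hp_dist pmulr_lgt0 // pmulr_rgt0 //.
Qed.

Lemma copen_disc : copen disc.
Proof. move=> z /= h; exists (1 - cmod z); first by rewrite subr_gt0.
by move=> w; rewrite /disc /=; have := cmod_sub w z; lra. Qed.

Lemma schwarz u : hol disc u -> (forall z, disc z -> cmod (u z) <= 1) -> u 0 = 0 ->
  forall z, disc z -> cmod (u z) <= cmod z.
Proof.
move=> hu u1 u0 z z1; rewrite leNgt; apply/negP => k.
have D0 : disc 0 by rewrite /disc /= cmod0.
have [l hl] := hu 0 D0; have hs := slope_hol copen_disc D0 hu hl.
have up : 0 < cmod (u z) by apply: le_lt_trans k; exact: cmod_ge0.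
(* A violation leaves room for a radius between [cmod z / cmod (u z)] and 1; on that circle the
   slope is at most [r^-1], which is less than its modulus at [z]. *)
pose r := (1 + Num.max (cmod z) (cmod z / cmod (u z))) / 2.
have q1 : cmod z / cmod (u z) < 1 by rewrite ltr_pdivrMr // mul1r.
have [q2 q3] : cmod z <= Num.max (cmod z) (cmod z / cmod (u z)) /\ cmod z / cmod (u z) <= Num.max (cmod z) (cmod z / cmod (u z)).
  by rewrite !le_max !lexx orbT.
have q4 : Num.max (cmod z) (cmod z / cmod (u z)) < 1 by rewrite gt_max q1 andbT.
have [rz rk r1] : [/\ cmod z < r, cmod z / cmod (u z) < r & r < 1].
  by rewrite /r; move: q2 q3 q4; move: (Num.max _ _) => m *; split; lra.
have r0 : 0 < r by apply: le_lt_trans rz; exact: cmod_ge0.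
have sb w : cmod w = r -> cmod (slope u 0 l w) <= r^-1.
  move=> wr; have w0 : w != 0 by rewrite -cmod_gt0 wr.
  rewrite slopeE // u0 !subr0 cmod_div wr; apply: ler_piMl; first by rewrite invr_ge0 ltW.
  by apply: u1; rewrite /disc /= wr.
have : cmod (slope u 0 l z) <= r^-1.
  apply: (@maxmod_ball R disc (slope u 0 l) 0 r _ copen_disc hs) => [w|||]; rewrite ?subr0 //.
  - by rewrite /disc /=; lra.
  - by rewrite invr_ge0 ltW.
  - by move=> w; rewrite subr0; exact: sb.
have z0 : z != 0 by apply/eqP => E; move: up; rewrite E u0 cmod0 ltxx.
rewrite slopeE // u0 !subr0 cmod_div; apply/negP; rewrite -ltNge.
have zp := cmod_neq0 z0; rewrite ltr_pdivlMr // mulrC ltr_pdivrMr //.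
by move: rk; rewrite ltr_pdivrMr // mulrC.
Qed.

(** Schwarz's lemma after moving [w] and [F w] to 0; denominators are cleared, and conjugates are
    the reflected points. *)
Lemma schwarz_pick_hp F : hol hp F -> (forall z, hp z -> hp (F z)) -> forall z w, hp z -> hp w ->
  cmod (F z - F w) * cmod (z - conjc w) <= cmod (F z - conjc (F w)) * cmod (z - w).
Proof.
move=> hF Fh z w hz hw.
have nz p q : hp p -> hp q -> p - conjc q != 0.
  move=> hp hq; apply: cmod_gt0P; apply: le_lt_trans (_ : cmod (p - q) < _); first exact: cmod_ge0.
  by rewrite hp_lt.
have ww : w - conjc w != 0 by exact: nz.
pose x c := (w - conjc w * c) / (1 - c).
have c1 c : disc c -> 1 - c != 0.
  by move=> h; rewrite subr_eq0; apply/eqP => E; move: h; rewrite /disc /= -E cmod1 ltxx.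
have xw c : disc c -> x c - w = c * (w - conjc w) / (1 - c) by move=> /c1 h; rewrite /x; field.
have xw' c : disc c -> x c - conjc w = (w - conjc w) / (1 - c) by move=> /c1 h; rewrite /x; field.
have xh c : disc c -> hp (x c).
  move=> dc; rewrite /hp /= -(hp_lt (x c) hw) xw // xw' // !cmod_div cmodM -mulrA gtr_pMl //.
  by rewrite mulr_gt0 ?invr_gt0 ?cmod_gt0 // c1.
pose u c := (F (x c) - F w) / (F (x c) - conjc (F w)).
have hx : hol disc x.
  apply: hol_div; last exact: c1.
    by apply: holB; [exact: hol_cst|apply: holM; [exact: hol_cst|exact: hol_id]].
  by apply: holB; [exact: hol_cst|exact: hol_id].
have hFx : hol disc (fun c => F (x c)) by apply: hol_comp hF.
have hu : hol disc u.
  apply: hol_div; [by apply: holB => //; exact: hol_cst|by apply: holB => //; exact: hol_cst|].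
  by move=> c dc; apply: nz; apply: Fh => //; exact: xh.
pose c := (z - w) / (z - conjc w).
have dc : disc c.
  by rewrite /disc /= cmod_div ltr_pdivrMr ?mul1r ?hp_lt // cmod_gt0 nz.
have xc : x c = z.
  have h := c1 _ dc; rewrite /x /c; field; rewrite nz //=.
  by move: h; rewrite /c; apply: contra_neq => E; rewrite -[X in X - _](divff (nz z w hz hw)) -mulrBl (_ : _ - (z - w) = 0) ?mul0r // -E; ring.
have H : cmod (u c) <= cmod c.
  apply: schwarz => //; last by rewrite /u /x mulr0 subr0 subr0 divr1 subrr mul0r.
  move=> p /xh /Fh hp; rewrite /u cmod_div ler_pdivrMr ?cmod_gt0 ?nz ?mul1r //; last exact: Fh.
  by rewrite ltW // hp_lt //; exact: Fh.
rewrite /u xc /c !cmod_div in H.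
have p1 : 0 < cmod (z - conjc w) by rewrite cmod_gt0 nz.
have p2 : 0 < cmod (F z - conjc (F w)) by rewrite cmod_gt0 nz //; exact: Fh.
by move: H; rewrite ler_pdivrMr // mulrAC ler_pdivlMr // (mulrC (cmod (z - w))).
Qed.

End ExpMobius.

(** * Square roots on open sets whose complement runs to infinity *)

Section SquareRoots.
Context {R : realType}.
Local Notation C := R[i].
Implicit Types (u v g h : C -> C) (B D L M K s e d t : R) (x y z w p q a b c l : C) (O T : set C).

(** Two square roots are compared through their ratio. With the bound 1/4 a product of four such
    ratios stays within 1.45 of 1, so it cannot come within 1/4 of -1. *)
Definition near1 x := cmod (x - 1) < 1 / 4.

Lemma near1_sub x : 0 < Re x -> cmod (x - 1) <= cmod (x ^+ 2 - 1).
Proof.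
move=> rx; have -> : x ^+ 2 - 1 = (x - 1) * (x + 1) by ring.
rewrite cmodM; have : 1 < cmod (x + 1).
  have := normRe (x + 1); rewrite cReD /= => k; have := ler_norm (Re x + 1); lra.
by have := cmod_ge0 (x - 1); nra.
Qed.

Lemma near1_root x : near1 (x ^+ 2) -> 0 < Re x -> near1 x.
Proof. by move=> h /near1_sub k; exact: le_lt_trans k h. Qed.

Lemma near1_div p q : 4 * cmod (p - q) < cmod q -> near1 (p / q).
Proof.
move=> h; have q0 : 0 < cmod q by have := cmod_ge0 (p - q); lra.
have nq : q != 0 by rewrite -cmod_gt0.
rewrite /near1 (_ : _ - 1 = (p - q) / q); last by field.
by rewrite cmod_div ltr_pdivrMr; lra.
Qed.

Lemma near1_close a p q : cmod (p - a) < cmod a / 16 -> cmod (q - a) < cmod a / 16 -> near1 (p / q).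
Proof.
move=> h1 h2; apply: near1_div; have := cmod_tri a p q; have := cmod_sub a q.
by have := cmod_ge0 (q - a); rewrite (cmodBC a); lra.
Qed.

Lemma near1_Re x : cmod (x - 1) < 1 -> 0 < Re x.
Proof.
by have := normRe (x - 1); rewrite cReB /= ler_norml => /andP[]; lra.
Qed.

Lemma near1_pos x : near1 x -> 0 < Re x.
Proof. by rewrite /near1 => h; apply: near1_Re; lra. Qed.

Lemma root_Re x : near1 (x ^+ 2) -> Re x != 0.
Proof.
rewrite /near1 => h; apply/eqP => E; have := normRe (x ^+ 2 - 1).
rewrite cReB expr2 cReM E /= mul0r sub0r => k.
have := ler_norm (- (- (Im x * Im x) - 1)); rewrite normrN => k'.
have : 0 <= Im x * Im x by rewrite -expr2 sqr_ge0.
move: h k; rewrite expr2; lra.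
Qed.

Lemma near1_rootV x : near1 (x ^+ 2) -> ~~ (0 < Re x) -> near1 (- x).
Proof.
move=> h k; apply: near1_root; first by rewrite sqrrN.
by rewrite cReN oppr_gt0 lt_neqAle root_Re //= leNgt.
Qed.

Lemma near1M p q (m : R) : cmod (p - 1) <= m -> near1 q -> cmod (p * q - 1) <= m + (1 + m) / 4.
Proof.
rewrite /near1 => hp hq; rewrite (_ : _ - 1 = p * (q - 1) + (p - 1)); last by ring.
apply: le_trans (cmodD _ _) _; rewrite cmodM.
have : cmod p <= 1 + m by have := cmod_sub p 1; rewrite cmod1; lra.
by have := cmod_ge0 (q - 1); have := cmod_ge0 p; nra.
Qed.

Lemma pm_gap x : 2 <= cmod (x - 1) + cmod (- x - 1).
Proof.
have := cmodD (x - 1) (- x - 1); rewrite (_ : x - 1 + _ = - (2%:R)%:C); last first.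
  by rewrite rmorph_nat; ring.
by rewrite cmodN cmod_real ger0_norm.
Qed.

Lemma near1_prod a b c y : near1 a -> near1 b -> near1 c -> near1 y ->
  near1 ((a * b * c * y) ^+ 2) -> 0 < Re (a * b * c * y).
Proof.
move=> ha hb hc hy h; have k := near1M (near1M (near1M (ltW ha) hb) hc) hy.
apply: contrapT => /negP n; have := near1_rootV h n; rewrite /near1.
by have := pm_gap (a * b * c * y); lra.
Qed.

Lemma near1_1 : near1 1.
Proof. by rewrite /near1 subrr cmod0; lra. Qed.

Lemma near1V x : x != 0 -> 0 < Re x -> 0 < Re x^-1.
Proof.
case: x => a b; rewrite -[complex.Complex a b]/(a +i* b) => x0 /= a0.
by rewrite divr_gt0 // ltr_pwDl ?exprn_gt0 // sqr_ge0.
Qed.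

Lemma root_ex z : exists w, w ^+ 2 = z.
Proof. by exists (sqrtc z); rewrite sqr_sqrtc. Qed.

Lemma root_Re_ex z : near1 z -> exists w, w ^+ 2 = z /\ near1 w.
Proof.
move=> h; have [w E] := root_ex z; rewrite -E in h.
have [k|k] := boolP (0 < Re w); first by exists w; split=> //; exact: near1_root.
by exists (- w); rewrite sqrrN; split=> //; exact: near1_rootV.
Qed.

Lemma root_fam (G : set C) (g : C -> C) : (forall p, G p -> near1 (g p)) ->
  exists t : C -> C, forall p, G p -> t p ^+ 2 = g p /\ near1 (t p).
Proof.
move=> h; have /choice [t ht] : forall p, exists x, G p -> x ^+ 2 = g p /\ near1 x; last by exists t.
move=> p; have [Gp|n] := pselect (G p); last by exists 0.
by have [x] := root_Re_ex (h p Gp); exists x.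
Qed.

Inductive echain O e B : C -> Prop :=
| echain_far a : ~ O a -> B < cmod a -> echain O e B a
| echain_step a b : ~ O a -> cmod (a - b) < e -> echain O e B b -> echain O e B a.

(** Stand-in for simple connectivity: at every scale, each point of the complement is joined to
    arbitrarily large ones by short jumps outside [O]. *)
Definition full O := forall a e B, ~ O a -> 0 < e -> echain O e B a.

(** The factor [t] is near 1, so a wrong sign in the new ratio would contradict the consistency of
    [rb] over the same step. *)
Lemma sqrt_step (G : set C) D s (a : C) (rb t : C -> C) : 0 < D -> s < D / 4 ->
  (forall p, G p -> D <= cmod (p - a)) ->
  (forall p, G p -> near1 (t p) /\ (rb p * t p) ^+ 2 = p - a) ->
  (forall p q, G p -> G q -> cmod (q - p) <= s -> near1 (rb q / rb p)) ->
  forall p q, G p -> G q -> cmod (q - p) <= s -> near1 ((rb q * t q) / (rb p * t p)).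
Proof.
move=> D0 sD Da ht hr p q Gp Gq pq.
have [tp Ep] := ht _ Gp; have [tq Eq] := ht _ Gq.
have pa := Da _ Gp; have nz : rb p * t p != 0.
  by apply/eqP => E; move: pa; rewrite -Ep E expr0n /= cmod0; lra.
have [rp0 tp0] : rb p != 0 /\ t p != 0 by move: nz; rewrite mulf_eq0 negb_or => /andP.
set x := _ / _; have hx : near1 (x ^+ 2).
  rewrite /x expr_div_n Ep Eq; apply: near1_div.
  by rewrite (_ : _ - _ = q - p); [lra|ring].
have [k|k] := boolP (0 < Re x); first exact: near1_root.
exfalso; have h1 := near1M (ltW (near1_rootV hx k)) tp; have := near1M (ltW (hr _ _ Gp Gq pq)) tq.
rewrite (_ : _ * t q = x * t p); last by rewrite /x; field; rewrite tp0 rp0.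
by rewrite mulNr in h1; have := pm_gap (x * t p); lra.
Qed.

(** A root of [p - a] is built along the chain: for a far point [p - a] is close to [- a], and each
    jump multiplies by the root near 1 of [(p - a) / (p - b)]. As [G] is a bare set of points,
    consistency is asserted between points at distance at most [s]. *)
Lemma echain_sqrt O (G : set C) D s a B e : 0 < D -> s < D / 4 -> e < D / 4 -> 0 <= B ->
  (forall p, G p -> cmod p <= B) ->
  (forall p b, G p -> ~ O b -> D <= cmod (p - b)) ->
  echain O e (4 * B + 1) a -> exists r : C -> C, (forall p, G p -> r p ^+ 2 = p - a) /\
    forall p q, G p -> G q -> cmod (q - p) <= s -> near1 (r q / r p).
Proof.
move=> D0 sD eD B0 GB GD; elim=> {a} [a na aB|a b na ab hb [rb [rb2 rbn]]].
  have a0 : a != 0 by rewrite -cmod_gt0; lra.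
  have [r0 E0] := root_ex (- a).
  have [|t ht] := @root_fam G (fun p => (a - p) / a).
    by move=> p /GB h; apply: near1_div; rewrite addrAC subrr sub0r cmodN; lra.
  exists (fun p => r0 * t p); split.
    by move=> p /ht [E _]; rewrite exprMn E E0; field.
  apply: (@sqrt_step G D s a (fun=> r0)) => //.
  - by move=> p Gp; exact: GD.
  - by move=> p /ht [E h]; split=> //; rewrite exprMn E E0; field.
  - move=> p q _ _ _; rewrite divff; first exact: near1_1.
    by apply/eqP => E; move: E0; rewrite E expr0n /= => /eqP; rewrite eq_sym oppr_eq0 (negPf a0).
have GD' p : G p -> D <= cmod (p - b) by move=> Gp; case: hb => c *; exact: GD.
have [|t ht] := @root_fam G (fun p => (p - a) / (p - b)).
  by move=> p /GD' nb; apply: near1_div; rewrite (_ : _ - _ = - (a - b)) ?cmodN; [lra|ring].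
have E p : G p -> (rb p * t p) ^+ 2 = p - a.
  move=> Gp; have [E _] := ht p Gp; rewrite exprMn E rb2 // mulrCA mulfV ?mulr1 //.
  by rewrite -cmod_gt0; have := GD' p Gp; lra.
exists (fun p => rb p * t p); split=> //.
apply: (@sqrt_step G D s a rb) => //; first by move=> p Gp; exact: GD.
by move=> p Gp; split; [have [] := ht p Gp|exact: E].
Qed.

Lemma near1M2 a b : near1 a -> near1 b -> 0 < Re (a * b).
Proof. by move=> ha hb; apply: near1_Re; have := near1M (ltW ha) hb; lra. Qed.

(** The sign in a comparison of two roots, as an element of Z/2. *)
Definition flip x : bool := ~~ (0 < Re x).

Lemma flip_mul x y : near1 (x ^+ 2) -> near1 (y ^+ 2) -> flip (x * y) = flip x (+) flip y.
Proof.
rewrite /flip => hx hy.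
have [kx|kx] := boolP (0 < Re x); have [ky|ky] := boolP (0 < Re y).
- by rewrite (near1M2 (near1_root hx kx) (near1_root hy ky)).
- have := near1M2 (near1_root hx kx) (near1_rootV hy ky).
  by rewrite mulrN cReN oppr_gt0 => h; rewrite -leNgt ltW.
- have := near1M2 (near1_rootV hx kx) (near1_root hy ky).
  by rewrite mulNr cReN oppr_gt0 => h; rewrite -leNgt ltW.
- by have := near1M2 (near1_rootV hx kx) (near1_rootV hy ky); rewrite mulrNN => ->.
Qed.

Lemma flipN x : near1 (x ^+ 2) -> flip (- x) = ~~ flip x.
Proof.
move=> /root_Re h; rewrite /flip cReN oppr_gt0 -leNgt le_eqVlt negbK.
by rewrite eq_sym (negPf h).
Qed.

Lemma Re_div x y : y != 0 -> (0 < Re (x / y)) = (0 < Re x * Re y + Im x * Im y).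
Proof.
case: y => a b; rewrite -[complex.Complex a b]/(a +i* b) => y0.
have p : 0 < a ^+ 2 + b ^+ 2.
  by have := cmod_neq0 y0; rewrite cmodE sqrtr_gt0.
rewrite cV cReM /= -(pmulr_rgt0 _ p); congr (0 < _).
by field; rewrite gt_eqF.
Qed.

Section Cochain.
Variables hh vv : nat -> nat -> bool.
(** Coboundary of the edge signs around the cell [(i, j)]; a cell where it is [true] obstructs a
    consistent choice of roots. *)
Definition omega i j := hh i j (+) vv i.+1 j (+) hh i j.+1 (+) vv i j.
(** Sum of the edge signs along the path that climbs column 0 and then follows row [j]. *)
Definition beta i j := (\big[addb/false]_(k < j) vv 0 k) (+) (\big[addb/false]_(k < i) hh k j).

Lemma beta_h i j : hh i j = beta i j (+) beta i.+1 j.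
Proof.
by rewrite /beta big_ord_recr /=; case: (hh i j); case: (bigop.body _ _ _); case: (bigop.body _ _ _).
Qed.

(** Discrete Green formula: on vertical edges [beta] fails to be a primitive by the sum of [omega]
    over the cells to the left. *)
Lemma beta_v i j : vv i j = beta i j (+) beta i j.+1 (+) \big[addb/false]_(k < i) omega k j.
Proof.
elim: i => [|i IH].
  rewrite /beta !big_ord0 big_ord_recr /= !addbF.
  by case: (bigop.body _ _ _); case: (vv 0 j).
have := beta_h i j; have := beta_h i j.+1; rewrite big_ord_recr /= {2}/omega.
move: IH; case: (vv i j); case: (vv i.+1 j); case: (hh i j); case: (hh i j.+1);
  case: (beta i j); case: (beta i.+1 j); case: (beta i j.+1); case: (beta i.+1 j.+1);
  case: (bigop.body _ _ _) => //.
Qed.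
End Cochain.

(** Model roots of [z - a'] on the grid, [a'] being the centre of the cell [(i0, j0)]. They are
    taken in the upper half-plane, so signs change only across the ray from [a'] to the right. *)
Lemma cell_flip s (i0 j0 : nat) : 0 < s ->
  exists q : nat -> nat -> C,
  [/\ forall i j : nat, q i j ^+ 2 = (s * (i%:R - i0%:R - 1 / 2)) +i* (s * (j%:R - j0%:R - 1 / 2)),
   forall i j : nat, flip (q i.+1 j / q i j) = false &
   forall i j : nat, flip (q i j.+1 / q i j) = (j == j0) && (i0 < i)%N].
Proof.
move=> s0; pose X (i : nat) := s * (i%:R - i0%:R - 1 / 2); pose Y (j : nat) := s * (j%:R - j0%:R - 1 / 2).
have Ysg (j : nat) : (j <= j0)%N -> Y j <= - (s / 2).
  by rewrite -(ler_nat R) /Y => h; nra.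
have Ysg' (j : nat) : (j0 < j)%N -> s / 2 <= Y j.
  by rewrite -(ler_nat R) -natr1 /Y => h; nra.
have Y0 (j : nat) : Y j != 0.
  have [h|h] := leqP j j0; first by have := Ysg _ h; apply: contraTneq => ->; rewrite -ltNge; lra.
  by have := Ysg' _ h; apply: contraTneq => ->; rewrite -ltNge; lra.
have H (ij : nat * nat) : exists w : C, w ^+ 2 = X ij.1 +i* Y ij.2 /\ 0 < Im w.
  have [w E] := root_ex (X ij.1 +i* Y ij.2).
  have I0 : Im w != 0.
    apply: contra_neq (Y0 ij.2) => I0; have : Im (w ^+ 2) = Y ij.2 by rewrite E.
    by rewrite expr2 cImM I0 mulr0 mul0r addr0.
  have [h|h] := ltP 0 (Im w); first by exists w.
  by exists (- w); rewrite sqrrN cImN oppr_gt0 lt_neqAle I0.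
have /choice [q hq] := H.
have qE i j : [/\ Re (q (i, j)) ^+ 2 - Im (q (i, j)) ^+ 2 = X i,
    2 * (Re (q (i, j)) * Im (q (i, j))) = Y j, 0 < Im (q (i, j)) & q (i, j) != 0].
  have [E I] := hq (i, j); split=> //.
  - by rewrite -[RHS]/(Re (X i +i* Y j)) -E !expr2 cReM.
  - by rewrite -[RHS]/(Im (X i +i* Y j)) -E !expr2 cImM; ring.
  - by apply: contraTneq I => ->; rewrite ltxx.
exists (fun i j => q (i, j)); split=> [i j|i j|i j]; first by have [] := hq (i, j).
  have [_ E1 I1 n1] := qE i j; have [_ E2 I2 n2] := qE i.+1 j.
  rewrite /flip Re_div //; apply/negbF.
  move: E1 I1 E2 I2; move: (Re _) (Im _) (Re _) (Im _) => a b a' b' E1 I1 E2 I2.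
  have : 0 <= (a * a') * (b * b') by have : (2 * (a * b)) * (2 * (a' * b')) = Y j ^+ 2; [rewrite E1 E2 expr2|have := sqr_ge0 (Y j); nra].
  have bb : 0 < b * b' by apply: mulr_gt0.
  by rewrite (pmulr_lge0 _ bb); lra.
have [Ea E1 I1 n1] := qE i j; have [Eb E2 I2 n2] := qE i j.+1.
have [Ej|nj] := eqVneq j j0; last first.
  have YY : 0 <= Y j * Y j.+1.
    have [h|h] := ltnP j j0; first by apply: mulr_le0; [have := Ysg j (ltnW h)|have := Ysg _ h]; lra.
    apply: mulr_ge0; last by have := Ysg' j.+1 h; lra.
    have h' : (j0 < j)%N by rewrite ltn_neqAle eq_sym nj.
    by have := Ysg' _ h'; lra.
  rewrite /flip Re_div //; apply/negbF.
  move: E1 I1 E2 I2 YY; clear Ea Eb; move: (Re _) (Im _) (Re _) (Im _) => a b a' b' <- I1 <- I2 YY.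
  have : 0 <= (a * a') * (b * b') by move: YY; nra.
  have bb : 0 < b * b' by apply: mulr_gt0.
  by rewrite (pmulr_lge0 _ bb); lra.
rewrite /flip Re_div // /= ltnNge; congr (~~ _).
have -> : (i <= i0)%N = (0 < - X i).
  rewrite oppr_gt0 /X pmulr_rlt0 //; case: leqP; first by rewrite -(ler_nat R) => h; apply/esym; lra.
  by rewrite -(ler_nat R) -natr1 => h; apply/esym/negbTE; rewrite -leNgt; lra.
congr (0 < _); have E3 : Y j.+1 = - Y j by rewrite /Y Ej -natr1; field.
move: E1 I1 E2 I2 Ea Eb; rewrite E3.
move: (Re _) (Im _) (Re _) (Im _) => a b a' b' E1 I1 E2 I2 <- Eb.
have E4 : a' * b' = - (a * b) by lra.
have : (b' ^+ 2 - b ^+ 2) * (b' ^+ 2 + a ^+ 2) = 0.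
  have -> : (b' ^+ 2 - b ^+ 2) * (b' ^+ 2 + a ^+ 2) = (a ^+ 2 - b ^+ 2 + b' ^+ 2) * b' ^+ 2 - (a * b) ^+ 2 by ring.
  by rewrite Eb subrK -exprMn E4 sqrrN subrr.
move/eqP; rewrite mulf_eq0 => /orP[|/eqP k]; last by have := sqr_ge0 a; nra.
rewrite subr_sqr mulf_eq0 subr_eq0 => /orP[/eqP k|/eqP k]; last lra.
have : a' = - a by apply: (mulIf (lt0r_neq0 I1)); rewrite E4 k mulNr.
by rewrite k => ->; ring.
Qed.

Ltac only_order := repeat match goal with
  | H : ?T |- _ => lazymatch type of T with Prop => lazymatch T with
     | is_true (@Order.le _ _ _ _) => fail
     | is_true (@Order.lt _ _ _ _) => fail
     | is_true (andb _ _) => fail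
     | @eq (Real.sort _) _ _ => fail
     | _ => clear H end end
  end.
Ltac flra := only_order; lra.

Definition vtx L s (i j : nat) : C := (s * i%:R - L) +i* (s * j%:R - L).

Lemma vtx_dist L s (i j i' j' : nat) : 0 < s ->
  cmod (vtx L s i j - vtx L s i' j') <= s * `|i%:R - i'%:R| + s * `|j%:R - j'%:R|.
Proof.
move=> s0; apply: le_trans (cmod_ReIm _) _; rewrite cReB cImB /=.
rewrite (_ : _ - _ - _ = s * (i%:R - i'%:R)); last by ring.
rewrite (_ : _ - _ - _ = s * (j%:R - j'%:R)); last by ring.
by rewrite !normrM (gtr0_norm s0).
Qed.

Lemma vtx_h L s (i j : nat) : 0 < s -> cmod (vtx L s i.+1 j - vtx L s i j) <= s.
Proof.
move=> s0; have := vtx_dist L i.+1 j i j s0.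
by rewrite -natr1 subrr normr0 mulr0 addr0 addrAC subrr add0r normr1 mulr1.
Qed.

Lemma vtx_v L s (i j : nat) : 0 < s -> cmod (vtx L s i j.+1 - vtx L s i j) <= s.
Proof.
move=> s0; have := vtx_dist L i j.+1 i j s0.
by rewrite -natr1 subrr normr0 mulr0 add0r addrAC subrr add0r normr1 mulr1.
Qed.

Lemma vtx_near L s (i j i' j' : nat) : 0 < s -> (i <= i'.+1)%N -> (i' <= i.+1)%N -> (j <= j'.+1)%N -> (j' <= j.+1)%N ->
  cmod (vtx L s i' j' - vtx L s i j) <= 2 * s.
Proof.
move=> s0 h1 h2 h3 h4; apply: le_trans (vtx_dist _ _ _ _ _ s0) _.
have near (m n : nat) : (m <= n.+1)%N -> (n <= m.+1)%N -> s * `|n%:R - m%:R| <= s.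
  rewrite -!(ler_nat R) -!natr1 => k1 k2; rewrite -[leRHS]mulr1 ler_pM2l // ler_distlC; split_lra.
by have := near _ _ h1 h2; have := near _ _ h3 h4; lra.
Qed.

Definition core O B D : set C := [set p | cmod p <= B /\ forall a, ~ O a -> D <= cmod (p - a)].

Lemma core_le O B B' D D' p : B <= B' -> D' <= D -> core O B D p -> core O B' D' p.
Proof. by move=> hB hD [p1 p2]; split=> [|a /p2]; lra. Qed.

Lemma core_sub O B D p : 0 < D -> core O B D p -> O p.
Proof. by move=> D0 [_ h]; apply: contrapT => /h; rewrite subrr cmod0; lra. Qed.

Lemma core_closed O B D : cclosed (core O B D).
Proof.
move=> z hz; split=> [|a na]; apply: le_small => e /hz [w [w1 w2] wz].
  by have := cmod_sub z w; rewrite (cmodBC z); lra.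
by have := w2 a na; have := cmod_tri3 w z a; lra.
Qed.

(** When the complement has a point near the cell, [p - a'] has a consistent root on [G]. Its
    comparison with the model of [cell_flip] yields a sign whose coboundary is exactly the ray to
    the right of the cell. *)
Lemma cell_sign O (G : set C) L s B D (i0 j0 : nat) a : full O -> 0 < s -> 0 < D -> s < D / 128 -> 0 <= B ->
  (forall p, G p -> cmod p <= B) -> (forall p b, G p -> ~ O b -> D / 2 <= cmod (p - b)) -> ~ O a ->
  cmod (((s * (i0%:R + 1 / 2) - L) +i* (s * (j0%:R + 1 / 2) - L)) - a) < D / 32 + s ->
  exists gam : nat -> nat -> bool, [/\ forall i j : nat, G (vtx L s i j) -> G (vtx L s i.+1 j) -> gam i j = gam i.+1 j &
     forall i j : nat, G (vtx L s i j) -> G (vtx L s i j.+1) -> gam i j (+) gam i j.+1 = (j == j0) && (i0 < i)%N].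
Proof.
set a' := _ +i* _; move=> fO s0 D0p s2 B0 GB GD na aa'.
have D8 : 0 < D / 8 / 2 by flra.
have [|||||||ra [ra2 ran]] := @echain_sqrt O G (D / 2) s a B (D / 8 / 2); [flra|flra|flra|flra|exact: GB|exact: GD|exact: fO|].
have [|t ht] := @root_fam G (fun p => (p - a') / (p - a)).
  move=> p Gp; have nb := GD p a Gp na; apply: near1_div.
  by rewrite (_ : _ - _ = - (a' - a)) ?cmodN; [flra|ring].
have E p : G p -> (ra p * t p) ^+ 2 = p - a'.
  move=> Gp; have [E _] := ht p Gp; rewrite exprMn E ra2 // mulrCA mulfV ?mulr1 //.
  by rewrite -cmod_gt0; have := GD p a Gp na; flra.
have da' p : G p -> 7 * D / 16 <= cmod (p - a').
  by move=> Gp; have := GD p a Gp na; have := cmod_tri3 p a' a; flra.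
have rn : forall p q, G p -> G q -> cmod (q - p) <= s -> near1 ((ra q * t q) / (ra p * t p)).
  apply: (@sqrt_step G (7 * D / 16) s a' ra) => //; try flra.
  by move=> p Gp; split; [have [] := ht p Gp|exact: E].
have [q [q2 qh qv]] := cell_flip i0 j0 s0.
pose r p := ra p * t p.
have rq i j : G (vtx L s i j) -> r (vtx L s i j) = (-1) ^+ (~~ (r (vtx L s i j) == q i j)) * q i j.
  move=> Gv; have [->|n] := eqVneq; first by rewrite expr0 mul1r.
  have : (r (vtx L s i j)) ^+ 2 = q i j ^+ 2.
    rewrite /r E // q2 /a' /vtx; apply: cplx_eq; rewrite !(cReB, cImB) /=; ring.
  by move/eqP; rewrite eqf_sqr (negPf n) /= expr1 mulN1r => /eqP.
have r0' i j : G (vtx L s i j) -> q i j != 0.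
  move=> Gv; have : r (vtx L s i j) != 0.
    by have := E _ Gv; have := da' _ Gv; rewrite -/(r _) => h1 h2; apply/eqP => h3; move: h1; rewrite -h2 h3 expr0n cmod0; flra.
  by apply: contra_neq => h; rewrite rq // h mulr0.
have key i j i' j' : G (vtx L s i j) -> G (vtx L s i' j') -> cmod (vtx L s i' j' - vtx L s i j) <= s ->
   flip (q i' j' / q i j) = (~~ (r (vtx L s i j) == q i j)) (+) (~~ (r (vtx L s i' j') == q i' j')).
  move=> G1 G2 h; have := rn _ _ G1 G2 h; rewrite -!/(r _).
  move: (rq _ _ G1) (rq _ _ G2); move: (~~ _) (~~ _) => b2 b1 -> ->.
  have q1 := r0' _ _ G1; have q2' := r0' _ _ G2.
  have -> : (-1) ^+ b2 * q i' j' / ((-1) ^+ b1 * q i j) = (-1) ^+ (b1 (+) b2) * (q i' j' / q i j).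
    by rewrite signr_addb invfM invr_sign; ring.
  move=> k; have k2 : near1 ((q i' j' / q i j) ^+ 2).
    have : near1 (((-1) ^+ (b1 (+) b2) * (q i' j' / q i j)) ^+ 2).
      rewrite exprMn sqrr_sign mul1r expr_div_n !q2 /near1.
      have -> : (s * (i'%:R - i0%:R - 1 / 2)) +i* (s * (j'%:R - j0%:R - 1 / 2)) = vtx L s i' j' - a'.
        by apply: cplx_eq; rewrite /a' /vtx !(cReB, cImB) /=; ring.
      have -> : (s * (i%:R - i0%:R - 1 / 2)) +i* (s * (j%:R - j0%:R - 1 / 2)) = vtx L s i j - a'.
        by apply: cplx_eq; rewrite /a' /vtx !(cReB, cImB) /=; ring.
      have dd := da' _ G1; apply: near1_div.
      by rewrite (_ : _ - _ = vtx L s i' j' - vtx L s i j); [flra|ring].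
    by rewrite exprMn sqrr_sign mul1r.
  move: k => /near1_pos; case: (b1 (+) b2) => /=; rewrite ?expr1 ?expr0 ?mulN1r ?mul1r => k.
    by rewrite cReN oppr_gt0 in k; rewrite /flip -leNgt ltW.
  by rewrite /flip k.
exists (fun i j => ~~ (r (vtx L s i j) == q i j)); split=> i j G1 G2.
  have := key i j i.+1 j G1 G2 (vtx_h L i j s0); rewrite qh.
  by case: (r _ == _); case: (r _ == _).
by rewrite -(key i j i j.+1 G1 G2 (vtx_v L i j s0)) qv.
Qed.

(** Adding to [beta] one such sign for each cell where [omega] is [true] cancels the error term of
    [beta_v]. *)
Lemma sign_coboundary (hh vv : nat -> nat -> bool) (N : nat) (Gd : nat -> nat -> Prop) :
  (forall i0 j0 : nat, (i0 < N)%N -> (j0 < N)%N -> omega hh vv i0 j0 ->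
   exists gam : nat -> nat -> bool, [/\ forall i j : nat, Gd i j -> Gd i.+1 j -> gam i j = gam i.+1 j &
     forall i j : nat, Gd i j -> Gd i j.+1 -> gam i j (+) gam i j.+1 = (j == j0) && (i0 < i)%N]) ->
  exists Gam : nat -> nat -> bool, (forall i j : nat, Gd i j -> Gd i.+1 j -> hh i j = Gam i j (+) Gam i.+1 j) /\
    forall i j : nat, (i <= N)%N -> (j < N)%N -> Gd i j -> Gd i j.+1 -> vv i j = Gam i j (+) Gam i j.+1.
Proof.
move=> cell.
have /choice [gam hgam] : forall c : nat * nat, exists gam : nat -> nat -> bool,
    (c.1 < N)%N -> (c.2 < N)%N -> omega hh vv c.1 c.2 ->
    (forall i j : nat, Gd i j -> Gd i.+1 j -> gam i j = gam i.+1 j) /\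
     forall i j : nat, Gd i j -> Gd i j.+1 -> gam i j (+) gam i j.+1 = (j == c.2) && (c.1 < i)%N.
  move=> [i0 j0] /=; have [[[iN jN] om]|n] := pselect (((i0 < N)%N /\ (j0 < N)%N) /\ omega hh vv i0 j0).
    by have [g [g1 g2]] := cell i0 j0 iN jN om; exists g.
  by exists (fun _ _ => false) => iN jN om; exfalso; apply: n.
pose Gam i j := beta hh vv i j (+) \big[addb/false]_(k < N) \big[addb/false]_(l < N)
   (omega hh vv k l && gam (nat_of_ord k, nat_of_ord l) i j).
exists Gam; split=> [i j|i j iN jN].
  move=> G1 G2; rewrite (beta_h hh vv) /Gam.
  set S1 := bigop.body _ _ _; set S2 := bigop.body _ _ _; have -> : S1 = S2; last first.
    by case: (beta _ _ _ _); case: (beta _ _ _ _); case: S2.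
  apply: eq_bigr => k _; apply: eq_bigr => l _; case om : (omega _ _ _ _) => //=.
  by have [g1 _] := hgam (nat_of_ord k, nat_of_ord l) (ltn_ord k) (ltn_ord l) om; exact: g1.
  move=> G1 G2; rewrite (beta_v hh vv) /Gam.
  set S1 := (X in _ (+) X = _); set S2 := (X in _ = (_ (+) X) (+) _); set S3 := (X in _ = _ (+) (_ (+) X)).
  have -> : S1 = S2 (+) S3; last by case: (beta _ _ _ _); case: (beta _ _ _ _); case: S2; case: S3.
  rewrite /S2 /S3 -big_split /= /S1 (big_ord_widen N (fun k => omega hh vv k j) iN) big_mkcond.
  apply: eq_bigr => k _; rewrite -big_split /=.
  rewrite (bigD1 (Ordinal jN)) //= big1 ?addbF.
    case om : (omega _ _ _ _); last by case: ifP.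
    have [_ g2] := hgam (nat_of_ord k, j) (ltn_ord k) jN om.
    by rewrite /= g2 //= eqxx; case: ifP.
  move=> l lj; case om : (omega _ _ _ _) => //=.
  have [_ g2] := hgam (nat_of_ord k, nat_of_ord l) (ltn_ord k) (ltn_ord l) om.
  rewrite g2 //= (_ : (j == l) = false) //; apply/negbTE; apply: contra lj => /eqP E.
  by apply/eqP/val_inj.
Qed.

Lemma flip_sign (b1 b2 : bool) p q : q != 0 -> flip (p / q) = b1 (+) b2 -> near1 ((p / q) ^+ 2) ->
  0 < Re ((-1) ^+ b2 * p / ((-1) ^+ b1 * q)).
Proof.
move=> q0 f n; have -> : (-1) ^+ b2 * p / ((-1) ^+ b1 * q) = (-1) ^+ (b1 (+) b2) * (p / q).
  by rewrite signr_addb invfM invr_sign; ring.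
rewrite -f; case E : (flip _); rewrite ?expr1 ?expr0 ?mulN1r ?mul1r; last by move/negbFE: E.
by have := flipN n; rewrite E => /negbFE.
Qed.

Lemma square_flip x00 x10 x01 x11 : x00 != 0 -> x10 != 0 -> x01 != 0 ->
  near1 ((x11 / x10) ^+ 2) -> near1 ((x10 / x00) ^+ 2) -> near1 ((x11 / x01) ^+ 2) -> near1 ((x01 / x00) ^+ 2) ->
  flip (x10 / x00) (+) flip (x11 / x10) (+) flip (x11 / x01) (+) flip (x01 / x00) = false.
Proof.
move=> n0 n1 n2 h1 h2 h3 h4; have := flip_mul h1 h2; have := flip_mul h3 h4.
have -> : x11 / x10 * (x10 / x00) = x11 / x00 by field; rewrite n0.
have -> : x11 / x01 * (x01 / x00) = x11 / x00 by field; rewrite n0.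
by move=> ->; case: (flip _); case: (flip _); case: (flip _); case: (flip _).
Qed.

Lemma index_step s L (t t' : R) (m n : nat) : 0 < s -> s * m%:R <= t + L -> t' + L < s * (n%:R + 1) ->
  t - t' < s -> (m <= n.+1)%N.
Proof.
move=> s0 h1 h2 h3; suff : s * m%:R < s * n.+2%:R by rewrite ltr_pM2l // ltr_nat.
by rewrite -addn2 natrD; lra.
Qed.

(** Roots of [u] at the grid vertices are first chosen arbitrarily and then corrected in sign. Cells
    away from the complement do not obstruct, the others are handled by [cell_sign]; every point
    finally inherits the root at the corner of its cell. *)
Lemma sqrt_grid O u B D0 : full O -> (forall z, O z -> ccont u z /\ u z != 0) -> 0 <= B -> 0 < D0 ->
  exists (q : C -> C) s, [/\ 0 < s, forall p, core O B D0 p -> q p ^+ 2 = u p &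
    forall p p', core O B D0 p -> core O B D0 p' -> cmod (p' - p) < s -> 0 < Re (q p' / q p)].
Proof.
move=> fO uO B0 D00; set X := core O B D0.
pose L := B + 1; have [D [D0p DD D1]] := min_pos2 D00 (ltr01 : 0 < 1 :> R).
have D32 : 0 < D / 32 by flra.
(* Three cores are nested: the target [X], the set [G] on which signs are corrected, and [K], on
   which [u] varies slowly. A vertex of the grid over [[-L, L]^2] has modulus at most [L + L]. *)
pose K := core O (L + L) (D / 32); have KO p : K p -> O p by exact: core_sub.
have [|||r0 r00 near] := @compact_uniform R K (fun y r => forall p, cmod (p - y) < r -> near1 (u p / u y)) (@core_closed _ _ _).
- by exists (L + L) => z [].
- by move=> y r r' h rr p py; apply: h; flra.
- move=> x Kx; have [uc ux] := uO x (KO x Kx); have mp := cmod_neq0 ux.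
  have m16 : 0 < cmod (u x) / 16 by flra.
  have [d d0 hd] := uc _ m16; exists (d / 2); split; first by flra.
  move=> y Ky yx p py; apply: (near1_close (a := u x)); apply: hd; last flra.
  by have := cmod_tri3 p y x; flra.
have Lp : 0 < L by rewrite /L; flra.
have [eps [ep e1 e2]] : exists e, [/\ 0 < e, e <= r0 / 8 & e <= D / 128].
  by apply: min_pos2; rewrite divr_gt0.
have eL : 0 < eps / (2 * L) by rewrite divr_gt0 // mulr_gt0.
have [N' hN] := inv_lt_eps eL; have {}hN := hN _ (leqnn N'); pose N := N'.+1.
pose s := 2 * L / N%:R.
have Np : 0 < N%:R :> R by rewrite ltr0n.
have s0 : 0 < s by rewrite divr_gt0 // mulr_gt0.
have sN : s * N%:R = 2 * L by rewrite /s divfK // gt_eqF.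
have se : s < eps.
  by move: hN; rewrite -/N ltr_pdivlMr ?mulr_gt0 // mulrC.
have [s1 s2] : s < r0 / 8 /\ s < D / 128 by split; flra.
clearbody s; clear e1 e2 se ep eL hN eps.
pose vtx i j := vtx L s i j.
have vsq (i : nat) : (i <= N)%N -> `|s * i%:R - L| <= L.
  rewrite -(ler_nat R) ler_norml => h; have : s * i%:R <= s * N%:R by rewrite ler_pM2l.
  have : 0 <= s * i%:R by rewrite mulr_ge0 // ltW.
  by rewrite sN => *; apply/andP; flra.
have /choice [w_ hw_] : forall ij : nat * nat, exists x, x ^+ 2 = u (vtx ij.1 ij.2) by move=> ij; exact: root_ex.
pose w i j := w_ (i, j); have hw i j : w i j ^+ 2 = u (vtx i j) := hw_ (i, j).
have nr (W : nat -> nat -> C) i j i' j' : (forall i j, W i j ^+ 2 = u (vtx i j)) -> K (vtx i j) ->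
    cmod (vtx i' j' - vtx i j) < r0 -> near1 ((W i' j' / W i j) ^+ 2).
  by move=> W2 Kv h; rewrite expr_div_n !W2; exact: near.
pose hh i j := flip (w i.+1 j / w i j); pose vv i j := flip (w i j.+1 / w i j).
have w0 i j : K (vtx i j) -> w i j != 0.
  by move=> /KO /uO [_]; rewrite -hw; apply: contra_neq => ->; rewrite expr0n.
pose G := core O (B + 1 / 2) (D / 2).
have GK p : G p -> K p by apply: core_le; rewrite /L; flra.
have cell (i0 j0 : nat) : (i0 < N)%N -> (j0 < N)%N -> omega hh vv i0 j0 ->
   exists gam : nat -> nat -> bool, [/\ forall i j : nat, G (vtx i j) -> G (vtx i.+1 j) -> gam i j = gam i.+1 j &
     forall i j : nat, G (vtx i j) -> G (vtx i j.+1) -> gam i j (+) gam i j.+1 = (j == j0) && (i0 < i)%N].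
  move=> iN jN om; pose a' : C := (s * (i0%:R + 1 / 2) - L) +i* (s * (j0%:R + 1 / 2) - L).
  (* Without such a point all four corners would lie in [K], and [omega] would be [false] by
     [square_flip]. *)
  have [a na aa'] : exists2 a, ~ O a & cmod (a' - a) < D / 32 + s.
    apply: contrapT => hn.
    have hK i j : (i0 <= i <= i0.+1)%N -> (j0 <= j <= j0.+1)%N -> K (vtx i j).
      move=> hi hj; have half (m n : nat) : (m <= n <= m.+1)%N -> `|m%:R + 1 / 2 - n%:R| <= 1 / 2 :> R.
        by rewrite -!(ler_nat R) -natr1 => /andP[k1 k2]; rewrite ler_norml; apply/andP; flra.
      have ctr : cmod (a' - vtx i j) <= s.
        apply: le_trans (cmod_ReIm _) _; rewrite cReB cImB /=.
        rewrite (_ : _ - _ - _ = s * (i0%:R + 1 / 2 - i%:R)); last by ring.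
        rewrite (_ : _ - _ - _ = s * (j0%:R + 1 / 2 - j%:R)); last by ring.
        by rewrite !normrM (gtr0_norm s0); have := half _ _ hi; have := half _ _ hj; nra.
      split=> [|a na].
        apply: le_trans (cmod_ReIm _) _; apply: lerD; apply: vsq.
          by case/andP: hi => _ /leq_trans; apply.
        by case/andP: hj => _ /leq_trans; apply.
      rewrite leNgt; apply/negP => k; apply: hn; exists a => //.
      by have := cmod_tri3 a' (vtx i j) a; flra.
    have [k00 k10 k01] : [/\ K (vtx i0 j0), K (vtx i0.+1 j0) & K (vtx i0 j0.+1)] by split; apply: hK; rewrite ?leqnn ?leqnSn.
    have [dh dv] : (forall i j, cmod (vtx i.+1 j - vtx i j) < r0) /\ forall i j, cmod (vtx i j.+1 - vtx i j) < r0.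
      by split=> i j; [have := vtx_h L i j s0|have := vtx_v L i j s0]; rewrite -!/(vtx _ _); flra.
    by move: om; rewrite /omega /hh /vv square_flip ?w0 //; exact: nr.
  apply: (@cell_sign O G L s (B + 1 / 2) D i0 j0 a) => //; first flra.
    by move=> p [].
  by move=> p b [_ h] /h.
have [Gam [Gh Gv]] := sign_coboundary cell.
pose w' i j := (-1) ^+ Gam i j * w i j.
have w'2 i j : w' i j ^+ 2 = u (vtx i j) by rewrite /w' exprMn sqrr_sign mul1r.
have w'0 i j : G (vtx i j) -> w' i j != 0.
  by move=> /GK h; rewrite /w' mulf_neq0 ?w0 // signr_eq0.
have wh i j : G (vtx i j) -> G (vtx i.+1 j) -> 0 < Re (w' i.+1 j / w' i j).
  move=> G1 G2; have K1 := GK _ G1; apply: flip_sign; rewrite ?w0 //; first by rewrite -Gh.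
  by apply: nr => //; have := vtx_h L i j s0; rewrite -!/(vtx _ _); flra.
have wv i j : (i <= N)%N -> (j < N)%N -> G (vtx i j) -> G (vtx i j.+1) -> 0 < Re (w' i j.+1 / w' i j).
  move=> iN jN G1 G2; have K1 := GK _ G1; apply: flip_sign; rewrite ?w0 //; first by rewrite -Gv.
  by apply: nr => //; have := vtx_v L i j s0; rewrite -!/(vtx _ _); flra.
have inv i j i' j' : G (vtx i j) -> G (vtx i' j') -> 0 < Re (w' i' j' / w' i j) -> 0 < Re (w' i j / w' i' j').
  move=> /w'0 n1 /w'0 n2 h; rewrite -[w' i j / _]invf_div; apply: near1V => //.
  by rewrite mulf_neq0 ?invr_eq0.
have one i j : G (vtx i j) -> 0 < Re (w' i j / w' i j).
  by move=> /w'0 h; rewrite divff //= ltr01.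
have adj (i i' : nat) : (i <= i'.+1)%N -> (i' <= i.+1)%N -> [\/ i' = i, i' = i.+1 | i = i'.+1].
  by clear; move=> h1 h2; have [h|h|h] := ltngtP i i'; [constructor 2|constructor 3|constructor 1]; lia.
have row i i' j : G (vtx i j) -> G (vtx i' j) -> (i <= i'.+1)%N -> (i' <= i.+1)%N -> near1 (w' i' j / w' i j).
  move=> G1 G2 h1 h2; apply: near1_root.
    by apply: nr => //; [exact: GK|have := vtx_near L s0 h1 h2 (leqnSn j) (leqnSn j); rewrite -!/(vtx _ _); flra].
  have [E|E|E] := adj _ _ h1 h2; rewrite E in G1 G2 *; [exact: one|exact: wh|apply: inv => //; exact: wh].
have column i j j' : (i <= N)%N -> (j <= N)%N -> (j' <= N)%N ->
    G (vtx i j) -> G (vtx i j') -> (j <= j'.+1)%N -> (j' <= j.+1)%N -> near1 (w' i j' / w' i j).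
  move=> iN jN jN' G1 G2 h1 h2; apply: near1_root.
    by apply: nr => //; [exact: GK|have := vtx_near L s0 (leqnSn i) (leqnSn i) h1 h2; rewrite -!/(vtx _ _); flra].
  by have [E|E|E] := adj _ _ h1 h2; rewrite E in jN jN' G1 G2 *; [exact: one|exact: wv|apply: inv => //; exact: wv].
pose ix (t : R) := Num.truncn ((t + L) / s).
have hix (t : R) : `|t| <= B -> [/\ s * (ix t)%:R <= t + L, t + L < s * ((ix t)%:R + 1) & (ix t < N)%N].
  rewrite ler_norml => /andP[t1 t2]; have tL : 0 <= (t + L) / s by rewrite divr_ge0 ?(ltW s0) //; rewrite /L; flra.
  have /andP[h1 h2] := truncn_itv tL; rewrite -/(ix t) in h1 h2.
  rewrite ler_pdivlMr // mulrC in h1; rewrite ltr_pdivrMr // mulrC -natr1 in h2; split=> //.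
  by rewrite -(ltr_nat R) -(ltr_pM2l s0) sN; rewrite /L in h1 *; flra.
pose vx p := vtx (ix (Re p)) (ix (Im p)).
have Xb p : X p -> `|Re p| <= B /\ `|Im p| <= B.
  by case=> h _; have := normRe p; have := normIm p; split; flra.
have vnear p p' : X p -> X p' -> cmod (p' - p) < s -> cmod (p - vtx (ix (Re p')) (ix (Im p))) <= 4 * s.
  move=> /Xb [p1 p2] /Xb [p1' p2'] pp; apply: le_trans (cmod_ReIm _) _; rewrite cReB cImB /=.
  have [a1 a2 _] := hix _ p1'; have [b1 b2 _] := hix _ p2.
  have := normRe (p' - p); rewrite cReB ler_norml => /andP[q1 q2].
  have k1 : `|Re p - (s * (ix (Re p'))%:R - L)| <= 2 * s by rewrite ler_norml; apply/andP; flra.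
  have k2 : `|Im p - (s * (ix (Im p))%:R - L)| <= s by rewrite ler_norml; apply/andP; flra.
  flra.
have vG p (v : C) : X p -> cmod (p - v) <= 4 * s -> G v.
  move=> [p1 p2] pv; split; first by have := cmod_sub v p; rewrite (cmodBC v); flra.
  by move=> a na; have := p2 a na; have := cmod_tri3 p v a; flra.
have pp0 p : X p -> cmod (p - p) < s by rewrite subrr cmod0.
have XK p : X p -> K p by apply: core_le; rewrite /L; flra.
have vxG p : X p -> G (vx p) by move=> Xp; apply: (vG p) => //; apply: vnear => //; exact: pp0.
have vxn p : X p -> cmod (vx p - p) < r0.
  by move=> Xp; have := vnear p p Xp Xp (pp0 p Xp); rewrite cmodBC -/(vx p); flra.
have [|t ht] := @root_fam X (fun p => u (vx p) / u p) => [p Xp|]; first by apply: near; [exact: XK|exact: vxn].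
pose wx p := w' (ix (Re p)) (ix (Im p)).
have t0 p : X p -> t p != 0.
  by move=> Xp; have [_ /near1_pos h] := ht p Xp; apply: contraTneq h => ->; rewrite ltxx.
have u0 p : X p -> u p != 0 by move=> /XK /KO /uO [].
have q2 p : X p -> (wx p / t p) ^+ 2 = u p.
  move=> Xp; have [E _] := ht p Xp; rewrite expr_div_n E w'2 -/(vx p) invf_div mulrCA divff ?mulr1 //.
  by have /KO /uO [] := GK _ (vxG p Xp).
exists (fun p => wx p / t p), s; split=> // p p' Xp Xp' pp.
have [p1 p2] := Xb _ Xp; have [p1' p2'] := Xb _ Xp'.
have Gm := vG p _ Xp (vnear p p' Xp Xp' pp); set wm := w' (ix (Re p')) (ix (Im p)).
have [_ _ bN] := hix _ p2; have [_ _ aN'] := hix _ p1'; have [_ _ bN'] := hix _ p2'.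
have adj_ix (x y : R) : `|x| <= B -> `|y| <= B -> `|y - x| < s -> (ix x <= (ix y).+1)%N && (ix y <= (ix x).+1)%N.
  move=> /hix[h1 h2 _] /hix[h3 h4 _]; rewrite ltr_norml => /andP[h5 h6].
  by rewrite (index_step s0 h1 h4) ?(index_step s0 h3 h2) //; clear -h5 h6; lra.
have [r1 r2] : `|Re p' - Re p| < s /\ `|Im p' - Im p| < s by rewrite -cReB -cImB; split; [exact: le_lt_trans (normRe _) pp|exact: le_lt_trans (normIm _) pp].
have /andP[h1 h2] := adj_ix _ _ p1 p1' r1.
have /andP[h3 h4] := adj_ix _ _ p2 p2' r2.
have R1 := row _ _ _ (vxG p Xp) Gm h1 h2.
have R2 := column _ _ _ (ltnW aN') (ltnW bN) (ltnW bN') Gm (vxG p' Xp') h3 h4.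
have nm := w'0 _ _ Gm; have nx := w'0 _ _ (vxG p Xp).
have [Et nt] := ht p Xp; have [Et' nt'] := ht p' Xp'.
(* Four factors near 1: the passages between [p], [p'] and their vertices, one horizontal move and
   one vertical move. *)
have E : wx p' / t p' / (wx p / t p) = (t p')^-1 * t p * (wx p' / wm) * (wm / wx p).
  by rewrite -/(wx p) in nx; field; rewrite nx nm !t0.
rewrite E; apply: near1_prod => //.
  apply: near1_root; last by apply: near1V; [exact: t0|exact: near1_pos].
  rewrite exprVn Et' invf_div; apply: near; first by apply: GK; exact: vxG.
  by rewrite cmodBC; exact: vxn.
rewrite -E expr_div_n !q2 //; apply: near; [exact: XK|apply: lt_trans pp _; clear -s1 r00; lra].
Qed.

Lemma convex_ball z s p p' t : cmod (p - z) < s -> cmod (p' - z) < s -> 0 <= t -> t <= 1 ->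
  cmod (p + t%:C * (p' - p) - z) < s.
Proof.
move=> hp hp' t0 t1; rewrite (_ : _ - z = (1 - t)%:C * (p - z) + t%:C * (p' - z)); last first.
  by rewrite rmorphB /=; ring.
apply: le_lt_trans (cmodD _ _) _; rewrite !cmodM !cmod_real !ger0_norm //; last lra.
have [h|h] := ltP t (1 / 2).
  have : t * cmod (p' - z) <= t * s by apply: ler_wpM2l => //; exact: ltW.
  have : (1 - t) * cmod (p - z) < (1 - t) * s by rewrite ltr_pM2l //; lra.
  lra.
have : t * cmod (p' - z) < t * s by rewrite ltr_pM2l //; lra.
have : (1 - t) * cmod (p - z) <= (1 - t) * s by apply: ler_wpM2l; [lra|exact: ltW].
lra.
Qed.

Lemma cconn_ball z s : cconn [set p : C | cmod (p - z) < s].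
Proof. by apply: cconn_convex => p p' t; exact: convex_ball. Qed.

Definition sqrt_prop O := forall u, hol O u -> (forall z, O z -> u z != 0) ->
  exists q : C -> C, hol O q /\ forall z, O z -> q z ^+ 2 = u z.

(** [q w - q z] equals [(u w - u z) / (q w + q z)], and local consistency of signs keeps the
    denominator away from 0. *)
Lemma sqrt_hol O u (q : C -> C) : copen O -> hol O u -> (forall z, O z -> u z != 0) ->
  (forall z, O z -> q z ^+ 2 = u z) ->
  (forall z, O z -> exists2 r : R, 0 < r & forall w, cmod (w - z) < r -> O w /\ 0 < Re (q w / q z)) -> hol O q.
Proof.
move=> oO hu u0 q2 qn z Oz; have [l hl] := hu z Oz.
have q0 w : O w -> q w != 0 by move=> Ow; apply: contra_neq (u0 w Ow); rewrite -q2 // => ->; rewrite expr0n.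
have [r r0 hr] := qn z Oz.
have qc : ccont q z.
  move=> e e0; have pz := cmod_neq0 (q0 z Oz); have pu := cmod_neq0 (u0 z Oz).
  have e1 : 0 < e / cmod (q z) * cmod (u z) by rewrite mulr_gt0 // divr_gt0.
  have [d d0 hd] := hasd_cont hl e1; exists (Num.min r d); first by rewrite lt_min r0.
  move=> w; rewrite lt_min => /andP[/hr [Ow k] /hd h].
  have := near1_sub k; have nz := u0 z Oz; have nq := q0 z Oz.
  rewrite expr_div_n !q2 // (_ : u w / u z - 1 = (u w - u z) / u z); last by field.
  rewrite (_ : q w / q z - 1 = (q w - q z) / q z); last by field.
  rewrite !cmod_div ler_pdivrMr // => k2; apply: le_lt_trans k2 _.
  by rewrite mulrAC ltr_pdivrMr // -ltr_pdivlMr // mulrAC.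
exists (l / (q z + q z)).
have Q0 : q z + q z != 0 by rewrite -mulr2n mulrn_eq0 /=; exact: q0.
have Qc : ccont (fun w => (q w + q z)^-1) z.
  apply: (ccont_comp (u := fun w => q w + q z)); first by apply: ccontD => //; exact: ccont_cst.
  by apply: hasd_cont; apply: hasd_inv.
have := slope_ccont_at hl => sc; have sm := ccontM sc Qc.
move=> e e0; have [d d0 hd] := sm e e0; exists (Num.min r d); first by rewrite lt_min r0.
move=> w; rewrite lt_min => /andP[/hr [Ow k] /hd].
rewrite slope_bb => /ltW h; have [->|wz] := eqVneq w z.
  by rewrite !subrr mulr0 subr0 cmod0 mulr0.
rewrite slopeE // in h; have wz0 : w - z != 0 by rewrite subr_eq0.
have s0 : q w + q z != 0.
  apply/eqP => /eqP; rewrite addr_eq0 => /eqP E; move: k; rewrite E mulNr divff ?q0 //.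
  by rewrite cReN /= oppr_gt0 ltr10.
rewrite (_ : q w - q z - _ = ((u w - u z) / (w - z) / (q w + q z) - l / (q z + q z)) * (w - z)).
  by rewrite cmodM; apply: ler_wpM2r => //; exact: cmod_ge0.
have qq := q0 z Oz; rewrite -!q2 //; by field; rewrite wz0 s0 Q0.
Qed.

(** Roots on an exhaustion by cores, each with its own sign, have an ultrafilter limit: at every
    point the ultrafilter settles the sign. *)
Lemma full_sqrt O : copen O -> full O -> sqrt_prop O.
Proof.
move=> oO fO u hu u0.
have hu' z : O z -> ccont u z /\ u z != 0 by move=> Oz; split; [exact: hol_cont hu Oz|exact: u0].
pose X (n : nat) := core O n%:R n.+1%:R^-1.
have /choice [q hq] : forall n : nat, exists q : C -> C, (forall p, X n p -> q p ^+ 2 = u p) /\ exists2 s : R, 0 < s &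
    forall p p', X n p -> X n p' -> cmod (p' - p) < s -> 0 < Re (q p' / q p).
  move=> n; have D0 : 0 < n.+1%:R^-1 :> R by rewrite invr_gt0.
  have [q [s [s0 h1 h2]]] := sqrt_grid fO hu' (ler0n _ n) D0.
  by exists q; split => //; exists s.
have /choice [q' hq'] : forall n : nat, exists q' : C -> C, forall p, (X n p -> q' p = q n p) /\ (~ X n p -> q' p = 0).
  move=> n; exists (fun p => if `[< X n p >] then q n p else 0) => p.
  by case: asboolP => h; split.
have q'b n p : O p -> cmod (q' n p) <= cmod (u p) + 1.
  move=> Op; have [Xp|nX] := pselect (X n p); last first.
    by rewrite (hq' n p).2 // cmod0; have := cmod_ge0 (u p); lra.
  rewrite (hq' n p).1 //; have [h _] := hq n; have := h p Xp => /(congr1 cmod).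
  rewrite cmodX => E; have := cmod_ge0 (q n p); rewrite -E expr2; nra.
have /choice [Q hQ] : forall p, exists l, O p -> forall e, 0 < e -> ufilter [set n | cmod (q' n p - l) < e].
  move=> p; have [Op|n] := pselect (O p); last by exists 0.
  by have [l hl] := ulim_ex (fun n => q'b n p Op); exists l.
have loc z : O z -> exists2 r : R, 0 < r & exists N : nat, forall n : nat, (N <= n)%N -> forall w, cmod (w - z) < r -> X n w.
  move=> Oz; have [r r0 hr] := oO z Oz; exists (r / 2); first by lra.
  have r2 : 0 < r / 2 by lra.
  have [N hN] := inv_lt_eps r2; pose M := Num.truncn (cmod z + r).
  exists (maxn N M.+1) => n; rewrite geq_max => /andP[nN nM] w wz; split.
    have := truncn_itv (_ : 0 <= cmod z + r); rewrite -/M => /(_ _) /andP; case.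
      by have := cmod_ge0 z; lra.
    move=> _ h; have : M.+1%:R <= n%:R :> R by rewrite ler_nat.
    by have := cmod_sub w z; lra.
  move=> a na; have := hN n nN; have : r <= cmod (a - z).
    by rewrite leNgt; apply/negP => /hr.
  have := cmod_tri3 a w z; rewrite (cmodBC a w); move: (n.+1%:R^-1) => x; lra.
have Q2 z : O z -> Q z ^+ 2 = u z.
  move=> Oz; have [r r0 [N hN]] := loc z Oz.
  apply/eqP; rewrite -subr_eq0; apply/eqP/cmod_small => e e0.
  pose M := cmod (u z) + 1 + cmod (Q z) + 1.
  have Mp : 0 < M by rewrite /M; have := cmod_ge0 (u z); have := cmod_ge0 (Q z); lra.
  have eM : 0 < e / M by rewrite divr_gt0.
  have [n [/= h1 h2]] := ufilter_ex (ufilterI (hQ z Oz _ eM) (ufilter_tail N)).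
  have Xz : X n z by apply: (hN n h2); rewrite subrr cmod0.
  have E : q' n z ^+ 2 = u z by rewrite (hq' n z).1 //; have [h _] := hq n; exact: h.
  rewrite -E (_ : _ - _ = - ((q' n z - Q z) * (q' n z + Q z))); last by ring.
  rewrite cmodN cmodM; have := cmodD (q' n z) (Q z); have := q'b n z Oz => k1 k2.
  have : cmod (q' n z - Q z) * cmod (q' n z + Q z) <= e / M * M.
    by apply: ler_pM; rewrite ?cmod_ge0 //; [exact: ltW|rewrite /M; lra].
  by rewrite divfK // gt_eqF.
exists Q; split=> //; apply: (sqrt_hol oO hu u0 Q2) => z Oz.
have [r r0 [N hN]] := loc z Oz; have [r1 r10 hr1] := oO z Oz.
have pu := cmod_neq0 (u0 z Oz); have pu8 : 0 < cmod (u z) / 16 by lra.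
have [d d0 hd] := (hu' z Oz).1 _ pu8.
pose s := Num.min r (Num.min r1 d).
have s0 : 0 < s by rewrite !lt_min r0 r10.
have [sr sr1 sd] : [/\ s <= r, s <= r1 & s <= d].
  by rewrite /s; split; rewrite !ge_min !lexx ?orbT.
exists s => // w wz; have Ow : O w by apply: hr1; lra.
split=> //.
have Q0 p : O p -> Q p != 0 by move=> Op; apply: contra_neq (u0 p Op); rewrite -Q2 // => ->; rewrite expr0n.
have nn p p' : cmod (p - z) < s -> cmod (p' - z) < s -> near1 (u p' / u p).
  by move=> pz pz'; apply: (near1_close (a := u z)); apply: hd; lra.
have zz : cmod (z - z) < s by rewrite subrr cmod0.
(* The scale at which [q n] is consistent may shrink with [n]; connectedness of the ball turns it
   into consistency over a ball independent of [n]. *)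
have H n : (N <= n)%N -> 0 < Re (q' n w / q' n z).
  move=> nN; have [h2 [t t0 ht]] := hq n.
  have XX p : cmod (p - z) < s -> X n p by move=> ps; apply: (hN n nN); lra.
  have nq p p' : cmod (p - z) < s -> cmod (p' - z) < s -> near1 ((q n p' / q n p) ^+ 2).
    by move=> h h'; rewrite expr_div_n !h2; [exact: nn|exact: XX|exact: XX].
  have nz p : cmod (p - z) < s -> q n p != 0.
    move=> ps; apply: contraTneq (nn _ _ zz ps) => E; rewrite -(h2 p (XX p ps)) E expr0n mul0r /near1 sub0r cmodN cmod1.
    by rewrite -leNgt; lra.
  rewrite !(hq' n _).1; [|exact: XX|exact: XX].
  have tr p p' p'' : cmod (p - z) < s -> cmod (p' - z) < s -> cmod (p'' - z) < s -> 0 < Re (q n p' / q n p) ->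
     0 < Re (q n p'' / q n p') -> 0 < Re (q n p'' / q n p).
    move=> h h' h'' k k'; have := near1M2 (near1_root (nq _ _ h' h'') k') (near1_root (nq _ _ h h') k).
    by rewrite mulrA divfK // nz.
  have cb := @cconn_ball z s [set p | 0 < Re (q n p / q n z)]; apply: cb => //=.
  - by exists z => //; rewrite divff ?nz //= ltr01.
  - move=> p hp k; exists t => // p' hp' pp; apply: (tr z p p') => //.
    by apply: ht => //; exact: XX.
  - move=> p hp k; exists t => // p' hp' pp k'; apply: k; apply: (tr z p' p) => //.
    by apply: ht; [exact: XX|exact: XX|rewrite cmodBC].
have nQ : near1 ((Q w / Q z) ^+ 2) by rewrite expr_div_n !Q2 //; exact: nn.
apply: contrapT => /negP ng; have := near1_rootV nQ ng; rewrite /near1 => k.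
have pq := cmod_neq0 (Q0 z Oz); have pq8 : 0 < cmod (Q z) / 8 by lra.
have [n [/= [h1 h2] h3]] := ufilter_ex (ufilterI (ufilterI (hQ z Oz _ pq8) (hQ w Ow _ pq8)) (ufilter_tail N)).
have nz0 : q' n z != 0.
  by rewrite -cmod_gt0; have := cmod_sub (Q z) (q' n z); rewrite (cmodBC (Q z)); lra.
have := H n h3; rewrite ltNge => /negP; apply.
have : 0 < Re (- (q' n w / q' n z)).
  apply: near1_Re; have Qz := Q0 z Oz.
  rewrite (_ : _ - 1 = - ((q' n w - Q w) + (q' n z - Q z) + Q z * (Q w / Q z + 1)) / q' n z); last by field; rewrite nz0 Qz.
  rewrite cmod_div cmodN ltr_pdivrMr ?mul1r ?cmod_gt0 //.
  have := cmodD ((q' n w - Q w) + (q' n z - Q z)) (Q z * (Q w / Q z + 1)); rewrite cmodM.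
  have := cmodD (q' n w - Q w) (q' n z - Q z).
  rewrite (_ : - (Q w / Q z) - 1 = - (Q w / Q z + 1)) ?cmodN in k; last by ring.
  have : cmod (Q z) * cmod (Q w / Q z + 1) <= cmod (Q z) / 4 by nra.
  have := cmod_sub (Q z) (q' n z); rewrite (cmodBC (Q z)); lra.
by rewrite cReN oppr_gt0 => /ltW.
Qed.

End SquareRoots.

(** * Disc automorphisms and the Riemann mapping theorem *)

Section Riemann.
Context {R : realType}.
Local Notation C := R[i].
Implicit Types (u v g h : C -> C) (s e t : R) (x y z w p a b l : C) (O T : set C).

Definition mob a z := (z - a) / (1 - conjc a * z).

Lemma conjM1 a z : disc a -> disc z -> 1 - conjc a * z != 0.
Proof.
rewrite /disc /= => ha hz; rewrite subr_eq0; apply/eqP => E.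
have : cmod (conjc a * z) = 1 by rewrite -E cmod1.
by rewrite cmodM cmod_conj; have := cmod_ge0 a; have := cmod_ge0 z; nra.
Qed.

Lemma mob_key a z : cmod (1 - conjc a * z) ^+ 2 - cmod (z - a) ^+ 2 = (1 - cmod a ^+ 2) * (1 - cmod z ^+ 2).
Proof.
rewrite !cmod_sqr !(cReB, cImB, cReM, cImM) cRe_conj cIm_conj /=; ring.
Qed.

Lemma disc_sqr z : disc z <-> 0 < 1 - cmod z ^+ 2.
Proof. by rewrite subr_gt0 expr_lt1 //; exact: cmod_ge0. Qed.

Lemma mob_disc a z : disc a -> disc z -> disc (mob a z).
Proof.
move=> ha hz; have nz := conjM1 ha hz.
rewrite /disc /= cmod_div ltr_pdivrMr ?mul1r ?cmod_gt0 // cmod_lt_sqr -subr_gt0 mob_key.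
by rewrite mulr_gt0 //; apply/disc_sqr.
Qed.

Lemma discN a : disc a -> disc (- a).
Proof. by rewrite /disc /= cmodN. Qed.

Lemma conjcN' a : conjc (- a) = - conjc a.
Proof. by rewrite rmorphN. Qed.

Lemma mobK a z : disc a -> disc z -> mob (- a) (mob a z) = z.
Proof.
move=> ha hz; have n1 := conjM1 ha hz; have n2 := conjM1 ha ha.
rewrite /mob conjcN' opprK mulNr opprK.
have E : 1 + conjc a * ((z - a) / (1 - conjc a * z)) = (1 - conjc a * a) / (1 - conjc a * z) by field.
rewrite E; field; rewrite n1 n2 //.
Qed.

Lemma mobNK a z : disc a -> disc z -> mob a (mob (- a) z) = z.
Proof. by move=> ha hz; rewrite -{1}[a]opprK mobK //; exact: discN. Qed.

Lemma mob_hol a : disc a -> hol disc (mob a).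
Proof.
move=> ha; apply: hol_div; last by move=> z; exact: conjM1.
  by apply: holB; [exact: hol_id|exact: hol_cst].
by apply: holB; [exact: hol_cst|apply: holM; [exact: hol_cst|exact: hol_id]].
Qed.

Lemma mob_biholo a : disc a -> biholo disc disc (mob a) (mob (- a)).
Proof.
move=> ha; have ha' := discN ha; split; [exact: mob_hol|exact: mob_hol| |].
  by move=> z hz; split; [exact: mob_disc|exact: mobK].
by move=> z hz; split; [exact: mob_disc|exact: mobNK].
Qed.

Lemma mob_at a : mob a a = 0.
Proof. by rewrite /mob subrr mul0r. Qed.

Lemma mob0 a : mob a 0 = - a.
Proof. by rewrite /mob mulr0 subr0 sub0r divr1. Qed.

Lemma biholo_comp O T (T' : set C) f g u v : biholo O T f g -> biholo T T' u v ->
  biholo O T' (fun z => u (f z)) (fun z => g (v z)).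
Proof.
move=> [f1 g1 h1 k1] [u1 v1 h2 k2]; split.
- by apply: hol_comp u1 => // z /h1 [].
- by apply: hol_comp g1 => // z /k2 [].
- by move=> z /h1 [/h2 [? ->] ->].
- by move=> z /k2 [/k1 [? ->] ->].
Qed.

Lemma open_mod_lt1 T : copen T -> (forall y, T y -> cmod y <= 1) -> forall y, T y -> disc y.
Proof.
move=> oT T1 y Ty; rewrite /disc /= lt_neqAle T1 // andbT; apply/eqP => E.
have [r r0 hr] := oT y Ty; have := T1 (y * (1 + r / 2)%:C).
rewrite cmodM E mul1r cmod_real ger0_norm; last lra.
move=> H; have : 1 + r / 2 <= 1; last lra.
apply: H; apply: hr; rewrite rmorphD mulrDr mulr1 addrC addKr cmodM E mul1r cmod_real ger0_norm; lra.
Qed.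

(** Koebe's extremal argument, with [cmod (f p1)] at a second point [p1] maximized among injective
    maps into the disc vanishing at [p]. If the extremal map omitted a value [a], a square root of
    [mob a (g0 z)] would produce a larger one. *)
Lemma riemann_mapping O (e0 : C -> C) p : copen O -> cconn O -> sqrt_prop O -> O p ->
  hol O e0 -> (forall z, O z -> disc (e0 z)) -> (forall z w, O z -> O w -> e0 z = e0 w -> z = w) ->
  exists f g, biholo O disc f g /\ f p = 0.
Proof.
move=> oO cO sO Op he ed ei.
pose F := [set f : C -> C | [/\ hol O f, forall z, O z -> disc (f z),
   forall z w, O z -> O w -> f z = f w -> z = w & f p = 0]].
have dp := ed p Op.
have F0 : F (fun z => mob (e0 p) (e0 z)).
  split; last exact: mob_at.
  - by apply: hol_comp (mob_hol dp) => // z /ed.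
  - by move=> z Oz; apply: mob_disc => //; exact: ed.
  - move=> z w Oz Ow /(congr1 (mob (- e0 p))); rewrite !mobK //; [exact: ei|exact: ed|exact: ed].
have [p1 Op1 p1p] : exists2 p1, O p1 & p1 != p.
  have [r r0 hr] := oO p Op; exists (p + (r / 2)%:C).
    by apply: hr; rewrite addrC addKr cmod_real ger0_norm; lra.
  by rewrite -subr_eq0 addrC addKr -cmod_gt0 cmod_real ger0_norm; lra.
pose S := [set m : R | exists2 f, F f & m = cmod (f p1)].
have hS : has_sup S.
  split; first by exists (cmod (mob (e0 p) (e0 p1))); exists (fun z => mob (e0 p) (e0 z)).
  by exists 1 => m [f [_ fd _ _] ->]; apply: ltW; exact: fd.
pose m := sup S.
have Sm f : F f -> cmod (f p1) <= m by move=> Ff; apply: ub_le_sup; [case: hS|exists f].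
have m0 : 0 < m.
  apply: lt_le_trans (Sm _ F0); rewrite cmod_gt0; apply: contra_neq p1p => E.
  by have [_ _ i z0] := F0; apply: i => //; rewrite E z0.
have /choice [f hf] : forall n : nat, exists f, F f /\ m - n.+1%:R^-1 < cmod (f p1).
  move=> n; have n0 : 0 < n.+1%:R^-1 :> R by rewrite invr_gt0.
  by have [_ [f Ff ->] h] := sup_adherent n0 hS; exists f.
have fb n z : O z -> cmod (f n z) <= 1 by move=> Oz; apply: ltW; have [[_ h _ _] _] := hf n; exact: h.
have /choice [g0 hg0] : forall z, exists l, O z -> forall e, 0 < e -> ufilter [set n | cmod (f n z - l) < e].
  move=> z; have [Oz|n] := pselect (O z); last by exists 0.
  by have [l hl] := ulim_ex (fun n => fb n z Oz); exists l.
have fh n : hol O (f n) by have [[]] := hf n.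
have gl z e : O z -> 0 < e -> ufilter [set n | cmod (f n z - g0 z) < e] by move=> Oz; exact: hg0.
have g0h : hol O g0 := ulim_hol oO fh fb gl.
have g0p : g0 p = 0.
  apply: cmod_small => e ee; have [n /= h] := ufilter_ex (gl p e Op ee).
  by have [[_ _ _ z0] _] := hf n; rewrite z0 sub0r cmodN in h; exact: ltW.
have g01 : m <= cmod (g0 p1).
  apply: le_small => e ee; have e2 : 0 < e / 2 by lra.
  have [N hN] := inv_lt_eps e2.
  have [n [/= h1 h2]] := ufilter_ex (ufilterI (gl p1 _ Op1 e2) (ufilter_tail N)).
  have := hN n h2; have [_] := hf n; have := cmod_sub (f n p1) (g0 p1).
  by move: (n.+1%:R^-1) => t; lra.
have g0i : forall z w, O z -> O w -> g0 z = g0 w -> z = w.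
  apply: (hurwitz_inj oO fh fb gl cO); first by move=> n z w; have [[_ _ h _] _] := hf n; exact: h.
  exists p, p1; split=> //; rewrite g0p eq_sym -cmod_gt0; lra.
have [oi [g hg]] := inj_biholo oO g0h g0i.
have g0b z : O z -> cmod (g0 z) <= 1.
  move=> Oz; apply: le_small => e ee; have [n /= h] := ufilter_ex (gl z e Oz ee).
  by have := fb n z Oz; have := cmod_sub (g0 z) (f n z); rewrite (cmodBC (g0 z)); lra.
have g0d z : O z -> disc (g0 z).
  move=> Oz; apply: (open_mod_lt1 oi); last by exists z.
  by move=> _ [x Ox <-]; exact: g0b.
exists g0, g; split=> //; suff -> : disc = image_of O g0 by [].
apply/seteqP; split=> [a da|_ [z Oz <-]]; last exact: g0d.
apply: contrapT => na.
have ma z : O z -> mob a (g0 z) != 0.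
  move=> Oz; apply/eqP => E; apply: na; exists z => //.
  rewrite -(mobK da (g0d z Oz)) E mob0 opprK //.
have hma : hol O (fun z => mob a (g0 z)) by apply: hol_comp (mob_hol da).
have [s [hs s2]] := sO _ hma ma.
have sd z : O z -> disc (s z).
  move=> Oz; have : disc (s z ^+ 2) by rewrite s2 //; apply: mob_disc => //; exact: g0d.
  by rewrite /disc /= cmodX expr_lt1 //; exact: cmod_ge0.
pose b := s p; have db : disc b := sd p Op.
have ba : b ^+ 2 = - a by rewrite /b s2 // g0p mob0.
pose gt z := mob b (s z).
have Fg : F gt.
  split; last exact: mob_at.
  - by apply: hol_comp (mob_hol db).
  - by move=> z Oz; apply: mob_disc => //; exact: sd.
  - move=> z w Oz Ow /(congr1 (mob (- b))); rewrite !mobK //; [|exact: sd|exact: sd].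
    move=> E; apply: g0i => //; rewrite -(mobK da (g0d z Oz)) -(mobK da (g0d w Ow)).
    by rewrite -!s2 // E.
(* [g0] is recovered from [gt] by a degree 2 self-map of the disc fixing 0, which splits off the
   factor [gt p1] and leaves a number of modulus below 1. *)
have E : g0 p1 = gt p1 * mob (- b) (s p1).
  rewrite -{1}(mobK da (g0d p1 Op1)) -s2 // /gt /mob !conjcN' !opprK !mulNr !opprK.
  have n1 := conjM1 db (sd p1 Op1); have n2 := conjM1 (discN db) (sd p1 Op1).
  rewrite conjcN' mulNr opprK in n2.
  have aE : a = - b ^+ 2 by rewrite ba opprK.
  rewrite aE rmorphN rmorphXn /= mulNr.
  have n3 : 1 - conjc b ^+ 2 * s p1 ^+ 2 != 0.
    by rewrite (_ : _ - _ = (1 - conjc b * s p1) * (1 + conjc b * s p1)); [rewrite mulf_neq0|ring].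
  move: (conjc b) (s p1) n1 n2 n3 => b' x n1 n2 n3.
  by rewrite mulf_div; congr (_ / _); ring.
have gp : 0 < cmod (g0 p1) by lra.
have tp : 0 < cmod (gt p1) by rewrite cmod_gt0; apply: contraTneq gp => E'; rewrite E E' mul0r cmod0 ltxx.
have : cmod (g0 p1) < cmod (gt p1).
  by rewrite E cmodM gtr_pMr //; apply: mob_disc; [exact: discN|exact: sd].
have := Sm _ Fg; lra.
Qed.

End Riemann.

(** * Lifting through local homeomorphisms, logarithms *)

Section Lifting.
Context {R : realType}.
Local Notation C := R[i].
Implicit Types (u v h p F L : C -> C) (B D M s e d r t : R) (x y z w q a b c l m : C) (T X Y Q : set C).

Lemma compact_image X u : cclosed X -> cbounded X -> (forall z, X z -> ccont u z) ->
  cclosed (image_of X u) /\ cbounded (image_of X u).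
Proof.
move=> Xc [M XM] uc; split; last first.
  have [[z Xz]|n] := pselect (X !=set0).
    have [x Xx hx] := @EVT_mod R X u Xc (ex_intro _ M XM) (ex_intro _ z Xz) uc.
    by exists (cmod (u x)) => _ [w Xw <-]; exact: hx.
  exists 0 => q [w Xw _]; exfalso; by apply: n; exists w.
move=> y hy; have /choice [z hz] : forall n : nat, exists z, X z /\ cmod (u z - y) < n.+1%:R^-1.
  move=> n; have n0 : 0 < n.+1%:R^-1 :> R by rewrite invr_gt0.
  by have [_ [z Xz <-] h] := hy _ n0; exists z.
have [l hl] := BW (fun n => XM _ (hz n).1).
have Xl : X l by apply: Xc => e e0; have [m _ h] := hl e 0%N e0; exists (z m) => //; exact: (hz m).1.
exists l => //; apply/eqP; rewrite -subr_eq0; apply/eqP/cmod_small => e e0.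
have e2 : 0 < e / 2 by lra.
have [d d0 hd] := uc l Xl _ e2; have [N hN] := inv_lt_eps e2.
have [m Nm h] := hl d N d0; have h1 := hd _ h; have h2 := (hz m).2; have h3 := hN m Nm.
by have := cmod_tri3 (u l) (u (z m)) y; rewrite (cmodBC (u l) (u (z m))); move: (m.+1%:R^-1) h2 h3 => *; lra.
Qed.

Definition ccontin T u z := forall e, 0 < e -> exists2 d : R, 0 < d &
  forall w, T w -> cmod (w - z) < d -> cmod (u w - u z) < e.

Lemma ccont_in T u z : ccont u z -> ccontin T u z.
Proof. by move=> uc e /uc [d d0 hd]; exists d => // w _; exact: hd. Qed.

Definition linj X u z := exists2 r : R, 0 < r & forall w1 w2, X w1 -> X w2 ->
  cmod (w1 - z) < r -> cmod (w2 - z) < r -> u w1 = u w2 -> w1 = w2.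

Lemma lift_uniq T X p (u v : C -> C) a : cconn T -> T a -> (forall z, X z -> linj X p z) ->
  (forall z, T z -> X (u z) /\ X (v z)) -> (forall z, T z -> ccontin T u z /\ ccontin T v z) ->
  (forall z, T z -> p (u z) = p (v z)) -> u a = v a -> forall z, T z -> u z = v z.
Proof.
move=> cT Ta pl TX uc pE uva; apply: (cT [set z | u z = v z]); first by exists a.
- move=> z Tz /= E; have [r r0 hr] := pl _ (TX z Tz).1.
  have [d1 d10 h1] := (uc z Tz).1 r r0; have [d2 d20 h2] := (uc z Tz).2 r r0.
  exists (Num.min d1 d2); first by rewrite lt_min d10.
  move=> w Tw; rewrite lt_min => /andP[/(h1 w Tw) k1 /(h2 w Tw) k2].
  by apply: hr; [exact: (TX w Tw).1|exact: (TX w Tw).2|exact: k1|rewrite E|exact: pE].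
- move=> z Tz /eqP; rewrite -subr_eq0 -cmod_gt0 => D0; have D2 : 0 < cmod (u z - v z) / 2 by lra.
  have [d1 d10 h1] := (uc z Tz).1 _ D2; have [d2 d20 h2] := (uc z Tz).2 _ D2.
  exists (Num.min d1 d2); first by rewrite lt_min d10.
  move=> w Tw; rewrite lt_min => /andP[/(h1 w Tw) k1 /(h2 w Tw) k2] /= E.
  have := cmod_tri3 (u z) (u w) (v z); rewrite (cmodBC (u z) (u w)) E; move: k1; rewrite E; lra.
Qed.

(** Covering over [Q] with uniform constants: one radius of injectivity and, for each [t], one
    radius of openness. Lifting in a fixed number of steps relies on this. *)
Definition lcov X p Q := exists r : R, [/\ 0 < r,
  (forall x, X x -> Q (p x) -> forall w1 w2, X w1 -> X w2 -> cmod (w1 - x) < r -> cmod (w2 - x) < r -> p w1 = p w2 -> w1 = w2) &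
  forall t, 0 < t -> exists2 d : R, 0 < d & forall x, X x -> Q (p x) -> forall y, cmod (y - p x) < d ->
    exists w, [/\ X w, cmod (w - x) < t & p w = y]].

(** The translations [Tr] move every point over [Q] into the compact [X'], so constants uniform on
    [X'] are uniform over [Q]. *)
Lemma lcov_compact X p Q (X' Tr : set C) : copen X -> hol X p ->
  (forall x l, X x -> hasd p x l -> l != 0) ->
  cclosed X' -> cbounded X' -> (forall x, X' x -> X x) ->
  (forall c w, Tr c -> X w -> X (w + c) /\ p (w + c) = p w) -> (forall c, Tr c -> Tr (- c)) ->
  (forall x, X x -> Q (p x) -> exists2 c, Tr c & X' (x + c)) -> lcov X p Q.
Proof.
move=> oX hp p0 cX' bX' X'X TrX TrN hQ.
have [||r r0 hr] := @compact_uniform R X' (fun y r => forall w1 w2, X w1 -> X w2 ->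
    cmod (w1 - y) < r -> cmod (w2 - y) < r -> p w1 = p w2 -> w1 = w2) cX' bX'.
- by move=> y r r' h rr w1 w2 X1 X2 h1 h2; apply: h => //; lra.
- move=> x /X'X Xx; have [l hl] := hp x Xx.
  have [rho [rho0 _ hi _]] := local_homeo oX Xx hp hl (p0 x l Xx hl).
  exists (rho / 2); split; first by lra.
  move=> y _ yx w1 w2 _ _ h1 h2; apply: hi.
    by have := cmod_tri3 w1 y x; lra.
  by have := cmod_tri3 w2 y x; lra.
exists r; split=> //.
  move=> x Xx Qx w1 w2 X1 X2 h1 h2 E; have [c Tc X'c] := hQ x Xx Qx.
  have [Y1 E1] := TrX c w1 Tc X1; have [Y2 E2] := TrX c w2 Tc X2.
  apply: (addIr c); apply: (hr _ X'c) => //; last by rewrite E1 E2.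
    by rewrite opprD addrACA subrr addr0.
  by rewrite opprD addrACA subrr addr0.
move=> t t0.
have [||d d0 hd] := @compact_uniform R X' (fun x d => forall y, cmod (y - p x) < d ->
    exists w, [/\ X w, cmod (w - x) < t & p w = y]) cX' bX'.
- by move=> y s s' h ss' z hz; apply: h; lra.
- move=> x /X'X Xx; have [l hl] := hp x Xx.
  have [rho [rho0 rX _ ho]] := local_homeo oX Xx hp hl (p0 x l Xx hl).
  have t2 : 0 < Num.min (t / 2) rho by rewrite lt_min rho0 divr_gt0.
  have [d d0 hd] := ho _ t2; have d2 : 0 < d / 2 by lra.
  have [d' d'0 hd'] := hasd_cont hl d2.
  have t20 : 0 < t / 2 by lra.
  have [s [s0 s1 s2]] := min_pos2 t20 d'0.
  have [s' [s'0 s3 s4]] := min_pos2 s0 d2; exists s'; split=> //.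
  move=> y _ yx z zy; have h1 : cmod (p y - p x) < d / 2 by apply: hd'; lra.
  have [|w + <-] := hd z; first by have := cmod_tri3 z (p y) (p x); lra.
  rewrite lt_min => /andP[wt wr]; exists w; split=> //; first exact: rX.
  by have := cmod_tri3 w x y; rewrite (cmodBC x); lra.
exists d => // x Xx Qx y yx; have [c Tc X'c] := hQ x Xx Qx.
have [Xc Ec] := TrX c x Tc Xx; rewrite -Ec in yx.
have [w [Xw wx E]] := hd _ X'c y yx; have [Xw' Ew'] := TrX (- c) w (TrN c Tc) Xw.
by exists (w - c); split=> //; [rewrite -addrA -opprD (addrC c)|rewrite Ew'].
Qed.

Lemma hasd_slope u k z r : 0 < r -> ccont k z -> (forall w, cmod (w - z) < r -> u w - u z = k w * (w - z)) ->
  hasd u z (k z).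
Proof.
move=> r0 kc hu e e0; have [d d0 hd] := kc e e0; exists (Num.min r d); first by rewrite lt_min r0.
move=> w; rewrite lt_min => /andP[/hu -> /hd h].
by rewrite -mulrBl cmodM; apply: ler_wpM2r; [exact: cmod_ge0|exact: ltW].
Qed.

(** The slope of [F] is the slope of [p] at [u w] times that of [u], and the former is nonzero near
    [z] by continuity of [u]. *)
Lemma lift_hasd u F p z l m : ccont u z -> hasd p (u z) l -> l != 0 -> hasd F z m ->
  (exists2 r : R, 0 < r & forall w, cmod (w - z) < r -> p (u w) = F w) -> hasd u z (m / l).
Proof.
move=> uc hp l0 hF [r r0 hr]; have lp := cmod_neq0 l0.
have sc := ccont_comp uc (slope_ccont_at hp).
have [d d0 hd] := sc _ lp.
have s0 w : cmod (w - z) < d -> slope p (u z) l (u w) != 0.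
  move=> /hd; rewrite slope_bb => h; apply/eqP => E; move: h; rewrite E sub0r cmodN ltxx //.
have sz : slope p (u z) l (u z) != 0 by rewrite slope_bb.
pose k w := slope F z m w * (slope p (u z) l (u w))^-1.
have kc : ccont k z.
  apply: ccontM; first exact: slope_ccont_at.
  by apply: (ccont_comp sc); apply: hasd_cont; apply: hasd_inv.
have E : k z = m / l by rewrite /k !slope_bb.
rewrite -E; apply: (@hasd_slope _ k z (Num.min r d)) => //; first by rewrite lt_min r0.
move=> w; rewrite lt_min => /andP[wr /s0 sw].
have rz : cmod (z - z) < r by rewrite subrr cmod0.
apply: (mulIf sw); rewrite [LHS]mulrC slopeM hr // hr // /k mulrAC divfK // slopeM //.
Qed.

Definition kset T M := [set w : C | cmod w <= M /\ forall b, ~ T b -> M^-1 <= cmod (w - b)].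

Definition star a T := forall w t, T w -> 0 <= t -> t <= 1 -> T (a + t%:C * (w - a)).

(** Lifts the contraction [P j w] of [T] to [a] in [N] steps, each moving [F] by less than the
    radius of openness; injectivity makes each new lift unique near the old one, hence
    continuous. *)
Lemma lift_compact T F X p a (x0 : C) M : 0 < M -> cclosed T -> (forall w, T w -> cmod w <= M) -> star a T -> T a ->
  (forall w, T w -> ccontin T F w) -> lcov X p (image_of T F) -> X x0 -> p x0 = F a ->
  exists L : C -> C, [/\ L a = x0, forall w, T w -> X (L w) /\ p (L w) = F w & forall w, T w -> ccontin T L w].
Proof.
move=> M0 Tc TM st Ta Fc [r [r0 hi ho]] Xx0 px0.
have r2 : 0 < r / 2 by lra.
have [d d0 hd] := ho _ r2.
have bT : cbounded T by exists M.
have [||eta eta0 heta] := @compact_uniform R T (fun y s => forall w, T w -> cmod (w - y) < s -> cmod (F w - F y) < d) Tc bT.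
- by move=> y s s' h ss w Tw wy; apply: h => //; lra.
- move=> x Tx; have d2 : 0 < d / 2 by lra.
  have [s s0 hs] := Fc x Tx _ d2; exists (s / 2); split; first by lra.
  move=> y Ty yx w Tw wy; have k1 := hs y Ty; have k2 := hs w Tw.
  have := cmod_tri3 (F w) (F x) (F y); rewrite (cmodBC (F x)).
  have : cmod (F y - F x) < d / 2 by apply: k1; lra.
  have : cmod (F w - F x) < d / 2 by apply: k2; have := cmod_tri3 w y x; lra.
  lra.
have eM : 0 < eta / (2 * M) by rewrite divr_gt0 // mulr_gt0.
have [N' hN] := inv_lt_eps eM; have {}hN := hN _ (leqnn N'); pose N := N'.+1; rewrite -/N in hN.
have Np : 0 < N%:R :> R by rewrite ltr0n.
pose P (j : nat) w := a + (j%:R / N%:R)%:C * (w - a).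
have PT (j : nat) w : (j <= N)%N -> T w -> T (P j w).
  move=> jN Tw; apply: st => //; by rewrite ler_pdivrMr // mul1r ler_nat.
have Pa (j : nat) : P j a = a by rewrite /P subrr mulr0 addr0.
have Pd (j : nat) w w' : (j <= N)%N -> cmod (P j w - P j w') <= cmod (w - w').
  move=> jN; rewrite /P (_ : _ - _ = (j%:R / N%:R)%:C * (w - w')); last by ring.
  rewrite cmodM cmod_real ger0_norm ?divr_ge0 //; apply: ler_piMl; first exact: cmod_ge0.
  by rewrite ler_pdivrMr // mul1r ler_nat.
have Ps (j : nat) w : T w -> cmod (P j.+1 w - P j w) < eta.
  move=> Tw; rewrite /P (_ : _ - _ = (N%:R^-1)%:C * (w - a)); last first.
    rewrite -natr1 mulrDl mul1r rmorphD /=; ring.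
  rewrite cmodM cmod_real ger0_norm ?invr_ge0 //.
  have : cmod (w - a) <= 2 * M by have := cmodB w a; have := TM w Tw; have := TM a Ta; lra.
  move: hN; rewrite ltr_pdivlMr ?mulr_gt0 // => k1 k2; apply: le_lt_trans k1.
  by apply: ler_wpM2l => //; rewrite invr_ge0.
have H (j : nat) : (j <= N)%N -> exists L : C -> C, [/\ L a = x0,
    forall w, T w -> X (L w) /\ p (L w) = F (P j w) & forall w, T w -> ccontin T L w].
  elim: j => [_|j IH jN].
    exists (fun=> x0); split=> //.
      by move=> w Tw; split=> //; rewrite /P mul0r mul0r addr0.
    by move=> w Tw e e0; exists 1 => // w' _ _; rewrite subrr cmod0.
  have [L [La LX Lc]] := IH (ltnW jN).
  have QL w : T w -> image_of T F (p (L w)).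
    by move=> Tw; exists (P j w); [apply: PT => //; exact: ltnW|rewrite (LX w Tw).2].
  have /choice [L' hL'] : forall w, exists x, T w -> [/\ X x, cmod (x - L w) < r / 2 & p x = F (P j.+1 w)].
    move=> w; have [Tw|n] := pselect (T w); last by exists 0.
    have [Xw Ew] := LX w Tw; have [|x hx] := hd _ Xw (QL w Tw) (F (P j.+1 w)); last by exists x.
    by rewrite Ew; apply: heta; [exact: PT (ltnW jN) Tw|exact: PT|exact: Ps].
  exists L'; split.
  - have [X1 h1 E1] := hL' a Ta; have [X2 E2] := LX a Ta; apply: (hi _ X2 (QL a Ta)) => //.
    + by lra.
    + by rewrite La subrr cmod0.
    + by rewrite E1 Pa px0.
  - by move=> w Tw; have [X1 _ E1] := hL' w Tw.
  - move=> w Tw e e0; have [X1 h1 E1] := hL' w Tw; have [X2 E2] := LX w Tw.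
    have [t [t0 te tr]] := min_pos2 e0 r2.
    have [d1 d10 hd1] := ho t t0.
    have Q1 : image_of T F (p (L' w)) by exists (P j.+1 w); [exact: PT|].
    have [d2 d20 hd2] := Fc _ (PT _ _ jN Tw) d1 d10.
    have [d3 d30 hd3] := Lc w Tw _ r2.
    exists (Num.min d2 d3); first by rewrite lt_min d20.
    move=> w' Tw'; rewrite lt_min => /andP[k2 /(hd3 w' Tw') k3].
    have [X1' h1' E1'] := hL' w' Tw'.
    have [|x [Xx xw Ex]] := hd1 _ X1 Q1 (F (P j.+1 w')).
      by rewrite E1; apply: hd2; [exact: PT|apply: le_lt_trans (Pd _ _ _ jN) k2].
    suff -> : L' w' = x by lra.
    apply: (hi _ X2 (QL w Tw)) => //; last by rewrite Ex.
      by have := cmod_tri3 (L' w') (L w') (L w); lra.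
    by have := cmod_tri3 x (L' w) (L w); lra.
have [L [La LX Lc]] := H N (leqnn _); exists L; split=> // w Tw.
have [X1 E1] := LX w Tw; split=> //; rewrite E1 /P divff ?gt_eqF //.
by rewrite mul1r addrC subrK.
Qed.

(** [T] is exhausted by the compacta [Kn], star-shaped about [a]. The lifts on two of them agree at
    a common point by uniqueness along the segment from [a], so they glue. *)
Lemma lift_convex T F X p a (x0 : C) : copen T ->
  (forall z w t, T z -> T w -> 0 <= t -> t <= 1 -> T (z + t%:C * (w - z))) -> T a ->
  (forall w, T w -> ccont F w) -> (forall x, X x -> linj X p x) ->
  (forall Q, cclosed Q -> cbounded Q -> (forall y, Q y -> exists2 w, T w & F w = y) -> lcov X p Q) -> X x0 -> p x0 = F a ->
  exists L : C -> C, [/\ L a = x0, forall w, T w -> X (L w) /\ p (L w) = F w & forall w, T w -> ccont L w].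
Proof.
move=> oT cT Ta Fc pl hc Xx0 px0; have [ra ra0 hra] := oT a Ta.
(* Large enough for [a] to belong to every [Kn]. *)
pose N0 := (Num.truncn (Num.max (cmod a) ra^-1)).+1.
have N0p : Num.max (cmod a) ra^-1 < N0%:R.
  have := truncn_itv (_ : 0 <= Num.max (cmod a) ra^-1); rewrite le_max cmod_ge0 => /(_ isT) /andP[] //.
move: N0p; rewrite gt_max => /andP[N0a N0r].
pose Kn (n : nat) := kset T (N0 + n)%:R.
have Np (n : nat) : 0 < (N0 + n)%:R :> R by rewrite ltr0n.
have N0n (n : nat) : N0%:R <= (N0 + n)%:R :> R by rewrite ler_nat leq_addr.
have KT n w : Kn n w -> T w.
  move=> [_ h]; apply: contrapT => /h; rewrite subrr cmod0 leNgt invr_gt0 Np //.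
have Kc n : cclosed (Kn n).
  move=> z hz; split.
    by apply: le_small => e /hz [w [w1 _] wz]; have := cmod_sub z w; rewrite (cmodBC z); lra.
  move=> b nb; apply: le_small => e /hz [w [_ w1] wz]; have := w1 b nb.
  by have := cmod_tri3 w z b; move: ((N0 + n)%:R^-1) => x; lra.
have Ka n : Kn n a.
  split; first by apply: ltW; apply: lt_le_trans N0a _.
  move=> b nb; apply: le_trans (_ : ra <= _).
    by rewrite -[ra]invrK lef_pV2 ?posrE ?invr_gt0 // ltW // (lt_le_trans N0r).
  by rewrite leNgt cmodBC; apply/negP => /hra.
(* If a complement point [b] were too close to a point [q] of the segment, translating both
   endpoints by [b - q] would keep them in [T], and convexity would put [b] in [T]. *)
have Kst n : star a (Kn n).
  move=> w t [w1 w2] t0 t1; split.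
    have [a1 _] := Ka n; rewrite (_ : a + _ = (1 - t)%:C * a + t%:C * w); last by rewrite rmorphB /=; ring.
    apply: le_trans (cmodD _ _) _; rewrite !cmodM !cmod_real !ger0_norm ?subr_ge0 //.
    have : (1 - t) * cmod a <= (1 - t) * (N0 + n)%:R by apply: ler_wpM2l => //; rewrite subr_ge0.
    have : t * cmod w <= t * (N0 + n)%:R by apply: ler_wpM2l.
    lra.
  move=> b nb; rewrite leNgt; apply/negP => k; apply: nb.
  have [_ a2] := Ka n.
  set q := a + _ in k; pose dl := b - q.
  have Ta' : T (a + dl).
    by apply: contrapT => /a2; rewrite leNgt => /negP; apply; rewrite opprD addNKr cmodN /dl cmodBC.
  have Tw' : T (w + dl).
    by apply: contrapT => /w2; rewrite leNgt => /negP; apply; rewrite opprD addNKr cmodN /dl cmodBC.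
  have := cT _ _ t Ta' Tw' t0 t1; congr (T _); rewrite /dl /q; ring.
have /choice [L hL] : forall n : nat, exists L : C -> C, [/\ L a = x0, forall w, Kn n w -> X (L w) /\ p (L w) = F w &
     forall w, Kn n w -> ccontin (Kn n) L w].
  move=> n; apply: (@lift_compact _ F X p a x0 (N0 + n)%:R) => //.
  - by move=> w [].
  - by move=> w /KT /Fc h; exact: ccont_in.
  - have Kb : cbounded (Kn n) by exists (N0 + n)%:R => w [].
    have [c1 c2] := @compact_image (Kn n) F (Kc n) Kb (fun z Kz => Fc z (KT n z Kz)).
    by apply: hc => // y [w /KT Tw <-]; exists w.
have uniq (n m : nat) w : Kn n w -> Kn m w -> L n w = L m w.
  move=> Kw Kw'; pose S := [set c : C | exists t : R, [/\ 0 <= t, t <= 1 & c = a + t%:C * (w - a)]].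
  have SK k c : Kn k w -> S c -> Kn k c by move=> kw [t [t0 t1 ->]]; exact: Kst.
  have [La LX Lc] := hL n; have [La' LX' Lc'] := hL m.
  apply: (@lift_uniq S X p (L n) (L m) a) => //.
  - apply: cconn_convex => _ _ t [t1 [h1 h2 ->]] [t2 [h3 h4 ->]] t0 t1'.
    exists (t1 + t * (t2 - t1)); split; [nra|nra|rewrite !(rmorphD,rmorphM,rmorphB) /=; ring].
  - by exists 0; split=> //; rewrite mul0r addr0.
  - by move=> z Sz; split; [exact: (LX z (SK _ _ Kw Sz)).1|exact: (LX' z (SK _ _ Kw' Sz)).1].
  - move=> z Sz; split=> e e0.
      by have [d d0 hd] := Lc z (SK _ _ Kw Sz) e e0; exists d => // w' Sw'; apply: hd; exact: SK.
    by have [d d0 hd] := Lc' z (SK _ _ Kw' Sz) e e0; exists d => // w' Sw'; apply: hd; exact: SK.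
  - by move=> z Sz; rewrite (LX z (SK _ _ Kw Sz)).2 (LX' z (SK _ _ Kw' Sz)).2.
  - by rewrite La La'.
  - by exists 1; split=> //; rewrite mul1r addrC subrK.
have loc w : T w -> exists n : nat, exists2 r : R, 0 < r & forall w', cmod (w' - w) < r -> Kn n w'.
  move=> Tw; have [r r0 hr] := oT w Tw.
  pose x := Num.max (cmod w + r) (2 / r).
  have x0' : 0 <= x by rewrite le_max; have := cmod_ge0 w; have -> : 0 <= cmod w + r by have := cmod_ge0 w; lra.
  have /andP[_ hx] := truncn_itv x0'; pose n := (Num.truncn x).+1.
  have nx : x < (N0 + n)%:R by apply: lt_le_trans hx _; rewrite ler_nat leq_addl.
  move: nx; rewrite gt_max => /andP[nx1 nx2].
  exists n, (r / 2); first by lra.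
  move=> w' ww'; split; first by have := cmod_sub w' w; lra.
  move=> b nb; have : r <= cmod (b - w) by rewrite leNgt; apply/negP => /hr.
  have : (N0 + n)%:R^-1 <= r / 2.
    by rewrite -[r / 2]invrK lef_pV2 ?posrE ?invr_gt0 // ?divr_gt0 // invf_div ltW.
  by have := cmod_tri3 b w' w; rewrite (cmodBC b w'); move: ((N0 + n)%:R^-1) => *; lra.
have /choice [n_ hn_] : forall w, exists n : nat, T w -> Kn n w.
  move=> w; have [Tw|n] := pselect (T w); last by exists 0%N.
  by have [n [r r0 hr]] := loc w Tw; exists n => _; apply: hr; rewrite subrr cmod0.
exists (fun w => L (n_ w) w); split.
- by have [] := hL (n_ a).
- by move=> w Tw; have [_ h _] := hL (n_ w); apply: h; exact: hn_.
- move=> w Tw e e0; have [n [r r0 hr]] := loc w Tw; have [_ _ Lc] := hL n.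
  have Kw : Kn n w by apply: hr; rewrite subrr cmod0.
  have [d d0 hd] := Lc w Kw e e0; exists (Num.min r d); first by rewrite lt_min r0.
  move=> w'; rewrite lt_min => /andP[/hr Kw' /(hd w' Kw')].
  by rewrite (uniq (n_ w') n w') ?(uniq (n_ w) n w) //; apply: hn_ => //; exact: KT Kw'.
Qed.

Lemma cexp_linj z : linj setT cexp z.
Proof.
exists 1 => // w1 w2 _ _ h1 h2; apply: cexp_inj.
have := cmod_tri3 w1 z w2; rewrite (cmodBC z); have := normIm (w1 - w2); rewrite cImB.
by have := @pi_ge2 R; rewrite mulr2n; lra.
Qed.

(** Periods bring [Im] into [[-pi, pi]]; the bound on [Re] comes from the bounds of the modulus on
    [Q] and the inequality [1 + x <= expR x]. *)
Lemma cexp_lcov Q : cclosed Q -> cbounded Q -> (forall y, Q y -> y != 0) -> lcov setT cexp Q.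
Proof.
move=> cQ [M QM] Q0.
have [[y0 Qy0]|nQ] := pselect (Q !=set0); last first.
  by exists 1; split=> // [x _ Qx|t t0]; [|exists 1 => // x _ Qx]; exfalso; apply: nQ; exists (cexp x).
have [q Qq hq] := @EVT_min R Q id cQ (ex_intro _ M QM) (ex_intro _ y0 Qy0) (fun z _ => @ccont_id R z).
have q0 : 0 < cmod q by rewrite cmod_gt0 Q0.
pose B := M + (cmod q)^-1; have q1 : 0 < (cmod q)^-1 by rewrite invr_gt0.
have M0 : 0 <= M by apply: le_trans (QM _ Qy0); exact: cmod_ge0.
apply: (@lcov_compact setT cexp Q [set x | `|Re x| <= B /\ `|Im x| <= pi] [set c | exists n, c = per n]) => //.
- by move=> z _; exists 1.
- exact: hol_cexp.
- by move=> x l _ h; rewrite (hasd_uniq h (hasd_cexp x)) cexp_neq0.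
- move=> z hz; split; apply: le_small => e /hz [w [w1 w2] wz].
    have := normRe (z - w); rewrite cReB (cmodBC z).
    by have := ler_normD (Re z - Re w) (Re w); rewrite subrK; lra.
  have := normIm (z - w); rewrite cImB (cmodBC z).
  by have := ler_normD (Im z - Im w) (Im w); rewrite subrK; lra.
- by exists (B + pi) => z [h1 h2]; have := cmod_ReIm z; lra.
- by move=> c w [n ->] _; split=> //; exact: cexpDper.
- by move=> c [n ->]; exists (- n); rewrite /per rmorphN /= mulNr rmorphN /= mulNr.
- move=> x _ Qx; have [w [Ew Iw _]] := cexp_surj (cexp_neq0 x).
  have [n En] := cexp_eq (esym Ew); exists (per n); first by exists n.
  rewrite /= -En; split=> //; rewrite En cReD Re_per addr0.
  have := hq _ Qx; have := QM _ Qx; rewrite /= cmod_cexp => h1 h2.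
  have h3 := expR_ge1Dx (Re x); have h4 := expR_ge1Dx (- Re x).
  have h5 : expR (- Re x) <= (cmod q)^-1 by rewrite expRN lef_pV2 ?posrE ?expR_gt0.
  by rewrite /B ler_norml; split_lra.
Qed.

Lemma log_uniq T (u v : C -> C) a : cconn T -> T a -> hol T u -> hol T v ->
  (forall z, T z -> cexp (u z) = cexp (v z)) -> u a = v a -> forall z, T z -> u z = v z.
Proof.
move=> cT Ta hu hv; apply: (@lift_uniq T setT cexp u v a cT Ta (fun z _ => cexp_linj z)) => // z Tz.
by split; apply: ccont_in; [exact: hol_cont hu Tz|exact: hol_cont hv Tz].
Qed.

Lemma hol_log T u : copen T -> (forall z w t, T z -> T w -> 0 <= t -> t <= 1 -> T (z + t%:C * (w - z))) ->
  hol T u -> (forall z, T z -> u z != 0) -> exists L : C -> C, hol T L /\ forall z, T z -> cexp (L z) = u z.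
Proof.
move=> oT cT hu u0; have [[a Ta]|n] := pselect (T !=set0); last first.
  by exists id; split=> z Tz; exfalso; apply: n; exists z.
have [x0 [E0 _ _]] := cexp_surj (u0 a Ta).
have [||L [La LX Lc]] := @lift_convex T u setT cexp a x0 oT cT Ta _ (fun x _ => cexp_linj x) _ I E0.
- by move=> w Tw; exact: hol_cont hu Tw.
- by move=> Q Qc Qb QT; apply: cexp_lcov => // y /QT [w Tw <-]; exact: u0.
exists L; split=> z Tz; last exact: (LX z Tz).2.
have [m hm] := hu z Tz; exists (m / cexp (L z)); apply: (lift_hasd (Lc z Tz) (hasd_cexp _) (cexp_neq0 _) hm).
by have [r r0 hr] := oT z Tz; exists r => // w /hr Tw; exact: (LX w Tw).2.
Qed.

Lemma convex_disc z w t : disc z -> disc w -> 0 <= t -> t <= 1 -> disc (z + t%:C * (w - z)).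
Proof. by move=> h1 h2 t0 t1; have := @convex_ball R 0 1 z w t; rewrite !subr0; apply. Qed.

Lemma log_disc : exists L : C -> C, hol disc L /\ forall w, disc w -> cexp (L w) = 1 - w.
Proof.
apply: (hol_log (@copen_disc R) convex_disc); first by apply: holB; [exact: hol_cst|exact: hol_id].
by move=> w; rewrite /disc /=; apply: contraTneq => /eqP; rewrite subr_eq0 => /eqP <-; rewrite cmod1 ltxx.
Qed.

Lemma copen_hp : copen (@hp R).
Proof.
move=> z hz; exists (Im z) => // w; have := normIm (w - z); rewrite cImB ler_norml /hp /mkset => /andP[]; lra.
Qed.

Lemma convex_hp z w t : hp z -> hp w -> 0 <= t -> t <= 1 -> hp (z + t%:C * (w - z)).
Proof. by rewrite /hp /mkset cImD cImMr cImB; nra. Qed.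

End Lifting.

(** * Uniformization of a disc minus a compact connected set *)

Section Annulus.
Context {R : realType}.
Local Notation C := R[i].
Implicit Types (u v f g h L K T : C -> C) (A B D s e d r t : R) (x y z w p q a b c l m : C) (O X Q E : set C).

(** At a point with nonzero derivative the image would contain values of modulus greater than 1. *)
Lemma hasd_open_lt1 O u z l : copen O -> hol O u -> (forall w, O w -> cmod (u w) <= 1) -> O z -> hasd u z l -> cmod (u z) = 1 -> l = 0.
Proof.
move=> oO hu u1 Oz hl E; apply/eqP; apply: contrapT => /negP l0.
have [rho [rho0 rO _ ho]] := local_homeo oO Oz hu hl l0.
have [d d0 hd] := ho rho rho0; have [|w wr Ew] := hd (u z * (1 + d / 2)%:C).
  rewrite rmorphD mulrDr mulr1 addrC addKr cmodM E mul1r cmod_real ger0_norm; lra.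
have := u1 w (rO w wr); rewrite Ew cmodM E mul1r cmod_real ger0_norm; lra.
Qed.

(** Schwarz for [h] and its inverse gives [cmod (h z) = cmod z]. The slope at 0 then has constant
    modulus 1, so its derivative is 0 by openness. *)
Lemma biholo_disc0 h g : biholo disc disc h g -> h 0 = 0 ->
  exists l, cmod l = 1 /\ forall z, disc z -> h z = l * z.
Proof.
move=> hb h0; have hb' := biholo_sym hb.
have [hh hg hK gK] := hb; have D0 : disc (0 : C) by rewrite /disc /= cmod0 ltr01.
have g0 : g 0 = 0 by rewrite -h0 (hK 0 D0).2.
have eqm z : disc z -> cmod (h z) = cmod z.
  move=> dz; have [dh gh] := hK z dz.
  have k1 : cmod (h z) <= cmod z by apply: schwarz => // w /hK [/ltW].
  have k2 : cmod (g (h z)) <= cmod (h z) by apply: (schwarz hg) => // w /gK [/ltW].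
  by rewrite gh in k2; apply/eqP; rewrite eq_le k1 k2.
have [l hl] := hh 0 D0; have hs := slope_hol copen_disc D0 hh hl.
have s1 z : disc z -> z != 0 -> cmod (slope h 0 l z) = 1.
  by move=> dz z0; rewrite slopeE // h0 !subr0 cmod_div eqm // divff // gt_eqF // cmod_gt0.
have l1 : cmod l = 1.
  apply/eqP; rewrite -subr_eq0 -normr_le0; apply: le_small => e e0.
  have [d d0 hd] := ccont_mod (hol_cont hs D0) e0.
  have [t [t0 td th]] := min_pos2 d0 (ltr01 : 0 < 1 :> R).
  have tn : cmod ((t / 2)%:C : C) = t / 2 by rewrite cmod_real ger0_norm //; lra.
  have := hd (t / 2)%:C; rewrite subr0 tn slope_bb s1.
  - by rewrite distrC => /(_ _) H; rewrite add0r; apply: ltW; apply: H; lra.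
  - by rewrite /disc /= tn; lra.
  - by rewrite -cmod_gt0 tn; lra.
have s1' z : disc z -> cmod (slope h 0 l z) = 1.
  by move=> dz; have [->|z0] := eqVneq z 0; [rewrite slope_bb|exact: s1].
have cs z : cmod (z - 0) < 1 -> slope h 0 l z = slope h 0 l 0.
  apply: hol_const0 => // w; rewrite subr0 => dw; have [m hm] := hs w dw.
  suff E : m = 0 by rewrite -{2}E.
  by apply: (hasd_open_lt1 copen_disc hs _ dw hm (s1' w dw)) => w' /s1' ->.
exists l; split=> // z dz; have := slopeM h 0 l z; rewrite cs ?subr0 //.
by rewrite slope_bb h0 !subr0 => <-.
Qed.

Lemma disc_auto T T' : biholo disc disc T T' -> exists a l, [/\ disc a, cmod l = 1 & forall z, disc z -> T z = l * mob a z].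
Proof.
move=> hT; have [hh hg hK gK] := hT; have D0 : disc (0 : C) by rewrite /disc /= cmod0 ltr01.
pose a := T' 0; have [da Ta] := gK 0 D0.
have [|l [l1 hl]] := biholo_disc0 (biholo_comp (mob_biholo (discN da)) hT).
  by rewrite mob0 opprK.
by exists a, l; split=> // z dz; rewrite -hl ?mobK //; exact: mob_disc.
Qed.

Lemma cmodi : cmod ('i : C) = 1.
Proof. exact: cmodI. Qed.

Lemma hpi : hp ('i : C).
Proof. by rewrite /hp /= ltr01. Qed.

Lemma conji : conjc ('i : C) = - 'i.
Proof. by apply: cplx_eq; rewrite /= ?oppr0. Qed.

Lemma i_neq0 : ('i : C) != 0.
Proof. by rewrite -cmod_gt0 cmodi ltr01. Qed.

Lemma cayley b : cmod b = 1 ->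
  biholo disc hp (fun z => 'i * (b + z) / (b - z)) (fun w => b * (w - 'i) / (w + 'i)).
Proof.
move=> b1; have b0 : b != 0 by rewrite -cmod_gt0 b1.
have nz z : disc z -> b - z != 0.
  by move=> dz; rewrite subr_eq0; apply/eqP => E; move: dz; rewrite /disc /= -E b1 ltxx.
have nw w : hp w -> w + 'i != 0.
  rewrite /hp /= => h; apply/eqP => E; have : Im (w + 'i) = 0 by rewrite E.
  by rewrite cImD /=; lra.
have i0 := i_neq0; have t0 : (2 : C) != 0 by rewrite pnatr_eq0.
split.
- apply: hol_div => //.
    by apply: holM; [exact: hol_cst|apply: holD; [exact: hol_cst|exact: hol_id]].
  by apply: holB; [exact: hol_cst|exact: hol_id].
- apply: hol_div => //.
    by apply: holM; [exact: hol_cst|apply: holB; [exact: hol_id|exact: hol_cst]].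
  by apply: holD; [exact: hol_id|exact: hol_cst].
- move=> z dz; have n := nz z dz.
  have E1 : 'i * (b + z) / (b - z) - 'i = 2 * 'i * z / (b - z) by field.
  have E2 : 'i * (b + z) / (b - z) + 'i = 2 * 'i * b / (b - z) by field.
  split; last by rewrite E1 E2; field; rewrite ?t0 ?b0 ?n ?i0.
  rewrite /hp /= -(hp_lt _ hpi) conji opprK E1 E2 !cmod_div !cmodM b1 mulr1.
  rewrite ltr_pM2r ?invr_gt0 ?cmod_gt0 // gtr_pMr //.
  by rewrite mulr_gt0 // cmod_gt0.
- move=> w hw; have n := nw w hw; split.
    rewrite /disc /= cmod_div cmodM b1 mul1r ltr_pdivrMr ?cmod_gt0 // mul1r.
    by have := hp_lt w hpi; rewrite conji opprK => ->.
  have E1 : b + b * (w - 'i) / (w + 'i) = 2 * b * w / (w + 'i) by field.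
  have E2 : b - b * (w - 'i) / (w + 'i) = 2 * b * 'i / (w + 'i) by field.
  by rewrite E1 E2; field; rewrite ?t0 ?b0 ?n ?i0.
Qed.

Lemma affine_hp a b : (forall z, hp z -> hp (a * z + b)) -> (forall z, hp z -> exists2 w, hp w & a * w + b = z) ->
  exists A B, [/\ 0 < A, a = A%:C & b = B%:C].
Proof.
move=> h1 h2; case: a h1 h2 => a1 a2; case: b => b1 b2.
rewrite -[complex.Complex a1 a2]/(a1 +i* a2) -[complex.Complex b1 b2]/(b1 +i* b2) => h1 h2.
have H (x y : R) : 0 < y -> 0 < a1 * y + a2 * x + b2.
  by move=> y0; have := h1 (x +i* y) y0; rewrite /hp /=.
have a20 : a2 = 0.
  apply/eqP; apply: contrapT => /negP n; have := H (- (a1 + b2) / a2) 1 ltr01.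
  by rewrite mulr1 mulrC divfK // addrAC subrr ltxx.
subst a2; have {}H (y : R) : 0 < y -> 0 < a1 * y + b2 by move=> y0; have := H 0 y y0; rewrite mul0r addr0.
have H2 (y : R) : 0 < y -> exists2 y', 0 < y' & a1 * y' + b2 = y.
  move=> y0; have [|[p q] /= hw E] := h2 (0 +i* y); first exact: y0.
  exists q; first exact: hw.
  by have := congr1 (@complex.Im R) E; rewrite /= mul0r addr0.
have b20 : 0 <= b2.
  rewrite leNgt; apply/negP => n; have [h|h] := leP a1 0; first by have := H 1 ltr01; lra.
  have : 0 < - b2 / a1 by rewrite divr_gt0 //; lra.
  by move/H; rewrite mulrC divfK ?gt_eqF // addNr ltxx.
have a10 : 0 <= a1.
  rewrite leNgt; apply/negP => n; have : 0 < (b2 + 1) / - a1 by rewrite divr_gt0 //; lra.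
  by move/H; rewrite invrN mulrN mulrN mulrC divfK ?lt_eqF //; lra.
have b2z : b2 = 0.
  apply/eqP; rewrite eq_le b20 andbT leNgt; apply/negP => n.
  have [|y y0 E] := H2 (b2 / 2); first lra.
  by have := mulr_ge0 a10 (ltW y0); lra.
subst b2; exists a1, b1; split=> //.
rewrite lt_neqAle a10 andbT eq_sym; apply/eqP => E.
by have [y y0] := H2 1 ltr01; rewrite E mul0r addr0 => /eqP; rewrite eq_sym oner_eq0.
Qed.

Lemma quadratic_root a b c : a != 0 -> exists z w, [/\ a * z ^+ 2 + b * z + c = 0, a * w ^+ 2 + b * w + c = 0 & a * (z * w) = c].
Proof.
move=> a0; have [s E] := @root_ex R (b ^+ 2 - 4 * a * c).
have t0 : (2 : C) != 0 by rewrite pnatr_eq0.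
have key z : (2 * a * z + b) ^+ 2 = b ^+ 2 - 4 * a * c -> a * z ^+ 2 + b * z + c = 0.
  move=> H; apply: (mulfI (mulf_neq0 (mulf_neq0 t0 t0) a0)); rewrite mulr0.
  have -> : 2 * 2 * a * (a * z ^+ 2 + b * z + c) = (2 * a * z + b) ^+ 2 - (b ^+ 2 - 4 * a * c) by ring.
  by rewrite H subrr.
exists ((- b + s) / (2 * a)), ((- b - s) / (2 * a)); split.
- by apply: key; rewrite -E; field; rewrite a0.
- by apply: key; rewrite -E; field; rewrite a0.
- have -> : a * ((- b + s) / (2 * a) * ((- b - s) / (2 * a))) = (b ^+ 2 - s ^+ 2) / (4 * a) by field; rewrite a0.
  by rewrite E; field; rewrite a0.
Qed.

(** The fixed points are roots of a quadratic equation, with product of modulus 1. None lies in the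
    disc, so a root [b] lies on the circle, and the Cayley map sending [b] to infinity turns [T]
    into an affine map. *)
Lemma auto_fixfree T T' : biholo disc disc T T' -> (forall z, disc z -> T z != z) ->
  exists K K' A B, [/\ biholo disc hp K K', 0 < A & forall z, disc z -> K (T z) = A%:C * K z + B%:C].
Proof.
move=> hT nf; have [a [l [da l1 hl]]] := disc_auto hT.
have a0 : a != 0.
  have D0 : disc (0 : C) by rewrite /disc /= cmod0 ltr01.
  by apply: contraNneq (nf 0 D0) => E; rewrite hl // E mob0 oppr0 mulr0.
have ca0 : conjc a != 0 by rewrite conjc_eq0.
have [z1 [z2 [E1 E2 E3]]] := quadratic_root (l - 1) (- (l * a)) ca0.
have nd z : conjc a * z ^+ 2 + (l - 1) * z + - (l * a) = 0 -> ~ disc z.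
  move=> E dz; have /eqP := nf z dz; apply; have n := conjM1 da dz.
  rewrite hl // /mob; apply: (mulIf n); rewrite mulrA divfK //; apply/eqP; rewrite -subr_eq0.
  rewrite (_ : _ - _ = conjc a * z ^+ 2 + (l - 1) * z + - (l * a)); last by ring.
  by rewrite E.
have m1 : cmod z1 * cmod z2 = 1.
  have ap := cmod_neq0 a0; have := congr1 (@cmod R) E3; rewrite cmodM cmod_conj cmodN !cmodM l1 mul1r.
  by move/(canRL (mulKf (lt0r_neq0 ap))) => ->; rewrite mulVf // gt_eqF.
have n1 : 1 <= cmod z1 by rewrite leNgt; apply/negP; exact: nd.
have n2 : 1 <= cmod z2 by rewrite leNgt; apply/negP; exact: nd.
have b1 : cmod z1 = 1 by apply/eqP; rewrite eq_le n1 andbT; nra.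
pose b := z1; have Kb := cayley b1; have [hK hK' KK KK'] := Kb.
pose K z := 'i * (b + z) / (b - z); pose K' w := b * (w - 'i) / (w + 'i).
have b0 : b != 0 by rewrite -cmod_gt0 b1.
have nz z : disc z -> b - z != 0.
  by move=> dz; rewrite subr_eq0; apply/eqP => E; move: dz; rewrite /disc /= -E b1 ltxx.
have i0 := i_neq0; have t0 : (2 : C) != 0 by rewrite pnatr_eq0.
have q0 : conjc a * b + l != 0.
  rewrite addr_eq0; apply/eqP => /(congr1 (@cmod R)); rewrite cmodN l1 cmodM b1 mulr1 cmod_conj => E.
  by move: da; rewrite /disc /= E ltxx.
have [q Eq] : exists q, q = conjc a * b + l by eexists.
rewrite -Eq in q0.
pose A' := l * (b - a) / (b * q); pose B' := 'i * (b - l * a - b * l + conjc a * b ^+ 2) / (2 * b * q).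
have KT z : disc z -> K (T z) = A' * K z + B'.
  move=> dz; have n := conjM1 da dz; have n' := nz z dz.
  have E4 : b - T z = (b - z) * q / (1 - conjc a * z).
    rewrite hl // /mob; apply: (mulIf n); rewrite divfK // mulrBl mulrA divfK //.
    rewrite (_ : b * _ - _ = (b - z) * q - (conjc a * b ^+ 2 + (l - 1) * b + - (l * a))); last by rewrite Eq; ring.
    by rewrite E1 subr0.
  pose X := b * (1 - conjc a * z) + l * (z - a).
  have E5 : b + T z = X / (1 - conjc a * z).
    by rewrite hl // /mob; apply: (mulIf n); rewrite divfK // mulrDl mulrA divfK.
  have E6 : X = (2 * l * (b - a) * (b + z) + (b - l * a - b * l + conjc a * b ^+ 2) * (b - z)) / (2 * b).
    apply: (mulIf (mulf_neq0 t0 b0)); rewrite divfK ?mulf_neq0 //.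
    rewrite (_ : X * _ = 2 * l * (b - a) * (b + z) + (b - l * a - b * l + conjc a * b ^+ 2) * (b - z)
       - (b + z) * (conjc a * b ^+ 2 + (l - 1) * b + - (l * a))); last by rewrite /X; ring.
    by rewrite E1 mulr0 subr0.
  rewrite /K E4 E5 E6 /A' /B' /K.
  by field; rewrite ?n ?q0 ?b0 ?n'.
exists K, K'.
have [||A [B [A0 EA EB]]] := @affine_hp A' B'.
- move=> z hz; have [d1 k1] := KK' z hz; rewrite -[X in A' * X]k1 -/(K _) -KT //.
  by apply: (KK _ _).1; have [_ _ h _] := hT; exact: (h _ d1).1.
- move=> z hz; have [d1 k1] := KK' z hz; have [_ _ _ h] := hT; have [d2 k2] := h _ d1.
  by exists (K (T' (K' z))); [exact: (KK _ d2).1|rewrite -KT // k2].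
exists A, B; split=> //.
by move=> z dz; rewrite KT // EA EB.
Qed.

Inductive chain E e y : C -> Prop :=
| chain_refl : E y -> chain E e y y
| chain_step z w : E z -> cmod (z - w) < e -> chain E e y w -> chain E e y z.

Definition chainc E := forall e z w, 0 < e -> E z -> E w -> chain E e z w.

Lemma cexp_open e : 0 < e -> exists2 d : R, 0 < d & forall q, cmod (q - 1) < d -> exists2 h : C, cmod h < e & cexp h = q.
Proof.
move=> e0; have B0 : cmod (0 - 0 : C) < 1 by rewrite subrr cmod0.
have [rh [rh0 _ _ ho]] := local_homeo (@copen_ball R 0 1) B0 (@hol_cexp R _) (@hasd_cexp R 0) (cexp_neq0 0).
have [d d0 hd] := ho _ e0; rewrite cexp0 in hd; exists d => // q /hd [h]; rewrite subr0 => *.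
by exists h.
Qed.

Lemma cclosedC E z : cclosed E -> ~ E z -> exists2 r : R, 0 < r & forall w, cmod (w - z) < r -> ~ E w.
Proof.
move=> cE nE; apply: contrapT => hn; apply: nE; apply: cE => e e0.
apply: contrapT => hk; apply: hn; exists e => // w we Ew; apply: hk.
by exists w.
Qed.

Lemma perD (n k : int) : per (n + k) = per n + per k :> C.
Proof. by rewrite /per intrD mulrDl rmorphD mulrDl. Qed.

Lemma per_iter X L c : (forall w n, X w -> X (w + per n)) -> (forall w, X w -> L (w + per 1) = L w + c) ->
  forall w (n : int), X w -> L (w + per n) = L w + n%:~R * c.
Proof.
move=> Xp h.
have H (k : nat) w : X w -> L (w + per k) = L w + k%:R * c.
  elim: k => [|k IH] Xw; first by rewrite /per mul0r mul0r addr0 mul0r addr0.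
  rewrite -addn1 PoszD perD addrA h; last exact: Xp.
  by rewrite IH // natrD mulrDl mul1r addrA.
move=> w [k|k] Xw; first by rewrite -pmulrn H.
have := H k.+1 (w + per (Negz k)) (Xp _ _ Xw).
rewrite -addrA -perD NegzE addNr /per mul0r mul0r addr0 => ->.
by rewrite (_ : (- k.+1%:Z)%:~R * c = - (k.+1%:R * c)) ?addrK // mulrNz mulNr -pmulrn.
Qed.

Lemma mid_ex (r : R) : 0 < r -> r < 1 -> exists x : R, [/\ 0 < x, r < x & x < 1].
Proof. by move=> r0 r1; exists ((1 + r) / 2); split; lra. Qed.

Lemma sgz_norm (x : R) (n : int) : (sgz x * n)%:~R * x = n%:~R * `|x| /\ (sgz x * n)%:~R * `|x| = n%:~R * x.
Proof.
case: (ltrgtP x 0) => [h|h|->]; last by rewrite normr0 !mulr0.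
- by rewrite ltr0_sgz // ltr0_norm // mulN1r mulrNz; split; ring.
- by rewrite gtr0_sgz // gtr0_norm // mul1r.
Qed.

Lemma cint_real (n : int) (x : R) : (n%:~R : C) * x%:C = (n%:~R * x)%:C.
Proof. by rewrite rmorphM /= (rmorph_int (@real_complex R)). Qed.

Section CylinderOfDisc.
Variables (E : set C) (rho : R).
Hypotheses (cE : cclosed E) (rho0 : 0 < rho) (rho1 : rho < 1) (Erho : forall z, E z -> cmod z <= rho)
  (E0 : E 0) (E1 : exists2 z, E z & z != 0) (chE : chainc E)
  (cA : cconn [set z | disc z /\ ~ E z]).
Let A0 := [set z | disc z /\ ~ E z].
(** The logarithmic cover of the annulus [A0], with deck group generated by [per 1]. It is connected
    and [full], so the Riemann mapping applies to it. *)
Let At := [set w : C | A0 (cexp w)].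

Lemma copen_A0 : copen A0.
Proof.
move=> z [dz nz]; have [r r0 hr] := cclosedC cE nz; have [s s0 hs] := copen_disc dz.
exists (Num.min r s); first by rewrite lt_min r0.
by move=> w; rewrite lt_min => /andP[/hr ? /hs ?].
Qed.

Lemma A0_neq0 z : A0 z -> z != 0.
Proof. by move=> [_ n]; apply: contra_notN n => /eqP ->. Qed.

Lemma At_Re w : At w -> Re w < 0.
Proof. by move=> [+ _]; rewrite /disc /= cmod_cexp => h; rewrite -(ltr_expR) expR0. Qed.

Lemma copen_At : copen At.
Proof.
move=> w Aw; have [r r0 hr] := copen_A0 Aw; have [d d0 hd] := hasd_cont (hasd_cexp w) r0.
by exists d => // w' /hd /hr.
Qed.

Lemma At_per w n : At w -> At (w + per n).
Proof. by rewrite /At /= cexpDper. Qed.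

Lemma At_img z : A0 z -> exists2 w, At w & cexp w = z.
Proof. by move=> Az; have [w [Ew _ _]] := cexp_surj (A0_neq0 Az); exists w; rewrite /At /= ?Ew. Qed.

(** A point of the right half-plane marches to the right. A logarithm of a point of [E] follows
    logarithms along a chain in [E] towards 0, until its real part falls below [- B]. *)
Lemma full_At : full At.
Proof.
move=> a e B na e0.
have right (k : nat) b : ~ At b -> 0 <= Re b -> B < Re b + k%:R * (e / 2) -> echain At e B b.
  elim: k b => [|k IH] b nb rb; first by rewrite mul0r addr0 => h; apply: echain_far => //; apply: lt_le_trans h _; have := normRe b; have := ler_norm (Re b); lra.
  move=> h; apply: (@echain_step _ _ _ _ b (b + (e / 2)%:C)) => //.
    by rewrite opprD addNKr cmodN cmod_real ger0_norm; lra.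
  apply: IH; [by move=> /At_Re; rewrite cReD /=; lra|rewrite cReD /=; lra|].
  by rewrite cReD /=; move: h; rewrite -natr1; lra.
have [ra|ra] := leP 0 (Re a).
  have [k hk] : exists k : nat, B < Re a + k%:R * (e / 2).
    exists (Num.truncn (Num.max 0 (B / (e / 2)))).+1.
    have := truncn_itv (_ : 0 <= Num.max 0 (B / (e / 2))); rewrite le_max lexx => /(_ isT) /andP[_].
    by rewrite gt_max => /andP[_]; rewrite ltr_pdivrMr; lra.
  exact: right hk.
have Ea : E (cexp a).
  apply: contrapT => n; apply: na; split=> //.
  by rewrite /disc /= cmod_cexp -expR0 ltr_expR.
pose r0 := expR (- B); have r00 : 0 < r0 := expR_gt0 _.
have [d d0 hd] := cexp_open e0.
(* A step below [d * r0] changes a point of modulus at least [r0] by a ratio within [d] of 1, hence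
   its logarithm by less than [e]. *)
have ch := chE (mulr_gt0 d0 r00) E0 Ea.
have : forall b, cexp b = cexp a -> echain At e B b; last by apply.
elim: ch => [_ b Eb|z w Ez zw _ IH b Eb]; first by have := cexp_neq0 b; rewrite Eb eqxx.
have nb : ~ At b by rewrite /At /= Eb => -[].
have [zr|zr] := ltP (cmod z) r0.
  apply: echain_far => //; move: zr; rewrite -Eb cmod_cexp /r0 ltr_expR => h.
  by have := normRe b; have := ler_norm (- Re b); rewrite normrN; lra.
have z0 : z != 0 by rewrite -cmod_gt0; exact: lt_le_trans zr.
have [|h h1 h2] := hd (w / z).
  rewrite (_ : _ - 1 = (w - z) / z); last by field.
  rewrite cmod_div ltr_pdivrMr ?cmod_gt0 // cmodBC; apply: lt_le_trans zw _.
  by apply: ler_wpM2l => //; exact: ltW.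
apply: (@echain_step _ _ _ _ b (b + h)) => //; first by rewrite opprD addNKr cmodN.
by apply: IH; rewrite cexpD Eb h2 mulrC divfK.
Qed.

(** Descent to [A0]: the points all of whose logarithms lie in [Q] form a clopen set, since small
    discs carry branches of the logarithm. It meets the ring near the circle, so it is everything by
    [cA]. *)
Lemma At_clopen (Q : set C) :
  (forall z, At z -> Q z -> exists2 r, 0 < r & forall w, At w -> cmod (w - z) < r -> Q w) ->
  (forall z, At z -> ~ Q z -> exists2 r, 0 < r & forall w, At w -> cmod (w - z) < r -> ~ Q w) ->
  (forall s : C, ln rho < Re s < 0 -> Q s) -> forall w, At w -> Q w.
Proof.
move=> Qo Qc QS w Aw.
have loc z : A0 z -> exists2 r : R, 0 < r & forall z', cmod (z' - z) < r ->
    (forall w, cexp w = z -> Q w) <-> (forall w, cexp w = z' -> Q w).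
  move=> Az; have [r r0 hr] := copen_A0 Az; exists r => // z' zz'.
  pose Bl := [set x : C | cmod (x - z) < r].
  have zz : Bl z by rewrite /Bl /= subrr cmod0.
  have [L [hL EL]] := @hol_log R Bl id (@copen_ball R z r) (@convex_ball R z r) (@hol_id R _) (fun x hx => A0_neq0 (hr x hx)).
  have AL x n : Bl x -> At (L x + per n).
    by move=> hx; apply: At_per; rewrite /At /= EL //; exact: hr.
  have Lo x n e : Bl x -> 0 < e -> exists2 d : R, 0 < d & forall y, Bl y -> cmod (y - x) < d -> cmod (L y + per n - (L x + per n)) < e.
    move=> hx e0; have [d d0 hd] := hol_cont hL hx e0; exists d => // y _ /hd.
    by rewrite opprD addrACA subrr addr0.
  have H n x y : Bl x -> Bl y -> Q (L x + per n) -> Q (L y + per n).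
    move=> hx hy Qx; apply: (@cconn_ball R z r [set x | Q (L x + per n)]) => //.
    - by exists x.
    - move=> p hp Qp; have [s s0 hs] := Qo _ (AL p n hp) Qp; have [d d0 hd] := Lo p n s hp s0.
      by exists d => // p' hp' pp; apply: hs; [exact: AL|exact: hd].
    - move=> p hp Qp; have [s s0 hs] := Qc _ (AL p n hp) Qp; have [d d0 hd] := Lo p n s hp s0.
      by exists d => // p' hp' pp; apply: hs; [exact: AL|exact: hd].
  have G x y : Bl x -> Bl y -> (forall w, cexp w = x -> Q w) -> forall w, cexp w = y -> Q w.
    move=> hx hy k w' Ew'; have [n ->] := cexp_eq (etrans (EL y hy) (esym Ew')).
    by apply: (H n x) => //; apply: k; rewrite cexpDper EL.
  by split; exact: G.
suff : forall z, A0 z -> forall w, cexp w = z -> Q w by move=> h; exact: (h _ Aw).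
apply: (cA (A := [set z | forall w, cexp w = z -> Q w])).
- have [x [x0 x1 x2]] := mid_ex rho0 rho1.
  have xm : cmod (x%:C : C) = x by rewrite cmod_real ger0_norm // ltW.
  exists x%:C; first by split; [rewrite /disc /= xm|move=> /Erho; rewrite xm leNgt x1].
  move=> w' Ew'; apply: QS; have := cmod_cexp w'; rewrite Ew' xm => E'.
  rewrite -ltr_expR lnK ?posrE // -E' x1 /=.
  by rewrite -ltr_expR -E' expR0.
- move=> z Az Wz; have [r r0 hr] := loc z Az; exists r => // y _ yz.
  by apply/(hr y yz).
- move=> z Az Wz; have [r r0 hr] := loc z Az; exists r => // y _ yz Wy.
  by apply: Wz; apply/(hr y yz).
Qed.

Lemma S_At (s : C) : ln rho < Re s < 0 -> At s.
Proof.
move=> /andP[h1 h2]; split.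
  by rewrite /disc /= cmod_cexp -expR0 ltr_expR.
move=> /Erho; rewrite cmod_cexp leNgt => /negP; apply.
by rewrite -[rho]lnK ?posrE // ltr_expR.
Qed.

Lemma cconn_S : cconn [set s : C | ln rho < Re s < 0].
Proof.
apply: cconn_convex => x y t /andP[x1 x2] /andP[y1 y2] t0 t1; rewrite /mkset cReD cReM cReB /= mul0r subr0.
by have [h|h] := ltP t (1 / 2); apply/andP; split; nra.
Qed.

(** The strip over the ring [rho < cmod z < 1] is connected, so it lies in [Q] or in its complement;
    [At_clopen] then applies to that one. *)
Lemma cconn_At : cconn At.
Proof.
move=> Q [z Az Qz] Qo Qc w Aw.
pose S := [set s : C | ln rho < Re s < 0]; have cS : cconn S := cconn_S.
have lr : ln rho < 0 by rewrite ln_lt0 // rho0.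
pose s0 : C := (ln rho / 2)%:C.
have Ss0 : S s0 by rewrite /S /=; split_lra.
have [Qs|nQs] := pselect (Q s0).
  apply: (@At_clopen Q) => // s Ss; apply: (cS Q) => //; first by exists s0.
    by move=> x /S_At Ax Qx; have [r r0 hr] := Qo x Ax Qx; exists r => // y /S_At; exact: hr.
  by move=> x /S_At Ax Qx; have [r r0 hr] := Qc x Ax Qx; exists r => // y /S_At; exact: hr.
exfalso; suff : (~` Q) z by apply.
apply: (@At_clopen (~` Q)) => //.
  by move=> x Ax /contrapT Qx; have [r r0 hr] := Qo x Ax Qx; exists r => // y Ay yx; apply; exact: hr.
move=> s Ss; apply: (cS (~` Q)) => //; first by exists s0.
  by move=> x /S_At Ax Qx; have [r r0 hr] := Qc x Ax Qx; exists r => // y /S_At; exact: hr.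
by move=> x /S_At Ax /contrapT Qx; have [r r0 hr] := Qo x Ax Qx; exists r => // y /S_At Ay yx; apply; exact: hr.
Qed.

Lemma At_riemann : exists f g, biholo At disc f g.
Proof.
have lr : ln rho < 0 by rewrite ln_lt0 // rho0.
have As0 : At (ln rho / 2)%:C by apply: S_At => /=; split_lra.
have n1 w : At w -> w - 1 != 0.
  by move=> /At_Re h; rewrite subr_eq0; apply/eqP => Ew; move: h; rewrite Ew /= ltr10.
have [||| f [g [h _]]] := @riemann_mapping R At (fun w => (w + 1) / (w - 1)) _ copen_At cconn_At (full_sqrt copen_At full_At) As0; last by exists f, g.
- by apply: hol_div => //; [apply: holD|apply: holB]; try exact: hol_id; exact: hol_cst.
- move=> w Aw; rewrite /disc /= cmod_div ltr_pdivrMr ?cmod_gt0 ?n1 // mul1r cmod_lt_sqr.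
  by rewrite !cmod_sqr !(cReD, cReB, cImD, cImB) /=; have := At_Re Aw; nra.
- move=> z w Az Aw; have nz := n1 z Az; have nw := n1 w Aw => /eqP.
  rewrite eqr_div // -subr_eq0 (_ : _ - _ = 2 * (w - z)); last by ring.
  by rewrite mulf_eq0 pnatr_eq0 /= subr_eq0 => /eqP ->.
Qed.

(** The deck translation becomes a disc automorphism without fixed points, hence an affine map of
    the half-plane. *)
Lemma At_halfplane : exists th ka A B, [/\ biholo At hp th ka, 0 < A & forall w, At w -> th (w + per 1) = A%:C * th w + B%:C].
Proof.
have [f [g fg]] := At_riemann; have [hf hg fK gK] := fg.
pose T z := f (g z + per 1); pose T' z := f (g z + per (- 1)).
have Tb : biholo disc disc T T'.
  have hT n : hol disc (fun z => f (g z + per n)).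
    apply: (hol_comp (O' := At) (u := fun z => g z + per n)) hf.
      by move=> z /gK [h _]; exact: At_per.
    by apply: holD => //; exact: hol_cst.
  have inv n z : disc z -> disc (f (g z + per n)) /\ f (g (f (g z + per n)) + per (- n)) = z.
    move=> /gK [Ag fg']; have [d1 E'] := fK _ (At_per n Ag); split=> //.
    by rewrite E' -addrA -perD subrr /per mul0r mul0r addr0.
  by split; [exact: hT|exact: hT|exact: inv|move=> z; have := inv (-1) z; rewrite opprK].
have per1 : per 1 != 0 :> C.
  by apply/eqP => /(congr1 (@complex.Im R)); rewrite Im_per mul1r /= => /eqP; rewrite gt_eqF // mulrn_wgt0 // pi_gt0.
have nf z : disc z -> T z != z.
  move=> dz; apply/eqP => /(congr1 g); have [Ag E'] := gK z dz.
  rewrite /T (fK _ (At_per 1 Ag)).2 => /eqP; rewrite -subr_eq0 addrC addKr; exact/negP.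
have [K [K' [A [B [Kb A0' KT]]]]] := auto_fixfree Tb nf.
have kk := biholo_comp fg Kb.
exists (fun w => K (f w)), (fun z => g (K' z)), A, B; split=> // w Aw.
by have := KT _ (fK w Aw).1; rewrite {1}/T (fK w Aw).2.
Qed.

Definition cyl (X : set C) (dx dy : R) := exists phi : C -> C,
  [/\ hol (strip dy) phi, forall w, strip dy w -> X (phi w), forall z, X z -> exists2 w, strip dy w & phi w = z &
   forall w w', strip dy w -> strip dy w' -> (phi w = phi w' <-> exists n : int, w' = w + (n%:~R * dx)%:C)].

Lemma strip_shift (dy t : R) w : strip dy w -> strip dy (w + t%:C).
Proof. by rewrite /strip /= cImD /= addr0. Qed.

(** Hyperbolic case: centred at the fixed point [be] the deck map is multiplication by [A], and the
    logarithm makes it translation by [ln A] in the strip of height [pi]. *)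
Lemma ratio_cyl th ka A B : biholo At hp th ka -> 0 < A -> A != 1 ->
  (forall w, At w -> th (w + per 1) = A%:C * th w + B%:C) -> exists2 dx, 0 < dx & cyl A0 dx pi.
Proof.
move=> tk A0' A1 thA; have [lg [_ hlg lgE Elg]] := @log_hp R; have [hth hka tkK ktK] := tk.
have A1' : 1 - A != 0 by rewrite subr_eq0 eq_sym.
pose be := B / (1 - A).
have hb z : hp z -> hp (z - be%:C) by rewrite /hp /= cImB /= subr0.
have hb' z : hp z -> hp (z + be%:C) by rewrite /hp /= cImD /= addr0.
pose la w := lg (th w - be%:C); pose ka' x := ka (cexp x + be%:C).
have hla : hol At la.
  apply: (hol_comp (O' := hp) (u := fun w => th w - be%:C)) hlg.
    by move=> w /tkK [/hb].
  by apply: holB => //; exact: hol_cst.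
have hka' : hol (strip pi) ka'.
  apply: (hol_comp (O' := hp) (u := fun w => cexp w + be%:C)) hka.
    by move=> w /hp_cexp /hb'.
  by apply: holD; [exact: hol_cexp|exact: hol_cst].
have laS w : At w -> strip pi (la w) /\ ka' (la w) = w.
  move=> /tkK [/hb h E']; have [h1 h2] := Elg _ h; split=> //.
  by rewrite /ka' /la h2 subrK.
have kaS x : strip pi x -> At (ka' x) /\ la (ka' x) = x.
  move=> sx; have h := hp_cexp sx; have [h1 h2] := ktK _ (hb' _ h); split=> //.
  by rewrite /la /ka' h2 addrK (lgE x sx).2.
have la1 w : At w -> la (w + per 1) = la w + (ln A)%:C.
  move=> Aw; have [s1 _] := laS _ Aw; have [s2 _] := laS _ (At_per 1 Aw).
  have E' : cexp (la (w + per 1)) = cexp (la w + (ln A)%:C).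
    rewrite cexpD /la (Elg _ (hb _ (tkK _ (At_per 1 Aw)).1)).2 (Elg _ (hb _ (tkK _ Aw).1)).2 thA //.
    have -> : cexp (ln A)%:C = A%:C.
      by apply: cplx_eq; rewrite ?Re_cexp ?Im_cexp /= lnK ?posrE // ?cos0 ?sin0 ?mulr1 ?mulr0.
    have -> : B%:C = (1 - A)%:C * be%:C by rewrite -rmorphM /= /be mulrC divfK.
    by rewrite rmorphB /=; ring.
  by rewrite -(lgE _ s2).2 E' (lgE _ (strip_shift _ s1)).2.
have lan := per_iter At_per la1.
have lA : ln A != 0.
  by apply: contra_neq A1 => E'; rewrite -[A]lnK ?posrE // E' expR0.
exists `|ln A|; first by rewrite normr_gt0.
exists (fun x => cexp (ka' x)); split.
- by apply: hol_comp (@hol_cexp R setT) => //.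
- by move=> x /kaS [].
- by move=> z /At_img [w Aw <-]; have [s1 E'] := laS w Aw; exists (la w); rewrite ?E'.
- move=> x y sx sy; have [Ax Ex] := kaS x sx; have [Ay Ey] := kaS y sy.
  split=> [/cexp_eq [n E']|[n E']].
    exists (sgz (ln A) * n); rewrite (sgz_norm _ n).2 -cint_real.
    by rewrite -Ey E' lan // Ex.
  have : ka' y = ka' x + per (sgz (ln A) * n).
    have := lan _ (sgz (ln A) * n) Ax; rewrite Ex cint_real (sgz_norm _ n).1 -E' => E3.
    by rewrite -E3 (laS _ (At_per _ Ax)).2.
  by move=> ->; rewrite cexpDper.
Qed.

(** [M] is a logarithm of [cexp (ka z)] seen from [q]. Over the ring it agrees, up to a period, with
    the explicit [N], so its increment is one period whichever point [q] of [E] is taken. *)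
Lemma winding_log th ka B q : biholo At hp th ka -> (forall w, At w -> th (w + per 1) = th w + B%:C) -> E q ->
  exists M, [/\ hol hp M, forall z, hp z -> A0 (cexp (ka z)) /\ cexp (M z) = mob q (cexp (ka z)) &
    forall z, hp z -> M (z + B%:C) = M z + per 1].
Proof.
move=> tk thB Eq; have [hth hka tkK ktK] := tk; have Dq : disc q := le_lt_trans (Erho Eq) rho1.
have Bh z : hp z -> hp (z + B%:C) by rewrite /hp /= cImD /= addr0.
have AK z : hp z -> A0 (cexp (ka z)) by move=> /ktK[].
have [||M [hM EM]] := hol_log copen_hp convex_hp (u := fun z => mob q (cexp (ka z))).
- apply: (hol_comp (O' := disc) (u := fun z => cexp (ka z))) (mob_hol Dq); first by move=> z /AK[].
  exact: (hol_comp (O' := setT)) hka (@hol_cexp R setT).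
- move=> z /AK[Dz nE]; rewrite /mob mulf_neq0 ?invr_eq0 ?conjM1 // subr_eq0.
  by apply/eqP => e; apply: nE; rewrite e.
exists M; split=> // [z hz|]; first by split; [exact: AK|exact: EM].
pose S := [set s : C | ln rho < Re s < 0]; have [L [hL EL]] := @log_disc R.
have SD w : S w -> disc (q / cexp w) /\ disc (conjc q * cexp w).
  move=> /andP[w1 w2]; have := Erho Eq; have := cmod_ge0 q.
  have : rho < cmod (cexp w) by rewrite cmod_cexp -[rho]lnK ?posrE // ltr_expR.
  have : cmod (cexp w) < 1 by rewrite cmod_cexp -expR0 ltr_expR.
  move=> a1 a2 q0 q1; rewrite /disc /= cmod_div ltr_pdivrMr ?cmodM ?cmod_conj; last lra.
  by split; nra.
have ne w : cexp w != 0 :> C by exact: cexp_neq0.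
(* [mob q (cexp w)] factors as [cexp w * (1 - q / cexp w) / (1 - conjc q * cexp w)], and the
   logarithms of the last two factors are periodic in [w]. *)
pose N w := w + L (q / cexp w) - L (conjc q * cexp w).
have hN : hol S N.
  apply: holB; first apply: holD; first exact: hol_id.
    by apply: (hol_comp (u := fun w => q / cexp w) _ _ hL) => [w /SD[]//|]; apply: hol_div => //; [exact: hol_cst|exact: hol_cexp].
  by apply: (hol_comp (u := fun w => conjc q * cexp w) _ _ hL) => [w /SD[]//|]; apply: holM; [exact: hol_cst|exact: hol_cexp].
have EN w : S w -> cexp (N w) = mob q (cexp w).
  by move=> /SD[d1 d2]; rewrite /N cexpB cexpD !EL // /mob mulrBr mulr1 mulrCA divff // mulr1.
have lr : ln rho < 0 by rewrite ln_lt0 // rho0.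
pose s0 : C := (ln rho / 2)%:C; have Ss0 : S s0 by rewrite /S /=; split_lra.
have Ss1 : S (s0 + per 1) by rewrite /S /mkset cReD Re_per addr0.
have MS w : S w -> cexp (N w) = cexp (M (th w)).
  by move=> Sw; have [hw e] := tkK w (S_At Sw); rewrite EN // EM // e.
have [k Ek] := cexp_eq (MS s0 Ss0).
have MN : forall w, S w -> M (th w) = N w + per k.
  apply: (log_uniq cconn_S Ss0); last exact: Ek.
  - by apply: (hol_comp (O' := hp) (u := th)) hM; [by move=> w /S_At/tkK[]|exact: hol_sub S_At hth].
  - by apply: holD => //; exact: hol_cst.
  - by move=> w Sw; rewrite cexpDper MS.
have A0s := S_At Ss0; have hs := (tkK _ A0s).1.
apply: (log_uniq (cconn_convex convex_hp) hs).
- by apply: (hol_comp (O' := hp) (u := fun z => z + B%:C)) hM => //; apply: holD; [exact: hol_id|exact: hol_cst].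
- by apply: holD => //; exact: hol_cst.
- move=> z hz; rewrite cexpDper !EM //; last exact: Bh.
  have [Aw e] := ktK z hz; have := thB _ Aw; rewrite e => <-.
  by rewrite (tkK _ (At_per 1 Aw)).2 cexpDper.
- by rewrite -thB // !MN // /N cexpDper; ring.
Qed.

(** Parabolic case. High up in the half-plane, translation by [B] is a hyperbolically short move,
    whereas [F] moves by [2 * pi]. Schwarz-Pick forces [Im (F z)] to be large, so [cexp (ka z)] is
    close to [q]. *)
Lemma cusp_limit th ka B q e : biholo At hp th ka -> (forall w, At w -> th (w + per 1) = th w + B%:C) -> E q -> 0 < e ->
  exists Y : R, forall y : R, 0 < y -> Y <= y -> cmod (mob q (cexp (ka (y%:C * 'i)))) < e.
Proof.
move=> tk thB Eq e0; have [M [hM EM MB]] := winding_log tk thB Eq.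
have Dq : disc q := le_lt_trans (Erho Eq) rho1.
have pi2 := @pi_ge2 R.
exists ((pi *+ 2 - ln e *+ 2) * `|B|) => y y0 yY; pose z : C := y%:C * 'i.
have hz : hp z by rewrite /hp /mkset /z cImMr /= mulr1.
have hzB : hp (z + B%:C) by rewrite /hp /mkset cImD /= addr0.
pose F z := - 'i * M z; have hF : hol hp F by apply: holM => //; exact: hol_cst.
have IF w : Im (F w) = - Re (M w) by rewrite /F cImM /=; ring.
have Fh w : hp w -> hp (F w).
  move=> hw; rewrite /hp /mkset IF oppr_gt0 -ltr_expR expR0 -cmod_cexp (EM w hw).2.
  by apply: mob_disc => //; exact: (EM w hw).1.1.
have FB : F (z + B%:C) = F z + (pi *+ 2)%:C.
  rewrite /F MB // mulrDr; congr (_ + _); rewrite /per mul1r.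
  by rewrite mulrCA mulNr -expr2 sqr_i opprK mulr1.
have := schwarz_pick_hp hF Fh hzB hz; rewrite FB !(addrC _ (_%:C)) addrK.
rewrite -/z -(EM z hz).2 cmod_cexp -[ltRHS]lnK ?posrE // ltr_expR.
rewrite (_ : B%:C + z - z = B%:C) ?addrK // !cmod_real ger0_norm; last by rewrite mulr2n; lra.
have h1 : y *+ 2 <= cmod (B%:C + z - conjc z).
  apply: le_trans (normIm _); apply: le_trans (ler_norm _).
  by rewrite cImB cImD cIm_conj /z cImMr /= mulr2n; lra.
have h2 : cmod ((pi *+ 2)%:C + F z - conjc (F z)) <= pi *+ 2 - Re (M z) *+ 2.
  apply: le_trans (cmod_ReIm _) _; rewrite cReB cImB cReD cImD cRe_conj cIm_conj IF /= add0r addrK opprK.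
  have := Fh z hz; rewrite /hp /mkset IF => k.
  by rewrite !ger0_norm; rewrite ?mulr2n; lra.
move=> k; rewrite ltNge; apply/negP => le; have := ler_pM _ _ (lexx (pi *+ 2)) h1.
have := normr_ge0 B; have := ler_wpM2r (normr_ge0 B) h2; move: k yY le; rewrite !mulr2n.
move: (cmod (B%:C + z - _)) (cmod (_ + F z - _)) (`|B|) (Re (M z)) (ln e) pi2 y0; clear=> a b c x l pi2 y0 k yY le h1 c0 h2.
have : (x + x) * c >= (l + l) * c by apply: ler_wpM2r => //; lra.
have := h2 (ltac:(lra)) (ltac:(lra)); have := ler_wpM2r (ltW y0) pi2.
lra.
Qed.

(** The limit along the imaginary axis would be both 0 and another point of [E]. *)
Lemma translation_absurd th ka B : biholo At hp th ka -> (forall w, At w -> th (w + per 1) = th w + B%:C) -> False.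
Proof.
move=> tk thB; have [q Eq q0] := E1; have qp := cmod_neq0 q0; have q4 : 0 < cmod q / 4 by lra.
have Dq : disc q := le_lt_trans (Erho Eq) rho1.
have [Y0 h0] := cusp_limit tk thB E0 q4; have [Y1 h1] := cusp_limit tk thB Eq q4.
pose y := `|Y0| + `|Y1| + 1; have y0 : 0 < y by rewrite ltr_wpDl // addr_ge0.
have := h0 y y0; have := h1 y y0; have := ler_norm Y0; have := ler_norm Y1.
have := normr_ge0 Y0; have := normr_ge0 Y1; rewrite -/y => a1 a2 a3 a4.
have [_ _ _ ktK] := tk; have [[Dx _] _] := ktK (y%:C * 'i) (ltac:(by rewrite /hp /mkset cImMr /= mulr1)).
move: (cexp _) Dx => x Dx /(_ ltac:(rewrite /y; lra)) k1 /(_ ltac:(rewrite /y; lra)).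
rewrite /mob conjc0 mul0r !subr0 divr1 => k0.
have : cmod (x - q) <= 2 * cmod (mob q x).
  have n := conjM1 Dq Dx; rewrite (_ : x - q = (1 - conjc q * x) * mob q x); last by rewrite /mob mulrCA divff ?mulr1.
  rewrite cmodM; apply: ler_wpM2r; first exact: cmod_ge0.
  apply: le_trans (cmodB _ _) _; rewrite cmod1 cmodM cmod_conj; move: Dq Dx; rewrite /disc /=.
  by have := cmod_ge0 q; have := cmod_ge0 x; nra.
by have := cmod_sub q x; rewrite (cmodBC q); rewrite /mob in k1 *; lra.
Qed.

Lemma cyl_exists : exists2 dx, 0 < dx & cyl A0 dx pi.
Proof.
have [th [ka [A [B [tk A0' thA]]]]] := At_halfplane.
have [EA|nA] := eqVneq A 1; last exact: ratio_cyl tk A0' nA thA.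
exfalso; apply: (translation_absurd (B := B) tk).
by move=> w Aw; rewrite thA // EA mul1r.
Qed.

End CylinderOfDisc.
End Annulus.

(** * Comparison of the modulus with an embedded cylinder *)

Section Moduli.
Context {R : realType}.
Local Notation C := R[i].
Implicit Types (u v h F L : C -> C) (M s e d r t : R) (x y z w p q a c l : C) (O X Q E : set C).

Lemma convex_strip (m : R) z w t : strip m z -> strip m w -> 0 <= t -> t <= 1 -> strip m (z + t%:C * (w - z)).
Proof.
rewrite /strip /mkset cImD cImM cImB /= mul0r addr0 => /andP[z1 z2] /andP[w1 w2] t0 t1.
move: (Im z) (Im w) z1 z2 w1 w2 => x y x1 x2 y1 y2; clear -t0 t1 x1 x2 y1 y2.
by have [h|h] := ltP t (1 / 2); apply/andP; split; nra.
Qed.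

Lemma cconn_strip (m : R) : cconn (@strip R m).
Proof. by apply: cconn_convex => z w t; exact: convex_strip. Qed.

Lemma half_scale (s t : R) : t != 0 -> s / t * (t / 2) = s / 2.
Proof. by move=> t0; field. Qed.

(** The hypothesis is Schwarz-Pick against the pair ['i], ['i * la], at hyperbolic distance [ln la];
    it bounds [ln mu] in absolute value by that distance, wherever [q] lies. *)
Lemma mobius_ratio (la mu : R) q : 1 < la -> 0 < mu -> q != 0 ->
  cmod (q * mu%:C - q) * (la + 1) <= cmod (q * mu%:C - conjc q) * (la - 1) -> mu <= la /\ mu^-1 <= la.
Proof.
move=> l1 mu0 q0; have qp := cmod_neq0 q0.
have -> : q * mu%:C - q = q * (mu - 1)%:C by rewrite rmorphB /=; ring.
rewrite cmodM cmod_real => h.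
have h2 : cmod (q * mu%:C - conjc q) <= cmod q * (mu + 1).
  by apply: le_trans (cmodB _ _) _; rewrite cmodM cmod_conj cmod_real gtr0_norm // mulrDr mulr1.
have h3 : cmod q * (`|mu - 1| * (la + 1)) <= cmod q * ((mu + 1) * (la - 1)).
  rewrite !mulrA; apply: (le_trans h); apply: ler_wpM2r => //; lra.
rewrite ler_pM2l // in h3.
have a1 := ler_norm (mu - 1); have a2 := ler_norm (- (mu - 1)); rewrite normrN in a2.
split; first by move: h3 a1 l1 mu0; clear; nra.
rewrite -[la]invrK lef_pV2 ?posrE ?invr_gt0 //; last lra.
rewrite -div1r ler_pdivrMr; last lra.
by move: h3 a2 l1 mu0; clear; nra.
Qed.

Section Cylinder.
Variables (X : set C) (dx dy : R) (phi : C -> C).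
Hypotheses (dx0 : 0 < dx) (hphi : hol (strip dy) phi) (phiX : forall w, strip dy w -> X (phi w))
  (phio : forall z, X z -> exists2 w, strip dy w & phi w = z)
  (phii : forall w w', strip dy w -> strip dy w' -> (phi w = phi w' <-> exists n : int, w' = w + (n%:~R * dx)%:C)).

Lemma phi_per w (n : int) : strip dy w -> phi (w + (n%:~R * dx)%:C) = phi w.
Proof.
by move=> sw; apply/esym/(phii sw (strip_shift _ sw)); exists n.
Qed.

Lemma phi_inj w w' : strip dy w -> strip dy w' -> cmod (w - w') < dx -> phi w = phi w' -> w = w'.
Proof.
move=> sw sw' h /(phii sw sw') [n E]; move: h; rewrite E opprD addrA subrr sub0r cmodN cmod_real normrM (gtr0_norm dx0).
rewrite -[X in _ < X]mul1r (ltr_pM2r dx0) => h.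
have : `|n| < 1 by rewrite -(ltr_int R) intr_norm.
by move=> h'; have n0 : n = 0; [move: h'; clear; lia|rewrite n0 mul0r addr0].
Qed.

Lemma phi_linj w : strip dy w -> linj (strip dy) phi w.
Proof.
move=> _; exists (dx / 2); first by rewrite divr_gt0.
move=> w1 w2 s1 s2 h1 h2; apply: phi_inj => //.
by have := cmod_tri3 w1 w w2; rewrite (cmodBC w w2); lra.
Qed.

Lemma phi_neq0 w l : strip dy w -> hasd phi w l -> l != 0.
Proof.
move=> sw; have dx2 : 0 < dx / 2 by rewrite divr_gt0.
have [r r0 hr] := copen_strip sw; have [t [t0 tr td]] := min_pos2 r0 dx2.
have ww : cmod (w - w) < t by rewrite subrr cmod0.
apply: (@inj_hasd_neq0 R [set x | cmod (x - w) < t] phi w l (@copen_ball R w t) ww).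
  by apply: hol_sub hphi => x /= h; apply: hr; exact: lt_le_trans tr.
move=> x y /= h1 h2; apply: phi_inj; [apply: hr; exact: lt_le_trans tr|apply: hr; exact: lt_le_trans tr|].
by have := cmod_tri3 x w y; rewrite (cmodBC w y); lra.
Qed.

(** The part over [Q] of a fundamental domain is compact. The point is closedness, since limits
    might leave the open strip. *)
Lemma phi_lcov Q : cclosed Q -> cbounded Q -> (forall y, Q y -> X y) -> lcov (strip dy) phi Q.
Proof.
move=> cQ bQ QX.
pose X' := [set x : C | [/\ strip dy x, Q (phi x), 0 <= Re x & Re x <= dx]].
have X'b : cbounded X'.
  exists (dx + dy) => x [/andP[i1 i2] _ r1 r2]; have := cmod_ReIm x.
  by rewrite !ger0_norm //; [lra|exact: ltW].
apply: (@lcov_compact R (strip dy) phi Q X' [set c | exists n : int, c = (n%:~R * dx)%:C]) => //.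
- exact: copen_strip.
- exact: phi_neq0.
- move=> x hx; have /choice [xn hxn] : forall n : nat, exists y, X' y /\ cmod (y - x) < n.+1%:R^-1.
    move=> n; have n0 : 0 < n.+1%:R^-1 :> R by rewrite invr_gt0.
    by have [y Xy yx] := hx _ n0; exists y.
  have [M hM] := bQ; have [q hq] := BW (fun n => hM _ (let: And4 _ h _ _ := (hxn n).1 in h)).
  have Qq : Q q by apply: cQ => e e0; have [k _ hk] := hq e 0%N e0; exists (phi (xn k)) => //; have [[]] := hxn k.
  have [v sv Ev] := phio (QX q Qq); have [l hl] := hphi sv.
  have [rho [rho0 rS _ ho]] := local_homeo (@copen_strip R dy) sv hphi hl (phi_neq0 sv hl).
  (* The limit point [x] is approached by translates of one preimage [v] of the limit value;
     translates are [dx] apart, so [x] is one of them and lies in the strip. *)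
  have near e : 0 < e -> exists n : int, cmod (v + (n%:~R * dx)%:C - x) < e.
    move=> e0; have e2 : 0 < Num.min (e / 2) rho by rewrite lt_min rho0 divr_gt0.
    have [d d0 hd] := ho _ e2; have e22 : 0 < e / 2 by lra.
    have [N hN] := inv_lt_eps e22; have [k Nk hk] := hq d N d0.
    rewrite -Ev in hk; have [w + Ew] := hd _ hk; rewrite lt_min => /andP[w1 w2].
    have [[sk _ _ _] xk] := hxn k.
    have [n En] := (phii (rS w w2) sk).1 Ew; exists n.
    have := hN k Nk; move: (k.+1%:R^-1) xk => t xk tk.
    have := cmod_tri3 (v + (n%:~R * dx)%:C) (w + (n%:~R * dx)%:C) x.
    rewrite -En.
    rewrite (_ : v + (n%:~R * dx)%:C - xn k = - (w - v)); last by rewrite En; ring.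
    by rewrite cmodN; lra.
  have dx4 : 0 < dx / 4 by rewrite divr_gt0.
  have [n0 hn0] := near _ dx4.
  have Ex : x = v + (n0%:~R * dx)%:C.
    apply/eqP; rewrite -subr_eq0 -oppr_eq0 opprB; apply/eqP/cmod_small => e e0.
    have [t [t0 te td]] := min_pos2 e0 dx4; have [n hn] := near t t0.
    suff E : n = n0 by rewrite -E; apply: ltW; exact: lt_le_trans te.
    have : `|(n - n0)%:~R * dx| < dx.
      rewrite -(cmod_real (_ * _)) intrB mulrBl rmorphB /=.
      have := cmod_tri3 (v + (n%:~R * dx)%:C) x (v + (n0%:~R * dx)%:C).
      rewrite (cmodBC x) (_ : v + _ - (v + _) = (n%:~R * dx)%:C - (n0%:~R * dx)%:C); last by ring.
      by lra.
    rewrite normrM (gtr0_norm dx0) -[X in _ < X]mul1r (ltr_pM2r dx0) => h.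
    have : `|n - n0| < 1 by rewrite -(ltr_int R) intr_norm.
    by clear; lia.
  have sx : strip dy x by rewrite Ex; exact: strip_shift.
  split=> //; first by rewrite Ex phi_per // Ev.
    apply: le_small => e /hx [y [_ _ y1 _] yx]; have := normRe (y - x); rewrite cReB ler_norml => /andP[].
    by lra.
  apply: le_small => e /hx [y [_ _ _ y1] yx]; have := normRe (y - x); rewrite cReB ler_norml => /andP[].
  by lra.
- by move=> x [].
- by move=> c w [n ->] sw; split; [exact: strip_shift|exact: phi_per].
- by move=> c [n ->]; exists (- n); rewrite intrN mulNr rmorphN.
- move=> x sx Qx; pose n := - Num.floor (Re x / dx).
  exists (n%:~R * dx)%:C; first by exists n.
  have h1 := floor_le (Re x / dx); have h2 := floorD1_gt (Re x / dx).
  rewrite ler_pdivlMr // in h1; rewrite ltr_pdivrMr // intrD mulrDl mul1r in h2.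
  split; [exact: strip_shift|by rewrite phi_per| |]; rewrite cReD /= /n intrN mulNr.
    by rewrite subr_ge0.
  by rewrite lerBlDl ltW // addrC.
Qed.

Variables (m : R) (psi : C -> C) (p : C) (Lp : C -> C).
Hypotheses (dy0 : 0 < dy) (m0 : 0 < m) (hpsi : hol (strip m) psi) (psiX : forall w, strip m w -> X (psi w))
  (psi1 : forall w, strip m w -> psi (w + 1) = psi w) (Xp : ~ X p) (cLp : forall w, strip m w -> ccont Lp w)
  (hLp : forall w, strip m w -> cexp (Lp w) = psi w - p) (Lp1 : forall w, strip m w -> Lp (w + 1) = Lp w + per 1).

Let i2 : C := (m / 2)%:C * 'i.

Lemma strip_i2 : strip m i2.
Proof. by have m0' := m0; rewrite /strip /i2 /mkset cImMr /=; split_lra. Qed.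

Lemma strip1 w : strip m w -> strip m (w + 1).
Proof. by move=> h; rewrite -[1]/((1 : R)%:C); exact: strip_shift. Qed.

(** [psi] lifts through [phi] and the lift shifts by [n] periods. If [n = 0], a logarithm of
    [phi - p] along the lift would be periodic, whereas [Lp] increases by [per 1]. *)
Lemma psi_lift : exists (L : C -> C) (n : int), [/\ hol (strip m) L, forall w, strip m w -> strip dy (L w),
   forall w, strip m w -> phi (L w) = psi w, n != 0 & forall w, strip m w -> L (w + 1) = L w + (n%:~R * dx)%:C].
Proof.
have s0 := strip_i2; have [x0 sx0 Ex0] := phio (psiX s0).
have [||L [_ LX Lc]] := @lift_convex R (strip m) psi (strip dy) phi i2 x0 (@copen_strip R m) (@convex_strip m) s0 _ phi_linj _ sx0 Ex0.
- by move=> w sw; exact: hol_cont hpsi sw.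
- by move=> Q cQ bQ hQ; apply: phi_lcov => // y /hQ [w sw <-]; exact: psiX.
have hL : hol (strip m) L.
  move=> w sw; have [l hl] := hpsi sw; have [k hk] := hphi (LX w sw).1.
  exists (l / k); apply: (lift_hasd (Lc w sw) hk (phi_neq0 (LX w sw).1 hk) hl).
  by have [r r0 hr] := copen_strip sw; exists r => // w' /hr sw'; exact: (LX w' sw').2.
have [n En] := (phii (LX _ s0).1 (LX _ (strip1 s0)).1).1 (etrans (LX _ s0).2 (etrans (esym (psi1 s0)) (esym (LX _ (strip1 s0)).2))).
have Lper w : strip m w -> L (w + 1) = L w + (n%:~R * dx)%:C.
  apply: (@lift_uniq R (strip m) (strip dy) phi (fun w => L (w + 1)) (fun w => L w + (n%:~R * dx)%:C) i2) => //.
  - exact: cconn_strip.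
  - exact: phi_linj.
  - by move=> z sz; split; [exact: (LX _ (strip1 sz)).1|apply: strip_shift; exact: (LX _ sz).1].
  - move=> z sz; split; apply: ccont_in.
      by apply: (ccont_comp (u := fun w => w + 1)); [apply: ccontD; [exact: ccont_id|exact: ccont_cst]|apply: Lc; exact: strip1].
    by apply: ccontD; [exact: Lc|exact: ccont_cst].
  - by move=> z sz; rewrite (LX _ (strip1 sz)).2 psi1 // phi_per; [rewrite (LX _ sz).2|exact: (LX _ sz).1].
exists L, n; split=> //; [by move=> w /LX []|by move=> w /LX []|].
apply/eqP => n0.
have pn x : strip dy x -> phi x - p != 0.
  by move=> sx; rewrite subr_eq0; apply: contra_notN Xp => /eqP <-; exact: phiX.
have hph : hol (strip dy) (fun x => phi x - p) by apply: holB => //; exact: hol_cst.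
have [la [hla Ela]] := hol_log (@copen_strip R dy) (@convex_strip dy) hph pn.
have [k Ek] : exists k, la (L i2) = Lp i2 + per k.
  by apply: cexp_eq; rewrite hLp // Ela ?(LX _ s0).2 //; exact: (LX _ s0).1.
have lE w : strip m w -> la (L w) = Lp w + per k.
  apply: (@lift_uniq R (strip m) setT cexp (fun w => la (L w)) (fun w => Lp w + per k) i2) => //.
  - exact: cconn_strip.
  - by move=> z _; exact: cexp_linj.
  - move=> z sz; split; apply: ccont_in.
      by apply: (ccont_comp (Lc z sz)); apply: hol_cont hla _; exact: (LX _ sz).1.
    by apply: ccontD; [exact: cLp|exact: ccont_cst].
  - by move=> z sz; rewrite cexpDper hLp // Ela ?(LX _ sz).2 //; exact: (LX _ sz).1.
have := lE _ (strip1 s0); rewrite Lper // n0 mul0r addr0 lE // Lp1 // => /eqP.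
rewrite addrAC -subr_eq0 opprD addrA subrr sub0r oppr_eq0 => /eqP /(congr1 (@complex.Im R)).
by rewrite Im_per mul1r /= => /eqP; rewrite gt_eqF // mulrn_wgt0 // pi_gt0.
Qed.

(** In half-plane coordinates the lift is a self-map [F]. A translation of hyperbolic length
    [pi / m] becomes one of length [pi * dx / dy] times the absolute value of [n]; Schwarz-Pick and
    [n != 0] give the claim. *)
Lemma modulus_ge : m <= dy / dx.
Proof.
have [L [n [hL LS LE n0 L1]]] := psi_lift.
have [lg [_ hlg lgE Elg]] := @log_hp R; have pp := pi_gt0 R.
have pk : 0 < m / pi by rewrite divr_gt0.
have pq : 0 < pi / dy by rewrite divr_gt0.
have st (s k k' : R) w : 0 < s -> k' = s * k -> strip k w -> strip k' (s%:C * w).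
  move=> s0 -> /andP[w1 w2]; rewrite /strip /mkset cImMr; apply/andP; split; first by rewrite mulr_gt0.
  by rewrite ltr_pM2l.
have st1 w : strip pi w -> strip m ((m / pi)%:C * w) by apply: st => //; rewrite divfK // gt_eqF.
have st2 w : strip dy w -> strip pi ((pi / dy)%:C * w) by apply: st => //; rewrite divfK // gt_eqF.
pose F z := cexp ((pi / dy)%:C * L ((m / pi)%:C * lg z)).
have hF : hol hp F.
  apply: (hol_comp (O' := setT) (u := fun z => (pi / dy)%:C * L ((m / pi)%:C * lg z))) (@hol_cexp R setT) => //.
  apply: holM; first exact: hol_cst.
  apply: (hol_comp (O' := strip m) (u := fun z => (m / pi)%:C * lg z)) hL.
    by move=> z /Elg [/st1].
  by apply: holM => //; exact: hol_cst.
have Fh z : hp z -> hp (F z) by move=> /Elg [/st1 /LS /st2 h _]; exact: hp_cexp.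
have la1 : 1 < expR (pi / m) by rewrite expR_gt1 divr_gt0.
pose w0 : C := (pi / 2)%:C * 'i; pose w1 := w0 + (pi / m)%:C.
have sw0 : strip pi w0 by rewrite /strip /mkset cImMr /=; split_lra.
have sw1 : strip pi w1 := strip_shift _ sw0.
have E0 : cexp w0 = 'i.
  by apply: cplx_eq; rewrite ?Re_cexp ?Im_cexp cReMr cImMr /= !(mulr0, mulr1) expR0 ?cos_pihalf ?sin_pihalf mul1r.
have Er (x : R) : cexp x%:C = (expR x)%:C.
  by apply: cplx_eq; rewrite ?Re_cexp ?Im_cexp /= ?cos0 ?sin0 ?mulr1 ?mulr0.
have E1 : cexp w1 = 'i * (expR (pi / m))%:C by rewrite cexpD E0 Er.
have h1 := hp_cexp sw1; have h0 := hp_cexp sw0.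
have := schwarz_pick_hp hF Fh h1 h0.
have Ew0 : (m / pi)%:C * w0 = i2.
  rewrite /w0 /i2 mulrA -rmorphM /=; congr (_%:C * _).
  by apply: half_scale; rewrite gt_eqF.
have F0 : F (cexp w0) = cexp ((pi / dy)%:C * L i2).
  by rewrite /F (lgE _ sw0).2 Ew0.
have F1 : F (cexp w1) = F (cexp w0) * (expR (pi / dy * (n%:~R * dx)))%:C.
  rewrite F0 -Er -cexpD /F (lgE _ sw1).2 (_ : (m / pi)%:C * w1 = i2 + 1).
    rewrite (L1 _ strip_i2) mulrDr; congr (cexp (_ + _)).
    by rewrite -rmorphM.
  rewrite /w1 mulrDr -rmorphM /= (_ : m / pi * (pi / m) = 1); last by rewrite mulrA divfK ?divff ?gt_eqF.
  by rewrite Ew0.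
rewrite F1 E1 E0 conji opprK.
have -> : cmod ('i * (expR (pi / m))%:C + 'i : C) = expR (pi / m) + 1.
  rewrite (_ : _ + _ = 'i * (expR (pi / m) + 1)%:C); last by rewrite rmorphD /=; ring.
  by rewrite cmodM cmodi mul1r cmod_real ger0_norm // addr_ge0 // expR_ge0.
have -> : cmod ('i * (expR (pi / m))%:C - 'i : C) = expR (pi / m) - 1.
  rewrite (_ : _ - _ = 'i * (expR (pi / m) - 1)%:C); last by rewrite rmorphB /=; ring.
  by rewrite cmodM cmodi mul1r cmod_real ger0_norm // subr_ge0 ltW.
move=> H; have q0 : F 'i != 0 by exact: cexp_neq0.
have [H1 H2] := mobius_ratio la1 (expR_gt0 _) q0 H.
rewrite -expRN ler_expR in H2; rewrite ler_expR in H1.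
have n1 : 1 <= `|n%:~R| :> R by rewrite -intr_norm ler1z; move: n0; clear; lia.
have H3 : pi * (dx / dy) <= pi / m.
  apply: le_trans (_ : pi * (dx / dy) * `|n%:~R| <= _).
    by rewrite -[X in X <= _]mulr1; apply: ler_wpM2l => //; rewrite !mulr_ge0 // ?invr_ge0 ltW.
  have -> : pi * (dx / dy) * `|n%:~R| = `|pi / dy * (n%:~R * dx)|.
    by rewrite !normrM (gtr0_norm pp) (gtr0_norm dx0) normfV (gtr0_norm dy0); ring.
  by rewrite ler_norml H1 andbT -lerNl.
rewrite ler_pM2l // in H3.
by rewrite -[m]invrK -[dy / dx]invrK lef_pV2 ?posrE ?invr_gt0 ?divr_gt0 // invf_div.
Qed.

End Cylinder.
End Moduli.

(** * The canonical potential *)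

Section Green.
Context {R : realType}.
Local Notation C := R[i].
Implicit Types (u v h L : C -> C) (M K s e r t : R) (x y z w p a b c l : C) (O E : set C).

Definition lp z : R := ln (Num.max 1 (cmod z)).

Lemma max1_ge (x : R) : 1 <= Num.max 1 x /\ x <= Num.max 1 x.
Proof. by rewrite !le_max !lexx orbT. Qed.

Lemma lp_ge0 z : 0 <= lp z.
Proof. by rewrite /lp ln_ge0 // (max1_ge _).1. Qed.

Lemma lp_exp z : expR (lp z) = Num.max 1 (cmod z).
Proof. by rewrite /lp lnK // posrE; apply: lt_le_trans (max1_ge _).1. Qed.

Lemma cmod_lp z : cmod z <= expR (lp z).
Proof. by rewrite lp_exp (max1_ge _).2. Qed.

Lemma lp_le z (x : R) : 0 <= x -> cmod z <= expR x -> lp z <= x.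
Proof. by move=> x0 h; rewrite -ler_expR lp_exp ge_max h andbT -expR0 ler_expR. Qed.

Lemma lp_ge z (x : R) : expR x <= cmod z -> x <= lp z.
Proof. by move=> h; rewrite -ler_expR; apply: le_trans h _; exact: cmod_lp. Qed.

Lemma lp_lip z w : lp z - lp w <= cmod (z - w).
Proof.
have h0 := cmod_ge0 (z - w).
suff : lp z <= lp w + cmod (z - w) by lra.
apply: lp_le; first by rewrite addr_ge0 ?lp_ge0.
rewrite expRD; have h1 := expR_ge1Dx (cmod (z - w)); have h2 : 1 <= expR (lp w) by rewrite -expR0 ler_expR lp_ge0.
have := cmod_lp w; have := cmod_sub z w.
by move: (expR (lp w)) (expR (cmod (z - w))) h1 h2 => a b; nra.
Qed.

Variables (f : {poly C}) (d : nat).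
Hypotheses (fd : degree f = d) (d3 : (3 <= d)%N).

Lemma d_ge3 : 3 <= d%:R :> R.
Proof. by rewrite (ler_nat R 3). Qed.

Lemma d_gt0 : 0 < d%:R :> R.
Proof. by have := d_ge3; lra. Qed.

Lemma small_pow K e : 0 <= K -> 0 < e -> exists N, forall n, (N <= n)%N -> K / d%:R ^+ n <= e.
Proof.
move=> K0 e0; have d0 := d_gt0; have d3' := d_ge3; have K1 : 0 < K + 1 by lra.
have [N hN] : exists n, d%:R^-1 ^+ n < e / (K + 1).
  apply: pow_small; [by rewrite invr_ge0 ltW|by rewrite invf_lt1 //; lra|exact: divr_gt0].
exists N => n Nn; rewrite ltr_pdivlMr // exprVn in hN.
have : (d%:R ^+ n)^-1 <= (d%:R ^+ N)^-1 :> R by rewrite lef_pV2 ?posrE ?exprn_gt0 // ler_weXn2l //; lra.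
have : 0 <= (d%:R ^+ n)^-1 :> R by rewrite invr_ge0 exprn_ge0 // ltW.
by move: hN; move: (d%:R ^- N) (d%:R ^- n) => x y; nra.
Qed.

Lemma expR_sub1 (x : R) : `|x| <= 1 / 2 -> `|expR x - 1| <= 2 * `|x|.
Proof.
move=> h; have h1 := expR_ge1Dx x; have h2 := expR_ge1Dx (- x); have h0 := expR_gt0 x; rewrite expRN in h2.
have h3 : (1 - x) * expR x <= 1 by rewrite -ler_pdivlMr // div1r.
move: h; rewrite !ler_norml => /andP[a1 a2]; case: (lerP 0 x) => x0; [rewrite (ger0_norm x0)|rewrite (ltr0_norm x0)];
  move: h0 h1 h3 a1 a2; move: (expR x) => y; clear -x0; move=> *; apply/andP; split; nra.
Qed.

(** For large [w] the leading term dominates; for [cmod w] below [r] the growth of [lp w] is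
    absorbed in the constant. *)
Lemma poly_growth : exists2 K : R, 0 <= K & forall w, `|lp f.[w] - d%:R * lp w| <= K.
Proof.
have sf : size f = d.+1 by move: fd d3; rewrite /degree; case: (size f) => [|n] /= <-.
pose S := \sum_(i < d.+1) cmod f`_i.
have fE w : f.[w] = \sum_(i < d.+1) f`_i * w ^+ i by rewrite horner_coef sf.
have S0 : 0 <= S by apply: sumr_ge0 => i _; exact: cmod_ge0.
have sumM (n : nat) (g : 'I_n -> C) : cmod (\sum_(i < n) g i) <= \sum_(i < n) cmod (g i).
  elim: n g => [|n IH] g; first by rewrite !big_ord0 cmod0.
  by rewrite !big_ord_recr /=; apply: le_trans (cmodD _ _) _; apply: lerD.
have upper w : lp f.[w] <= S + d%:R * lp w.
  apply: lp_le; first by rewrite addr_ge0 // mulr_ge0 // lp_ge0.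
  rewrite expRD [d%:R * _]mulrC expRM_natr lp_exp fE mulrC; set m := Num.max 1 (cmod w).
  have [m1 m2] := max1_ge (cmod w); rewrite -/m in m1 m2.
  apply: le_trans (sumM _ _) _; apply: le_trans (_ : m ^+ d * S <= _); last first.
    by apply: ler_wpM2l; [rewrite exprn_ge0 //; lra|have := expR_ge1Dx S; lra].
  rewrite mulr_sumr; apply: ler_sum => i _; rewrite cmodM cmodX mulrC; apply: ler_wpM2r; first exact: cmod_ge0.
  apply: le_trans (_ : m ^+ i <= _); first by rewrite lerXn2r ?nnegrE ?cmod_ge0 //; lra.
  by apply: ler_weXn2l => //; rewrite -ltnS.
pose a := cmod f`_d; have a0 : 0 < a.
  rewrite cmod_gt0; have := lead_coef_eq0 f; rewrite lead_coefE sf /= => ->.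
  by rewrite -size_poly_eq0 sf.
pose S' := \sum_(i < d) cmod f`_i; have S'0 : 0 <= S' by apply: sumr_ge0 => i _; exact: cmod_ge0.
pose r := 1 + 2 * S' / a; have r1 : 1 <= r by rewrite lerDl divr_ge0 ?mulr_ge0 // ltW.
have lower w : r <= cmod w -> a / 2 * cmod w ^+ d <= cmod f.[w].
  move=> rw; have w1 : 1 <= cmod w by lra.
  have : cmod (\sum_(i < d) f`_i * w ^+ i) <= cmod w ^+ d.-1 * S'.
    apply: le_trans (sumM _ _) _; rewrite mulr_sumr; apply: ler_sum => i _; rewrite cmodM cmodX mulrC.
    apply: ler_wpM2r; first exact: cmod_ge0.
    by apply: ler_weXn2l => //; rewrite -ltnS prednK // (leq_ltn_trans _ (ltn_ord i)).
  have dd : d = d.-1.+1 by rewrite prednK // (leq_trans _ d3).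
  have h2 : cmod w ^+ d.-1 * S' <= a / 2 * cmod w ^+ d.
    rewrite {2}dd exprS mulrCA mulrA mulrC; apply: ler_wpM2r; first by rewrite exprn_ge0 // cmod_ge0.
    rewrite /r in rw; have : 2 * S' / a <= cmod w by lra.
    by rewrite ler_pdivrMr // => k; move: k; rewrite mulrC; clear; lra.
  rewrite fE big_ord_recr /=; set s1 := \sum_(i < d) _ => h1.
  have := cmod_sub (f`_d * w ^+ d) (- s1); rewrite opprK cmodN cmodM cmodX -/a (addrC s1).
  move: (cmod w ^+ d) h1 h2 => x h1 h2; lra.
have r0 : 0 < r by lra.
pose K2 := d%:R * ln r + `|ln (a / 2)|.
have lr0 : 0 <= ln r by rewrite ln_ge0.
have K20 : 0 <= K2 by rewrite addr_ge0 // mulr_ge0.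
have lower' w : d%:R * lp w - K2 <= lp f.[w].
  have [rw|rw] := leP r (cmod w).
    have w0 : 0 < cmod w by lra.
    have -> : lp w = ln (cmod w) by rewrite /lp; congr ln; apply/max_idPr; lra.
    apply: le_trans (_ : ln (a / 2) + d%:R * ln (cmod w) <= _).
      have := ler_norm (- ln (a / 2)); rewrite normrN /K2; have := mulr_ge0 (ler0n R d) lr0; lra.
    apply: lp_ge; rewrite expRD [d%:R * _]mulrC expRM_natr !lnK ?posrE ?divr_gt0 //.
    exact: lower.
  have : lp w <= ln r.
    by apply: lp_le => //; rewrite lnK ?posrE // ltW.
  move=> h; have := lp_ge0 f.[w]; have := ler_wpM2l (ler0n R d) h; have := normr_ge0 (ln (a / 2)).
  by rewrite /K2; lra.
exists (S + K2); first by rewrite addr_ge0.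
move=> w; rewrite ler_norml; have := upper w; have := lower' w => *; split_lra.
Qed.

Lemma fwd_S z n : fwd_orbit f z n.+1 = f.[fwd_orbit f z n].
Proof. by []. Qed.

Lemma fwd_Sr z n : fwd_orbit f z n.+1 = fwd_orbit f f.[z] n.
Proof. by rewrite /fwd_orbit iterSr. Qed.

Lemma fwd_add z n m : fwd_orbit f z (n + m) = fwd_orbit f (fwd_orbit f z m) n.
Proof. by rewrite /fwd_orbit iterD. Qed.

Definition gn n z := lp (fwd_orbit f z n) / d%:R ^+ n.

Lemma green_approx : exists2 K : R, 0 <= K & forall n z, `|green f z - gn n z| <= K / d%:R ^+ n.
Proof.
have [K K0 hK] := poly_growth; exists K => // n z.
have d0 := d_gt0; have d3' := d_ge3; have dn (k : nat) : 0 < d%:R ^+ k :> R by rewrite exprn_gt0.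
have step k : `|gn k.+1 z - gn k z| <= K / d%:R ^+ k.+1.
  rewrite /gn fwd_S exprS invfM mulrA; set x := fwd_orbit f z k.
  rewrite (_ : _ - _ = (lp f.[x] - d%:R * lp x) / (d%:R * d%:R ^+ k)); last first.
    by rewrite invfM; field; rewrite !gt_eqF.
  rewrite normrM (gtr0_norm (x := (_ * _)^-1)); last by rewrite invr_gt0 mulr_gt0.
  by rewrite -invfM; apply: ler_wpM2r => //; rewrite invr_ge0 mulr_ge0 // ltW.
(* Bounded by a difference so that the induction closes: [2 * (K / d ^+ n.+1)] is at most
   [K / d ^+ n]. *)
have tele k m : `|gn (k + m) z - gn k z| <= K / d%:R ^+ k - K / d%:R ^+ (k + m).
  elim: m => [|m IH]; first by rewrite addn0 !subrr normr0.
  rewrite addnS; have := step (k + m)%N; have := ler_normD (gn (k + m).+1 z - gn (k + m) z) (gn (k + m) z - gn k z).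
  rewrite addrA subrK => h1 h2.
  have h3 : 2 * (K / d%:R ^+ (k + m).+1) <= K / d%:R ^+ (k + m).
    rewrite exprS invfM; have p : 0 <= K / d%:R ^+ (k + m) by rewrite divr_ge0 // ltW.
    rewrite (_ : 2 * _ = 2 / d%:R * (K / d%:R ^+ (k + m))); last by ring.
    by apply: ler_piMl => //; rewrite ler_pdivrMr // mul1r; lra.
  by move: h1 h2 h3 IH; clear; lra.
have bnd k m : (k <= m)%N -> `|gn m z - gn k z| <= K / d%:R ^+ k.
  move=> km; have := tele k (m - k)%N; rewrite subnKC // => h; apply: le_trans h _.
  by rewrite lerBlDr lerDl divr_ge0 // ltW.
have [|l hl] := @ulimR R (fun m => gn m z) (`|gn 0 z| + K).
  move=> m; have := bnd 0%N m (leq0n m); rewrite expr0 divr1.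
  by have := ler_normD (gn m z - gn 0 z) (gn 0 z); rewrite subrK; lra.
have near k : `|l - gn k z| <= K / d%:R ^+ k.
  apply: le_small => e e0; have [m [/= h1 h2]] := ufilter_ex (ufilterI (hl e e0) (ufilter_tail k)).
  have := bnd k m h2; have := ler_normD (l - gn m z) (gn m z - gn k z); rewrite addrA subrK (distrC l (gn m z)).
  by move: h1; clear; lra.
suff -> : green f z = l by [].
rewrite /green fd; apply: cvg_lim => //; apply/cvgrPdist_le => e e0.
have [N hN] := small_pow K0 e0; exists N => // m /= Nm; exact: le_trans (near m) (hN _ Nm).
Qed.

Lemma fwd_hol n O : hol O (fun z => fwd_orbit f z n).
Proof.
elim: n => [|n IH]; first exact: hol_id.
apply: (hol_comp (O' := setT) (u := fun z => fwd_orbit f z n) (v := fun z => f.[z])) => // z _.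
exists (f^`().[z]); exact: hasd_poly.
Qed.

Local Notation G := (green f).

Lemma green_cont z e : 0 < e -> exists2 r : R, 0 < r & forall w, cmod (w - z) < r -> `|G w - G z| < e.
Proof.
move=> e0; have [K K0 hK] := green_approx; have d0 := d_gt0; have d3' := d_ge3.
have e' : 0 < e / 4 by lra.
have [N hN] := small_pow K0 e'; have KN := hN N (leqnn N); have dn : 0 < d%:R ^+ N :> R by rewrite exprn_gt0.
have e4 : 0 < e / 4 by lra.
have [r r0 hr] := hol_cont (@fwd_hol N setT) (I : setT z) e4; exists r => // w /hr h.
have k1 := hK N w; have k2 := hK N z.
have k3 : `|gn N w - gn N z| <= e / 4.
  rewrite /gn -mulrBl normrM (gtr0_norm (x := _^-1)) ?invr_gt0 //.
  rewrite ler_pdivrMr //; apply: le_trans (_ : e / 4 * 1 <= _).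
    rewrite mulr1; apply: le_trans (ltW h); rewrite ler_norml lp_lip andbT lerNl opprB.
    by rewrite (cmodBC (fwd_orbit f w N)) lp_lip.
  by apply: ler_wpM2l; [lra|apply: exprn_ege1; lra].
have -> : G w - G z = (G w - gn N w) + ((gn N w - gn N z) - (G z - gn N z)) by ring.
have n1 := ler_normD (G w - gn N w) ((gn N w - gn N z) - (G z - gn N z)).
have n2 := ler_normB (gn N w - gn N z) (G z - gn N z).
by move: n1 n2 k1 k2 k3 KN e0; clear; lra.
Qed.

Lemma green_f z : G f.[z] = d%:R * G z.
Proof.
have [K K0 hK] := green_approx; have d0 := d_gt0; have d3' := d_ge3.
apply/eqP; rewrite -subr_eq0 -normr_le0; apply: le_small => e e0; rewrite add0r.
have e' : 0 < e / 2 by lra.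
have [N hN] := small_pow K0 e'; have KN := hN N (leqnn N); have dn : 0 < d%:R ^+ N :> R by rewrite exprn_gt0.
have E : gn N f.[z] = d%:R * gn N.+1 z.
  by rewrite /gn fwd_Sr exprS invfM mulrCA mulVKf ?gt_eqF.
have k1 := hK N f.[z]; have k2 := hK N.+1 z.
have k3 : d%:R * `|G z - gn N.+1 z| <= K / d%:R ^+ N.
  apply: le_trans (ler_wpM2l (ltW d0) k2) _; rewrite exprS invfM.
  by rewrite (_ : d%:R * _ = K / d%:R ^+ N) //; field; rewrite !gt_eqF.
have -> : G f.[z] - d%:R * G z = (G f.[z] - gn N f.[z]) - d%:R * (G z - gn N.+1 z) by rewrite E; ring.
have := ler_normB (G f.[z] - gn N f.[z]) (d%:R * (G z - gn N.+1 z)); rewrite normrM (gtr0_norm d0).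
by move: k1 k3 KN; clear; lra.
Qed.

Lemma green_fwd z n : G (fwd_orbit f z n) = d%:R ^+ n * G z.
Proof. by elim: n => [|n IH]; rewrite ?expr0 ?mul1r // fwd_S green_f IH exprS mulrA. Qed.

Lemma green_ge0 z : 0 <= G z.
Proof.
have [K K0 hK] := green_approx; have d0 := d_gt0; have d3' := d_ge3.
apply: le_small => e e0.
have [N hN] := small_pow K0 e0; have KN := hN N (leqnn N); have dn : 0 < d%:R ^+ N :> R by rewrite exprn_gt0.
have : 0 <= gn N z by rewrite divr_ge0 ?lp_ge0 // ltW.
by have := hK N z; rewrite ler_norml => /andP[]; lra.
Qed.

Lemma green_lp : exists2 K : R, 0 <= K & forall z, `|G z - lp z| <= K.
Proof.
have [K K0 hK] := green_approx; exists K => // z.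
by have := hK 0%N z; rewrite /gn expr0 !divr1.
Qed.

Lemma green0P z : filled_julia f z <-> G z = 0.
Proof.
have [K K0 hK] := green_approx; have d0 := d_gt0; have d3' := d_ge3; split.
  move=> [M hM]; pose m := Num.max 1 M; have [m1 m2] := max1_ge M; rewrite -/m in m1 m2.
  have lm : 0 <= ln m by rewrite ln_ge0.
  apply/eqP; rewrite -normr_le0; apply: le_small => e e0; rewrite add0r.
  have lK : 0 <= ln m + K by lra.
  have [N hN] := small_pow lK e0; have := hN N (leqnn N); rewrite mulrDl => le.
  have dn : 0 < d%:R ^+ N :> R by rewrite exprn_gt0.
  have h1 : `|gn N z| <= ln m / d%:R ^+ N.
    rewrite ger0_norm; last by rewrite divr_ge0 ?lp_ge0 ?(ltW dn).
    apply: ler_wpM2r; first by rewrite invr_ge0 ltW.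
    by apply: lp_le => //; rewrite lnK ?posrE; [exact: le_trans (hM N) m2|lra].
  have := hK N z; have := ler_normD (G z - gn N z) (gn N z); rewrite subrK.
  by move: h1 le; clear; lra.
move=> G0; have [K' K'0 hK'] := green_lp; exists (expR K') => n.
apply: le_trans (cmod_lp _) _; rewrite ler_expR.
by have := hK' (fwd_orbit f z n); rewrite green_fwd G0 mulr0 sub0r normrN; have := ler_norm (lp (fwd_orbit f z n)); lra.
Qed.

Lemma sublevel_closed t : cclosed [set z | G z <= t].
Proof.
move=> z hz /=; apply: le_small => e e0; have [r r0 hr] := green_cont z e0.
by have [w /= w1 /hr] := hz r r0; rewrite ltr_norml => /andP[]; lra.
Qed.

Lemma sublevel_bounded t : cbounded [set z | G z <= t].
Proof.
have [K K0 hK] := green_lp; exists (expR (t + K)) => z /= h.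
apply: le_trans (cmod_lp _) _; rewrite ler_expR; have := hK z; rewrite ler_norml => /andP[]; lra.
Qed.

Lemma sublevel_open t : copen [set z | G z < t].
Proof.
move=> z /= h; have h0 : 0 < t - G z by rewrite subr_gt0.
have [r r0 hr] := green_cont z h0; exists r => // w /hr; rewrite ltr_norml => /andP[]; lra.
Qed.

(** Near [z] the iterates from index [N] on have modulus above 1, so they have holomorphic roots of
    order [d ^+ (N + n)] on the disc. These are bounded, and their ultrafilter limit has modulus
    [expR (G w)]. *)
Lemma green_local z : 0 < G z -> exists r (u : C -> C), [/\ 0 < r, hol [set w | cmod (w - z) < r] u &
  forall w, cmod (w - z) < r -> cmod (u w) = expR (G w)].
Proof.
move=> Gz; have [K K0 hK] := green_approx; have d0 := d_gt0; have d3' := d_ge3.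
pose e := G z / 3; have e0 : 0 < e by rewrite /e; lra.
have [r r0 hr] := green_cont z e0.
have Gw w : cmod (w - z) < r -> 2 * e < G w <= 4 * e.
  by move=> /hr; rewrite ltr_norml /e => /andP[h1 h2]; split_lra.
have [N hN] := small_pow K0 e0.
have dn (n : nat) : 0 < d%:R ^+ n :> R by rewrite exprn_gt0.
have KN n : K / d%:R ^+ (N + n) <= e by apply: hN; rewrite leq_addr.
pose Bl := [set w : C | cmod (w - z) < r].
have fE n w : Bl w -> cmod (fwd_orbit f w (N + n)) = expR (gn (N + n) w * d%:R ^+ (N + n)) /\ gn (N + n) w <= 5 * e.
  move=> Bw; have := hK (N + n)%N w; have := KN n; have /andP[g1 g2] := Gw w Bw.
  move=> h1; rewrite ler_norml => /andP[h2 h3]; split; last by lra.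
  rewrite /gn divfK ?gt_eqF // lp_exp; apply/esym/max_idPr.
  have lpos : 0 < lp (fwd_orbit f w (N + n)).
    have : 0 < gn (N + n) w by lra.
    by rewrite /gn pmulr_lgt0 // invr_gt0.
  rewrite leNgt; apply/negP => h; move: lpos; rewrite /lp (_ : Num.max _ _ = 1) ?ln1 ?ltxx //.
  by apply/max_idPl/ltW.
have nz n w : Bl w -> fwd_orbit f w (N + n) != 0.
  by move=> Bw; rewrite -cmod_gt0 (fE n w Bw).1 expR_gt0.
have /choice [L hL] : forall n, exists L : C -> C, hol Bl L /\ forall w, Bl w -> cexp (L w) = fwd_orbit f w (N + n).
  move=> n; apply: (hol_log (@copen_ball R z r) (@convex_ball R z r)); last exact: nz.
  exact: fwd_hol.
pose c n : C := ((d%:R ^+ (N + n))^-1)%:C.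
pose un n w := cexp (c n * L n w).
have une n w : Bl w -> cmod (un n w) = expR (gn (N + n) w).
  move=> Bw; rewrite /un cmod_cexp cReMr; congr expR.
  have [_ E] := hL n; have := congr1 (@cmod R) (E w Bw); rewrite cmod_cexp (fE n w Bw).1 => /expR_inj ->.
  by rewrite mulrC mulfK // gt_eqF.
have unh n : hol Bl (un n).
  apply: (hol_comp (O' := setT) (u := fun w => c n * L n w)) (@hol_cexp R setT) => //.
  by apply: holM; [exact: hol_cst|exact: (hL n).1].
have unb n w : Bl w -> cmod (un n w) <= expR (5 * e).
  by move=> Bw; rewrite une // ler_expR; exact: (fE n w Bw).2.
have /choice [u hu] : forall w, exists l, Bl w -> forall e, 0 < e -> ufilter [set n | cmod (un n w - l) < e].
  move=> w; have [Bw|n] := pselect (Bl w); last by exists 0.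
  by have [l hl] := ulim_ex (fun n => unb n w Bw); exists l.
exists r, u; split=> //.
  by apply: (ulim_hol (@copen_ball R z r) unh unb) => w t Bw; exact: hu.
move=> w Bw; apply/eqP; rewrite -subr_eq0 -normr_le0; apply: le_small => t t0; rewrite add0r.
have t2 : 0 < t / 2 by lra.
have E0 : 0 < expR (G w) by exact: expR_gt0.
have t4 : 0 < Num.min (t / 4 / expR (G w)) (1 / 2) by rewrite lt_min !divr_gt0 //; lra.
have [M hM] := small_pow K0 t4.
have [n [/= h1 h2]] := ufilter_ex (ufilterI (hu w Bw _ t2) (ufilter_tail M)).
have := hK (N + n)%N w; have := hM (N + n)%N (leq_trans h2 (leq_addl _ _)); rewrite le_min => /andP[h3 h4] h5.
have h6 : `|gn (N + n) w - G w| <= t / 4 / expR (G w) by rewrite distrC (le_trans h5).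
have h7 : `|gn (N + n) w - G w| <= 1 / 2 by rewrite distrC (le_trans h5).
have h8 : `|expR (gn (N + n) w) - expR (G w)| <= 2 * expR (G w) * `|gn (N + n) w - G w|.
  have -> : expR (gn (N + n) w) - expR (G w) = expR (G w) * (expR (gn (N + n) w - G w) - 1).
    by rewrite expRD expRN; field; rewrite gt_eqF.
  rewrite normrM gtr0_norm //; have := expR_sub1 h7; move: E0; move: (`|_|) (`|_|) (expR _) => x y v; nra.
have h9 : 2 * expR (G w) * `|gn (N + n) w - G w| <= t / 2.
  by move: h6; rewrite ler_pdivlMr //; move: (`|_|) => x; lra.
have := cmod_sub (un n w) (u w); have := cmod_sub (u w) (un n w); rewrite (cmodBC (u w)) une //.
move: h1 h8 h9; rewrite !ler_norml => h1 /andP[a1 a2] h9 a3 a4; apply/andP; split; move: a1 a2 h9 a3 a4 h1; clear; lra.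
Qed.
End Green.

(** * Dictionary with the library's topology and differentials *)

Section Bridges.
Context {R : realType}.
Local Notation C := R[i].
Implicit Types (u h : C -> C) (B K s e r t : R) (x y z w p a b c l : C) (O X Q E T : set C).

Lemma pos_realC c : 0 < c -> 0 < Re c /\ c = (Re c)%:C.
Proof. by rewrite ltcE /= => /andP[/eqP h0 h]; split=> //; apply: cplx_eq => //=; rewrite -h0. Qed.

Lemma nbhsC z X : nbhs z X <-> exists2 r : R, 0 < r & forall w, cmod (w - z) < r -> X w.
Proof.
split=> [/nbhs_ballP [e /= /pos_realC [e0 eE] he]|[r r0 hr]].
  exists (Re e) => // w h; apply: he; rewrite -ball_normE /= distrC eE.
  by change ((cmod (w - z))%:C < (Re e)%:C); rewrite ltcR.
apply/nbhs_ballP; exists r%:C => /=; first by rewrite ltcR.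
by move=> w; rewrite -ball_normE /= distrC => h; apply: hr; rewrite -ltcR.
Qed.

Lemma openC O : open O <-> copen O.
Proof. by rewrite openE; split=> h z /h /nbhsC. Qed.

Lemma connectedC E : connected E <-> cconn E.
Proof.
(* An open set of the plane whose trace on [E] is [Q] as soon as [Q] is relatively open. *)
pose hull Q := [set w | exists z r, [/\ E z, Q z, cmod (w - z) < r & forall w, E w -> cmod (w - z) < r -> Q w]].
have hull_open Q : open (hull Q).
  apply/openC => w [a [r [Ea Qa ar hr]]]; exists (r - cmod (w - a)); first by rewrite subr_gt0.
  by move=> b h; exists a, r; split=> //; apply: le_lt_trans (cmod_tri w _ _) _; lra.
have hullE Q w : (forall z, E z -> Q z -> exists2 r, 0 < r & forall w, E w -> cmod (w - z) < r -> Q w) ->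
    E w -> hull Q w <-> Q w.
  move=> h Ew; split=> [[a [r [_ _ ar hr]]]|Qw]; first exact: hr.
  by have [r r0 hr] := h w Ew Qw; exists w, r; split=> //; rewrite subrr cmod0.
split=> [cE Q [z0 Ez Qz] oQ oQ' z Ez1|cE B [z Bz] [Ov oO BO] [X' cX BX]].
  suff : (E `&` Q) z by case.
  rewrite (cE (E `&` Q)) //; first by exists z0.
  - exists (hull Q) => //; apply/seteqP; split=> w [Ew]; by [split=> //; apply/hullE|move=> /(hullE _ _ oQ Ew)].
  - exists (~` hull (~` Q)); first exact: open_closedC.
    apply/seteqP; split=> w [Ew h]; split=> //; first by move=> /(hullE _ _ oQ' Ew).
    by apply: contrapT => nQ; apply: h; apply/(hullE _ _ oQ' Ew).
have BE w : B w -> E w by rewrite BO => -[].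
apply/seteqP; split=> // w; move: w; apply: cE; first by exists z => //; exact: BE.
- move=> w Ew; rewrite BO => -[_ Ow]; have [r r0 hr] := (openC Ov).1 oO w Ow.
  by exists r => // y Ey /hr Oy; split.
- move=> w Ew nB; have nX : (~` X') w by move=> Xw; apply: nB; rewrite BX.
  have [r r0 hr] := (openC _).1 (closed_openC cX) w nX.
  by exists r => // y Ey /hr nXy; rewrite BX => -[].
Qed.

Lemma derivableC u z : derivable u z 1 <-> exists l, hasd u z l.
Proof.
have key l (h : C) : h != 0 -> l - h^-1 *: (u (h *: 1 + z) - u z) = - ((u (h + z) - u z - l * h) / h).
  by move=> h0; rewrite /GRing.scale /= mulr1; field.
split=> [/cvg_ex [l /cvgrPdist_lt hl]|[l hl]].
  exists l => e e0; have /hl : 0 < e%:C by rewrite ltcR.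
  move=> /nbhsC [r r0 hr]; exists r => // w h; have [->|wz] := eqVneq w z; first by rewrite !subrr mulr0 subrr cmod0 mulr0.
  have wz' : w - z != 0 by rewrite subr_eq0.
  have := hr (w - z); rewrite subr0 => /(_ h wz') /=; rewrite key // normrN subrK => k.
  have {k} : cmod ((u w - u z - l * (w - z)) / (w - z)) < e by rewrite -ltcR.
  by rewrite cmod_div ltr_pdivrMr ?cmod_gt0 // => /ltW.
apply/cvg_ex; exists l; apply/cvgrPdist_lt => e /pos_realC [e0 eE]; have e2 : 0 < Re e / 2 by lra.
have [r r0 hr] := hl _ e2; apply/nbhsC; exists r => // h; rewrite subr0 => hh h0 /=.
rewrite key // normrN eE; change ((cmod ((u (h + z) - u z - l * h) / h))%:C < (Re e)%:C).
rewrite ltcR cmod_div ltr_pdivrMr ?cmod_gt0 //; have := hr (h + z); rewrite addrK => /(_ hh) k.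
apply: le_lt_trans k _; rewrite ltr_pM2r ?cmod_gt0 //; lra.
Qed.

Lemma cconn_image T u : cconn T -> (forall z, T z -> ccontin T u z) -> cconn (image_of T u).
Proof.
move=> cT cu Q [_ [z0 Tz <-] Qz] oQ oQ' _ [z Tz1 <-].
apply: (cT (fun w => Q (u w))) z Tz1; first by exists z0.
- move=> w Tw Qw; have [r r0 hr] := oQ (u w) (ex_intro2 _ _ w Tw erefl) Qw.
  by have [s s0 hs] := cu w Tw r r0; exists s => // a Ta /(hs a Ta) /hr; apply; exists a.
- move=> w Tw Qw; have [r r0 hr] := oQ' (u w) (ex_intro2 _ _ w Tw erefl) Qw.
  by have [s s0 hs] := cu w Tw r r0; exists s => // a Ta /(hs a Ta) /hr; apply; exists a.
Qed.

Lemma cconn_chainc E : cconn E -> chainc E.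
Proof.
move=> cE e z w e0 Ez Ew; apply: (cE (chain E e z)) w Ew; first by exists z => //; left.
- by move=> x Ex cx; exists e => // y Ey h; apply: (chain_step (w := x)).
- move=> x Ex nx; exists e => // y Ey h cy; apply: nx; apply: (chain_step (w := y)) => //.
  by rewrite cmodBC.
Qed.

(** Maximum principle for the constant function 1 with bound 0: the boundary condition holds
    vacuously, and a point of [O] would give [1 <= 0]. *)
Lemma no_clopen O : copen O -> cbounded O ->
  (forall b, ~ O b -> exists2 r : R, 0 < r & forall z, O z -> ~ cmod (z - b) < r) -> forall z, ~ O z.
Proof.
move=> oO bO h z Oz; have := @maxmod R O (fun=> 1) 0 oO bO (@hol_cst R O 1) (lexx 0) _ z Oz.
rewrite cmod1; apply: contraPP => _; rewrite leNgt ltr01 => /(_ _) k; apply: (notF); apply: k => b nb e e0.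
by have [r r0 hr] := h b nb; exists r => // w Ow /hr.
Qed.

(** Transfers estimates on a function of modulus [expR (G w)] back to the potential. *)
Lemma expR_dist (a b : R) : 0 <= a -> 0 <= b -> `|a - b| <= `|expR a - expR b|.
Proof.
move=> a0 b0; wlog ab : a b a0 b0 / b <= a => [h|].
  by have /orP[/h|/h] := le_total b a; [apply|rewrite distrC (distrC (expR a)); apply].
have e1 : 1 <= expR b by rewrite -expR0 ler_expR.
have := expR_ge1Dx (a - b); have := expR_gt0 a; rewrite expRD expRN => ea h; have eb := expR_gt0 b.
rewrite ger0_norm ?subr_ge0 // ger0_norm ?subr_ge0 ?ler_expR //.
have : (1 + (a - b)) * expR b <= expR a by rewrite -ler_pdivlMr.
by move: ab e1; move: (expR a) (expR b) => x y; clear; nra.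
Qed.

Lemma diff_zero (V W : normedModType R) (g : V -> W) (p : V) :
  (forall e, 0 < e -> \forall h \near (0 : V), `|g (h + p) - g p| <= e * `|h|) -> is_diff p g (cst 0).
Proof.
move=> hg; have key : continuous (\0 : V -> W) /\ g \o shift p = cst (g p) + \0 +o_ 0 id.
  split; first exact: cst_continuous.
  by apply/eqaddoP => e e0; apply: filterS (hg e e0) => h; rewrite /= addr0.
have dg : 'd g p = \0 :> (V -> W) by apply/diff_unique; case: key.
by apply: DiffDef => //; apply/diff_locallyP; rewrite dg; exact: key.
Qed.

End Bridges.

(** * Maximum principle for the potential *)

Section GreenMax.
Context {R : realType}.
Local Notation C := R[i].
Implicit Types (u h : C -> C) (B K s e r t : R) (x y z w p a b c l : C) (O X Q E T : set C).
Variable f : {poly C}.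
Hypothesis d3 : (3 <= degree f)%N.
Local Notation G := (green f).
Local Notation d := (degree f).

(** [maxmod] for the iterate of order [N], whose [lp] is [d ^+ N * G] up to [K]; division by
    [d ^+ N] makes the error small. *)
Lemma green_max O t : 0 <= t -> copen O -> cbounded O -> (forall b, ~ O b -> forall e, 0 < e -> exists2 r : R, 0 < r &
     forall z, O z -> cmod (z - b) < r -> G z <= t + e) -> forall z, O z -> G z <= t.
Proof.
move=> t0 oO bO h z Oz; have d0 := @d_gt0 R d d3; have [K K0 hK] := green_lp erefl d3 (f := f).
apply: le_small => e e0; have e2 : 0 < e / 2 by lra.
have K2 : 0 <= 2 * K by lra.
have [N hN] := small_pow d3 K2 e2; have := hN N (leqnn N) => {}hN.
have dn : 0 < d%:R ^+ N :> R by rewrite exprn_gt0.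
have mm := @maxmod R O (fun w => fwd_orbit f w N) (expR (d%:R ^+ N * (t + e / 2) + K)) oO bO (@fwd_hol R f N O) (expR_ge0 _) _ z Oz.
have : cmod (fwd_orbit f z N) <= expR (d%:R ^+ N * (t + e / 2) + K).
  apply: mm => b nb s s0; have [r r0 hr] := h b nb _ e2; exists r => // w Ow /(hr w Ow) Gw.
  apply: le_trans (cmod_lp _) _; apply: le_trans (_ : expR (d%:R ^+ N * (t + e / 2) + K) <= _); last by rewrite lerDl ltW.
  rewrite ler_expR; have := hK (fwd_orbit f w N); rewrite (green_fwd erefl d3) ler_norml => /andP[h1 _].
  by have := ler_wpM2l (ltW dn) Gw; lra.
have p0 : 0 <= d%:R ^+ N * (t + e / 2) by rewrite mulr_ge0 ?ltW //; lra.
move=> k; have := lp_le (addr_ge0 p0 K0) k; have := hK (fwd_orbit f z N); rewrite (green_fwd erefl d3) ler_norml => /andP[_ h2] h3.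
suff : d%:R ^+ N * (G z - t - e) <= 0 by rewrite pmulr_rle0 //; lra.
have : 2 * K <= d%:R ^+ N * (e / 2) by rewrite (mulrC (d%:R ^+ N)) -ler_pdivrMr.
by move: h2 h3; rewrite !mulrBr mulrDr; lra.
Qed.

End GreenMax.

(** * Area of plane sets *)

Section PlaneArea.
Context {R : realType}.
Local Notation C := R[i].
Implicit Types (r s M : R) (a z w : C) (A B O S : set C).

Definition plane A : set (measurableTypeR R * measurableTypeR R) := [set q | A (q.1 +i* q.2)].

Definition mble A : Prop := measurable (plane A).

(** Meaningful on bounded measurable sets, as [fine] sends an infinite area to 0. *)
Definition ar A : R := fine (area A).

Definition sqr a s : set C := [set z | `|Re z - Re a| < s /\ `|Im z - Im a| < s].

Lemma plane_sqr a s : plane (sqr a s) =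
  `]Re a - s, Re a + s[%classic `*` `]Im a - s, Im a + s[%classic.
Proof.
by apply/seteqP; split=> [[x y]|[x y]]; rewrite /plane /sqr /= !in_itv /= !ltr_norml => -[/andP[h1 h2] /andP[h3 h4]];
  split; split_lra.
Qed.

Lemma mble_sqr a s : mble (sqr a s).
Proof. by rewrite /mble plane_sqr; apply: measurableX; exact: measurable_itv. Qed.

Lemma area_sqr a s : 0 < s -> area (sqr a s) = ((2 * s) ^+ 2)%:E.
Proof.
move=> s0; rewrite /area -/(plane _) plane_sqr product_measure1E; [|exact: measurable_itv|exact: measurable_itv].
have len (x : R) : lebesgue_measure (`]x - s, x + s[%classic : set R) = (2 * s)%:E.
  by rewrite lebesgue_measure_itv /= lte_fin ifT; [rewrite -EFinB; congr EFin; ring|lra].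
by apply: (etrans (f_equal2 mule (len _) (len _))); rewrite -EFinM expr2.
Qed.

Lemma area_le A B : mble A -> mble B -> (forall z, A z -> B z) -> (area A <= area B)%E.
Proof. by move=> mA mB h; apply: le_measure; rewrite ?inE // => q; exact: h. Qed.

Lemma area_fin A : mble A -> cbounded A -> area A = (ar A)%:E.
Proof.
move=> mA [M hM]; rewrite /ar fineK // ge0_fin_numE; last exact: measure_ge0.
have M1 : 0 < Num.max M 0 + 1 by have : 0 <= Num.max M 0 := (ltac:(by rewrite le_max lexx orbT)); lra.
apply: (@le_lt_trans _ _ (area (sqr 0 (Num.max M 0 + 1)))); last by rewrite area_sqr // ltry.
apply: area_le mA (mble_sqr _ _) _ => z /hM zM; have : cmod z <= Num.max M 0 by rewrite le_max zM.
by rewrite /sqr /= !subr0; have := normRe z; have := normIm z; split; lra.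
Qed.

Lemma ar_ge0 A : 0 <= ar A.
Proof. by rewrite fine_ge0 // measure_ge0. Qed.

Lemma mbleI A B : mble A -> mble B -> mble (A `&` B).
Proof. exact: measurableI. Qed.

Lemma mbleD A B : mble A -> mble B -> mble (A `\` B).
Proof. exact: measurableD. Qed.

Lemma ar_le A B : mble A -> mble B -> cbounded B -> (forall z, A z -> B z) -> ar A <= ar B.
Proof.
move=> mA mB bB h; rewrite -lee_fin -!area_fin //; [exact: area_le|exact: cbounded_sub h bB].
Qed.

Lemma ar_split A B : mble A -> mble B -> cbounded A -> ar A = ar (A `&` B) + ar (A `\` B).
Proof.
move=> mA mB bA; have bI : cbounded (A `&` B) by apply: cbounded_sub bA => z [].
have bD : cbounded (A `\` B) by apply: cbounded_sub bA => z [].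
apply: EFin_inj; rewrite EFinD -!area_fin //; [|exact: mbleD|exact: mbleI].
rewrite /area -/(plane _) -/(plane (A `&` B)) -/(plane (A `\` B)) -measureU; [|exact: mbleI|exact: mbleD|].
  by congr (_ _); apply/seteqP; split=> q; [move=> Aq; have [Bq|nB] := pselect (B (q.1 +i* q.2)); [left|right]|case=> -[]].
by apply/seteqP; split=> q // [[_ Bq] [_ nB]].
Qed.

Lemma ar_sqr a s : 0 < s -> ar (sqr a s) = (2 * s) ^+ 2.
Proof. by move=> s0; rewrite /ar area_sqr. Qed.

Lemma open_sqr O z : copen O -> O z -> exists p : rat * rat * nat,
  let S := sqr (ratr p.1.1 +i* ratr p.1.2) p.2.+1%:R^-1 in S z /\ forall w, S w -> O w.
Proof.
move=> oO Oz; have [r r0 hr] := oO z Oz; have r4 : 0 < r / 4 by lra.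
have [N hN] := inv_lt_eps r4; have := hN N (leqnn N); have : 0 < N.+1%:R^-1 :> R by rewrite invr_gt0.
set s := N.+1%:R^-1 => s0 sr.
have rat_near (x : R) : exists q : rat, `|x - ratr q| < s.
  have [|q] := @rat_in_itvoo R (x - s) (x + s); first lra.
  rewrite in_itv /= => /andP[h1 h2]; exists q; rewrite ltr_norml; split_lra.
have [q1 h1] := rat_near (Re z); have [q2 h2] := rat_near (Im z).
have tri (x y q : R) : `|x - q| < s -> `|y - q| < s -> `|x - y| < r / 2.
  by rewrite !ltr_norml => /andP[? ?] /andP[? ?]; split_lra.
exists (q1, q2, N); split=> //= w [/= k1 k2]; apply: hr; apply: le_lt_trans (cmod_ReIm _) _; rewrite cReB cImB.
have := tri _ _ _ k1 h1; have := tri _ _ _ k2 h2; lra.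
Qed.

Lemma mble_open O : copen O -> mble O.
Proof.
move=> oO; pose S (p : rat * rat * nat) := sqr (ratr p.1.1 +i* ratr p.1.2 : C) p.2.+1%:R^-1.
have -> : O = \bigcup_a \bigcup_b \bigcup_n (if `[< forall w, S (a, b, n) w -> O w >] then S (a, b, n) else set0).
  apply/seteqP; split=> [z /(open_sqr oO)[[[a b] n] /= [h1 h2]]|z [a _ [b _ [n _]]]]; last by case: ifP => // /asboolP h /h.
  by exists a => //; exists b => //; exists n => //; rewrite asboolT.
apply: bigcupT_measurable_rat => a; apply: bigcupT_measurable_rat => b; apply: bigcupT_measurable => n.
case: ifP => _; [exact: mble_sqr|exact: measurable0].
Qed.

Lemma mble_closed O : cclosed O -> mble O.
Proof.
move=> cO; rewrite /mble -[plane O]setCK; apply: measurableC; apply: (@mble_open (~` O)) => z /(cclosedC cO).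
by [].
Qed.

Lemma ar_squares (I : eqType) (s : seq I) (c : I -> C) (rad : I -> R) S : mble S -> cbounded S -> uniq s ->
  (forall i, i \in s -> 0 < rad i /\ forall z, sqr (c i) (rad i) z -> S z) ->
  (forall i j z, i \in s -> j \in s -> sqr (c i) (rad i) z -> sqr (c j) (rad j) z -> i = j) ->
  \sum_(i <- s) (2 * rad i) ^+ 2 <= ar S.
Proof.
elim: s S => [|i s IH] S mS bS us hs dis; first by rewrite big_nil ar_ge0.
rewrite big_cons (ar_split mS (mble_sqr (c i) (rad i)) bS); have [ri hi] := hs i (mem_head _ _).
have /andP[nis us'] := us; apply: lerD.
  by rewrite -(ar_sqr (c i) ri); apply: ar_le; [exact: mble_sqr|exact: mbleI mS (mble_sqr _ _)|by apply: cbounded_sub bS => z []|by move=> z zi; split=> //; exact: hi].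
apply: IH => //; first exact: mbleD mS (mble_sqr _ _).
- by apply: cbounded_sub bS => z [].
- move=> j js; have ji : j \in i :: s by rewrite inE js orbT.
  have [rj hj] := hs j ji; split=> // z zj; split; first exact: hj.
  by move=> zi; move: nis; rewrite (dis i j z _ ji zi zj) ?mem_head // js.
- by move=> j k z js ks; apply: dis; rewrite inE ?js ?ks orbT.
Qed.

End PlaneArea.

(** * The length-area inequality *)

Section LengthArea.
Context {R : realType}.
Local Notation C := R[i].
Implicit Types (u v psi L : C -> C) (B D K s e d r t m : R) (z w p q a b c l : C) (X S : set C).

(** The closed horizontal curves of [psi] wind exactly once about [p], expressed by a logarithm of
    [psi - p] that gains one period. *)
Definition wind (m : R) psi p := exists L, [/\ hol (strip m) L,
  forall w, strip m w -> cexp (L w) = psi w - p & forall w, strip m w -> L (w + 1) = L w + per 1].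

Lemma wind_neq m psi p w : wind m psi p -> strip m w -> psi w != p.
Proof. by move=> [L [_ hL _]] /hL e; rewrite -subr_eq0 -e cexp_neq0. Qed.

Lemma strip_real (m t : R) w : strip m w -> strip m (w + t%:C).
Proof. by rewrite /strip /= cImD addr0. Qed.

(** If the loop stayed closer to [psi a] than [p] is, the ratios [(psi w - p) / (psi a - p)] would
    stay in the right half-plane and the argument could not gain a full turn. *)
Lemma wind_radius m psi p a r : wind m psi p -> strip m a ->
  (forall t, 0 <= t -> t <= 1 -> cmod (psi (a + t%:C) - psi a) <= r) -> cmod (psi a - p) <= r.
Proof.
move=> [L [hL EL L1]] Sa hr; rewrite leNgt; apply/negP => rp.
pose T := [set w : C | exists t, [/\ 0 <= t, t <= 1 & w = a + t%:C]].
have TS w : T w -> strip m w by move=> [t [_ _ ->]]; exact: strip_real.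
have cT : cconn T.
  apply: cconn_convex => z w s [t [t0 t1 ->]] [t' [t0' t1' ->]] s0 s1; exists (t + s * (t' - t)); split.
  - by case: (leP t t') => ?; nra.
  - by case: (leP t t') => ?; nra.
  - by rewrite rmorphD rmorphM rmorphB /=; ring.
have pa : psi a - p != 0 by rewrite -EL // cexp_neq0.
pose th w := Im (L w) - Im (L a).
have cosp w : T w -> 0 < cos (th w).
  move=> Tw; have -> : th w = Im (L w - L a) by rewrite cImB.
  have : 0 < Re (cexp (L w - L a)); last by rewrite Re_cexp pmulr_rgt0 // expR_gt0.
  apply: near1_Re; rewrite cexpB !EL //; last exact: TS.
  rewrite (_ : _ / _ - 1 = (psi w - psi a) / (psi a - p)); last by field.
  rewrite cmod_div ltr_pdivrMr ?cmod_gt0 // mul1r; apply: le_lt_trans rp.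
  by move: Tw => [t [t0 t1 ->]]; exact: hr.
have thpi w : T w -> th w != pi.
  by move=> /cosp; apply: contraTneq => ->; rewrite cospi -leNgt oppr_le0 ler01.
have cth w e : T w -> 0 < e -> exists2 d : R, 0 < d & forall x, T x -> cmod (x - w) < d -> `|th x - th w| < e.
  move=> Tw e0; have [d d0 hd] := hol_cont hL (TS w Tw) e0; exists d => // x _ /hd; apply: le_lt_trans.
  by rewrite /th opprB addrA subrK -cImB; exact: normIm.
have Ta : T a by exists 0; rewrite addr0; split=> //; exact: ler01.
have Ta1 : T (a + 1) by exists 1; split=> //; exact: ler01.
have pi0 := pi_gt0 R; have : th (a + 1) < pi.
  apply: (cT (fun w => th w < pi)) Ta1; first by exists a => //; rewrite /th subrr.
  - move=> w Tw h; have h0 : 0 < pi - th w by rewrite subr_gt0.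
    have [d d0 hd] := cth w _ Tw h0; exists d => // x Tx /(hd x Tx); rewrite ltr_norml => /andP[_]; lra.
  - move=> w Tw /negP; rewrite -leNgt le_eqVlt eq_sym (negPf (thpi w Tw)) /= => h; have h0 : 0 < th w - pi by rewrite subr_gt0.
    by have [d d0 hd] := cth w _ Tw h0; exists d => // x Tx /(hd x Tx); rewrite ltr_norml => /andP[+ _] k; lra.
rewrite /th L1 // cImD Im_per mul1r; lra.
Qed.

(** Constants uniform over one period of the middle half of the strip, by compactness: a lower bound
    of the derivative, a second-order Taylor constant and a radius of surjectivity. *)
Lemma derivative_bounds m psi : 0 < m -> hol (strip m) psi -> (forall z w, strip m z -> strip m w -> cmod (z - w) < 1 -> psi z = psi w -> z = w) ->
  exists B la rho : R, [/\ 0 < la, 0 < rho, 0 <= B &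
  forall z l, 0 <= Re z <= 1 -> m / 4 <= Im z <= 3 * m / 4 -> hasd psi z l -> [/\ la <= cmod l,
    forall w, cmod (w - z) < rho -> cmod (psi w - psi z - l * (w - z)) <= B * cmod (w - z) ^+ 2 &
    forall t y, 0 < t -> t <= rho -> cmod (y - psi z) < cmod l * t / 16 -> exists2 w, cmod (w - z) < t & psi w = y]].
Proof.
move=> m0 hpsi inj.
pose X := [set z : C | -1 <= Re z <= 2 /\ m / 8 <= Im z <= 7 * m / 8].
pose Y := [set z : C | 0 <= Re z <= 1 /\ m / 4 <= Im z <= 3 * m / 4].
have cbox (x0 x1 y0 y1 : R) : cclosed [set z : C | x0 <= Re z <= x1 /\ y0 <= Im z <= y1].
  move=> z hz /=; have sm (x y : R) : (forall e, 0 < e -> x <= y + e) -> x <= y by exact: le_small.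
  split; apply/andP; split; apply: le_small => e e0; have [w [/andP[w1 w2] /andP[w3 w4]]] := hz e e0 => wz;
    have := normRe (w - z); have := normIm (w - z); rewrite cReB cImB !ler_norml => /andP[h1 h2] /andP[h3 h4]; lra.
have bX : cbounded X.
  exists (2 + (m + 2)) => z [/andP[z1 z2] /andP[z3 z4]]; apply: le_trans (cmod_ReIm _) _.
  have : `|Re z| <= 2 by rewrite ler_norml; split_lra.
  have : `|Im z| <= m by rewrite ler_norml; split_lra.
  lra.
have XS z : X z -> strip m z by move=> [_ /andP[z3 z4]]; rewrite /strip /=; split_lra.
have neX : X !=set0 by exists (0 +i* (m / 2)); split=> /=; split_lra.
have [b Xb Bmax] := EVT_mod (cbox _ _ _ _) bX neX (fun z Xz => hol_cont hpsi (XS z Xz)); set M := cmod (psi b) in Bmax.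
have [r [r0 r1 rm]] := min_pos2 (ltr01 : 0 < 1 :> R) (ltac:(lra) : 0 < m / 8).
have YX z w : Y z -> cmod (w - z) < r -> X w.
  move=> [/andP[z1 z2] /andP[z3 z4]] wz; have := normRe (w - z); have := normIm (w - z).
  by rewrite cReB cImB !ler_norml => /andP[h1 h2] /andP[h3 h4]; split; split_lra.
have M0 : 0 <= M by exact: cmod_ge0.
pose K := 64 * M / r ^+ 2; have K0 : 0 <= K by rewrite divr_ge0 ?mulr_ge0 ?exprn_ge0 // ltW.
have r2 : 0 < r / 2 by lra.
have tay z l : Y z -> hasd psi z l -> forall w, cmod (w - z) < r -> cmod (psi w - psi z - l * (w - z)) <= K * cmod (w - z) ^+ 2.
  move=> Yz hl; have hz : hol [set w | cmod (w - z) < r] psi by apply: hol_sub hpsi => w /(YX z w Yz); exact: XS.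
  have [|_ h w] := taylor2 r0 M0 hz (fun w wz => Bmax w (YX z w Yz wz)) _ hl; first by rewrite subrr cmod0.
  exact: h.
have lip z w l n : Y z -> Y w -> cmod (w - z) < r -> hasd psi z l -> hasd psi w n -> cmod (l - n) <= 2 * K * cmod (w - z).
  move=> Yz Yw wz hl hn; have [wz'|zw] := eqVneq w z.
    by rewrite wz' in hn *; rewrite (hasd_uniq hl hn) !subrr cmod0 mulr0.
  have d0 : 0 < cmod (w - z) by rewrite cmod_gt0 subr_eq0.
  have h1 := tay z l Yz hl w wz; have := tay w n Yw hn z; rewrite cmodBC => /(_ wz) h2.
  rewrite -(ler_pM2r d0) -cmodM (_ : (l - n) * (w - z) = - ((psi w - psi z - l * (w - z)) + (psi z - psi w - n * (z - w)))); last by ring.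
  rewrite cmodN; apply: le_trans (cmodD _ _) _; move: h1 h2; rewrite expr2; move: (cmod (w - z)) => x; lra.
have l0 z l : Y z -> hasd psi z l -> l != 0.
  move=> Yz hl; have half : 0 < Num.min (1 / 2) r by rewrite lt_min r0 andbT; lra.
  apply: (@inj_hasd_neq0 R [set w | cmod (w - z) < Num.min (1 / 2) r] psi z l (@copen_ball R z _) _ _ _ hl).
  - by rewrite /= subrr cmod0.
  - by apply: hol_sub hpsi => w /=; rewrite lt_min => /andP[_ /(YX z w Yz)/XS].
  - move=> x w /=; rewrite !lt_min => /andP[x1 x2] /andP[w1 w2]; apply: inj; [exact/XS/(YX z x Yz)|exact/XS/(YX z w Yz)|].
    by have := cmod_tri z x w; rewrite (cmodBC z w); lra.
have [|||la la0 hla] := @compact_uniform R Y (fun z r => forall l, hasd psi z l -> r <= cmod l) (cbox _ _ _ _).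
- by apply: cbounded_sub bX => z [/andP[z1 z2] /andP[z3 z4]]; split; split_lra.
- by move=> y s s' h ss l /h; lra.
- move=> z Yz; have [l hl] := hpsi z (XS z (YX z z Yz (ltac:(by rewrite subrr cmod0)))).
  have lp := cmod_neq0 (l0 z l Yz hl); have K1 : 0 < 4 * (K + 1) by lra.
  have [s [s0 s1 s2]] := min_pos2 r0 (divr_gt0 lp K1); exists (Num.min s (cmod l / 2)); split; first by rewrite lt_min s0; lra.
  move=> w Yw; rewrite lt_min => /andP[ws _] n hn; have wr : cmod (w - z) < r by lra.
  have h1 := lip z w l n Yz Yw wr hl hn; have h2 := cmod_sub l n.
  have : 2 * K * cmod (w - z) <= cmod l / 2.
    have : cmod (w - z) * (4 * (K + 1)) <= cmod l by rewrite -ler_pdivlMr //; lra.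
    by have := cmod_ge0 (w - z); move: (cmod (w - z)) => x; lra.
  by rewrite ge_min; move=> ?; apply/orP; right; lra.
(* [ift] is used for [l^-1 * psi], with derivative 1 and bound [M / la], so that the radius of the
   covered disc scales with [cmod l]. *)
have [rho [rho0 rhor hift]] := @ift R r (M / la) 1 r0 (divr_ge0 M0 (ltW la0)) ltr01.
exists K, la, rho; split=> // z l z1 z2 hl; have Yz : Y z by [].
have lal := hla z Yz l hl; have ln0 := l0 z l Yz hl; have lp := cmod_neq0 ln0; split=> //.
  by move=> w wr; apply: (tay z l Yz hl); lra.
move=> t y t0 tr hy; pose v w := l^-1 * psi w.
have hv : hol [set w | cmod (w - z) < r] v.
  by apply: holM; [exact: hol_cst|apply: hol_sub hpsi => w /(YX z w Yz)/XS].
have vb w : cmod (w - z) < r -> cmod (v w) <= M / la.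
  move=> /(YX z w Yz)/Bmax h; rewrite cmodM cmodV mulrC ler_pM ?cmod_ge0 ?invr_ge0 ?cmod_ge0 // lef_pV2 ?posrE //.
have := hasdM (hasd_cst l^-1 z) hl; rewrite mul0r add0r mulVf // => vd.
have [|_ h] := hift v z 1 hv vb vd; first by rewrite cmod1.
have [|w wz e] := h t (l^-1 * y) t0 tr; first by rewrite mul1r /v -mulrBr cmodM cmodV ltr_pdivrMl //; lra.
by exists w => //; apply: (mulfI (invr_neq0 ln0)).
Qed.

Lemma int_small (k : int) : `|k%:~R : R| < 1 -> k = 0.
Proof. by rewrite -intr_norm (_ : 1 = 1%:~R) // ltr_int; lia. Qed.

Lemma mod_small (i i' n : nat) (k : int) : (i < n)%N -> (i' < n)%N -> i'%:Z - i%:Z - k * n%:Z = 0 -> k = 0.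
Proof.
move=> h1 h2 e; have e' : i'%:Z - i%:Z = k * n%:Z by lia.
have [k0|k0|//] := ltrgtP k 0; exfalso.
  have : k * n%:Z <= - n%:Z by rewrite -mulN1r ler_wpM2r //; lia.
  by lia.
have : n%:Z <= k * n%:Z by rewrite -[leLHS]mul1r ler_wpM2r //; lia.
by lia.
Qed.

(** Length-area on a finite grid of mesh [h], with [a] the modulus of the derivative. Each row gives
    [dl <= 4 * h * s] for the sum [s] of its [a]; this bounds the sum of [a ^+ 2] below, and
    disjoint squares of half-side [a * h / 64] in the image turn that into area. *)
Lemma length_area m psi S p q : 0 < m -> hol (strip m) psi -> (forall w, strip m w -> psi (w + 1) = psi w) ->
  (forall w w', strip m w -> strip m w' -> psi w = psi w' -> exists n : int, w' = w + n%:~R) ->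
  (forall w, strip m w -> S (psi w)) -> mble S -> cbounded S -> wind m psi p -> wind m psi q ->
  m * cmod (p - q) ^+ 2 <= 2 ^+ 16 * ar S.
Proof.
move=> m0 hpsi psi1 inj psiS mS bS wp wq.
have cint (k : int) : k%:~R = (k%:~R : R)%:C :> C by rewrite rmorph_int.
have [|B [la [rho [la0 rho0 B0 hder]]]] := derivative_bounds m0 hpsi.
  move=> z w Sz Sw zw /(inj z w Sz Sw)[k wk]; have k0 : k = 0.
    by apply: int_small; move: zw; rewrite wk opprD addNKr cmodN cint cmod_real.
  by rewrite wk k0 addr0.
(* A mesh below [la / (B + 1)] keeps the Taylor error of one step below the linear term; one below
   [m / 4] keeps the cells inside the strip and leaves rows of total height at least [m / 4]. *)
pose e0 := Num.min rho (Num.min (la / (B + 1)) (m / 4)).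
have B1 : 0 < B + 1 by lra.
have e00 : 0 < e0 by rewrite !lt_min rho0 divr_gt0 //=; lra.
have [n [h [n0 h0 nh hb]]] : exists (n : nat) (h : R), [/\ 0 < n%:R :> R, 0 < h, n%:R * h = 1 & h < e0].
  have [n hn] := inv_lt_eps e00; exists n.+1, n.+1%:R^-1; rewrite invr_gt0 ltr0n; split=> //; last exact: hn.
  by rewrite mulfV // pnatr_eq0.
move: hb; rewrite !lt_min => /and3P[hrho]; rewrite ltr_pdivlMr // => hla hm.
have [J [J1 J2]] : exists J : nat, J%:R * h <= m / 2 /\ m / 4 <= J%:R * h.
  have x0 : 0 <= n%:R * (m / 2) by rewrite mulr_ge0 //; lra.
  have [J /andP[a1 a2]] : exists J : nat, J%:R <= n%:R * (m / 2) < J%:R + 1.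
    by exists (Num.truncn (n%:R * (m / 2))); rewrite natr1; exact: truncn_itv.
  exists J; have := ler_wpM2r (ltW h0) a1; have : n%:R * (m / 2) * h < (J%:R + 1) * h by rewrite ltr_pM2r.
  by rewrite mulrAC nh mulrDl !mul1r => b1 b2; clear -b1 b2 hm; split; lra.
pose pt (ij : nat * nat) : C := (ij.2%:R * h) +i* (m / 4 + ij.1%:R * h).
have ptY j i : (j < J)%N -> (i <= n)%N -> 0 <= Re (pt (j, i)) <= 1 /\ m / 4 <= Im (pt (j, i)) <= 3 * m / 4.
  move=> jJ ni; have jJ' : j%:R * h <= J%:R * h by rewrite ler_wpM2r ?(ltW h0) // ler_nat ltnW.
  have ni' : i%:R * h <= 1 by rewrite -[leRHS]nh ler_wpM2r ?(ltW h0) // ler_nat.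
  have a1 : 0 <= i%:R * h by rewrite mulr_ge0 // ltW.
  have a2 : 0 <= j%:R * h by rewrite mulr_ge0 // ltW.
  by rewrite /=; clear -jJ' ni' a1 a2 J1; split; split_lra.
have ptS j i : (j < J)%N -> (i <= n)%N -> strip m (pt (j, i)).
  by move=> jJ ni; have [_ /andP[b1 b2]] := ptY j i jJ ni; rewrite /strip /=; rewrite /= in b1 b2; clear -b1 b2 m0; split_lra.
have /choice [D hD] : forall w, exists l, strip m w -> hasd psi w l.
  by move=> w; have [/hpsi[l hl]|nS] := pselect (strip m w); [exists l|exists 0].
have der j i jJ ni := hder (pt (j, i)) _ (ptY j i jJ ni).1 (ptY j i jJ ni).2 (hD _ (ptS j i jJ ni)).
pose a ij := cmod (D (pt ij)); set dl := cmod (p - q).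
(* One factor 2 absorbs the Taylor error, the other comes from joining [p] to [q] through the base
   point of the row. *)
have row j : (j < J)%N -> dl <= 4 * h * \sum_(0 <= i < n) a (j, i).
  move=> jJ; pose w0 := pt (j, 0%N).
  have w0E i : w0 + (i%:R * h)%:C = pt (j, i) by rewrite /w0 /pt /= mul0r; apply: cplx_eq; rewrite ?cReD ?cImD /= ?add0r ?addr0.
  have walk i : (i <= n)%N -> forall t, 0 <= t -> t <= i%:R * h -> cmod (psi (w0 + t%:C) - psi w0) <= 2 * h * \sum_(0 <= k < i) a (j, k).
    elim: i => [|i IH] ni t t0 ti.
      have -> : t = 0 by move: ti; rewrite mul0r; lra.
      by rewrite big_geq // mulr0 addr0 subrr cmod0.
    have mono : 2 * h * \sum_(0 <= k < i) a (j, k) <= 2 * h * \sum_(0 <= k < i.+1) a (j, k).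
      rewrite ler_wpM2l //; first lra.
      by rewrite [leRHS]big_nat_recr //= lerDl cmod_ge0.
    have [ti'|ti'] := leP t (i%:R * h); first by apply: le_trans mono; apply: IH => //; exact: ltnW.
    rewrite big_nat_recr //= mulrDr; apply: le_trans (cmod_tri (psi (pt (j, i))) _ _) _; rewrite addrC; apply: lerD.
      by rewrite -w0E; apply: IH => //; [exact: ltnW|rewrite mulr_ge0 // ltW].
    have [c1 c2 _] := der j i jJ (ltnW ni); set l := D _ in c1 c2; have al : a (j, i) = cmod l by [].
    have E : w0 + t%:C - pt (j, i) = (t - i%:R * h)%:C by rewrite -w0E rmorphB /=; ring.
    have tt : `|t - i%:R * h| <= h by clear -ti ti'; rewrite ger0_norm; move: ti; rewrite -natr1 mulrDl mul1r; lra.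
    have := c2 (w0 + t%:C); rewrite E cmod_real => /(_ (le_lt_trans tt hrho)) c3.
    have := cmodD (psi (w0 + t%:C) - psi (pt (j, i)) - l * (t - i%:R * h)%:C) (l * (t - i%:R * h)%:C).
    rewrite subrK cmodM cmod_real al; move: c3 tt (normr_ge0 (t - i%:R * h)); move: (`|_|) => x c3 tt x0 c4.
    have Bl : B * h <= cmod l by clear -hla c1 h0; move: hla; rewrite mulrDr mulr1 mulrC; lra.
    by have := ler_wpM2l B0 tt; rewrite expr2 in c3; clear -c3 tt x0 c4 Bl B0 h0; nra.
  have rad (u : C) : wind m psi u -> cmod (psi w0 - u) <= 2 * h * \sum_(0 <= k < n) a (j, k).
    move=> wu; apply: wind_radius wu (ptS j 0%N jJ (leq0n _)) _ => t t0 t1; apply: walk => //; by rewrite nh.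
  have := cmod_tri (psi w0) p q; have := rad p wp; have := rad q wq; rewrite (cmodBC p (psi w0)) /dl; lra.
have rowsq j : (j < J)%N -> n%:R * (dl / 4) ^+ 2 <= \sum_(0 <= i < n) a (j, i) ^+ 2.
  move=> jJ; have dl0 : 0 <= dl by exact: cmod_ge0.
  (* Cauchy-Schwarz, by completing the square at the mean value [dl / 4]. *)
  have : \sum_(0 <= i < n) (2 * (dl / 4) * a (j, i) - (dl / 4) ^+ 2) <= \sum_(0 <= i < n) a (j, i) ^+ 2.
    by apply: ler_sum => i _; have := sqr_ge0 (a (j, i) - dl / 4); rewrite !expr2; lra.
  apply: le_trans; rewrite sumrB -mulr_sumr sumr_const_nat subn0 -[X in _ - X]mulr_natl.
  have := row j jJ; move: (\sum_(0 <= i < n) _) => s hs.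
  have : n%:R * (dl / 4) <= s by have := ler_wpM2l (ltW n0) hs; rewrite (_ : _ * (4 * h * s) = 4 * (n%:R * h) * s); [rewrite nh; lra|ring].
  by rewrite expr2; nra.
pose s := [seq (j, i) | j <- iota 0 J, i <- iota 0 n].
have sE j i : ((j, i) \in s) = (j < J)%N && (i < n)%N.
  by apply/allpairsP/andP => [[[j' i'] /= [+ + [-> ->]]]|[jJ ni]]; rewrite ?mem_iota //; exists (j, i); rewrite /= !mem_iota.
(* The square lies in the disc of radius [a * h / 32], which [psi] covers from the disc of radius
   [h / 2] about the grid point; these source discs are disjoint modulo the period. *)
have cell j i z : (j < J)%N -> (i < n)%N -> sqr (psi (pt (j, i))) (a (j, i) * h / 64) z ->
    exists w, [/\ strip m w, cmod (w - pt (j, i)) < h / 2 & psi w = z].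
  move=> jJ ni [z1 z2]; have [c1 _ c3] := der j i jJ (ltnW ni).
  have [|||w wz e] := c3 (h / 2) z; [by clear -h0; lra|by clear -h0 hrho; lra| |exists w; split=> //].
    apply: le_lt_trans (cmod_ReIm _) _; rewrite cReB cImB -/(a (j, i)); lra.
  have [_ /andP[b1 b2]] := ptY j i jJ (ltnW ni); have := normIm (w - pt (j, i)); rewrite cImB ler_norml => /andP[d1 d2].
  by rewrite /strip /=; clear -b1 b2 d1 d2 wz hm; split_lra.
have key : \sum_(ij <- s) (2 * (a ij * h / 64)) ^+ 2 <= ar S.
  apply: (@ar_squares R _ s (fun ij => psi (pt ij)) (fun ij => a ij * h / 64) S mS bS).
  - by apply: allpairs_uniq; [exact: iota_uniq|exact: iota_uniq|move=> [? ?] [? ?]].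
  - move=> [j i]; rewrite sE => /andP[jJ ni]; split; last by move=> z /(cell j i z jJ ni)[w [Sw _ <-]]; exact: psiS.
    have [c1 _ _] := der j i jJ (ltnW ni); rewrite divr_gt0 // mulr_gt0 //; exact: lt_le_trans c1.
  move=> [j i] [j' i'] z; rewrite !sE => /andP[jJ ni] /andP[jJ' ni'] /(cell _ _ _ jJ ni)[w [Sw wz e]] /(cell _ _ _ jJ' ni')[w' [Sw' wz' e']].
  have [k wk] := inj w w' Sw Sw' (etrans e (esym e')).
  have kR : Re w' = Re w + k%:~R /\ Im w' = Im w by rewrite wk cint cReD cImD /= addr0.
  have := normRe (w - pt (j, i)); have := normRe (w' - pt (j', i')); have := normIm (w - pt (j, i)); have := normIm (w' - pt (j', i')).
  rewrite !(cReB, cImB) kR.1 kR.2 /= !ler_norml => /andP[b1 b2] /andP[b3 b4] /andP[b5 b6] /andP[b7 b8].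
  clear -mS wz wz' b1 b2 b3 b4 b5 b6 b7 b8 h0 nh ni ni'.
  have ii : i'%:Z - i%:Z - k * n%:Z = 0.
    apply: int_small; rewrite !rmorphB rmorphM /= -!pmulrn; have E : k%:~R * n%:R * h = k%:~R :> R by rewrite -mulrA nh mulr1.
    have : `|(i'%:R - i%:R - k%:~R * n%:R) * h| < h by rewrite ltr_norml !mulrBl E; split_lra.
    by rewrite normrM (gtr0_norm h0) gtr_pMl.
  have jj : j'%:Z - j%:Z = 0.
    apply: int_small; rewrite rmorphB /= -!pmulrn.
    have : `|(j'%:R - j%:R) * h| < h by rewrite ltr_norml !mulrBl; split_lra.
    by rewrite normrM (gtr0_norm h0) gtr_pMl.
  have k0 := mod_small ni ni' ii.
  by move/eqP: jj; move/eqP: ii; rewrite k0 mul0r subr0 !subr_eq0 => /eqP[->] /eqP[->].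
rewrite big_allpairs_dep /= in key; have p16 : 0 <= 2 ^+ 16 :> R by rewrite exprn_ge0.
apply: le_trans (ler_wpM2l p16 key).
have inner j : (j < J)%N -> h ^+ 2 / 2 ^+ 10 * (n%:R * (dl / 4) ^+ 2) <= \sum_(i <- iota 0 n) (2 * (a (j, i) * h / 64)) ^+ 2.
  move=> jJ; apply: le_trans (_ : h ^+ 2 / 2 ^+ 10 * \sum_(0 <= i < n) a (j, i) ^+ 2 <= _).
    by rewrite ler_wpM2l ?rowsq // divr_ge0 ?exprn_ge0 // ltW.
  by rewrite mulr_sumr /index_iota subn0; apply: ler_sum => i _; rewrite le_eqVlt; apply/orP; left; apply/eqP; field.
apply: le_trans (_ : 2 ^+ 16 * \sum_(j <- iota 0 J) h ^+ 2 / 2 ^+ 10 * (n%:R * (dl / 4) ^+ 2) <= _); last first.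
  apply: ler_wpM2l => //; rewrite !big_seq; apply: ler_sum => j; rewrite mem_iota => /andP[_ jJ]; exact: inner.
rewrite big_const_seq count_predT size_iota iter_addr_0 -[_ *+ J]mulr_natl.
(* Of the 16 binary powers, 10 pay for the squares [(2 * (a * h / 64)) ^+ 2] and 4 for
   [(dl / 4) ^+ 2]; the remaining factor 4 meets [m / 4 <= J%:R * h]. *)
rewrite (_ : 2 ^+ 16 * _ = 4 * (J%:R * h) * (n%:R * h) * dl ^+ 2); last by field.
by rewrite nh mulr1 ler_wpM2r ?sqr_ge0 //; lra.
Qed.
End LengthArea.

(** * Combinatorics of tableaux *)

Section Tableau.
Context {R : realType}.
Local Open Scope nat_scope.
Implicit Types (M N : nat -> nat -> bool) (i j k l m n q r : nat).

(** The number of critical entries on the diagonal that starts at depth [k] in column 0; [i < k]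
    leaves out depth 0. *)
Definition hits M k := count (fun i => M (k - i) i) (iota 0 k).

Definition weight M k : R := (2^-1 ^+ hits M k)%R.

Definition diverges (w : nat -> R) := forall A : R, exists n, (A <= \sum_(0 <= k < n) w k)%R.

Lemma weight_ge0 M k : (0 <= weight M k)%R.
Proof. by rewrite exprn_ge0 // invr_ge0 ler0n. Qed.

Lemma sum_sub (w : nat -> R) (s : seq nat) m n : (forall k, (0 <= w k)%R) -> uniq s -> all (fun k => m <= k < n) s ->
  (\sum_(k <- s) w k <= \sum_(m <= k < n) w k)%R.
Proof.
move=> w0 us sn; rewrite [leRHS](bigID (mem s)) /= -[leLHS]addr0; apply: lerD; last by apply: sumr_ge0.
rewrite -[X in (_ <= X)%R]big_filter; rewrite (perm_big [seq k <- index_iota m n | mem s k]) //.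
apply: uniq_perm => //; first by rewrite filter_uniq // iota_uniq.
by move=> k; rewrite mem_filter mem_index_iota /=; case ks: (k \in s) => //=; rewrite (allP sn).
Qed.

Lemma hits_bounded M b : (forall k, hits M k <= b) -> diverges (weight M).
Proof.
move=> hb A; have b0 : (0 < 2 ^+ b :> R)%R by rewrite exprn_gt0.
have An := le_lt_trans (ler_norm (A * 2 ^+ b)%R) (archi_boundP (normr_ge0 (A * 2 ^+ b)%R)).
exists (Num.bound `|A * 2 ^+ b|%R); set n := Num.bound _ in An *.
apply: (@le_trans _ _ (\sum_(0 <= k < n) (2^-1 ^+ b : R))%R); last first.
  by apply: ler_sum => k _; apply: ler_wiXn2l; rewrite ?invr_ge0 ?ler0n ?invf_le1 ?ler1n //; exact: hb.
by rewrite sumr_const_nat subn0 -[leRHS]mulr_natl exprVn ler_pdivlMr // ltW.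
Qed.

Lemma count_late k n (a : pred nat) : (forall i, i < k -> a i -> k - i < n) -> count a (iota 0 k) <= n.
Proof.
move=> h; have [kn|nk] := leqP k n; first by apply: leq_trans (count_size _ _) _; rewrite size_iota.
rewrite -(subnKC (ltnW nk)) addnC iotaD count_cat add0n.
have -> : count a (iota 0 (k - n)) = 0; last first.
  by rewrite add0n; apply: leq_trans (count_size _ _) _; rewrite size_iota.
apply/eqP; rewrite -leqn0 leqNgt -has_count; apply/hasPn => i; rewrite mem_iota add0n => /andP[_ ik].
by apply/negP => /h; lia.
Qed.

Variable M : nat -> nat -> bool.
Hypotheses (M0 : forall n, M n 0) (M1 : forall n i, M n.+1 i -> M n i).

Lemma down N n n' i : (forall n i, N n.+1 i -> N n i) -> n' <= n -> N n i -> N n' i.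
Proof.
move=> N1 /subnK <-; elim: (n - n') => [|j IH] //; by rewrite addSn => /N1.
Qed.

Section Column.
Variable N : nat -> nat -> bool.
Hypotheses (N1 : forall n i, N n.+1 i -> N n i)
  (N2 : forall n i j, N n i -> j <= n -> N (n - j) (i + j) = M (n - j) j).

(** Before column [r] the diagonal has no critical entry; from there, at depth [m], it repeats a
    diagonal of the critical tableau. *)
Lemma hits_shift m r : (forall j, j < r -> ~~ N (m + r - j) j) -> N m r -> hits N (m + r) = hits M m.
Proof.
move=> no Nm; rewrite /hits addnC iotaD count_cat add0n.
have -> : count (fun i => N (r + m - i) i) (iota 0 r) = 0.
  apply/eqP; rewrite -leqn0 leqNgt -has_count; apply/hasPn => i; rewrite mem_iota add0n => /andP[_ ir].
  by rewrite addnC; exact: no.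
rewrite add0n -[in iota r m](addn0 r) iotaDl count_map; apply: eq_in_count => j; rewrite mem_iota add0n => /andP[_ jm] /=.
by rewrite subnDl -(N2 Nm (ltnW jm)).
Qed.

(** If some depth has no critical entry, hits occur only near the end of each diagonal and are
    bounded in number. Otherwise the first critical column [r k] at each depth embeds the critical
    sum into this one, [k] going to [k + r k] with equal weight. *)
Lemma column_diverges : diverges (weight M) -> diverges (weight N).
Proof.
move=> dM; have [hN|] := pselect (forall n, exists i, N n i); last first.
  move=> /existsNP[n hn]; apply: (@hits_bounded N n) => k; apply: count_late => i ik Ni.
  rewrite ltnNge; apply/negP => ni; apply: hn; exists i; exact: down Ni.
move=> A; have [n An] := dM A.
pose r k := ex_minn (hN k); have rP k : N k (r k) /\ forall i, N k i -> r k <= i by rewrite /r; case: ex_minnP.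
pose s := [seq k + r k | k <- iota 0 n]; exists (\max_(k <- s) k).+1.
apply: le_trans An _; have -> : (\sum_(0 <= k < n) weight M k = \sum_(k <- s) weight N k)%R.
  rewrite big_map /index_iota subn0; apply: eq_bigr => k _; rewrite /weight hits_shift //; last by case: (rP k).
  move=> j jr; apply/negP => Nj; have : N k j by apply: down Nj => //; lia.
  by move=> /(rP k).2; lia.
apply: sum_sub; first exact: weight_ge0.
- rewrite map_inj_in_uniq ?iota_uniq // => k k' _ _ e; wlog kk : k k' e / k < k' => [h|].
    by have [kk|kk|//] := ltngtP k k'; [exact: h|apply/esym/h].
  have /(rP k).2 : N k (r k') by apply: down (rP k').1 => //; exact: ltnW.
  by lia.
- by apply/allP => k ks; rewrite ltnS; exact: leq_bigmax_seq.
Qed.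

End Column.

(** The tableau rules. By [M2] a diagonal copies the critical tableau from a critical entry on. By
    [M3] the lower end of the critical entries in column [i] excludes a match in column [i + r],
    when column [r] is critical one level deeper and is the first return on its diagonal. *)
Hypothesis M2 : forall n i j, M n i -> j <= n -> M (n - j) (i + j) = M (n - j) j.
Hypothesis M3 : forall k i r, 0 < r -> r < k -> M k i -> ~~ M k.+1 i ->
  (forall j, 0 < j -> j < r -> ~~ M (k - j) j) -> M (k - r).+1 r -> ~~ M (k - r).+1 (i + r).
Hypothesis aperiodic : forall i, 0 < i -> exists n, ~~ M n i.

(** [m + r] is a child of [m]: after column 0 its diagonal is next critical at depth [m]. A child
    has one hit more, hence half the weight. *)
Definition kid m r := M m r /\ forall j, 0 < j -> j < r -> ~~ M (m + r - j) j.

Lemma hits_kid m r : 0 < r -> kid m r -> hits M (m + r) = (hits M m).+1.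
Proof.
move=> r0 [Mm no]; rewrite /hits addnC iotaD count_cat add0n.
have -> : count (fun i => M (r + m - i) i) (iota 0 r) = 1.
  case: r r0 Mm no => // r _ Mm no; rewrite /= M0 -[RHS]addn0; congr (_ + _).
  apply/eqP; rewrite -leqn0 leqNgt -has_count; apply/hasPn => i; rewrite mem_iota => /andP[i0 ir].
  by rewrite addnC; apply: no; lia.
rewrite add1n; congr _.+1; rewrite -[in iota r m](addn0 r) iotaDl count_map; apply: eq_in_count => j.
by rewrite mem_iota add0n => /andP[_ jm] /=; rewrite subnDl -(M2 Mm (ltnW jm)).
Qed.

(** The first return [r1] to depth [m] gives one child. By aperiodicity column [r1] is critical only
    down to some depth [D]; [M3] carries this end along the multiples of [r1], which clears the
    diagonal for a second return beyond column [q]. *)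
Lemma two_kids m : 0 < m -> (forall n, 0 < n -> exists i, (0 < i) && M n i) ->
  exists r1 r2, [/\ 0 < r1, r1 < r2, kid m r1 & kid m r2].
Proof.
move=> m0 rec; case: (ex_minnP (rec m m0)) => r1 /andP[r10 Mr1] min1.
have no1 n j : m <= n -> 0 < j -> j < r1 -> ~~ M n j.
  by move=> mn j0 jr; apply/negP => /(down M1 mn) Mj; have := min1 j; rewrite j0 Mj => /(_ isT); lia.
(* [D] is the last depth at which column [r1] is critical. *)
case: (ex_minnP (aperiodic r10)) => -[|D] nD minD; first by rewrite M0 in nD || (by have := down M1 (leq0n m) Mr1; rewrite (negPf nD)).
have MD : M D r1 by apply/negPn/negP => /minD; rewrite ltnn.
have mD : m <= D by rewrite leqNgt; apply/negP => h; have := down M1 h Mr1; rewrite (negPf nD).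
(* In column [l.+1 * r1] the critical entries end exactly at depth [D - l * r1]. *)
have semi l : m + l * r1 <= D -> M (D - l * r1) (l.+1 * r1) /\ ~~ M (D - l * r1).+1 (l.+1 * r1).
  elim: l => [|l IH] h; first by rewrite mul0n subn0 mul1n.
  have [|Ml nMl] := IH; first by rewrite mulSn in h; lia.
  have E : D - l.+1 * r1 = D - l * r1 - r1 by rewrite mulSn; lia.
  have rk : r1 < D - l * r1 by rewrite mulSn in h; lia.
  have E2 : l.+2 * r1 = l.+1 * r1 + r1 by rewrite mulSn addnC.
  rewrite E E2 M2 ?(ltnW rk) //; split; first by apply: down MD => //; lia.
  apply: M3 => //; last by apply: down MD => //; lia.
  by move=> j j0 jr; apply: no1 => //; rewrite mulSn in h; lia.
pose q := r1 + D - m.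
(* On the diagonal from depth [m + q + 1], columns 1 to [q] are noncritical: off the multiples of
   [r1] because no return is shorter than [r1], on them by [semi]. *)
have below i : 0 < i -> i <= q -> ~~ M ((m + q).+1 - i) i.
  move=> i0 iq; have E : (m + q).+1 - i = (D + r1).+1 - i by rewrite /q; lia.
  rewrite {}E; have [ir|ri] := ltnP i r1; first by apply: no1 => //; lia.
  have [l [j [jr iE]]] : exists l j, j < r1 /\ i = l.+1 * r1 + j.
    exists (i %/ r1).-1, (i %% r1); rewrite ltn_mod prednK ?divn_gt0 //; split=> //; exact: divn_eq.
  have lD : m + l * r1 + j <= D by move: iq; rewrite iE mulSn /q; lia.
  have [|Ml nMl] := semi l; first by lia.
  have E : (D + r1).+1 - i = (D - l * r1 - j).+1 by rewrite iE mulSn; lia.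
  rewrite {}E; have [j0|j0] := posnP j; first by rewrite iE j0 subn0 addn0.
  apply/negP => /M1; rewrite iE M2 //; last by lia.
  by apply/negP/no1 => //; lia.
have [i /andP[i0 Mi]] : exists i, (0 < i) && M (m + q) i by apply: rec; lia.
(* Repeating one return time [i] leads to a critical column beyond [q] while the depth is still at
   least [m]. *)
have many t : t * i <= q -> M (m + q - t * i) (t.+1 * i).
  elim: t => [|t IH] h; first by rewrite subn0 mul1n.
  have E : m + q - t.+1 * i = m + q - t * i - i by rewrite mulSn; lia.
  rewrite mulSn in h; have -> : t.+2 * i = t.+1 * i + i by rewrite (mulSn t.+1) addnC.
  by rewrite E M2; [apply: down Mi => //; lia|apply: IH; lia|lia].
have ex2 : exists j, (q < j) && M m j.
  exists ((q %/ i).+1 * i); rewrite ltn_ceil //=; apply: down (many (q %/ i) _) => //; last exact: leq_trunc_div.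
  by have := leq_trunc_div q i; lia.
case: (ex_minnP ex2) => r2 /andP[qr2 Mr2] min2; exists r1, r2; split=> //; first by apply: leq_trans qr2; rewrite ltnS /q; lia.
- by split=> // j j0 jr; apply: no1 => //; lia.
split=> // j j0 jr; have [jq|qj] := leqP j q.
  by apply/negP => Mj; have := below j j0 jq; rewrite (down M1 _ Mj) //; lia.
apply/negP => Mj; have : M m j by apply: down Mj => //; lia.
by move=> Mm; have := min2 j; rewrite qj Mm => /(_ isT); lia.
Qed.

(** In the recurrent case each [m > 0] has two children of half its weight, an index has only one
    parent, and 1 is no child. The children of an initial range repeat its sum, and the index 1 adds
    its weight 1/2; so partial sums grow by 1/2 again and again. *)
Lemma critical_diverges : diverges (weight M).
Proof.
have [rec|] := pselect (forall n, 0 < n -> exists i, (0 < i) && M n i); last first.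
  move=> /existsNP[n /not_implyP[n0 hn]]; apply: (@hits_bounded M n.+1) => -[|k] //; rewrite /hits /= M0.
  have -> : iota 1 k = map (addn 1) (iota 0 k) by rewrite -iotaDl.
  rewrite count_map ltnS; apply: count_late => i ik /= Mi; rewrite ltnNge; apply/negP => ni.
  by apply: hn; exists i.+1; apply: down Mi.
have /choice [kk hkk] : forall m, exists rr : nat * nat, 0 < m -> [/\ 0 < rr.1, rr.1 < rr.2, kid m rr.1 & kid m rr.2].
  by move=> m; have [->|/two_kids/(_ rec)[r1 [r2 h]]] := posnP m; [exists (0, 0)|exists (r1, r2)].
pose k1 m := m + (kk m).1; pose k2 m := m + (kk m).2.
have kid_inj m m' r r' : 0 < r -> 0 < r' -> kid m r -> kid m' r' -> m + r = m' + r' -> m = m'.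
  move=> r0 r0' [Mm h] [Mm' h'] e; case: (ltngtP m m') => // mm.
    by have := h r' r0'; rewrite e addnK Mm' => /(_ ltac:(lia)).
  by have := h' r r0; rewrite -e addnK Mm => /(_ ltac:(lia)).
pose S n := (\sum_(1 <= k < n) weight M k)%R.
have step n : exists n', (S n + 2^-1 <= S n')%R.
  pose s := 1 :: [seq k1 m | m <- index_iota 1 n] ++ [seq k2 m | m <- index_iota 1 n].
  exists (\max_(k <- s) k).+1; have half m : 0 < m -> (weight M (k1 m) + weight M (k2 m) = weight M m)%R.
    move=> m0; have [r1 r12 kr1 kr2] := hkk m m0; rewrite /weight /k1 /k2 !hits_kid //; last exact: ltn_trans r12.
    by rewrite exprS; field.
  have -> : (S n + 2^-1 = \sum_(k <- s) weight M k)%R.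
    rewrite big_cons big_cat /= !big_map -big_split /= addrC /S; congr (_ + _)%R; first by rewrite /weight /hits /= M0 expr1.
    by apply: eq_big_nat => m /andP[m0 _]; rewrite -half.
  have big m : 0 < m -> 1 < k1 m /\ k1 m < k2 m by move=> m0; have [r1 r12 _ _] := hkk m m0; rewrite /k1 /k2; lia.
  have P (g h : nat -> nat) : (forall m, 0 < m -> exists2 r, 0 < r & g m = m + r /\ kid m r) ->
      (forall m, 0 < m -> exists2 r, 0 < r & h m = m + r /\ kid m r) ->
      forall m m', m \in index_iota 1 n -> m' \in index_iota 1 n -> g m = h m' -> m = m'.
    move=> hg hh m m'; rewrite !mem_index_iota => /andP[/hg[r r0 [-> kr]] _] /andP[/hh[r' r0' [-> kr']] _].
    exact: kid_inj.
  have K1 m : 0 < m -> exists2 r, 0 < r & k1 m = m + r /\ kid m r.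
    by move=> m0; have [r1 r12 a b] := hkk m m0; exists (kk m).1.
  have K2 m : 0 < m -> exists2 r, 0 < r & k2 m = m + r /\ kid m r.
    by move=> m0; have [r1 r12 a b] := hkk m m0; exists (kk m).2 => //; exact: ltn_trans r12.
  apply: sum_sub; first exact: weight_ge0; last first.
    apply/allP => k ks; rewrite ltnS leq_bigmax_seq // andbT; move: ks; rewrite /s inE => /predU1P[->//|].
    rewrite mem_cat => /orP[] /mapP[m]; rewrite mem_index_iota => /andP[/big[a b] _] ->; lia.
  rewrite /= cat_uniq !map_inj_in_uniq ?iota_uniq ?andbT /=; [|exact: P|exact: P].
  rewrite mem_cat negb_or; apply/andP; split; last first.
    apply/hasPn => _ /mapP[m mn ->]; apply/negP => /mapP[m' mn' e]; have mm := P _ _ K2 K1 m m' mn mn' e.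
    by move: mn; rewrite mem_index_iota => /andP[/big[_]]; rewrite e mm ltnn.
  by apply/andP; split; apply/negP => /mapP[m]; rewrite mem_index_iota => /andP[/big[a b] _] e; lia.
have grow t : exists n, (t%:R * 2^-1 <= S n)%R.
  elim: t => [|t [n hn]]; first by exists 0; rewrite mul0r /S big_geq.
  by have [n' hn'] := step n; exists n'; rewrite -natr1 mulrDl mul1r; apply: le_trans hn'; rewrite lerD2r.
move=> A; have An := le_lt_trans (ler_norm (A * 2)%R) (archi_boundP (normr_ge0 (A * 2)%R)).
have [n hn] := grow (Num.bound `|A * 2|%R); exists n; apply: le_trans (_ : S n <= _)%R; last first.
  apply: sum_sub; [exact: weight_ge0|exact: iota_uniq|by apply/allP => k; rewrite mem_index_iota => /andP[_ ->]].
by apply: le_trans hn; rewrite ler_pdivlMr // ltW.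
Qed.

End Tableau.

Lemma telescope (R : realType) (A c d : R) (u w : nat -> R) n :
  (forall k, c * w k * d <= A * (u k - u k.+1)) -> c * d * \sum_(0 <= k < n) w k <= A * (u 0%N - u n).
Proof.
move=> h; elim: n => [|n IH]; first by rewrite big_geq // subrr !mulr0.
by rewrite big_nat_recr //=; have := h n; lra.
Qed.

(** * Levels of the potential and the critical point *)

Section PuzzlePieces.
Context {R : realType}.
Local Notation C := R[i].
Implicit Types (u v h F L : C -> C) (A B D M K s e r t : R) (x y z w p q a b c l : C) (O X Y Q E T : set C).
Variables (f : {poly C}) (c0 : C) (G0 : R).
Hypotheses (d3 : (3 <= degree f)%N) (c0s : sole_bounded_critical_point f c0) (adm : admissible_level f G0).
Local Notation G := (green f).
Local Notation d := (degree f).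
Local Notation P := (puzzle_piece f G0).

Definition lev (k : nat) : R := G0 / d%:R ^+ k.

Lemma dr_gt0 : 0 < d%:R :> R. Proof. exact: d_gt0 d3. Qed.
Lemma dr_ge3 : 3 <= d%:R :> R. Proof. exact: d_ge3 d3. Qed.
Lemma drX_gt0 (k : nat) : 0 < d%:R ^+ k :> R. Proof. by rewrite exprn_gt0 // dr_gt0. Qed.

Lemma lev_gt0 k : 0 < lev k.
Proof. by case: adm => h _ _; rewrite divr_gt0 // drX_gt0. Qed.

Lemma levS k : d%:R * lev k.+1 = lev k.
Proof. by rewrite /lev exprS; field; rewrite !gt_eqF ?dr_gt0 ?drX_gt0. Qed.

Lemma levX k : d%:R ^+ k * lev k = G0.
Proof. by rewrite /lev; field; rewrite gt_eqF ?drX_gt0. Qed.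

Lemma lev_lt k : lev k.+1 < lev k.
Proof. by rewrite -(levS k); have := lev_gt0 k.+1; have := dr_ge3; move: (d%:R) (lev _) => a b; nra. Qed.

Lemma lev_mono k n : (k <= n)%N -> lev n <= lev k.
Proof. by elim: n => [|n IH]; [rewrite leqn0 => /eqP ->|rewrite leq_eqVlt => /predU1P[->//|/IH]; have := lev_lt n; lra]. Qed.

Lemma Gf z : G f.[z] = d%:R * G z. Proof. exact: (green_f erefl d3). Qed.
Lemma Gle k z : (G f.[z] <= lev k) = (G z <= lev k.+1).
Proof. by rewrite Gf -levS ler_pM2l // dr_gt0. Qed.
Lemma Glt k z : (G f.[z] < lev k) = (G z < lev k.+1).
Proof. by rewrite Gf -levS ltr_pM2l // dr_gt0. Qed.

Lemma deriv_neq0 : f^`() != 0.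
Proof.
apply/eqP => /(congr1 (fun p : {poly C} => p`_d.-1)); rewrite coef_deriv coef0 prednK ?(leq_trans _ d3) //.
move/eqP; rewrite mulrn_eq0 -lead_coefE lead_coef_eq0 => /orP[/eqP h|/eqP h]; first by move: d3; rewrite h.
by move: d3; rewrite /degree h size_poly0.
Qed.

(** A potential at most [lev 1] puts the critical value at most at level [G0], where admissibility
    leaves only potential 0; so the critical point has bounded orbit. *)
Lemma crit_c0 c : root f^`() c -> G c <= lev 1 -> c = c0.
Proof.
move=> rc Gc; have [s fs fk] := c0s; have : c \in [seq c <- s | `[< filled_julia f c >]].
  rewrite mem_filter; apply/andP; split; last first.
    move: rc; rewrite fs rootE hornerZ mulf_eq0 lead_coef_eq0 (negPf deriv_neq0) /= -rootE root_prod_XsubC //.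
  apply/asboolP/(green0P erefl d3); have := green_ge0 erefl d3 c; rewrite le_eqVlt => /predU1P[//|Gp].
  case: adm => _ _ /(_ c rc); rewrite Gf mulr_gt0 ?dr_gt0 //=; case.
  by rewrite -[G0]divr1 -[X in _ / X](expr0 d%:R) -/(lev 0) -levS ler_pM2l // dr_gt0.
by rewrite fk inE => /eqP.
Qed.

Lemma G_c0 : G c0 = 0.
Proof.
have [s fs fk] := c0s; apply/(green0P erefl d3); have : c0 \in [seq c <- s | `[< filled_julia f c >]] by rewrite fk inE.
by rewrite mem_filter => /andP[/asboolP].
Qed.

(** The critical points of bounded orbit form exactly the list [[:: c0]], so [c0] is a simple root
    of the derivative and [f - f.[c0]] vanishes there to order exactly 2. *)
Lemma c0_fact : exists2 g : {poly C}, f - (f.[c0])%:P = g * ('X - c0%:P) ^+ 2 & g.[c0] != 0.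
Proof.
have [s fs fk] := c0s; have : c0 \in [seq c <- s | `[< filled_julia f c >]] by rewrite fk inE.
rewrite mem_filter => /andP[/asboolP Kc cs].
pose q := lead_coef f^`() *: \prod_(c <- rem c0 s) ('X - c%:P).
have fq : f^`() = q * ('X - c0%:P).
  by rewrite {1}fs (perm_big _ (perm_to_rem cs)) big_cons /q -scalerAl; congr (_ *: _); exact: mulrC.
have qc : q.[c0] != 0.
  rewrite /q hornerZ mulf_eq0 lead_coef_eq0 (negPf deriv_neq0) /= -rootE root_prod_XsubC.
  apply/count_memPn/eqP; have /permP/(_ (pred1 c0)) := perm_to_rem cs; rewrite /= eqxx.
  have -> : count_mem c0 s = count_mem c0 [seq c <- s | `[< filled_julia f c >]].
    by rewrite count_filter; apply: eq_count => c /=; case: eqP => [->|//]; rewrite asboolT.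
  by rewrite fk /= eqxx addn0 add1n => -[<-].
have /factor_theorem [h hE] : root (f - (f.[c0])%:P) c0 by rewrite rootE !hornerE subrr.
have dE : f^`() = h^`() * ('X - c0%:P) + h by have := congr1 (@deriv _) hE; rewrite derivB derivC derivM derivXsubC subr0 mulr1.
have /factor_theorem [g gE] : root h c0.
  have := congr1 (fun p : {poly C} => p.[c0]) dE; rewrite fq !hornerE subrr !mulr0 add0r => h0.
  by rewrite rootE -h0.
exists g; first by rewrite hE gE expr2 mulrA.
apply: contraNneq qc => g0; have : q * ('X - c0%:P) = (g^`() * ('X - c0%:P) + g *+ 2) * ('X - c0%:P).
  by rewrite -fq dE gE derivM derivXsubC mulr1; ring.
move/(mulIf (negbT (polyXsubC_eq0 c0))) => ->; by rewrite hornerD hornerM hornerXsubC subrr mulr0 hornerMn g0 mul0rn addr0.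
Qed.

(** If the derivative of [u] were 0, [expR G] and with it [G] would have zero differential at [z],
    making [G0] a critical value. *)
Lemma level_local0 z : G z = G0 -> exists r u l, [/\ 0 < r, hol [set w | cmod (w - z) < r] u,
  forall w, cmod (w - z) < r -> cmod (u w) = expR (G w), hasd u z l & l != 0].
Proof.
move=> Gz; have [G0p nc _] := adm; have [|r [u [r0 hu Gu]]] := @green_local _ f _ erefl d3 z; first by rewrite Gz.
have [l hl] : exists l, hasd u z l by apply: hu; rewrite /= subrr cmod0.
exists r, u, l; split=> //; apply: contra_notN nc => /eqP l0; exists z => //; rewrite {}l0 in hl.
apply: diff_zero => e e0; have e2 : 0 < e / 2 by lra.
have [s s0 hs] := hl _ e2; have [t [t0 ts tr]] := min_pos2 s0 r0; have t2 : 0 < t / 2 by lra.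
apply/nbhs_normP; exists (t / 2) => // h; rewrite /ball_ /= => hn0; have hn : `|h| < t / 2 by move: hn0; rewrite -normrN opprB subr0.
pose w := (h.1 + Re z) +i* (h.2 + Im z).
have [h1 h2] : `|h.1| <= `|h| /\ `|h.2| <= `|h| by rewrite [`|h|]prod_normE !le_max !lexx orbT.
have wz : cmod (w - z) <= 2 * `|h|.
  apply: le_trans (cmod_ReIm _) _; rewrite cReB cImB /= !addrK; lra.
change (`|G w - G (Re z +i* Im z)| <= e * `|h|); rewrite -cplxE.
have wr : cmod (w - z) < r by lra.
apply: le_trans (expR_dist (green_ge0 erefl d3 w) (green_ge0 erefl d3 z)) _.
rewrite -Gu // -Gu ?subrr ?cmod0 //; apply: le_trans (_ : cmod (u w - u z) <= _).
  by rewrite ler_norml cmod_sub andbT lerNl opprB (cmodBC (u w)) cmod_sub.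
have ws : cmod (w - z) < s by lra.
have := hs w ws; rewrite mul0r subr0; move: wz; move: (cmod (w - z)) (cmod (u w - u z)) (`|h|) => a b c; clear -e0; nra.
Qed.

(** On its way up to level [G0] the orbit is differentiated only at points of positive potential at
    most [lev 1], where [f] has no critical point. *)
Lemma fwd_neq0 z (k : nat) : G z = lev k -> exists2 l, hasd (fun w => fwd_orbit f w k) z l & l != 0.
Proof.
elim: k z => [|k IH] z Gz; first by exists 1; [exact: hasd_id|exact: oner_neq0].
have [|l hl l0] := IH f.[z]; first by rewrite Gf Gz levS.
exists (l * f^`().[z]); last first.
  rewrite mulf_neq0 //; apply/negP => rz; have /(crit_c0 rz) zc : G z <= lev 1 by rewrite Gz lev_mono.
  by have := lev_gt0 k.+1; rewrite -Gz zc G_c0 ltxx.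
have := hasd_comp (hasd_poly f z) hl; have -> // : (fun w => fwd_orbit f f.[w] k) = (fun w => fwd_orbit f w k.+1).
by apply/funext => w; rewrite fwd_Sr.
Qed.

Lemma level_local z k : G z = lev k -> exists r u l, [/\ 0 < r, hol [set w | cmod (w - z) < r] u,
  forall w, cmod (w - z) < r -> cmod (u w) = expR (d%:R ^+ k * G w), hasd u z l & l != 0].
Proof.
move=> Gz; have Gk w : G (fwd_orbit f w k) = d%:R ^+ k * G w by exact: (green_fwd erefl d3).
have [|r [u [l [r0 hu Gu ul l0]]]] := @level_local0 (fwd_orbit f z k); first by rewrite Gk Gz levX.
have [m hm m0] := fwd_neq0 Gz; have [s s0 hs] := hasd_cont hm r0.
exists s, (fun w => u (fwd_orbit f w k)), (l * m); split=> //; last exact: mulf_neq0.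
- by apply: (hol_comp (u := fun w => fwd_orbit f w k) hs (@fwd_hol R f k _) hu).
- by move=> w ws; rewrite Gu ?Gk //; exact: hs.
- exact: (hasd_comp (u := fun w => fwd_orbit f w k)).
Qed.

(** Openness of the chart [u]: its modulus cannot have a local maximum. *)
Lemma level_nint z k r : G z = lev k -> 0 < r -> exists2 w, cmod (w - z) < r & lev k < G w.
Proof.
move=> Gz r0; have [s [u [l [s0 hu Gu ul l0]]]] := level_local Gz; have [t [t0 tr ts]] := min_pos2 r0 s0.
apply: contrapT => h; have Gw w : cmod (w - z) < t -> G w <= lev k.
  by move=> wt; rewrite leNgt; apply/negP => k'; apply: h; exists w => //; lra.
have uz : cmod (u z) = expR G0 by rewrite Gu ?subrr ?cmod0 // Gz levX.
have E0 : 0 < expR G0 by exact: expR_gt0.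
have hu' : hol [set w | cmod (w - z) < t] (fun w => (expR G0)^-1%:C * u w).
  by apply: holM; [exact: hol_cst|apply: hol_sub hu => w /=; lra].
have := hasdM (hasd_cst (expR G0)^-1%:C z) ul; rewrite mul0r add0r => hl.
have : (expR G0)^-1%:C * l = 0.
  apply: (hasd_open_lt1 (@copen_ball R z t) hu' _ _ hl); [|by rewrite /= subrr cmod0|].
  - move=> w wt; rewrite cmodM cmod_real gtr0_norm ?invr_gt0 // ler_pdivrMl // mulr1 Gu; last by move: wt => /=; lra.
    by rewrite ler_expR -(levX k) ler_wpM2l ?Gw // ltW // drX_gt0.
  - by rewrite cmodM cmod_real gtr0_norm ?invr_gt0 // uz mulVf // gt_eqF.
move/eqP; rewrite mulf_eq0 (negPf l0) orbF => /eqP /(congr1 (@complex.Re R)) /= /eqP.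
by rewrite invr_eq0 gt_eqF.
Qed.

(** In the chart [u] the closed and open sublevel sets are round discs met with a small disc, hence
    convex; [N] and [N'] are their images. The last clause approaches [z] along a radius. *)
Lemma level_nbhd z k : G z = lev k -> exists r N N', [/\ 0 < r,
  [/\ cconn N, N z, forall w, N w -> G w <= lev k & forall w, G w <= lev k -> cmod (w - z) < r -> N w],
  [/\ cconn N', forall w, N' w -> N w /\ G w < lev k & forall w, G w < lev k -> cmod (w - z) < r -> N' w] &
  forall e, 0 < e -> exists2 w, cmod (w - z) < e & G w < lev k].
Proof.
move=> Gz; have [s [u [l [s0 hu Gu ul l0]]]] := level_local Gz.
have zz t : 0 < t -> cmod (z - z) < t by rewrite subrr cmod0.
have [rho [rho0 hrho inj _]] := local_homeo (@copen_ball R z s) (zz s s0) hu ul l0.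
have hu' := hol_sub hrho hu; pose B := [set w : C | cmod (w - z) < rho].
have [oI [g [_ hg guK ugK]]] := inj_biholo (@copen_ball R z rho) hu' inj.
have Iz : image_of B u (u z) by exists z; [exact: zz|].
have [eta eta0 hI] := oI _ Iz; have gz : g (u z) = z by have [] := guK z (zz _ rho0).
have uG w : B w -> (G w <= lev k) = (cmod (u w) <= expR G0) /\ (G w < lev k) = (cmod (u w) < expR G0).
  by move=> /hrho /Gu ->; rewrite ler_expR ltr_expR -(levX k) ler_pM2l ?ltr_pM2l ?drX_gt0.
have uz : cmod (u z) = expR G0 by rewrite Gu ?Gz ?levX //; exact: zz.
have [t t0 ht] := hol_cont hu' (zz _ rho0) eta0; have [r [r0 rt rrho]] := min_pos2 t0 rho0.
pose N0 (Q : C -> Prop) := [set y | cmod (y - u z) < eta /\ Q y].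
have cN (Q : C -> Prop) : (forall y w t, Q y -> Q w -> 0 <= t -> t <= 1 -> Q (y + t%:C * (w - y))) -> cconn (image_of (N0 Q) g).
  move=> hQ; apply: cconn_image; last by move=> y [/hI Iy _]; exact: ccont_in (hol_cont hg Iy).
  by apply: cconn_convex => y w q [hy Qy] [hw Qw] q0 q1; split; [exact: convex_ball|exact: hQ].
have NB Q w : image_of (N0 Q) g w -> B w /\ Q (u w).
  by move=> [y [/hI Iy Qy] <-]; have [Bg ->] := ugK y Iy.
have BN (Q : C -> Prop) w : cmod (w - z) < r -> Q (u w) -> image_of (N0 Q) g w.
  move=> wr Qw; have Bw : B w by rewrite /B /=; lra.
  by exists (u w); [split=> //; apply: ht; lra|have [] := guK w Bw].
pose Q1 y := cmod y <= expR G0; pose Q2 y := cmod y < expR G0.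
have cvx (q : R) y w : 0 <= q -> q <= 1 -> cmod (y + q%:C * (w - y)) <= (1 - q) * cmod y + q * cmod w.
  move=> q0 q1; rewrite (_ : _ + _ = (1 - q)%:C * y + q%:C * w); last by rewrite rmorphB /=; ring.
  by apply: le_trans (cmodD _ _) _; rewrite !cmodM !cmod_real !ger0_norm ?subr_ge0.
exists r, (image_of (N0 Q1) g), (image_of (N0 Q2) g); split=> //; first split.
- apply: cN => y w q h1 h2 q0 q1 /=; have := cvx q y w q0 q1; rewrite /Q1 in h1 h2 *; move: (expR _) h1 h2 => E; nra.
- by exists (u z) => //; split; [rewrite subrr cmod0|rewrite /Q1 uz].
- by move=> w /NB[Bw]; rewrite (uG w Bw).1.
- by move=> w Gw wr; apply: BN => //; rewrite /Q1 -(uG w _).1 // /B /=; lra.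
- split.
  + apply: cN => y w q h1 h2 q0 q1 /=; have := cvx q y w q0 q1; rewrite /Q2 in h1 h2 *; move: (expR _) h1 h2 => E; case: (leP q (1 / 2)) => ?; nra.
  + move=> w Nw; have [Bw Qw] := NB _ _ Nw; rewrite (uG w Bw).2; split=> //.
    by case: Nw => y [hy Qy] <-; exists y => //; split=> //; exact: ltW.
  + by move=> w Gw wr; apply: BN => //; rewrite /Q2 -(uG w _).2 // /B /=; lra.
- move=> e e0; have [q q0 hq] := hol_cont hg Iz e0; have E0 := expR_gt0 G0.
  have [m [m0 mq meta]] := min_pos2 q0 eta0; pose x := Num.min (1 / 2) (m / 2 / expR G0).
  have [x0 x1 x2] : [/\ 0 < x, x <= 1 / 2 & x * expR G0 <= m / 2].
    rewrite /x; split; [by rewrite lt_min !divr_gt0 //; lra|by rewrite ge_min lexx|].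
    by rewrite -ler_pdivlMr // ge_min lexx orbT.
  have dist : cmod ((1 - x)%:C * u z - u z) <= m / 2.
    rewrite (_ : _ - _ = (- x)%:C * u z); last by rewrite rmorphB rmorphN /=; ring.
    by rewrite cmodM cmod_real normrN gtr0_norm // uz.
  have Iy : image_of B u ((1 - x)%:C * u z) by apply: hI; lra.
  exists (g ((1 - x)%:C * u z)); first by rewrite -{2}gz; apply: hq; lra.
  have [Bg ug] := ugK _ Iy; rewrite (uG _ Bg).2 ug cmodM cmod_real uz gtr0_norm; last lra.
  by rewrite gtr_pMl //; lra.
Qed.

(** * Topology of puzzle pieces and of their interiors *)

Lemma P_le k z w : P k z w -> G w <= lev k.
Proof. by move/connected_component_sub. Qed.

Lemma P_refl k z : G z <= lev k -> P k z z.
Proof. by move=> h; apply: connected_component_refl. Qed.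

Lemma P_eq k z w : P k z w -> P k z = P k w.
Proof. exact: same_connected_component. Qed.

Lemma P_in k z w : P k z w -> G z <= lev k.
Proof. by move=> /connected_component_sym /P_le. Qed.

Lemma P_conn k z : cconn (P k z).
Proof. by apply/connectedC/component_connected. Qed.

Lemma P_max k z w E : cconn E -> E z -> E w -> (forall x, E x -> G x <= lev k) -> P k z w.
Proof. by move=> /connectedC cE Ez Ew h; apply: (connected_component_max Ez h cE). Qed.

(** Below the level by openness, on it by [level_nbhd]; compactness makes the radius uniform.
    Different pieces are therefore at positive distance. *)
Lemma P_sep k : exists2 r : R, 0 < r & forall x, G x <= lev k -> forall w, G w <= lev k -> cmod (w - x) < r -> P k x w.
Proof.
pose X := [set z | G z <= lev k].
pose Q x r := forall w, G w <= lev k -> cmod (w - x) < r -> P k x w.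
have [||r r0 hr] := @compact_uniform R X Q (@sublevel_closed R f d erefl d3 (lev k)) (@sublevel_bounded R f d erefl d3 (lev k)).
  by move=> y r r' h rr w Gw wr; apply: h => //; lra.
- move=> x Xx; suff [r [N [r0 cN Nle hN]]] : exists r N, [/\ 0 < r, cconn N, forall w, N w -> G w <= lev k &
      forall w, G w <= lev k -> cmod (w - x) < r -> N w].
    exists (r / 2); split; first lra.
    move=> y Xy yr w Gw wr; apply: (P_max cN) => //; apply: hN => //; first by lra.
    by have := cmod_tri y w x; lra.
  move: Xx; rewrite /X /= le_eqVlt => /predU1P[/level_nbhd [r [N [N' [r0 [cN Nx Nle hN] _ _]]]]|Gx].
    by exists r, N.
  have [r r0 hr] := sublevel_open erefl d3 Gx.
  exists r, [set w | cmod (w - x) < r]; split=> //; [exact: cconn_ball|by move=> w /hr /ltW].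
by exists r => // x Gx w Gw wr; exact: hr.
Qed.

Definition V k z : set C := [set w | P k z w /\ G w < lev k].

Lemma P_closed k z : cclosed (P k z).
Proof.
move=> w hw; have [r r0 hr] := P_sep k; have [x Px xw] := hw r r0.
have Gw : G w <= lev k by apply: (sublevel_closed erefl d3) => e /hw[y /P_le]; exists y.
by rewrite (P_eq Px); apply: hr => //; [exact: P_le Px|rewrite cmodBC].
Qed.

Lemma P_bounded k z : cbounded (P k z).
Proof. by apply: cbounded_sub (@sublevel_bounded R f d erefl d3 (lev k)) => w /P_le. Qed.

Lemma V_open k z : copen (V k z).
Proof.
move=> w [Pw Gw]; have [r r0 hr] := P_sep k; have [s s0 hs] := sublevel_open erefl d3 Gw.
have [t [t0 tr ts]] := min_pos2 r0 s0; exists t => // x xw; have Gx : G x < lev k by apply: hs; lra.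
by split=> //; rewrite (P_eq Pw); apply: hr; [exact: ltW|exact: ltW|lra].
Qed.

Lemma P_int k z : interior (P k z) = V k z.
Proof.
apply/seteqP; split=> w; last by move=> Vw; apply/nbhsC; have [r r0 hr] := V_open Vw; exists r => // x /hr [].
move=> /nbhsC [r r0 hr]; have Pw : P k z w by apply: hr; rewrite subrr cmod0.
split=> //; have := P_le Pw; rewrite le_eqVlt => /predU1P[Gw|//].
by have [x /hr /P_le] := level_nint Gw r0; rewrite leNgt => /negP.
Qed.

Lemma V_refl k z : G z < lev k -> V k z z.
Proof. by move=> h; split=> //; apply/P_refl/ltW. Qed.

Lemma V_sub k n z w : (k < n)%N -> P n z w -> V k z w.
Proof.
move=> kn Pw; have lt : lev n < lev k by apply: le_lt_trans (lev_lt k); exact: lev_mono.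
split; last by apply: le_lt_trans (P_le Pw) lt.
by apply: (P_max (@P_conn n z)) => //; [apply/P_refl/(P_in Pw)|move=> x /P_le; lra].
Qed.

(** Near a boundary point the open sublevel set contains the connected [N'], so a clopen subset of
    the interior extends without ambiguity to the closed piece, which is connected. *)
Lemma V_cconn k z : cconn (V k z).
Proof.
move=> A [a Va Aa] oA oA'.
pose good (Q : set C) x := exists2 r, 0 < r & forall w, V k z w -> cmod (w - x) < r -> Q w.
have dich x : P k z x -> good A x \/ good (~` A) x.
  move=> Px; have [Vx|nVx] := pselect (V k z x).
    by have [Ax|nAx] := pselect (A x); [left|right]; [exact: oA|exact: oA'].
  have Gx : G x = lev k by have := P_le Px; rewrite le_eqVlt => /predU1P[//|h]; case: nVx.
  have [r [N [N' [r0 [cN Nx Nle hN] [cN' Nlt hN'] dense]]]] := level_nbhd Gx.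
  have NV w : N' w -> V k z w.
    move=> /Nlt[Nw Gw]; split=> //; rewrite (P_eq Px); exact: (P_max cN).
  have sub (Q : set C) : (exists2 w, N' w & Q w) -> (forall z0, V k z z0 -> Q z0 -> exists2 r, 0 < r & forall w, V k z w -> cmod (w - z0) < r -> Q w) ->
     (forall z0, V k z z0 -> ~ Q z0 -> exists2 r, 0 < r & forall w, V k z w -> cmod (w - z0) < r -> ~ Q w) -> good Q x.
    move=> ne o1 o2; exists r => // w Vw wx; apply: (cN' Q ne _ _ w (hN' w Vw.2 wx)).
      by move=> y Ny Qy; have [s s0 hs] := o1 y (NV y Ny) Qy; exists s => // v /NV; exact: hs.
    by move=> y Ny Qy; have [s s0 hs] := o2 y (NV y Ny) Qy; exists s => // v /NV; exact: hs.
  have [w wx Gw] := dense r r0; have Nw := hN' w Gw wx.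
  have [Aw|nAw] := pselect (A w); [left|right]; apply: sub; [by exists w|exact: oA|exact: oA'|by exists w|exact: oA'|].
  by move=> y Vy /contrapT Ay; have [s s0 hs] := oA y Vy Ay; exists s => // v Vv /(hs v Vv) k' /(_ k').
have both x : P k z x -> good A x -> good (~` A) x -> False.
  move=> Px [r1 r10 h1] [r2 r20 h2]; have [r [r0 rr1 rr2]] := min_pos2 r10 r20.
  have [w Vw wx] : exists2 w, V k z w & cmod (w - x) < r.
    have := P_le Px; rewrite le_eqVlt => /predU1P[Gx|Gx]; last by exists x; rewrite ?subrr ?cmod0.
    have [s [N [N' [s0 [cN Nx Nle hN] [cN' Nlt hN'] dense]]]] := level_nbhd Gx.
    have [t [t0 tr ts]] := min_pos2 r0 s0; have [w wx Gw] := dense t t0; exists w; last lra.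
    split=> //; rewrite (P_eq Px); apply: (P_max cN) => //; apply: hN; [exact: ltW|lra].
  by apply: (h2 w Vw _) (h1 w Vw _); lra.
have open_good (Q : set C) x : good Q x -> exists2 r, 0 < r & forall w, P k z w -> cmod (w - x) < r -> good Q w.
  move=> [r r0 hr]; have r2 : 0 < r / 2 by lra.
  exists (r / 2) => // w _ wx; exists (r / 2) => // y Vy yw; apply: hr => //.
  by have := cmod_tri w y x; lra.
have all_good : forall x, P k z x -> good A x.
  apply: (@P_conn k z); first by exists a; [case: Va|exact: oA].
  - by move=> x _; exact: open_good.
  - move=> x Px nA; have [//|gA] := dich x Px; have [r r0 hr] := open_good _ _ gA.
    by exists r => // w Pw wx gw; apply: (both w Pw gw); exact: hr.
move=> w Vw; have [r r0 hr] := all_good w Vw.1; apply: hr => //; by rewrite subrr cmod0.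
Qed.

(** Complement points not chained to infinity would form, together with [V k z], a bounded open set
    on which the maximum principle gives [G <= lev k]. Being at positive distance from the piece,
    they would make a bounded clopen set. *)
Lemma V_full k z : full (V k z).
Proof.
move=> a e B na e0; apply: contrapT => nch.
pose S := [set b | ~ V k z b /\ ~ echain (V k z) e B b].
have near_S x y : S x -> ~ V k z y -> cmod (y - x) < e -> S y.
  move=> [nx cx] ny yx; split=> // cy; apply: cx; apply: (@echain_step _ _ _ _ _ y) => //; by rewrite cmodBC.
pose U := [set b | V k z b \/ S b].
have Sb : cbounded S.
  by exists B => b [nb cb]; rewrite leNgt; apply/negP => h; apply: cb; exact: echain_far.
have Uo : copen U.
  move=> b [Vb|Sb']; first by have [r r0 hr] := V_open Vb; exists r => // w /hr; left.
  by exists e => // w we; have [|nw] := pselect (V k z w); [left|right; exact: near_S we].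
have UG : forall b, U b -> G b <= lev k.
  apply: (green_max d3 (ltW (lev_gt0 k)) Uo).
    have [M1 h1] := Sb; have [M2 h2] := @P_bounded k z; exists (Num.max M1 M2) => b [[Pb _]|Sb'].
      by apply: le_trans (h2 b Pb) _; rewrite le_max lexx orbT.
    by apply: le_trans (h1 b Sb') _; rewrite le_max lexx.
  move=> b nb s s0; exists e => // w [[/P_le Gw _] _|Sw wb]; first lra.
  by exfalso; apply: (nb); right; apply: (near_S w) => //; [move=> Vb; apply: nb; left|rewrite cmodBC].
have SG b : S b -> G b < lev k.
  move=> Sb'; have := UG b (or_intror Sb'); rewrite le_eqVlt => /predU1P[Gb|//].
  have [r r0 hr] := Uo b (or_intror Sb').
  by have [w /hr /UG] := level_nint Gb r0; rewrite leNgt => /negP.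
have nP b : S b -> ~ P k z b by move=> Sb' Pb; have := SG b Sb'; case: Sb' => nV _ Gb; apply: nV.
have So : copen S.
  move=> b Sb'; have [r r0 hr] := P_sep k; have [t [t0 tr te]] := min_pos2 r0 e0; exists t => // w wb.
  apply: (near_S b) => //; last lra.
  move=> [Pw Gw]; apply: (nP b Sb'); rewrite (P_eq Pw); apply: hr; [exact: ltW|exact: ltW (SG b Sb')|].
  by rewrite cmodBC; lra.
apply: (no_clopen So Sb _ (z := a)) => // b nb.
have [Vb|nVb] := pselect (V k z b).
  by have [r r0 hr] := V_open Vb; exists r => // w [nw _] /hr.
by exists e => // w Sw wb; apply: nb; apply: (near_S w) => //; rewrite cmodBC.
Qed.

Lemma V_riemann k z : G z < lev k -> exists h h', biholo disc (V k z) h h' /\ h 0 = z.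
Proof.
move=> Gz; have [M hM] := @P_bounded k z; have Vz := V_refl Gz.
have M1 : 0 < M + 1 by have := hM z Vz.1; have := cmod_ge0 z; lra.
have M0 : ((M + 1)^-1)%:C != 0 :> C by rewrite -cmod_gt0 cmod_real normr_gt0 invr_eq0 gt_eqF.
have [|||h [g [bh hz]]] := @riemann_mapping R (V k z) (fun w => ((M + 1)^-1)%:C * w) z (@V_open k z) (@V_cconn k z)
   (full_sqrt (@V_open k z) (@V_full k z)) Vz.
- by apply: holM; [exact: hol_cst|exact: hol_id].
- move=> w [/hM Pw _]; rewrite /disc /= cmodM cmod_real gtr0_norm ?invr_gt0 // ltr_pdivrMl // mulr1; lra.
- by move=> x w _ _ /(mulfI M0).
exists g, h; split; first exact: biholo_sym.
by rewrite -hz; case: bh => _ _ /(_ z Vz) [].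
Qed.

(** * Lifting Riemann maps of pieces through [f] *)

Lemma f_hol O : hol O (fun z => f.[z]).
Proof. by move=> z _; exists (f^`().[z]); exact: hasd_poly. Qed.

Lemma P_map k z w : P k.+1 z w -> P k f.[z] f.[w].
Proof.
move=> Pw; apply: (@P_max _ _ _ (image_of (P k.+1 z) (fun z => f.[z]))); last by move=> _ [x Px <-]; rewrite Gle; exact: P_le Px.
- by apply: cconn_image; [exact: P_conn|move=> x _; apply: ccont_in; exact: hasd_cont (hasd_poly f x)].
- by exists z => //; exact: P_refl (P_in Pw).
- by exists w.
Qed.

Lemma V_map k z w : V k.+1 z w -> V k f.[z] f.[w].
Proof. by move=> [Pw Gw]; split; [exact: P_map|rewrite Glt]. Qed.

Lemma f_noncrit k z w : V k.+1 z w -> w != c0 -> f^`().[w] != 0.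
Proof.
move=> [_ Gw]; apply: contraNneq => fw; apply/eqP/crit_c0; first by apply/rootP.
by apply: le_trans (ltW Gw) _; exact: lev_mono.
Qed.

Definition over k z (W : set C) : set C := [set w | V k.+1 z w /\ W f.[w]].

Lemma over_open k z W : copen W -> copen (over k z W).
Proof.
move=> oW w [Vw Ww]; have [r r0 hr] := V_open Vw; have [s s0 hs] := oW _ Ww.
have [t t0 ht] := hasd_cont (hasd_poly f w) s0; have [m [m0 mr mt]] := min_pos2 r0 t0.
by exists m => // x xw; split; [apply: hr|apply/hs/ht]; lra.
Qed.

Lemma over_linj k z W x : copen W -> (forall w, over k z W w -> w != c0) -> over k z W x ->
  linj (over k z W) (fun w => f.[w]) x.
Proof.
move=> oW nc Xx; have [r [r0 _ inj _]] := local_homeo (over_open oW) Xx (@f_hol _) (hasd_poly f x) (f_noncrit Xx.1 (nc x Xx)).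
by exists r => // w1 w2 _ _ h1 h2; exact: inj.
Qed.

(** [f] is proper on a piece: the part over a compact [Q] is closed and keeps off the boundary,
    because [G f.[x]] determines [G x]. The translation group is trivial here. *)
Lemma over_lcov k z W Q : copen W -> (forall w, over k z W w -> w != c0) -> cclosed Q -> cbounded Q ->
  (forall y, Q y -> V k f.[z] y /\ W y) -> lcov (over k z W) (fun w => f.[w]) Q.
Proof.
move=> oW nc cQ bQ QV; apply: (@lcov_compact _ _ _ Q [set w | P k.+1 z w /\ Q f.[w]] [set 0]).
- exact: over_open.
- exact: f_hol.
- by move=> x l Xx /(hasd_uniq (hasd_poly f x)) <-; apply: f_noncrit Xx.1 _; exact: nc.
- move=> w hw; split; first by apply: P_closed => e /hw[y [Py _] yw]; exists y.
  apply: cQ => e e0; have [r r0 hr] := hasd_cont (hasd_poly f w) e0; have [y [_ Qy] /hr yw] := hw r r0.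
  by exists f.[y].
- by apply: cbounded_sub (@P_bounded k.+1 z) => w [].
- by move=> x [Px /QV[[_ Vx] Wx]]; split=> //; split=> //; rewrite -Glt.
- by move=> c w ->; rewrite addr0.
- by move=> c ->; rewrite oppr0.
- by move=> x [[Px _] _] Qx; exists 0 => //; rewrite addr0.
Qed.

Lemma over_lift k z W T F a (x0 : C) : copen T ->
  (forall z w t, T z -> T w -> 0 <= t -> t <= 1 -> T (z + t%:C * (w - z))) -> T a ->
  copen W -> (forall w, over k z W w -> w != c0) -> hol T F -> (forall w, T w -> V k f.[z] (F w) /\ W (F w)) ->
  over k z W x0 -> f.[x0] = F a ->
  exists L : C -> C, [/\ L a = x0, hol T L & forall w, T w -> over k z W (L w) /\ f.[L w] = F w].
Proof.
move=> oT cT Ta oW nc hF FV Xx e.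
have [|||L [La hL cL]] := @lift_convex R T F (over k z W) (fun w => f.[w]) a x0 oT cT Ta _ _ _ Xx e.
- by move=> w Tw; exact: hol_cont hF Tw.
- by move=> x Xx'; exact: over_linj.
- by move=> Q cQ bQ hQ; apply: over_lcov => // y /hQ[w Tw <-]; exact: FV.
exists L; split=> // w Tw; have [Xw fw] := hL w Tw; have [m hm] := hF w Tw.
exists (m / f^`().[L w]); apply: lift_hasd (cL w Tw) (hasd_poly f _) _ hm _; first by apply: f_noncrit Xw.1 _; exact: nc.
by have [r r0 hr] := oT w Tw; exists r => // y /hr /hL[].
Qed.

(** The image of [F] is open. It is closed in the piece because points over a disc of radius [s] can
    only be reached from a fixed closed disc, whose image is compact. *)
Lemma lift_onto k z h h' F (n : nat) : n = 1%N \/ n = 2%N -> biholo disc (V k f.[z]) h h' -> hol disc F ->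
  (forall w, disc w -> V k.+1 z (F w) /\ f.[F w] = h (w ^+ n)) -> (forall w x, disc w -> disc x -> F w = F x -> w = x) ->
  exists F', biholo disc (V k.+1 z) F F'.
Proof.
move=> n12 [hh hh' K K'] hF FV inj; have [oI [F' [_ hF' FK FK']]] := inj_biholo (@copen_disc R) hF inj.
have dn w : disc w -> disc (w ^+ n).
  by case: n12 => -> //; rewrite /disc /= cmodX => w1; have := cmod_ge0 w; nra.
suff E w : V k.+1 z w -> image_of disc F w.
  exists F'; split=> // [w /E|w Dw|w /E /FK'//]; first exact: hF'.
  by split; [exact: (FV w Dw).1|have [] := FK w Dw].
move: w; apply: (@V_cconn k.+1 z).
- by exists (F 0); [apply: (FV _ _).1|exists 0 => //]; rewrite /disc /= cmod0.
- by move=> w _ /oI[r r0 hr]; exists r => // x _; exact: hr.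
move=> x Vx nx; have Vfx := V_map Vx; have [Dx _] := K' _ Vfx; pose s := (1 + cmod (h' f.[x])) / 2.
have [s1 s2] : cmod (h' f.[x]) < s /\ s < 1 by rewrite /s; move: Dx; rewrite /disc /=; split; lra.
have ch : ccont (fun w => h' f.[w]) x.
  exact: (ccont_comp (u := fun w => f.[w]) (hasd_cont (hasd_poly f x)) (hol_cont hh' Vfx)).
have [e e0 he] : exists2 e, 0 < e & forall w, cmod (w - x) < e -> cmod (h' f.[w]) < s.
  have s0 : 0 < s - cmod (h' f.[x]) by lra.
  have [e e0 he] := ch _ s0; exists e => // w /he h1; have := cmod_sub (h' f.[w]) (h' f.[x]); lra.
(* [cmod y ^+ n < s] implies [cmod y <= (1 + s) / 2], by the inequality of means when [n = 2]. *)
pose D0 := [set w : C | cmod (w - 0) <= (1 + s) / 2].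
have D0D w : D0 w -> disc w by rewrite /D0 /disc /= subr0; lra.
have [cI _] := compact_image (@cclosed_ball R 0 _) (@cbounded_ball R 0 _) (fun w (Dw : D0 w) => hol_cont hF (D0D w Dw)).
have nI : ~ image_of D0 F x by move=> [w /D0D Dw Fw]; apply: nx; exists w.
have [r r0 hr] := cclosedC cI nI; have [t [t0 te tr]] := min_pos2 e0 r0; exists t => // w _ wx [y Dy Fy].
apply: (hr w); [lra|exists y => //]; have := he w; rewrite -Fy (FV y Dy).2 (K _ (dn _ Dy)).2 Fy cmodX => /(_ ltac:(lra)).
by rewrite /D0 /= subr0; have := cmod_ge0 y; case: n12 => ->; rewrite ?expr1; nra.
Qed.

Lemma pull1 k z h h' : G z < lev k.+1 -> ~ V k.+1 z c0 -> biholo disc (V k f.[z]) h h' ->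
  exists F F', biholo disc (V k.+1 z) F F' /\ forall w, disc w -> f.[F w] = h w.
Proof.
move=> Gz nc bh; have [hh hh' K K'] := bh; have Vz := V_refl Gz; have [Da ha] := K' _ (V_map Vz).
have cD (x w : C) (t : R) : disc x -> disc w -> 0 <= t -> t <= 1 -> disc (x + t%:C * (w - x)).
  by move=> h1 h2 t0 t1; have := @convex_ball R 0 1 x w t; rewrite !subr0; apply.
have [|||||F [_ hF FV]] := @over_lift k z setT disc h (h' f.[z]) z (@copen_disc R) cD Da _ _ hh.
- by move=> w _; exists 1.
- by move=> w [Vw _]; apply: contra_notN nc => /eqP <-.
- by move=> w /K [].
- by split.
- by rewrite ha.
have FV' w : disc w -> V k.+1 z (F w) /\ f.[F w] = h (w ^+ 1) by rewrite expr1 => /FV[[? _] ->].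
have [|F' bF] := lift_onto (or_introl erefl) bh hF FV'.
  move=> w x Dw Dx e; apply: (biholo_inj bh Dw Dx).
  by rewrite -(FV w Dw).2 -(FV x Dx).2 e.
by exists F, F'; split=> // w /FV[].
Qed.

Lemma cexp_half : cexp ((pi : R)%:C * 'i) = -1 :> C.
Proof.
by apply: cplx_eq; rewrite ?Re_cexp ?Im_cexp cReMr cImMr /= mulr0 mulr1 expR0 ?cospi ?sinpi mul1r ?oppr0.
Qed.

Lemma hol_sqrt T u : copen T -> (forall z w t, T z -> T w -> 0 <= t -> t <= 1 -> T (z + t%:C * (w - z))) ->
  hol T u -> (forall z, T z -> u z != 0) -> exists q : C -> C, hol T q /\ forall z, T z -> q z ^+ 2 = u z.
Proof.
move=> oT cT hu u0; have [L [hL EL]] := hol_log oT cT hu u0; exists (fun z => cexp (2^-1 * L z)); split.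
  by apply: (hol_comp (O' := setT) (u := fun z => 2^-1 * L z)) (@hol_cexp R setT) => //; apply: holM => //; exact: hol_cst.
by move=> z Tz; rewrite -cexp_mulrn mulrA mulfV ?mul1r ?EL // pnatr_eq0.
Qed.

Lemma ball0 (x : C) t : 0 < t -> cmod (x - x) < t.
Proof. by rewrite subrr cmod0. Qed.

(** A local coordinate at [c0] in which [f - f.[c0]] is squaring, from the factorization
    [c0_fact]. *)
Lemma sqrt_c0 : exists r (s : C -> C) l, [/\ 0 < r, hol [set w | cmod (w - c0) < r] s, s c0 = 0, hasd s c0 l & l != 0 /\
  forall w, cmod (w - c0) < r -> s w ^+ 2 = f.[w] - f.[c0]].
Proof.
have [g gE g0] := c0_fact; have gp := cmod_neq0 g0; have [r r0 hr] := ccont_mod (hasd_cont (hasd_poly g c0)) gp.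
have [|||q [hq qE]] := @hol_sqrt [set w | cmod (w - c0) < r] (fun w => g.[w]) (@copen_ball R c0 r).
- by move=> z w t; exact: convex_ball.
- by move=> w _; exists (g^`().[w]); exact: hasd_poly.
- by move=> w /hr; rewrite -cmod_gt0 ltr_norml => /andP[]; lra.
have [m qm] := hq c0 (ball0 c0 r0); have hx := hasdD (hasd_id c0) (hasd_cst (- c0) c0).
have := hasdM hx qm; rewrite subrr mul0r addr0 addr0 mul1r => sm.
exists r, (fun w => (w - c0) * q w), (q c0); split=> //; last split.
- by apply: holM => //; apply: holB; [exact: hol_id|exact: hol_cst].
- by rewrite subrr mul0r.
- by rewrite -cmod_gt0 -(ltr_pXn2r (n := 2)) ?nnegrE ?cmod_ge0 // expr0n /= -cmodX qE ?cmod_gt0 //; exact: ball0.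
- move=> w wr; rewrite exprMn qE // mulrC; have := congr1 (fun p : {poly C} => p.[w]) gE.
  by rewrite hornerD hornerN hornerC hornerM horner_exp hornerXsubC => ->.
Qed.

(** Matches squaring in the disc with squaring at [c0]: [h (w ^+ 2) - f.[c0]] is the square of
    [w * q (w ^+ 2)], and [F] is the local inverse of [s] at that root. *)
Lemma local_double k h h' : biholo disc (V k f.[c0]) h h' -> h 0 = f.[c0] ->
  exists e (F : C -> C), [/\ 0 < e, e <= 1, hol [set w | cmod (w - 0) < e] F, F 0 = c0 &
    forall w, cmod w < e -> [/\ V k.+1 c0 (F w), f.[F w] = h (w ^+ 2) & w != 0 -> F w != F (- w)]].
Proof.
move=> bh h0; have [hh _ K _] := bh; have [r [s [l [r0 hs sc sl [l0 sE]]]]] := sqrt_c0.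
have Vc : V k.+1 c0 c0 by apply: V_refl; rewrite G_c0 lev_gt0.
have [rv rv0 hrv] := V_open Vc; have [r1 [r10 r1r r1v]] := min_pos2 r0 rv0.
have hs1 : hol [set w | cmod (w - c0) < r1] s by apply: hol_sub hs => w /=; lra.
have [rho [rho0 hrho inj _]] := local_homeo (@copen_ball R c0 r1) (ball0 c0 r10) hs1 sl l0.
pose B := [set w : C | cmod (w - c0) < rho].
have [oI [g [_ hg gsK sgK]]] := inj_biholo (@copen_ball R c0 rho) (hol_sub hrho hs1) inj.
have I0 : image_of B s 0 by exists c0; [exact: ball0|].
have D0 : disc (0 : C) by rewrite /disc /= cmod0.
have [m hm] := hh 0 D0; have m0 := biholo_neq0 (@copen_disc R) bh D0 hm.
have D2 (w : C) : disc w -> disc (w ^+ 2) by rewrite /disc /= cmodX; have := cmod_ge0 w; nra.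
have hX : hol disc (fun w => w ^+ 2) by apply: holX; exact: hol_id.
have m1 w : disc w -> slope h 0 m w != 0.
  move=> Dw; have [->|w0] := eqVneq w 0; first by rewrite slope_bb.
  by rewrite slopeE // mulf_neq0 ?invr_eq0 ?subr_eq0 //; apply: contra_neq w0; exact: (biholo_inj bh Dw D0).
have [q [hq qE]] := hol_sqrt (@copen_disc R) convex_disc (slope_hol (@copen_disc R) D0 hh hm) m1.
have q0 w : disc w -> q w != 0.
  by move=> Dw; apply: contra_neq (m1 w Dw) => qw; rewrite -qE // qw expr0n.
pose S w := w * q (w ^+ 2).
have hS : hol disc S by apply: holM; [exact: hol_id|exact: (hol_comp (u := fun w => w ^+ 2) D2 hX hq)].
have SE w : disc w -> S w ^+ 2 = h (w ^+ 2) - f.[c0].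
  by move=> Dw; rewrite /S exprMn qE; [rewrite -h0 -[RHS](slopeM _ _ m) subr0 mulrC|exact: D2].
have S0 : S 0 = 0 by rewrite /S mul0r.
have [eta eta0 hI] := oI 0 I0; have [e' e0 he] := hol_cont hS D0 eta0.
have [e [ep ee' e1]] := min_pos2 e0 (@ltr01 R).
have eD w : cmod w < e -> disc w by rewrite /disc /=; lra.
have IS w : cmod w < e -> image_of B s (S w).
  by move=> we; apply: hI; have := he w; rewrite subr0 S0; apply; lra.
exists e, (fun w => g (S w)); split=> //.
- apply: (hol_comp (u := S) _ _ hg); first by move=> w; rewrite /= subr0; exact: IS.
  by apply: hol_sub hS => w; rewrite /= subr0; exact: eD.
- by rewrite S0 -sc; have [] := gsK c0 (ball0 c0 rho0).
- move=> w we; have [Bg sg] := sgK _ (IS w we); have /hrho gr := Bg; split.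
  + by apply: hrv; move: gr => /=; lra.
  + have := sE (g (S w)); rewrite sg SE; last exact: eD.
    by move=> /(_ _)/(addIr _) -> //; move: gr => /=; lra.
  + move=> w0; apply/eqP => gg; have wN : cmod (- w) < e by rewrite cmodN.
    have [_ sgN] := sgK _ (IS _ wN); have : S w = S (- w) by rewrite -sg -sgN gg.
    rewrite /S sqrrN mulNr => /eqP; rewrite -subr_eq0 opprK -mulr2n mulrn_eq0 mulf_eq0 (negPf w0) /=.
    by apply/negP/q0/D2/eD.
Qed.

Definition lhp : set C := [set w | Re w < 0].

Lemma copen_lhp t : copen [set w : C | Re w < t].
Proof.
move=> z /= h; exists (t - Re z); first by rewrite subr_gt0.
by move=> w; have := ler_norm (Re (w - z)); have := normRe (w - z); rewrite cReB; lra.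
Qed.

Lemma convex_lhp t (z w : C) s : Re z < t -> Re w < t -> 0 <= s -> s <= 1 ->
  Re (z + s%:C * (w - z)) < t.
Proof. by rewrite cReD cReMr cReB; move: (Re z) (Re w) => a b; case: (leP s (1 / 2)) => ?; nra. Qed.

Lemma lhp_disc w : lhp w <-> disc (cexp w).
Proof. by rewrite /lhp /disc /= cmod_cexp -expR_lt1. Qed.

(** The punctured disc is unwrapped by [cexp]: [h (cexp w ^+ 2)] avoids the critical value and lifts
    over the left half-plane. Near the puncture the lift is that of [local_double], so it has period
    [per 1] but not half of it, and it descends to an injective map of the disc. *)
Lemma pull2 k h h' : biholo disc (V k f.[c0]) h h' -> h 0 = f.[c0] ->
  exists F F', biholo disc (V k.+1 c0) F F' /\ forall w, disc w -> f.[F w] = h (w ^+ 2).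
Proof.
move=> bh h0; have [hh _ K _] := bh; have [e [F0 [e0 e1 hF0 F00 F0E]]] := local_double bh h0.
have D0 : disc (0 : C) by rewrite /disc /= cmod0.
have D2 (w : C) : disc w -> disc (w ^+ 2) by rewrite /disc /= cmodX; have := cmod_ge0 w; nra.
pose W := [set y : C | y != f.[c0]]; pose H w := h (cexp w ^+ 2).
have oW : copen W.
  move=> y yc; exists (cmod (y - f.[c0])); first by rewrite cmod_gt0 subr_eq0.
  by move=> w h1; apply/eqP => we; move: h1; rewrite we cmodBC ltxx.
have HW w : lhp w -> V k f.[c0] (H w) /\ W (H w).
  move=> /lhp_disc Dw; have D' := D2 _ Dw; have [Vh _] := K _ D'; split=> //.
  rewrite /W /= /H -h0; apply/eqP => /(biholo_inj bh D' D0) /eqP; rewrite expf_eq0 /=; exact/negP/cexp_neq0.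
have hH : hol lhp H.
  apply: (hol_comp (O' := disc) (u := fun w => cexp w ^+ 2)) hh; first by move=> w /lhp_disc /D2.
  by apply: holX; exact: hol_cexp.
have nc w : over k c0 W w -> w != c0 by move=> [_]; apply: contraTneq => ->; rewrite /W /= eqxx.
pose le := ln e; have small w : Re w < le -> cmod (cexp w) < e.
  by rewrite cmod_cexp -ltr_expR lnK.
have small' w : Re w < le -> lhp w by move=> /small h1; apply/lhp_disc; rewrite /disc /=; lra.
pose w0 : C := (le - 1)%:C; have w0l : Re w0 < le by rewrite /=; lra.
have F0W w : Re w < le -> over k c0 W (F0 (cexp w)) /\ f.[F0 (cexp w)] = H w.
  by move=> wl; have [Vw fw _] := F0E _ (small w wl); split=> //; split=> //; rewrite fw; exact: (HW w (small' w wl)).2.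
have [X0 f0] := F0W w0 w0l.
have [L [L0 hL LH]] := @over_lift k c0 W lhp H w0 (F0 (cexp w0)) (@copen_lhp 0) (@convex_lhp 0) (small' w0 w0l) oW nc hH HW X0 f0.
have uq T (u v : C -> C) : cconn T -> T w0 -> hol T u -> hol T v -> (forall z, T z -> [/\ over k c0 W (u z), over k c0 W (v z) & f.[u z] = f.[v z]]) ->
    u w0 = v w0 -> forall z, T z -> u z = v z.
  move=> cT Tw hu hv uv; apply: (@lift_uniq R T (over k c0 W) (fun w => f.[w])) => //.
  - by move=> z; exact: over_linj.
  - by move=> z /uv[].
  - by move=> z Tz; split; apply: ccont_in; [exact: hol_cont hu Tz|exact: hol_cont hv Tz].
  - by move=> z /uv[].
have LF0 w : Re w < le -> L w = F0 (cexp w).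
  apply: (uq [set w | Re w < le] L (fun w => F0 (cexp w))) => //.
  - by apply: cconn_convex; exact: convex_lhp.
  - by apply: hol_sub hL => z; exact: small'.
  - by apply: (hol_comp (u := cexp) _ (@hol_cexp R _) hF0) => z zl; rewrite /= subr0; exact: small.
  - by move=> z zl; have [X1 f1] := F0W z zl; have [X2 f2] := LH z (small' z zl); rewrite f1 f2.
have shift w (c : C) : Re c = 0 -> lhp w -> lhp (w + c) by rewrite /lhp /= cReD => ->; rewrite addr0.
have hLs (c : C) : Re c = 0 -> hol lhp (fun w => L (w + c)).
  move=> c1; apply: (hol_comp (O' := lhp) (u := fun w => w + c)) hL; first by move=> w; exact: shift.
  by apply: holD; [exact: hol_id|exact: hol_cst].
(* For a period [c] of [H], the lift and its translate lift the same map; if they agree at one point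
   they agree everywhere. *)
have per2 (c : C) : Re c = 0 -> cexp c ^+ 2 = 1 -> (exists2 w, lhp w & L w = L (w + c)) -> forall w, lhp w -> L w = L (w + c).
  move=> c1 c2 [w1 Tw1 E1]; apply: (@lift_uniq R lhp (over k c0 W) (fun w => f.[w]) _ _ w1) => //.
  - by apply: cconn_convex; exact: convex_lhp.
  - by move=> z; exact: over_linj.
  - by move=> z Tz; split; [exact: (LH z Tz).1|exact: (LH _ (shift z c c1 Tz)).1].
  - by move=> z Tz; split; apply: ccont_in; [exact: hol_cont hL Tz|exact: hol_cont (hLs c c1) Tz].
  - by move=> z Tz; rewrite (LH z Tz).2 (LH _ (shift z c c1 Tz)).2 /H cexpD exprMn c2 mulr1.
have Lper w n : lhp w -> L (w + per n) = L w.
  move=> Tw; apply/esym; move: w Tw; apply: per2; [exact: Re_per|by rewrite cexp_per expr1n|].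
  exists w0; first exact: small'.
  by rewrite !LF0 // ?cexpDper // cReD Re_per addr0.
have [lg lgE] : exists lg : C -> C, forall z, z != 0 -> cexp (lg z) = z.
  have /choice [lg hlg] : forall z : C, exists w, z != 0 -> cexp w = z.
    by move=> z; have [->|/cexp_surj[w [ew _ _]]] := eqVneq z 0; [exists 0|exists w].
  by exists lg.
pose F z := if z == 0 then c0 else L (lg z).
have FL w : lhp w -> F (cexp w) = L w.
  move=> Tw; rewrite /F (negPf (cexp_neq0 w)); have /esym/cexp_eq[n ->] := lgE _ (cexp_neq0 w).
  exact: Lper.
have lT z : disc z -> z != 0 -> exists2 w, lhp w & cexp w = z.
  by move=> Dz /lgE e2; exists (lg z) => //; apply/lhp_disc; rewrite e2.
have FF0 z : cmod (z - 0) < e -> F0 z = F z.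
  rewrite subr0 => ze; have [->|z0] := eqVneq z 0; first by rewrite /F eqxx F00.
  have [|w Tw we] := lT z _ z0; first by rewrite /disc /=; lra.
  rewrite -we FL // LF0 // /le -ltr_expR lnK // -cmod_cexp we //.
have hF : hol disc F.
  move=> z Dz; have [->|z0] := eqVneq z 0.
    have [l hl] := hF0 0 (ball0 0 e0); exists l; exact: hasd_loc e0 FF0 hl.
  have zp := cmod_neq0 z0; pose T := disc `&` [set w | cmod (w - z) < cmod z].
  have oT : copen T by apply: copenI; [exact: copen_disc|exact: copen_ball].
  have Tz : T z by split=> //; exact: ball0.
  have [||l [hl lE]] := @hol_log R T id oT _ (@hol_id R T).
  + by move=> a b t [a1 a2] [b1 b2] t0 t1; split; [exact: convex_disc|exact: convex_ball].
  + by move=> w [_ wz]; apply/eqP => w0'; move: wz; rewrite w0' /= sub0r cmodN ltxx.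
  have hT : hol T (fun w => L (l w)).
    by apply: (hol_comp (O' := lhp)) hL => // w Tw; apply/lhp_disc; rewrite lE //; case: Tw.
  have FT : hol T F.
    by apply: hol_eq oT _ hT => w Tw; rewrite -{2}(lE w Tw) FL //; apply/lhp_disc; rewrite lE //; case: Tw.
  exact: FT.
have FV w : disc w -> V k.+1 c0 (F w) /\ f.[F w] = h (w ^+ 2).
  move=> Dw; have [->|w1] := eqVneq w 0; first by rewrite /F eqxx expr0n /= h0; split=> //; apply: V_refl; rewrite G_c0 lev_gt0.
  by have [x Tx <-] := lT w Dw w1; rewrite FL //; have [[]] := LH x Tx.
have [|F' bF] := lift_onto (or_intror erefl) bh hF FV; last by exists F, F'; split=> // w /FV[].
move=> w x Dw Dx FF; have := (FV x Dx).2; rewrite -FF (FV w Dw).2 => /(biholo_inj bh (D2 w Dw) (D2 x Dx)) /eqP.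
rewrite eqf_sqr => /orP[/eqP//|/eqP wx].
have [x0|x0] := eqVneq x 0; first by rewrite wx x0 oppr0.
have [a Ta ax] := lT x Dx x0; pose hf : C := pi%:C * 'i; have hf0 : Re hf = 0 by rewrite cReMr mulr0.
have wa : cexp (a + hf) = w by rewrite cexpD cexp_half mulrN1 ax wx.
(* Equal values at [w] and [- w] would make [pi * 'i] a period everywhere, against the last clause
   of [local_double]. *)
have hall := per2 hf hf0 _ _ w0 (small' w0 w0l); exfalso.
have /F0E[_ _] := small w0 w0l; move=> /(_ (cexp_neq0 _))/eqP; apply.
have -> : - cexp w0 = cexp (w0 + hf) by rewrite cexpD cexp_half mulrN1.
rewrite -!LF0 //; last by rewrite cReD hf0 addr0.
apply: hall; first by rewrite cexp_half sqrrN expr1n.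
by exists a => //; rewrite -!FL ?ax ?wa //; exact: shift.
Qed.

Lemma cconn_eq (X Y : set C) : (forall z, X z <-> Y z) -> cconn X -> cconn Y.
Proof. by move=> h; suff -> : X = Y by []; apply/seteqP; split=> z /h. Qed.

(** 0 is its own only root. If [Q] is clopen upstairs and contains 0, the points all of whose roots
    lie in [Q] form a clopen set containing 0; otherwise the complement of [Q] is treated in the
    same way. *)
Lemma cconn_sqrt X : X 0 -> cconn X -> cconn [set z | X (z ^+ 2)].
Proof.
move=> X0 cX; pose Y := [set z : C | X (z ^+ 2)].
have near_root (a b y : C) r : a ^+ 2 = y -> 0 < r -> cmod (b ^+ 2 - y) < r ^+ 2 -> cmod (b - a) < r \/ cmod (- b - a) < r.
  move=> <- r0; rewrite subr_sqr cmodM => h; have [/ltW h1|] := ltP (cmod (b - a)) r; [by left; lra|move=> h1; right].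
  have -> : - b - a = - (b + a) by ring.
  rewrite cmodN ltNge; apply/negP => h2; move: h; rewrite ltNge expr2 => /negP; apply; by apply: ler_pM => //; exact: ltW.
have main (Q : set C) : Q 0 ->
   (forall z, Y z -> Q z -> exists2 r, 0 < r & forall w, Y w -> cmod (w - z) < r -> Q w) ->
   (forall z, Y z -> ~ Q z -> exists2 r, 0 < r & forall w, Y w -> cmod (w - z) < r -> ~ Q w) -> forall z, Y z -> Q z.
  move=> Q0 o1 o2 z Yz; suff /(_ _ Yz z erefl) : forall y, X y -> forall w, w ^+ 2 = y -> Q w by [].
  apply: cX; first by exists 0 => // w /eqP; rewrite expf_eq0 /= => /eqP ->.
  - move=> y Xy hy; have [a ay] := root_ex y; have Ya : Y a by rewrite /Y /= ay.
    have aN : (- a) ^+ 2 = y by rewrite sqrrN.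
    have YN : Y (- a) by rewrite /Y /= aN.
    have [r1 r10 h1] := o1 a Ya (hy a ay); have [r2 r20 h2] := o1 _ YN (hy _ aN).
    have [r [r0 rr1 rr2]] := min_pos2 r10 r20; exists (r ^+ 2); first by rewrite exprn_gt0.
    move=> y' Xy' yy w wy; have Yw : Y w by rewrite /Y /= wy.
    rewrite -wy in yy; have [h|h] := near_root a w y r ay r0 yy; first by apply: h1 => //; lra.
    by apply: h2 => //; rewrite (_ : w - - a = - (- w - a)) ?cmodN; [lra|ring].
  - move=> y Xy hy; have [a [ay nQa]] : exists a, a ^+ 2 = y /\ ~ Q a.
      by apply: contrapT => k; apply: hy => w wy; apply: contrapT => nQ; apply: k; exists w.
    have Ya : Y a by rewrite /Y /= ay.
    have [r r0 hr] := o2 a Ya nQa; exists (r ^+ 2); first by rewrite exprn_gt0.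
    move=> y' Xy' yy k; have [b by'] := root_ex y'; rewrite -by' in yy.
    have Yb : Y b by rewrite /Y /= by'.
    have bN : (- b) ^+ 2 = y' by rewrite sqrrN.
    have YN : Y (- b) by rewrite /Y /= bN.
    by have [h|h] := near_root a b y r ay r0 yy; [apply: (hr b) => //; exact: k|apply: (hr (- b)) => //; exact: k].
move=> Q [z1 Yz1 Qz1] o1 o2; have [Q0|nQ0] := pselect (Q 0); first exact: main.
exfalso; have := main (~` Q) nQ0 o2 _ z1 Yz1; case=> // z Yz /contrapT Qz.
by have [r r0 hr] := o1 z Yz Qz; exists r => // w Yw /(hr w Yw) k /(_ k).
Qed.

(* [z] and the critical point may share their piece only when they coincide;
   then the preimage in the piece of [z] of the next smaller piece of [f z] is connected. *)
Lemma P_pull k z x : G z <= lev k.+2 -> (~ V k.+1 z c0 \/ z = c0) -> V k.+1 z x -> P k.+1 f.[z] f.[x] -> P k.+2 z x.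
Proof.
move=> Gz zc Vx Px; have Gz1 := le_lt_trans Gz (lev_lt k.+1).
have Gfz : G f.[z] < lev k by rewrite Glt.
have [h [h' [bh h0]]] := V_riemann Gfz; have [hh hh' K K'] := bh.
have sub w : P k.+1 f.[z] w -> V k f.[z] w by apply: V_sub.
pose S := [set y | disc y /\ P k.+1 f.[z] (h y)].
have cS : cconn S.
  apply: (@cconn_eq (image_of (P k.+1 f.[z]) h')).
    move=> y; split=> [[w Pw <-]|[Dy Py]]; first by have [Dw E] := K' w (sub w Pw); split; rewrite ?E.
    by exists (h y) => //; have [] := K y Dy.
  by apply: cconn_image; [exact: P_conn|move=> w /sub Vw; exact: ccont_in (hol_cont hh' Vw)].
have S0 : S 0 by split; [rewrite /disc /= cmod0|rewrite h0; apply: P_refl; rewrite Gle].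
have [n [F [F' [bF fF cSn]]]] : exists (n : nat) (F F' : C -> C), [/\ biholo disc (V k.+1 z) F F',
    forall w, disc w -> disc (w ^+ n) /\ f.[F w] = h (w ^+ n) & cconn [set w | disc w /\ S (w ^+ n)]].
  have [nz|cz] := pselect (V k.+1 z c0); last first.
    have [F [F' [bF fF]]] := pull1 Gz1 cz bh; exists 1%N, F, F'; split=> //; first by move=> w; rewrite expr1 => Dw; rewrite fF.
    by apply: (cconn_eq _ cS) => w; rewrite /= expr1; split=> [[]|[]].
  case: zc => [/(_ nz)//|zc]; subst z; have [F [F' [bF fF]]] := pull2 bh h0; exists 2%N, F, F'.
  have D2 (w : C) : disc w <-> disc (w ^+ 2).
    by rewrite /disc /= cmodX; have := cmod_ge0 w; split=> ?; nra.
  split=> // [w Dw|]; first by split; [exact: (D2 w).1|exact: fF].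
  apply: (cconn_eq _ (cconn_sqrt S0 cS)) => w /=; split=> [Sw|[]//]; split=> //; apply/D2; by case: Sw.
have [hF hF' J J'] := bF.
apply: (@P_max _ _ _ (image_of [set w | disc w /\ S (w ^+ n)] F)).
- by apply: cconn_image cSn _ => w [Dw _]; exact: ccont_in (hol_cont hF Dw).
- have Vz := V_refl Gz1; have [Dz Fz] := J' z Vz; exists (F' z) => //; split=> //; have [D1 E] := fF _ Dz.
  by split=> //; rewrite -E Fz; apply: P_refl; rewrite Gle.
- have [Dz Fz] := J' x Vx; exists (F' x) => //; split=> //; have [D1 E] := fF _ Dz.
  by split=> //; rewrite -E Fz.
- by move=> _ [w [Dw [_ Pw]] <-]; rewrite -Gle (fF w Dw).2; exact: P_le Pw.
Qed.

(** * Conformal structure of the annuli *)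

Lemma piece_in_disc k z h h' : G z < lev k.+1 -> biholo disc (V k z) h h' ->
  let E := [set y | disc y /\ P k.+1 z (h y)] in
  [/\ cclosed E, chainc E, exists rho : R, [/\ 0 < rho, rho < 1 & forall y, E y -> cmod y <= rho] &
      exists2 y, E y & y != h' z].
Proof.
move=> Gz [hh hh' K K'] E; have sub w : P k.+1 z w -> V k z w by apply: V_sub.
have EE : E = image_of (P k.+1 z) h'.
  apply/seteqP; split=> [y [Dy Py]|y [w Pw <-]]; first by exists (h y) => //; have [] := K y Dy.
  by have [Dw e] := K' w (sub w Pw); split; rewrite ?e.
have [cE bE] := compact_image (@P_closed k.+1 z) (@P_bounded k.+1 z) (fun w Pw => hol_cont hh' (sub w Pw)).
have Vz := V_refl Gz; have Ez : E (h' z) by rewrite EE; exists z => //; case: Vz.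
split.
- by rewrite EE.
- rewrite EE; apply: cconn_chainc; apply: (cconn_image (@P_conn k.+1 z)).
  by move=> w /sub Vw; exact: ccont_in (hol_cont hh' Vw).
- rewrite -EE in cE bE; have ne : E !=set0 by exists (h' z).
  have [y [Dy _] ymax] := EVT_mod cE bE ne (fun z _ => ccont_id z).
  move: Dy; rewrite /disc /= => Dy; have y0 := cmod_ge0 y.
  by exists ((1 + cmod y) / 2); split; [lra|lra|move=> w /ymax; lra].
- have [r r0 hr] := V_open Vz; pose w := z + (r / 2)%:C.
  have Vw : V k.+1 z w by apply: hr; rewrite /w addrC addKr cmod_real gtr0_norm; lra.
  exists (h' w); first by rewrite EE; exists w => //; case: Vw.
  apply/eqP => e; have := (K' w (sub w Vw.1)).2; rewrite e (K' z (sub z Vz.1)).2 /w => /eqP.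
  rewrite eq_sym -subr_eq0 addrC addKr => /eqP/(congr1 (@cmod R)); rewrite cmod_real cmod0 gtr0_norm; lra.
Qed.

Lemma cconn_ring (rho : R) : 0 < rho -> cconn [set z : C | rho < cmod z < 1].
Proof.
move=> r0; apply: (@cconn_eq (image_of [set w : C | ln rho < Re w /\ Re w < 0] cexp)).
  move=> z; split=> [[w [w1 w2] <-]|/andP[z1 z2]].
    by rewrite /= cmod_cexp expR_lt1 w2 andbT -{1}(@lnK R rho r0) ltr_expR.
  have [|w [wz _ _]] := @cexp_surj R z; first by rewrite -cmod_gt0; lra.
  exists w => //; rewrite -wz cmod_cexp in z1 z2; split; last by rewrite -expR_lt1.
  by rewrite -ltr_expR lnK.
apply: cconn_image; last by move=> w _; apply/ccont_in/(hol_cont (@hol_cexp R setT)).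
apply: cconn_convex => z w t [z1 z2] [w1 w2] t0 t1; split; last exact: convex_lhp.
rewrite cReD cReMr cReB; move: z1 w1; move: (Re z) (Re w) => a b; case: (leP t (1 / 2)) => ?; nra.
Qed.

(** A clopen part of the complement of [E] that avoids the outer ring goes to a bounded open set
    whose boundary lies in the smaller piece. The maximum principle gives [G <= lev k.+1] there,
    [P_sep] then separates it from that piece, and a bounded clopen set is empty. *)
Lemma cconn_annulus k z h h' : G z < lev k.+1 -> biholo disc (V k z) h h' ->
  cconn [set y | disc y /\ ~ (disc y /\ P k.+1 z (h y))].
Proof.
move=> Gz bh; have [hh hh' K K'] := bh.
have [cE _ [rho [r0 r1 Erho]] _] := piece_in_disc Gz bh.
set E := [set y | _] in cE Erho; pose X := [set y | disc y /\ ~ E y].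
have claim (Q : set C) : (forall y, X y -> Q y -> exists2 r, 0 < r & forall w, X w -> cmod (w - y) < r -> Q w) ->
   (forall y, X y -> ~ Q y -> exists2 r, 0 < r & forall w, X w -> cmod (w - y) < r -> ~ Q w) ->
   (forall y, X y -> rho < cmod y -> ~ Q y) -> forall y, X y -> ~ Q y.
  move=> o1 o2 nQ y0 Xy0 Qy0; pose U := [set w | V k z w /\ X (h' w) /\ Q (h' w)].
  have contV w e : V k z w -> 0 < e -> exists2 r, 0 < r & forall x, cmod (x - w) < r -> V k z x /\ cmod (h' x - h' w) < e.
    move=> Vw e0; have [r r0' hr] := V_open Vw; have [s s0 hs] := hol_cont hh' Vw e0.
    by have [t [t0 tr ts]] := min_pos2 r0' s0; exists t => // x xw; split; [apply: hr|apply: hs]; lra.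
  have Uo : copen U.
    move=> w [Vw [[Dw nE] Qw]]; have [r r0' hr] := o1 _ (conj Dw nE) Qw; have [s s0 hs] := cclosedC cE nE.
    have [t [t0 tr ts]] := min_pos2 r0' s0; have [m m0 hm] := contV w t Vw t0.
    exists m => // x /hm[Vx xw]; have Dx := (K' x Vx).1.
    have Xx : X (h' x) by split=> //; apply: hs; lra.
    by split=> //; split=> //; apply: hr => //; lra.
  have Ub : cbounded U by apply: cbounded_sub (@P_bounded k z) => w [[]].
  pose Dr := [set y : C | cmod (y - 0) <= rho].
  have DrD y : Dr y -> disc y by rewrite /Dr /disc /= subr0; lra.
  have [cI _] := compact_image (@cclosed_ball R 0 rho) (@cbounded_ball R 0 rho) (fun y (Dy : Dr y) => hol_cont hh (DrD y Dy)).
  have bdry b : ~ U b -> (exists2 r, 0 < r & forall w, U w -> ~ cmod (w - b) < r) \/ V k z b /\ E (h' b).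
    move=> nU; have [[y Dy yb]|nI] := pselect (image_of Dr h b); last first.
      left; have [r r0' hr] := cclosedC cI nI; exists r => // w [Vw [Xw Qw]] /hr; apply.
      by exists (h' w); [rewrite /Dr /= subr0 leNgt; apply/negP => k'; exact: (nQ _ Xw k')|have [] := K' w Vw].
    have [Vb hb] := K y (DrD y Dy); rewrite yb in Vb hb.
    have [Eb|nE] := pselect (E (h' b)); [by right|left].
    have Xb : X (h' b) by split=> //; have [] := K' b Vb.
    have nQb : ~ Q (h' b) by move=> Qb; apply: nU.
    have [r r0' hr] := o2 _ Xb nQb; have [s s0 hs] := contV b r Vb r0'.
    by exists s => // w [Vw [Xw Qw]] /hs[_ /hr]; apply.
  have UG : forall w, U w -> G w <= lev k.+1.
    apply: (green_max d3 (ltW (lev_gt0 k.+1)) Uo Ub) => b nU e e0; have [[r r0' hr]|[Vb [Db Pb]]] := bdry b nU.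
      by exists r => // w Uw /(hr w Uw).
    have [r r0' hr] := green_cont erefl d3 b e0; exists r => // w _ /hr.
    by have := P_le Pb; rewrite (K' b Vb).2 ltr_norml => + /andP[]; lra.
  apply: (no_clopen Uo Ub _ (z := h y0)); last by have [Vh e] := K y0 Xy0.1; split=> //; rewrite e.
  move=> b nU; have [//|[Vb [Db Pb]]] := bdry b nU; rewrite (K' b Vb).2 in Pb.
  have [r r0' hr] := P_sep k.+1; exists r => // w Uw wb; have [Vw [[Dw nE] _]] := Uw; apply: nE; split=> //.
  by rewrite (K' w Vw).2 (P_eq Pb); apply: hr => //; [exact: P_le Pb|exact: UG].
have ringX y : rho < cmod y < 1 -> X y.
  by move=> /andP[y1 y2]; split=> // Ey; have := Erho y Ey; lra.
move=> A [a Xa Aa] oA oA'.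
have flip (Q : set C) : (forall y, X y -> Q y -> exists2 r, 0 < r & forall w, X w -> cmod (w - y) < r -> Q w) ->
   (forall y, X y -> ~ ~ Q y -> exists2 r, 0 < r & forall w, X w -> cmod (w - y) < r -> ~ ~ Q w).
  by move=> o y Xy /contrapT Qy; have [r r0' hr] := o y Xy Qy; exists r => // w Xw /(hr w Xw) q; apply.
have [[b br Ab]|nA] := pselect (exists2 b, rho < cmod b < 1 & A b); last first.
  exfalso; apply: (claim A oA oA' _ a Xa Aa) => y Xy yr Ay; apply: nA; exists y => //.
  by rewrite yr; case: Xy => Dy _; exact: Dy.
have ringA : forall y, rho < cmod y < 1 -> A y.
  apply: (cconn_ring r0); first by exists b.
  - by move=> y /ringX Xy Ay; have [r r0' hr] := oA y Xy Ay; exists r => // w /ringX; exact: hr.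
  - by move=> y /ringX Xy Ay; have [r r0' hr] := oA' y Xy Ay; exists r => // w /ringX; exact: hr.
move=> y Xy; apply: contrapT; apply: (claim (~` A) oA' (flip A oA) _ y Xy) => w [Dw _] wr; apply; apply: ringA.
by rewrite wr; exact: Dw.
Qed.

Definition ann k z : set C := [set w | V k z w /\ ~ P k.+1 z w].

Lemma ann_cyl k z : G z < lev k.+1 -> exists2 dx : R, 0 < dx & cyl (ann k z) dx pi.
Proof.
move=> Gz; have [h [h' [bh h0]]] := V_riemann (lt_trans Gz (lev_lt k)); have [hh hh' K K'] := bh.
have [cE chE [rho [r0 r1 Erho]] E1] := piece_in_disc Gz bh.
have D0 : disc (0 : C) by rewrite /disc /= cmod0.
have hz : h' z = 0 by rewrite -h0; have [] := K 0 D0.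
rewrite hz in E1; have E0 : disc (0 : C) /\ P k.+1 z (h 0) by split=> //; rewrite h0; exact: P_refl (ltW Gz).
have [dx dx0 [phi [hphi phiX phio phii]]] := cyl_exists cE r0 r1 Erho E0 E1 chE (cconn_annulus Gz bh).
exists dx => //; exists (fun w => h (phi w)); split.
- by apply: (hol_comp (u := phi) _ hphi hh) => w /phiX[].
- by move=> w /phiX[Dw nE]; have [Vh e] := K _ Dw; split=> // Pw; apply: nE.
- move=> y [Vy nP]; have [Dy hy] := K' y Vy; have [|w Sw pw] := phio (h' y); last by exists w; rewrite ?pw.
  by split=> // -[_]; rewrite hy.
- move=> w w' Sw Sw'; rewrite -phii //; split=> [|-> //]; apply: (biholo_inj bh); [exact: (phiX w Sw).1|exact: (phiX w' Sw').1].
Qed.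

(** * Collars and their behaviour under pullback *)

Lemma wind_comp m (u psi : C -> C) p : hol disc u -> (forall w x, disc w -> disc x -> u w = u x -> w = x) ->
  hol (strip m) psi -> (forall w, strip m w -> disc (psi w) /\ psi (w + 1) = psi w) -> disc p ->
  wind m psi p -> wind m (fun w => u (psi w)) (u p).
Proof.
move=> hu inj hpsi pD Dp [L [hL EL L1]]; have [l hl] := hu p Dp.
have l0 := inj_hasd_neq0 (@copen_disc R) Dp hu inj hl.
(* Winding passes from [psi] to [u (psi w)] by adding a logarithm of the divided difference of [u]
   at [p]; this logarithm is single-valued on the disc, as [u] is injective. *)
have [|M [hM EM]] := hol_log (@copen_disc R) convex_disc (slope_hol (@copen_disc R) Dp hu hl).
  move=> w Dw; have [->|wp] := eqVneq w p; first by rewrite slope_bb.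
  by rewrite slopeE // mulf_neq0 ?invr_eq0 ?subr_eq0 //; apply: contra_neq wp; exact: inj.
exists (fun w => M (psi w) + L w); split.
- by apply: holD => //; apply: (hol_comp (u := psi) _ hpsi hM) => w /pD[].
- by move=> w Sw; rewrite cexpD EM ?EL //; [exact: slopeM|exact: (pD w Sw).1].
- by move=> w Sw; rewrite (pD w Sw).2 L1 // addrA.
Qed.

(** An embedded cylinder of circumference 1 and height [m] in the piece, winding about everything of
    level [k.+1] there and not only about one subpiece. It is stored in Riemann coordinates, where
    lifting through [f] is the identity or a square root. *)
Definition collar k z (m : R) := exists h h' psi, [/\ biholo disc (V k z) h h', hol (strip m) psi,
  forall w, strip m w -> disc (psi w) /\ psi (w + 1) = psi w,
  forall w w', strip m w -> strip m w' -> psi w = psi w' -> exists n : int, w' = w + n%:~R &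
  forall p, disc p -> G (h p) <= lev k.+1 -> wind m psi p].

Lemma collar_le k z (m m' : R) : m' <= m -> collar k z m -> collar k z m'.
Proof.
move=> mm [h [h' [psi [bh hpsi pD inj hw]]]]; have sub w : strip m' w -> strip m w.
  by rewrite /strip /= => /andP[-> ?]; lra.
exists h, h', psi; split=> //.
- exact: hol_sub hpsi.
- by move=> w /sub; exact: pD.
- by move=> w w' /sub Sw /sub; exact: inj.
- move=> p Dp Gp; have [L [hL EL L1]] := hw p Dp Gp; exists L; split.
  + exact: hol_sub hL.
  + by move=> w /sub; exact: EL.
  + by move=> w /sub; exact: L1.
Qed.

(** A round annulus outside the compact part of level [k.+1], parametrized by
    [cexp (2 * pi * 'i * w)]. *)
Lemma collar_base k z : G z < lev k -> exists2 m : R, 0 < m & collar k z m.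
Proof.
move=> Gz; have [h [h' [bh h0]]] := V_riemann Gz; have [hh hh' K K'] := bh.
pose X := [set w | P k z w /\ G w <= lev k.+1].
have XV w : X w -> V k z w by move=> [Pw Gw]; split=> //; exact: le_lt_trans Gw (lev_lt k).
have cX : cclosed X.
  move=> w hw; split; first by apply: P_closed => e /hw[y [Py _] yw]; exists y.
  by apply: (sublevel_closed erefl d3) => e /hw[y [_ Gy] yw]; exists y.
have bX : cbounded X by apply: cbounded_sub (@P_bounded k z) => w [].
have [rho [r0 r1 hr]] : exists rho : R, [/\ 0 < rho, rho < 1 & forall p, disc p -> G (h p) <= lev k.+1 -> cmod p <= rho].
  have [[x Xx]|nX] := pselect (exists x, X x); last first.
    exists (1 / 2); split; [lra|lra|move=> p Dp Gp; case: nX; exists (h p); split=> //; exact: (K p Dp).1.1].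
  have [||y Xy ymax] := @EVT_mod R X h' cX bX; [by exists x|by move=> w /XV; exact: hol_cont|].
  have [Dy _] := K' y (XV y Xy); have y0 := cmod_ge0 (h' y).
  exists ((1 + cmod (h' y)) / 2); split; try (by move: Dy; rewrite /disc /=; lra).
  move=> p Dp Gp; have [Vp e] := K p Dp; have := ymax (h p); rewrite e => /(_ (conj Vp.1 Gp)).
  by move: Dy; rewrite /disc /=; lra.
have pi2 : 0 < (pi : R) *+ 2 by rewrite mulrn_wgt0 // pi_gt0.
have ln0 : ln rho < 0 by rewrite ln_lt0 // r0.
pose m := - ln rho / (pi *+ 2); have m0 : 0 < m by rewrite divr_gt0 // oppr_gt0.
pose a : C := (pi *+ 2)%:C * 'i; pose psi w := cexp (a * w).
have Rea w : Re (a * w) = - ((pi *+ 2) * Im w) by rewrite /a -mulrA cReMr cReM /= mul0r mul1r sub0r mulrN.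
have psi_mod w : strip m w -> rho < cmod (psi w) < 1.
  move=> /andP[w1 w2]; rewrite cmod_cexp Rea expR_lt1 oppr_lt0 mulr_gt0 // andbT -{1}(@lnK R rho r0) ltr_expR.
  by rewrite ltrNr mulrC -ltr_pdivlMr.
have hpsi : hol (strip m) psi.
  apply: (hol_comp (O' := setT) (u := fun w => a * w)) (@hol_cexp R setT) => //.
  by apply: holM; [exact: hol_cst|exact: hol_id].
have aper n : a * n%:~R = per n by rewrite /per -cint_real mulrC /a mulrA.
have aw1 w : a * (w + 1) = a * w + per 1 by rewrite mulrDr -[1]/(1%:~R) aper.
have psi1 w : psi (w + 1) = psi w by rewrite /psi aw1 cexpDper.
exists m => //; exists h, h', psi; split=> //.
- by move=> w /psi_mod/andP[].
- move=> w w' _ _ /cexp_eq[n e]; exists n; have a0 : a != 0.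
    by rewrite -cmod_gt0 cmodM cmodi mulr1 cmod_real gtr0_norm.
  by apply: (mulfI a0); rewrite e mulrDr aper.
- move=> p Dp Gp; have pr := hr p Dp Gp.
  have [M [hM EM]] := @log_disc R.
  have Dq w : strip m w -> disc (p / psi w).
    by move=> /psi_mod/andP[w1 w2]; rewrite /disc /= cmod_div ltr_pdivrMr ?mul1r; lra.
  exists (fun w => a * w + M (p / psi w)); split.
  + apply: holD; first by apply: holM; [exact: hol_cst|exact: hol_id].
    apply: (hol_comp (u := fun w => p / psi w) Dq) hM; apply: hol_div hpsi _ => [|w _]; [exact: hol_cst|exact: cexp_neq0].
  + move=> w Sw; rewrite cexpD EM; last exact: Dq.
    by rewrite -/(psi w) mulrBr mulr1 mulrCA divff ?mulr1 //; exact: cexp_neq0.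
  + by move=> w Sw; rewrite psi1 aw1 addrAC.
Qed.

Lemma collar_step1 k z (m : R) : G z < lev k.+1 -> ~ V k.+1 z c0 -> collar k f.[z] m -> collar k.+1 z m.
Proof.
move=> Gz nc [h [h' [psi [bh hpsi pD inj hw]]]]; have [F [F' [bF fF]]] := pull1 Gz nc bh.
by exists F, F', psi; split=> // p Dp Gp; apply: hw => //; rewrite -fF // Gle.
Qed.

Lemma strip_double (m : R) (w : C) : strip (m / 2) w -> strip m (2 * w).
Proof. by rewrite /strip /= -(rmorph_nat (real_complex R)) cImMr => /andP[w1 w2]; split_lra. Qed.

Lemma strip_half (m : R) (w : C) : strip m w -> strip m (w + 2^-1).
Proof. by move=> /(strip_real 2^-1); rewrite fmorphV rmorph_nat. Qed.

Lemma half_per1 : (2^-1 : C) * per 1 = (pi : R)%:C * 'i.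
Proof. by rewrite /per mul1r mulrA; congr (_ * _); apply: cplx_eq; rewrite !(cReM, cImM) /=; field. Qed.

(* The log of [psi2 (2 w) - p ^+ 2] is the sum of those of [psi - p] and [psi + p],
   which have equal increments because [psi (w + 1/2) = - psi w]. *)
Lemma wind_sqrt (m : R) (psi psi2 : C -> C) p : hol (strip (m / 2)) psi -> (forall w, strip (m / 2) w -> psi w ^+ 2 = psi2 (2 * w)) ->
  (forall w, strip (m / 2) w -> psi (w + 2^-1) = - psi w) -> wind m psi2 (p ^+ 2) -> wind (m / 2) psi p.
Proof.
move=> hpsi sq odd wp2; have [M [hM EM M1]] := wp2; pose T := strip (m / 2) : set C.
have S2 w : T w -> strip m (2 * w) by exact: strip_double.
have Th w : T w -> T (w + 2^-1) by exact: strip_half.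
have ne w : T w -> psi w - p != 0.
  move=> Tw; rewrite subr_eq0; apply/eqP => e; have := wind_neq wp2 (S2 w Tw); by rewrite -sq // e eqxx.
have [|||L [hL EL]] := @hol_log R T (fun w => psi w - p) (@copen_strip R _).
- by move=> z w t; exact: convex_strip.
- by apply: holB => //; exact: hol_cst.
- exact: ne.
exists L; split=> // w Tw.
pose D x := L x + L (x + 2^-1) + (pi : R)%:C * 'i - M (2 * x).
have h2 : hol T (fun w => w + 2^-1) by apply: holD; [exact: hol_id|exact: hol_cst].
have hD : hol T D.
  apply: holB; last by apply: (hol_comp (u := fun w => 2 * w) S2 _ hM); apply: holM; [exact: hol_cst|exact: hol_id].
  apply: holD; last exact: hol_cst.
  by apply: holD => //; exact: (hol_comp (u := fun w => w + 2^-1) Th h2 hL).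
have eD x : T x -> cexp (D x) = 1.
  move=> Tx; have Sx := S2 x Tx; have Hx := Th x Tx; rewrite /D cexpB EM // !cexpD cexp_half !EL // odd // -sq //.
  rewrite (_ : (psi x - p) * (- psi x - p) * -1 = psi x ^+ 2 - p ^+ 2); last by ring.
  by rewrite divff // sq // subr_eq0; exact: wind_neq (S2 x Tx).
have cD : forall x, T x -> D x = D w.
  apply: (log_uniq (@cconn_strip R _) Tw hD (hol_cst _)) => // z Tz.
  by rewrite !eD.
have Sw := S2 w Tw; have := cD _ (Th w Tw); rewrite /D mulrDr mulfV ?pnatr_eq0 // M1 // -(addrA w).
rewrite (_ : 2^-1 + 2^-1 = 1 :> C); last by rewrite [RHS]splitr div1r.
by move=> e; apply/eqP; rewrite -subr_eq0; apply/eqP; move: e => /eqP; rewrite -subr_eq0 => /eqP <-; ring.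
Qed.

Lemma int_parity (n : int) : exists j : int, n = j * 2 \/ n = j * 2 + 1.
Proof.
exists (divz n 2); have := divz_eq n 2; have := @modz_ge0 n 2 isT; have := @ltz_pmod n 2 isT.
by move: (modz n 2) (divz n 2) => a b; lia.
Qed.

Lemma V_eq k z w : P k z w -> V k z = V k w.
Proof. by move=> Pw; rewrite /V (P_eq Pw). Qed.

(** With the critical value moved to 0, [f] is squaring in disc coordinates. The square root of the
    strip map has period 2 in the old parameter, and rescaling to period 1 halves the height. *)
Lemma collar_step2 k z (m : R) : V k.+1 z c0 -> collar k f.[z] m -> collar k.+1 z (m / 2).
Proof.
move=> Vc [h [h' [psi [bh hpsi pD inj hw]]]]; have fc := V_map Vc.
have VE : V k f.[z] = V k f.[c0] by exact: V_eq fc.1.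
rewrite /collar (V_eq Vc.1); rewrite VE in bh fc; have [hh hh' K K'] := bh.
pose a := h' f.[c0]; have [Da ha] := K' _ fc.
pose h2 y := h (mob (- a) y); pose psi2 w := mob a (psi w).
have bh2 : biholo disc (V k f.[c0]) h2 (fun y => mob a (h' y)).
  by apply: biholo_comp bh; apply/biholo_sym/mob_biholo.
have h20 : h2 0 = f.[c0] by rewrite /h2 mob0 opprK.
have [F [F' [bF fF]]] := pull2 bh2 h20; have minj := biholo_inj (mob_biholo Da).
have wind2 p : disc p -> G (h2 p) <= lev k.+1 -> wind m psi2 p.
  move=> Dp Gp; rewrite -(mobNK Da Dp); apply: wind_comp (mob_hol Da) minj hpsi pD _ _; first exact: mob_disc (discN Da) Dp.
  by apply: hw => //; exact: mob_disc (discN Da) Dp.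
have D0 : disc (0 : C) by rewrite /disc /= cmod0.
have [L [hL EL L1]] : wind m psi2 0.
  by apply: wind2 => //; rewrite h20 Gf G_c0 mulr0; exact: ltW (lev_gt0 _).
pose psi3 w := cexp (2^-1 * L (2 * w)); pose T := strip (m / 2) : set C.
have S2 w : T w -> strip m (2 * w) by exact: strip_double.
have hT : hol T psi3.
  apply: (hol_comp (O' := setT) (u := fun w => 2^-1 * L (2 * w))) (@hol_cexp R setT) => //.
  apply: holM; first exact: hol_cst.
  by apply: (hol_comp (u := fun w => 2 * w) S2 _ hL); apply: holM; [exact: hol_cst|exact: hol_id].
have sq w : T w -> psi3 w ^+ 2 = psi2 (2 * w).
  by move=> Tw; have Sw := S2 w Tw; rewrite -cexp_mulrn mulrA mulfV ?pnatr_eq0 // mul1r EL // subr0.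
have odd w : T w -> psi3 (w + 2^-1) = - psi3 w.
  by move=> Tw; have Sw := S2 w Tw; rewrite /psi3 mulrDr mulfV ?pnatr_eq0 // L1 // mulrDr half_per1 cexpD cexp_half mulrN1.
have Th w : T w -> T (w + 2^-1) by exact: strip_half.
have one w : T w -> psi3 (w + 1) = psi3 w.
  by move=> Tw; rewrite [1]splitr div1r addrA odd ?odd ?opprK //; exact: Th.
have per_n w (n : int) : T w -> psi3 (w + n%:~R) = psi3 w.
  move=> Tw; have Tn x (j : nat) : T x -> T (x + j%:R) by move=> Tx; have := strip_real j%:R Tx; rewrite rmorph_nat.
  have nat_per x (j : nat) : T x -> psi3 (x + j%:R) = psi3 x.
    by move=> Tx; elim: j => [|j IH]; rewrite ?addr0 // -natr1 addrA one ?IH //; exact: Tn.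
  case: n => j; first exact: nat_per.
  rewrite NegzE mulrNz; have := nat_per (w - j.+1%:R) j.+1; rewrite subrK => -> //.
  by have := strip_real (- j.+1%:R) Tw; rewrite rmorphN rmorph_nat.
exists F, F', psi3; split=> //.
- move=> w Tw; split; last exact: one.
  rewrite /disc /= -(ltr_pXn2r (n := 2)) ?nnegrE ?cmod_ge0 // expr1n -cmodX sq //.
  exact: mob_disc Da (pD _ (S2 w Tw)).1.
- move=> w w' Tw Tw' e.
  have [|n nE] := inj (2 * w) (2 * w') (S2 w Tw) (S2 w' Tw').
    by apply: minj; [exact: (pD _ (S2 w Tw)).1|exact: (pD _ (S2 w' Tw')).1|rewrite -/(psi2 _) -/(psi2 _) -!sq // e].
  have w'E : w' = w + n%:~R / 2 by rewrite -[w'](mulKf (x := 2)) ?pnatr_eq0 // nE mulrDr mulKf ?pnatr_eq0 // mulrC.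
  (* [n] counts half periods of [psi3]; an odd number of them would change its sign. *)
  have [j [nj|nj]] := int_parity n; rewrite {}nj in w'E.
    by exists j; rewrite w'E rmorphM /= mulfK // pnatr_eq0.
  have : psi3 w' = - psi3 w.
    by rewrite w'E rmorphD rmorphM /= mulrDl mulfK ?pnatr_eq0 // div1r [_ + 2^-1]addrC addrA per_n ?odd //; exact: Th.
  rewrite -e => /eqP; rewrite -subr_eq0 opprK -mulr2n mulrn_eq0 /=; by rewrite (negPf (cexp_neq0 _)).
- move=> p Dp Gp; apply: (wind_sqrt hT sq odd); apply: wind2; last by rewrite -fF // Gle.
  by move: Dp; rewrite /disc /= cmodX; have := cmod_ge0 p; nra.
Qed.

Lemma collar_mod k z (m dx dy : R) : G z <= lev k.+1 -> 0 < m -> collar k z m -> 0 < dx -> 0 < dy -> cyl (ann k z) dx dy -> m <= dy / dx.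
Proof.
move=> Gz m0 [h [h' [psi [bh hpsi pD inj hw]]]] dx0 dy0 [phi [hphi phiX phio phii]].
have [hh hh' K K'] := bh; have Vz : V k z z by apply: V_refl; exact: le_lt_trans Gz (lev_lt k).
have [Dz hz] := K' z Vz.
have [|L [hL EL L1]] := @wind_comp m h psi (h' z) hh (biholo_inj bh) hpsi pD Dz; first by apply: hw => //; rewrite hz.
apply: (@modulus_ge R (ann k z) dx dy phi dx0 hphi phiX phio phii m (fun w => h (psi w)) z L) => //.
- by apply: (hol_comp (u := psi) _ hpsi hh) => w /pD[].
- move=> w Sw; have [Dp _] := pD w Sw; have [Vh e] := K _ Dp; split=> // /P_le Gp.
  by have := wind_neq (hw _ Dp Gp) Sw; rewrite eqxx.
- by move=> w Sw; rewrite (pD w Sw).2.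
- by move=> [_]; apply; exact: P_refl.
- by move=> w Sw; exact: hol_cont hL Sw.
- by move=> w Sw; rewrite EL // hz.
Qed.

(** * Returns to the critical pieces and lower bounds of moduli *)

Local Notation K := (filled_julia f).
Local Notation fwd := (fwd_orbit f).

Definition returns z n i : bool := `[< P n c0 (fwd z i) >].

Lemma KP z : K z <-> G z = 0. Proof. exact: (green0P erefl d3). Qed.
Lemma K_lt z k : K z -> G z < lev k. Proof. by move=> /KP ->; exact: lev_gt0. Qed.
Lemma K_V k z x : K x -> P k z x -> V k z x. Proof. by move=> Kx Px; split=> //; exact: K_lt. Qed.

Lemma K_closed : cclosed K.
Proof.
move=> z hz; apply/KP/le_anti; rewrite (green_ge0 erefl d3) andbT; apply: (sublevel_closed erefl d3 (t := 0)) => e /hz[w /KP Gw wz].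
by exists w => //=; rewrite Gw.
Qed.

Lemma K_bounded : cbounded K.
Proof. by apply: cbounded_sub (@sublevel_bounded R f d erefl d3 0) => z /KP /= ->. Qed.

Lemma K_fwd z i : K z -> K (fwd z i).
Proof. by move=> /KP Gz; apply/KP; rewrite (green_fwd erefl d3) Gz mulr0. Qed.

Lemma P_le_depth k n z w : (k <= n)%N -> P n z w -> P k z w.
Proof. by rewrite leq_eqVlt => /predU1P[->//|/V_sub h] /h[]. Qed.

Lemma P_fwd n i z w : P (n + i) z w -> P n (fwd z i) (fwd w i).
Proof. by elim: i n => [|i IH] n; rewrite ?addn0 // addnS -addSn => /IH /P_map. Qed.

Lemma hitsS z k : hits (returns z) k.+1 = (returns z k.+1 0 + hits (returns f.[z]) k)%N.
Proof.
rewrite /hits /= subn0; congr (_ + _)%N; have -> : iota 1 k = map (addn 1) (iota 0 k) by rewrite -iotaDl.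
by rewrite count_map; apply: eq_count => i; rewrite /= /returns subSS add1n fwd_Sr.
Qed.

(** Compactness of [K] gives one [m0] at depth 0. The induction then follows [f]: a critical piece
    halves the height, any other keeps it, which is the recursion [hitsS] of the hit count. *)
Lemma collar_uniform : exists2 m0 : R, 0 < m0 & forall k z, K z -> collar k z (m0 * weight (returns z) k).
Proof.
have [||m0 m00 h0] := @compact_uniform R K (collar 0) K_closed K_bounded.
- by move=> y r r' h rr; exact: collar_le h.
- move=> x Kx; have [m mp hm] := collar_base (K_lt 0 Kx); have [r r0 hr] := V_open (V_refl (K_lt 0 Kx)).
  have [s [s0 sr sm]] := min_pos2 r0 mp; exists s; split=> // y Ky yx; apply: (collar_le sm).
  by rewrite /collar -(V_eq (hr y (lt_le_trans yx sr)).1).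
exists m0 => //; elim=> [|k IH] z Kz; first by rewrite /weight expr0 mulr1; exact: h0.
have Kfz : K f.[z] := K_fwd 1 Kz; rewrite /weight hitsS; have := IH _ Kfz.
case: (boolP (returns z k.+1 0)) => [/asboolP Pz|/asboolPn nP] h.
  rewrite exprS mulrCA mulrC; apply: collar_step2 h; split; last by rewrite G_c0 lev_gt0.
  exact: connected_component_sym.
by apply: collar_step1 => //; [exact: K_lt|move=> [Pz _]; apply: nP; exact: connected_component_sym].
Qed.

Lemma returns_down z n i : returns z n.+1 i -> returns z n i.
Proof. by move=> /asboolP Pz; apply/asboolP; exact: P_le_depth Pz. Qed.

Lemma returns_diag z n i j : returns z n i -> (j <= n)%N -> returns z (n - j) (i + j) = returns c0 (n - j) j.
Proof.
move=> /asboolP Pz jn; rewrite -(subnK jn) in Pz; have := P_fwd Pz; rewrite -fwd_add addnC => Pj.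
by apply: asbool_equiv_eq; split=> h; [rewrite (P_eq h); exact: connected_component_sym|rewrite (P_eq h)].
Qed.

(** A match in column [i + r] at depth [(k - r).+1] would be pulled back by [P_pull], through
    noncritical pieces until [c0] itself is reached, and give the match in column [i] at depth
    [k.+1] that fails. *)
Lemma returns_semi (k i r : nat) : (0 < r)%N -> (r < k)%N -> returns c0 k i -> ~~ returns c0 k.+1 i ->
  (forall j, (0 < j)%N -> (j < r)%N -> ~~ returns c0 (k - j) j) -> returns c0 (k - r).+1 r -> ~~ returns c0 (k - r).+1 (i + r).
Proof.
move=> r0 rk /asboolP Mk /asboolPn nM no /asboolP Mr; apply/asboolPn => Pr.
have Gc j n : G (fwd c0 j) <= lev n by rewrite (green_fwd erefl d3) G_c0 mulr0; exact: ltW (lev_gt0 n).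
have Pj j : (j <= k)%N -> P (k - j) (fwd c0 j) (fwd c0 (i + j)).
  by move=> jk; rewrite -(subnK jk) in Mk; have := P_fwd Mk; rewrite -fwd_add addnC.
have key j : (j < r)%N -> ~ P (k - j) (fwd c0 j.+1) (fwd c0 (i + j.+1)).
  elim: j => [|j IH] jr Pc.
    case: k rk Mk Pc nM {no Mr Pr Pj} => // k rk Mk Pc; apply; apply: P_pull; [by rewrite G_c0; exact: ltW (lev_gt0 _)|by right| |].
      by split=> //; rewrite (green_fwd erefl d3) G_c0 mulr0 lev_gt0.
    by move: Pc; rewrite subn0 addnS addn0.
  have [n kj] : exists n, (k - j.+1)%N = n.+1 by exists (k - j.+1).-1; lia.
  apply: (IH (ltnW jr)); have -> : (k - j)%N = n.+2 by lia.
  apply: P_pull; [exact: Gc| | |].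
  - left=> -[Pz _]; have /asboolPn := no j.+1 isT jr; apply; rewrite kj; exact: connected_component_sym.
  - by rewrite -kj; split; [apply: Pj; lia|apply: le_lt_trans (lev_lt _); exact: Gc].
  - by move: Pc; rewrite kj addnS !fwd_S.
have rr : r.-1.+1 = r by rewrite prednK.
have := key r.-1; rewrite rr leqnn => /(_ isT); apply; have -> : (k - r.-1)%N = (k - r).+1 by lia.
by rewrite -(P_eq Mr).
Qed.

Hypothesis np : ~ critical_tableau_periodic f G0 c0.

Lemma weights_diverge z : @diverges R (weight (returns z)).
Proof.
apply: (@column_diverges R (returns c0)); [exact: returns_down|exact: returns_diag|].
apply: critical_diverges; [|exact: returns_down|exact: returns_diag|exact: returns_semi|].
- by move=> n; apply/asboolP/P_refl; rewrite G_c0 ltW // lev_gt0.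
- move=> i i0; apply: contrapT => h; apply: np; exists i => // k.
  by apply/esym/P_eq; apply: contrapT => nP; apply: h; exists k; apply/asboolPn.
Qed.

Lemma puzzle_annulusE k z : puzzle_annulus f G0 k z = ann k z.
Proof. by rewrite /puzzle_annulus P_int. Qed.

Lemma cylP X (dx dy : R) : cylinder_isomorphic X dx dy <-> cyl X dx dy.
Proof.
split=> -[phi].
  move=> [hphi im inj]; exists phi; split=> //.
  - by move=> w /hphi /derivableC.
  - by move=> w Sw; rewrite -im; exists w.
  - by move=> z; rewrite -im => -[w Sw <-]; exists w.
move=> [hphi into onto inj]; exists phi; split=> //.
- by move=> w /hphi h; apply/derivableC.
- by apply/seteqP; split=> [z [w Sw <-]|z /onto[w Sw <-]]; [exact: into|exists w].
Qed.

(** Existence of a cylinder excludes the default value of [xget]; whichever cylinder is chosen,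
    [collar_mod] bounds its modulus. *)
Lemma modulus_lower k z (m : R) : K z -> 0 < m -> collar k z m -> m <= modulus (puzzle_annulus f G0 k z).
Proof.
move=> Kz m0 hm; rewrite puzzle_annulusE /modulus.
have [dx dx0 hc] := ann_cyl (K_lt k.+1 Kz).
have ex : exists x : R, is_modulus (ann k z) x by exists (pi / dx), dx, pi; split=> //; [exact: pi_gt0|exact/cylP].
case: (xgetPex 0 ex) => dx' [dy' [dx'0 dy'0 /cylP hc' ->]].
exact: collar_mod (ltW (K_lt _ Kz)) m0 hm dx'0 dy'0 hc'.
Qed.

Lemma weight_gt0 (M : nat -> nat -> bool) k : 0 < weight M k :> R.
Proof. by rewrite exprn_gt0 // invr_gt0 ltr0n. Qed.

Lemma moduli_diverge z : K z -> (\sum_(0 <= k <oo) (modulus (puzzle_annulus f G0 k z))%:E = +oo)%E.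
Proof.
move=> Kz; have [m0 m00 hm] := collar_uniform.
have ge k : m0 * weight (returns z) k <= modulus (puzzle_annulus f G0 k z).
  by apply: modulus_lower => //; [rewrite mulr_gt0 // weight_gt0|exact: hm].
have ge0 k : 0 <= modulus (puzzle_annulus f G0 k z).
  by apply: le_trans (ge k); rewrite mulr_ge0 ?weight_ge0 // ltW.
apply/eqyP => A A0; have [n hn] := weights_diverge z (A / m0).
apply: (@le_trans _ _ (\sum_(0 <= k < n) (modulus (puzzle_annulus f G0 k z))%:E)%E); last first.
  by apply: nneseries_lim_ge => k _ _; rewrite lee_fin.
rewrite sumEFin lee_fin; apply: le_trans (_ : \sum_(0 <= k < n) m0 * weight (returns z) k <= _); last by apply: ler_sum.
by rewrite -mulr_sumr mulrC -ler_pdivrMr.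
Qed.

(** * Area: nests are points and [K] is a null set *)

Lemma mble_V k z : mble (V k z). Proof. by apply: mble_open; exact: V_open. Qed.

Lemma mble_sub k : mble [set w | G w <= lev k].
Proof. by apply: mble_closed; exact: (sublevel_closed erefl d3). Qed.

Lemma V_bounded k z : cbounded (V k z).
Proof. by apply: cbounded_sub (@P_bounded k z) => w []. Qed.

(** Length-area for the collar, whose image avoids level [k.+1] because it winds about the points of
    that level. *)
Lemma V_area k z (m : R) p q : 0 < m -> collar k z m -> V k z p -> V k z q -> G p <= lev k.+1 -> G q <= lev k.+1 ->
  m * cmod (p - q) ^+ 2 <= 2 ^+ 16 * ar (V k z `\` [set w | G w <= lev k.+1]).
Proof.
move=> m0 [h [h' [psi [bh hpsi pD inj hw]]]] Vp Vq Gp Gq; have [hh hh' J J'] := bh.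
have wd (u : C) : V k z u -> G u <= lev k.+1 -> wind m (fun w => h (psi w)) u.
  move=> Vu Gu; have [Du <-] := J' u Vu; apply: wind_comp hh (biholo_inj bh) hpsi pD Du _.
  by apply: hw; [exact: (J' u Vu).1|rewrite (J' u Vu).2].
apply: (@length_area R m (fun w => h (psi w))) => //.
- by apply: (hol_comp (u := psi) _ hpsi hh) => w /pD[].
- by move=> w /pD[_ ->].
- move=> w w' Sw Sw' e; apply: inj => //; exact: (biholo_inj bh (pD w Sw).1 (pD w' Sw').1).
- move=> w Sw; have [Dw _] := pD w Sw; split; first exact: (J _ Dw).1.
  by move=> /(hw _ Dw)/wind_neq/(_ Sw); rewrite eqxx.
- exact: mbleD (mble_V k z) (mble_sub _).
- by apply: cbounded_sub (@V_bounded k z) => w [].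
- exact: wd.
- exact: wd.
Qed.

(** With a second point [w] in the nest, each depth would use up area at least a fixed multiple of
    its weight times [cmod (z - w) ^+ 2], while the area of [V 0 z] is finite. *)
Lemma nest_point z : K z -> nest_intersection f G0 z = [set z].
Proof.
move=> Kz; apply/seteqP; split=> [w hw|_ -> k _]; last exact/P_refl/ltW/K_lt.
apply: contrapT => wz; have [m0 m00 hm] := collar_uniform.
have dp : 0 < cmod (z - w) ^+ 2 by rewrite exprn_gt0 // cmod_gt0 subr_eq0 eq_sym; apply/eqP.
have Gw k : G w <= lev k by exact: P_le (hw k I).
have Vw k : V k z w by apply: (V_sub (ltnSn k)); exact: hw.
have [A A0 step] : exists2 A : R, 0 <= A & forall k, m0 * weight (returns z) k * cmod (z - w) ^+ 2 <= A * (ar (V k z) - ar (V k.+1 z)).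
  exists (2 ^+ 16) => [|k]; first by rewrite exprn_ge0.
  have mk : 0 < m0 * weight (returns z) k by rewrite mulr_gt0 // weight_gt0.
  apply: le_trans (V_area mk (hm k z Kz) (V_refl (K_lt k Kz)) (Vw k) (ltW (K_lt _ Kz)) (Gw _)) _.
  rewrite ler_pM2l ?exprn_gt0 // lerBrDl (ar_split (mble_V k z) (mble_sub k.+1) (@V_bounded k z)) lerD2r.
  apply: ar_le; [exact: mble_V|exact: mbleI (mble_V k z) (mble_sub k.+1)|by apply: cbounded_sub (@V_bounded k z) => x []|].
  by move=> x [Px Gx]; split; [exact: V_sub Px|exact: ltW].
have c1 : 0 < m0 * cmod (z - w) ^+ 2 by rewrite mulr_gt0.
(* The extra 1 makes the weighted sum exceed the available [A * ar (V 0 z)]. *)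
have [n hn] := weights_diverge z ((A * ar (V 0 z) + 1) / (m0 * cmod (z - w) ^+ 2)).
have := telescope n step; rewrite ler_pdivrMr // in hn.
have An : 0 <= A * ar (V n z) by rewrite mulr_ge0 ?ar_ge0.
rewrite [X in X <= _ -> _]mulrC mulrBr => /(le_trans hn); rewrite lerBrDr -addrA gerDl leNgt.
by rewrite ltr_wpDr.
Qed.

Lemma ar0 : ar (set0 : set C) = 0.
Proof. by rewrite /ar /area (_ : [set q | _] = set0) ?measure0 //; apply/seteqP; split. Qed.

Lemma mble_K : mble K. Proof. by apply: mble_closed; exact: K_closed. Qed.

(** A greedy choice of points in ever new pieces would cluster, and two of them would be closer than
    the separation of [P_sep]. *)
Lemma pieces_cover (n : nat) : exists s : seq C, forall x, K x -> exists2 p, p \in s & P n p x.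
Proof.
apply: contrapT => no; have /choice [F hF] : forall s : seq C, exists x, K x /\ forall p, p \in s -> ~ P n p x.
  move=> s; apply: contrapT => h; apply: no; exists s => x Kx; apply: contrapT => h'; apply: h; exists x; split=> // p ps Pp.
  by apply: h'; exists p.
pose fix L (k : nat) : seq C := if k is k'.+1 then F (L k') :: L k' else [::].
have Lin j k : (j < k)%N -> F (L j) \in L k.
  by elim: k => // k IH; rewrite ltnS leq_eqVlt inE => /predU1P[->|/IH ->]; rewrite ?eqxx ?orbT.
have [M hM] := K_bounded; have [r r0 hr] := P_sep n; have r2 : 0 < r / 2 by lra.
have [l hl] := BW (fun k => hM _ (hF (L k)).1).
have [k1 _ h1] := hl _ 0%N r2; have [k2 k12 h2] := hl _ k1.+1 r2.
have [Kx nx] := hF (L k2); apply: (nx _ (Lin _ _ k12)); apply: hr; [exact/ltW/K_lt/(hF (L k1)).1|exact/ltW/K_lt|].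
by have := cmod_tri l (F (L k2)) (F (L k1)); rewrite (cmodBC l); lra.
Qed.

(** Pieces of one depth are disjoint or equal, so finitely many can be split off from [X] one at a
    time. *)
Lemma pieces_sum (n : nat) X (t c : R) : mble X -> cbounded X ->
  (forall p, K p -> X p -> (forall w, V n p w -> X w) /\ t * ar (K `&` V n p) <= c * ar (V n p)) -> 0 <= c ->
  t * ar (K `&` X) <= c * ar X.
Proof.
move=> mX bX hX c0'; have [s hs] := pieces_cover n.
have {hs} : forall x, K x -> X x -> exists2 p, p \in s & P n p x by move=> x Kx _; exact: hs.
elim: s X mX bX hX => [|p s IH] X mX bX hX hs.
  rewrite (_ : K `&` X = set0) ?ar0 ?mulr0 ?mulr_ge0 ?ar_ge0 //.
  by apply/seteqP; split=> // x [Kx Xx]; have [] := hs x Kx Xx.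
have [[x [Kx Xx Px]]|no] := pselect (exists x, [/\ K x, X x & P n p x]); last first.
  apply: IH => // x Kx Xx; have [q] := hs x Kx Xx; rewrite inE => /predU1P[-> Pq|qs Pq]; last by exists q.
  by case: no; exists x.
have [VX hV] := hX x Kx Xx; have mV := mble_V n x; have mY := mbleD mX mV.
have bKX : cbounded (K `&` X) by apply: cbounded_sub bX => z [].
rewrite (ar_split (mbleI mble_K mX) mV bKX) (ar_split mX mV bX).
have -> : (K `&` X) `&` V n x = K `&` V n x.
  by apply/seteqP; split=> z; [move=> [[? _] ?]|move=> [? Vz]; split=> //; split=> //; exact: VX].
have -> : X `&` V n x = V n x by apply/seteqP; split=> z; [case|move=> Vz; split=> //; exact: VX].
have -> : (K `&` X) `\` V n x = K `&` (X `\` V n x) by rewrite setIDA.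
rewrite !mulrDr; apply: lerD hV _; apply: IH mY _ _ _.
- by apply: cbounded_sub bX => z [].
- move=> q Kq [Xq nVq]; have [VqX hq] := hX q Kq Xq; split=> // w Vw; split; first exact: VqX.
  move=> [Pxw _]; apply: nVq; apply: K_V => //; rewrite (P_eq Pxw); exact: connected_component_sym Vw.1.
- move=> y Ky [Xy nVy]; have [q] := hs y Ky Xy; rewrite inE => /predU1P[-> Pq|qs Pq]; last by exists q.
  by case: nVy; apply: K_V => //; rewrite -(P_eq Px).
Qed.

Section Nullity.
Variable m0 : R.
Hypotheses (m00 : 0 < m0) (hm : forall k z, K z -> collar k z (m0 * weight (returns z) k)).

Let mo k z := m0 * weight (returns z) k.

Lemma mo_gt0 k z : 0 < mo k z.
Proof. by rewrite mulr_gt0 // weight_gt0. Qed.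

Lemma mo_eq k z x : P k z x -> mo k x = mo k z.
Proof.
move=> Px; congr (_ * _ ^+ _); apply: eq_in_count => i; rewrite mem_iota add0n => /andP[_ ik].
have Pi : P (k - i) (fwd z i) (fwd x i) by apply: P_fwd; rewrite subnK // ltnW.
apply: asbool_equiv_eq; split=> h; rewrite (P_eq h); [exact: connected_component_sym Pi|exact: Pi].
Qed.

(** The part of [K] in the piece lies within [t] of [z], hence in a square of area
    [2 ^+ 4 * t ^+ 2], and [V_area] at two points at distance [t] bounds [mo k z * t ^+ 2]. The
    exponent 20 is 16 plus 4. *)
Lemma collar_area k z : K z -> mo k z * ar (K `&` V k z) <= 2 ^+ 20 * ar (V k z `\` [set w | G w <= lev k.+1]).
Proof.
move=> Kz; have mz := mo_gt0 k z; pose X := [set w | K w /\ P k z w].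
have cX : cclosed X.
  by move=> w hw; split; [apply: K_closed => e /hw[y [? _] ?]|apply: P_closed => e /hw[y [_ ?] ?]]; exists y.
have bX : cbounded X by apply: cbounded_sub K_bounded => w [].
have neX : X !=set0 by exists z; split=> //; exact/P_refl/ltW/K_lt.
have cz w : ccont (fun w => w - z) w by apply: ccontB; [exact: ccont_id|exact: ccont_cst].
have [q [Kq Pq] qmax] := EVT_mod cX bX neX (fun w _ => cz w); set t := cmod (q - z) in qmax.
have t0 : 0 <= t by exact: cmod_ge0.
have mI := mbleI mble_K (mble_V k z).
have small s : t < s -> ar (K `&` V k z) <= (2 * s) ^+ 2.
  move=> ts; have s0 : 0 < s by lra.
  rewrite -(ar_sqr z s0); apply: ar_le => //; first exact: mble_sqr.
    exists (cmod z + (s + s)) => w [w1 w2]; have := cmodD z (w - z); rewrite addrC subrK.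
    by have := cmod_ReIm (w - z); rewrite cReB cImB; lra.
  move=> w [Kw [Pw _]]; have := qmax w (conj Kw Pw); have := normRe (w - z); have := normIm (w - z).
  by rewrite cReB cImB /sqr /=; lra.
have p20 : 0 <= 2 ^+ 20 * ar (V k z `\` [set w | G w <= lev k.+1]) by rewrite mulr_ge0 ?ar_ge0 ?exprn_ge0.
have [t1|t1] := eqVneq t 0.
  suff : ar (K `&` V k z) <= 0 by move=> h; apply: le_trans p20; rewrite pmulr_rle0.
  apply: le_small => e e0; have [s [s0 s1 s2]] := min_pos2 (ltr01 : 0 < 1 :> R) (ltac:(lra) : 0 < e / 4).
  have := small s; rewrite t1 => /(_ s0); rewrite expr2 add0r; nra.
have {}t1 : 0 < t by rewrite lt_def t1.
have := V_area mz (hm k Kz) (K_V Kq Pq) (V_refl (K_lt k Kz)) (ltW (K_lt _ Kq)) (ltW (K_lt _ Kz)); rewrite -/t => hA.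
have t2 : t < 2 * t by lra.
have := ler_wpM2l (ltW mz) (small _ t2); set A := ar _ in hA *; rewrite (_ : mo k z * (2 * (2 * t)) ^+ 2 = 2 ^+ 4 * (mo k z * t ^+ 2)); last by ring.
by move=> h; apply: le_trans h _; rewrite (exprD 2 4 16) -mulrA ler_wpM2l // exprn_ge0.
Qed.

(** Induction on the number of depths: the term [mo k z] is paid by the area outside level [k.+1]
    through [collar_area], and the rest of the sum by the subpieces, whose area is disjoint from
    it. *)
Lemma null_step (n k : nat) z (t : R) : (forall x, K x -> V k z x -> t <= \sum_(k <= i < k + n) mo i x) ->
  t * ar (K `&` V k z) <= 2 ^+ 20 * ar (V k z).
Proof.
have p20 : 0 <= 2 ^+ 20 :> R by rewrite exprn_ge0.
elim: n k z t => [|n IH] k z t ht.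
  have [[x [Kx Vx]]|no] := pselect (exists x, K x /\ V k z x); last first.
    rewrite (_ : K `&` V k z = set0) ?ar0 ?mulr0 ?mulr_ge0 ?ar_ge0 //.
    by apply/seteqP; split=> // x [Kx Vx]; case: no; exists x.
  have := ht x Kx Vx; rewrite addn0 big_geq // => t0; apply: (@le_trans _ _ 0); last by rewrite mulr_ge0 ?ar_ge0.
  by rewrite mulr_le0_ge0 ?ar_ge0.
have [[z1 [Kz1 Vz1]]|no] := pselect (exists x, K x /\ V k z x); last first.
  rewrite (_ : K `&` V k z = set0) ?ar0 ?mulr0 ?mulr_ge0 ?ar_ge0 //.
  by apply/seteqP; split=> // x [Kx Vx]; case: no; exists x.
rewrite (V_eq Vz1.1) in ht *; clear z Vz1; move: z1 Kz1 ht => z Kz ht.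
pose Y := [set w | G w <= lev k.+1]; have mY : mble Y := mble_sub k.+1.
rewrite (ar_split (mble_V k z) mY (@V_bounded k z)).
have KE : K `&` V k z = K `&` (V k z `&` Y).
  by apply/seteqP; split=> x; [move=> [Kx Vx]; split=> //; split=> //; exact/ltW/K_lt|move=> [Kx []]].
have sub : (t - mo k z) * ar (K `&` (V k z `&` Y)) <= 2 ^+ 20 * ar (V k z `&` Y).
  apply: (@pieces_sum k.+1) => //.
  - exact: mbleI (mble_V k z) mY.
  - by apply: cbounded_sub (@V_bounded k z) => x [].
  - move=> p Kp [Vp _]; have VV w : V k.+1 p w -> V k z w /\ Y w.
      by move=> [Pw Gw]; split; [rewrite (V_eq Vp.1); exact: V_sub Pw|exact: ltW].
    split=> //; apply: IH => x Kx Vx; have := ht x Kx (VV x Vx).1.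
    by rewrite addnS -addSn big_ltn ?leq_addr // (mo_eq (VV x Vx).1.1); lra.
rewrite mulrDr -[t in t * _](subrK (mo k z)) mulrDl {1}KE; apply: lerD sub _; exact: collar_area.
Qed.

(** The sum diverges at a cluster point of supposed exceptions; since [mo] depends only on the
    piece, the same partial sum is reached nearby. *)
Lemma sums_uniform (A : R) : exists n, forall x, K x -> A <= \sum_(0 <= i < n) mo i x.
Proof.
apply: contrapT => no; have /choice [x hx] : forall n : nat, exists x, K x /\ \sum_(0 <= i < n) mo i x < A.
  move=> n; apply: contrapT => h; apply: no; exists n => x Kx; rewrite leNgt; apply/negP => k; apply: h; exists x.
  by split.
have [M hM] := K_bounded; have [l hl] := BW (fun n => hM _ (hx n).1).
have Kl : K l by apply: K_closed => e e0; have [m _ h] := hl e 0%N e0; exists (x m) => //; exact: (hx m).1.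
have [n hn] := weights_diverge l (A / m0); have [r r0 hr] := V_open (V_refl (K_lt n Kl)).
have [m nm xm] := hl r n r0; have [Pm _] := hr _ xm; have [Kx] := hx m; rewrite ltNge => /negP; apply.
apply: (@le_trans _ _ (\sum_(0 <= i < n) mo i l)); first by rewrite /mo -mulr_sumr mulrC -ler_pdivrMr.
rewrite (@big_cat_nat _ _ _ n 0 m) //= -[leLHS]addr0; apply: lerD; last by apply: sumr_ge0 => i _; exact/ltW/mo_gt0.
rewrite !big_nat; apply: ler_sum => i /andP[_ ni]; rewrite (mo_eq (P_le_depth (ltnW ni) Pm)) //.
Qed.

Lemma K_null : ar K = 0.
Proof.
apply/le_anti; rewrite ar_ge0 andbT leNgt; apply/negP => aK.
pose Y := [set w | G w <= lev 0]; have bY : cbounded Y := sublevel_bounded erefl d3 (lev 0).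
have KY : K `&` Y = K by apply/seteqP; split=> x; [case|move=> Kx; split=> //; exact/ltW/K_lt].
(* With this [A] the summed inequality reads [2 ^+ 20 * ar Y + 1 <= 2 ^+ 20 * ar Y]. *)
pose A := (2 ^+ 20 * ar Y + 1) / ar K; have [n hn] := sums_uniform A.
have := @pieces_sum 0 Y A (2 ^+ 20) (mble_sub 0) bY _ _; rewrite KY /A divfK ?gt_eqF //.
suff : forall p, K p -> Y p -> (forall w, V 0 p w -> Y w) /\ A * ar (K `&` V 0 p) <= 2 ^+ 20 * ar (V 0 p).
  move=> h /(_ h); have p20 : 0 <= 2 ^+ 20 :> R by rewrite exprn_ge0.
  by move=> /(_ p20); lra.
by move=> p Kp _; split; [move=> w [_ /ltW]|apply: (@null_step n) => x Kx _; rewrite add0n; exact: hn].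
Qed.

End Nullity.

Lemma K_area : area K = 0%E.
Proof.
by have [m0 m00 hm] := collar_uniform; rewrite (area_fin mble_K K_bounded) (K_null m00 hm).
Qed.

(** * The Julia set *)

Lemma component_point z E : K z -> connected E -> E z -> (forall w, E w -> K w) -> forall w, E w -> w = z.
Proof.
move=> Kz /connectedC cE Ez EK w Ew; have : nest_intersection f G0 z w.
  by move=> k _; apply: (P_max cE) => // x /EK Kx; exact/ltW/K_lt.
by rewrite nest_point.
Qed.

(** A disc inside [K] is connected, so it lies in a single nest, which is a point. Hence [K] has
    empty interior and, being closed, equals its boundary. *)
Lemma julia_eq : julia f = K.
Proof.
rewrite /julia; have -> : interior K = set0.
  apply/seteqP; split=> // z /nbhsC[r r0 hr]; have Kz : K z by apply: hr; exact: ball0.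
  have r2 : 0 < r / 2 by lra.
  have := @component_point z [set w | cmod (w - z) < r] Kz _ (ball0 z r0) hr (z + (r / 2)%:C).
  rewrite /= addrC addKr cmod_real gtr0_norm // => h; have := h (ltac:(apply/connectedC; exact: cconn_ball)) (ltac:(lra)).
  by rewrite -[RHS]addr0 => /addrI/(congr1 (@complex.Re R)) /=; lra.
rewrite setD0; apply/seteqP; split=> z; last exact: subset_closure.
move=> hz; apply: K_closed => e e0; have [|w [Kw wz]] := hz [set w | cmod (w - z) < e]; last by exists w.
by apply/nbhsC; exists e.
Qed.

Lemma julia_disconnected : totally_disconnected (julia f).
Proof.
rewrite julia_eq => z Kz; apply/seteqP; split=> [w hw|_ ->]; last exact: connected_component_refl.
apply: (component_point Kz (@component_connected _ K z)) hw; first exact: connected_component_refl.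
by move=> x /connected_component_sub.
Qed.

End PuzzlePieces.

Theorem theorem4 (R : realType) (f : {poly R[i]}) (c0 : R[i]) (G0 : R)
    (degree_ge3 : (3 <= degree f)%N)
    (c0_sole : sole_bounded_critical_point f c0)
    (G0_admissible : admissible_level f G0) :
  (~ critical_tableau_periodic f G0 c0 <->
     forall p : nat, (1 <= p)%N -> ~ nest_intersection f G0 c0 (fwd_orbit f c0 p)) /\
  (~ critical_tableau_periodic f G0 c0 ->
     [/\ forall z0 : R[i], filled_julia f z0 ->
           (\sum_(0 <= k <oo) (modulus (puzzle_annulus f G0 k z0))%:E = +oo)%E /\
           nest_intersection f G0 z0 = [set z0],
         julia f = filled_julia f,
         totally_disconnected (julia f) &
         area (julia f) = 0%E]).
Proof.
split.
  split=> [np p p1 h|h [p p1 hp]].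
    by apply: np; exists p => // k; apply/esym/same_connected_component/h.
  by apply: (h p p1) => k _; rewrite -hp; apply: P_refl;
    rewrite (green_fwd erefl degree_ge3) (G_c0 degree_ge3 c0_sole) mulr0 ltW // (lev_gt0 degree_ge3 G0_admissible).
move=> np; split.
- move=> z Kz; split; first exact: (moduli_diverge degree_ge3 c0_sole G0_admissible np).
  exact: (nest_point degree_ge3 c0_sole G0_admissible np).
- exact: (julia_eq degree_ge3 c0_sole G0_admissible np).
- exact: (julia_disconnected degree_ge3 c0_sole G0_admissible np).
- rewrite (julia_eq degree_ge3 c0_sole G0_admissible np); exact: (K_area degree_ge3 c0_sole G0_admissible np).
Qed.
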